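(* Let $(M,\tau,\ell,\mathfrak m)$ be a forward metric measure spacetime that is infinitesimally Minkowskian, and let $0\ne p<1$. Then: (i) If $f:M\to\bar{\mathbb R}$ is causal and $g$ is such that $\pm g\in\mathrm{Pert}(f)$, then $$-\mathrm d^+(-g)(\nabla f)\,|\mathrm df|^{p-2}=\mathrm d^+g(\nabla f)\,|\mathrm df|^{p-2}\qquad\mathfrak m\text{-a.e. on }\{|\mathrm df|>0\}.$$ (ii) If, in addition, $\boldsymbol\pi$ represents the initial $p$-gradient of $f$ on the Borel set $E$, then $$\lim_{t\downarrow0}\int\frac{g(\gamma_t)-g(\gamma_0)}t\,\mathrm d\boldsymbol\pi(\gamma)=\int\mathrm d^+g(\nabla f)\,|\mathrm df|^{p-2}(\gamma_0)\,\mathrm d\boldsymbol\pi(\gamma).$$ (iii) For $f,g,h:M\to\bar{\mathbb R}$ causal, define $\mathrm d^+g(\nabla f)$ on $\{|\mathrm df|\in(0,+\infty)\}$ as the product of $|\mathrm df|^{2-p}$ and $\mathrm d^+g(\nabla f)|\mathrm df|^{p-2}$. Then this quantity does not depend on $p$; moreover, for $\alpha,\beta\in[0,\infty)$ both $$\mathrm d^+g(\nabla f)=\mathrm d^+f(\nabla g)\qquad\text{and}\qquad \mathrm d^+(\alpha g+\beta h)(\nabla f)=\alpha\,\mathrm d^+g(\nabla f)+\beta\,\mathrm d^+h(\nabla f)$$ hold $\mathfrak m$-a.e. on the set where $\min\{|\mathrm df|,|\mathrm dg|,|\mathrm dh|\}>0$ and $|\mathrm d(f+g+h)|<\infty$.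
   Context: Conventions in $\bar{\mathbb R}=[-\infty,+\infty]$: $+\infty-(+\infty)=+\infty$, $-\infty-(-\infty)=+\infty$, $\pm\infty+z=\pm\infty$ for every $z\in\bar{\mathbb R}$, $0\cdot(\pm\infty)=0$. For $0\ne r\le1$, $u_r(z)=z^r/r$ for $z\in(0,\infty)$, $u_r=-\infty$ on $[-\infty,0)$, $u_r(0)=-\infty$ if $r<0$ and $0$ if $r>0$, $u_r(+\infty)=0$ if $r<0$ and $+\infty$ if $r>0$; $\frac1rz^r$ is understood as $u_r(z)$. Spacetimes. A time separation on a set $M$ is a map $\ell:M\times M\to\{-\infty\}\cup[0,+\infty]$ with $\ell(x,x)=0$ and $\min\{\ell(x,y)+\ell(y,z),\ell(y,z)+\ell(x,y)\}\le\ell(x,z)$; write $x\le y$ if $\ell(x,y)\ge0$. A forward metric measure spacetime $(M,\tau,\ell,\mathfrak m)$: $\tau$ is a Polish topology, $\ell$ a time separation with $\le$ a partial order and $\{\ell\ge0\}$ closed in $M^2$, every sequence with $x_n\le x_{n+1}\le\bar x$ for all $n$ and some $\bar x$ converges, and $\mathfrak m$ is a non-zero non-negative Radon measure. Curves. $\gamma:[0,1]\to M$ is causal if $s\le t$ implies $\gamma_s\le\gamma_t$. Its causal speed $|\dot\gamma_t|\in[0,+\infty]$ is the density of the absolutely continuous part (w.r.t. Lebesgue measure) of the largest Borel measure $\nu$ on $[0,1]$ with $\nu((a,b))\le\ell(\gamma_a,\gamma_b)$ for all $0\le a<b\le1$; for a.e. $t$ it equals $\lim_{h\downarrow0}\ell(\gamma_t,\gamma_{t+h})/h$.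 $\mathrm{LCC}([0,1];M)$ is the set of left-continuous causal curves with the topology of the distance $\mathsf D(\gamma,\eta)=\mathsf d(\gamma_0,\eta_0)+\int_0^1\mathsf d(\gamma_t,\eta_t)\,\mathrm dt$, $\mathsf d$ a bounded distance inducing $\tau$. $\mathsf e_t(\gamma):=\gamma_t$. Subslopes. A causal function is an $\mathfrak m$-measurable $f:M\to\bar{\mathbb R}$ such that $x\le y$ implies $f(x)\le f(y)$. A test plan is a Borel probability measure $\boldsymbol\pi$ on $\mathrm{LCC}([0,1];M)$ such that for some $C>0$, $(\mathsf e_t)_*\boldsymbol\pi\le C\mathfrak m$ for all $t\in[0,1]$. A Borel $G:M\to[0,+\infty]$ is a weak subslope of $f$ if $\int[f(\gamma_1)-f(\gamma_0)]\,\mathrm d\boldsymbol\pi\ge\iint_0^1G(\gamma_t)|\dot\gamma_t|\,\mathrm dt\,\mathrm d\boldsymbol\pi$ for every test plan $\boldsymbol\pi$; $|\mathrm df|$ denotes the $\mathfrak m$-a.e. largest weak subslope (it exists and is $\mathfrak m$-a.e. unique). $M$ is infinitesimally Minkowskian if for all causal $f,g$: $2|\mathrm d(f+g)|^2+2|\mathrm df|^2=|\mathrm dg|^2+|\mathrm d(2f+g)|^2$ $\mathfrak m$-a.e. Vertical derivative. $\mathrm{Pert}(f)$ is the set of $\mathfrak m$-measurable $g:M\to\bar{\mathbb R}$ with $f+\varepsilon g$ causal for some $\varepsilon>0$. For $g\in\mathrm{Pert}(f)$, the single symbol $\mathrm d^+g(\nabla f)|\mathrm df|^{p-2}$ denotes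 the $\mathfrak m$-a.e. limit $\lim_{\varepsilon\downarrow0}\frac{u_p(|\mathrm d(f+\varepsilon g)|)-u_p(|\mathrm df|)}{\varepsilon}$ (a monotone limit) on $\{|\mathrm df|<\infty\}$, and $0$ on $\{|\mathrm df|=\infty\}$. Initial test plans and gradients. A Borel probability measure $\boldsymbol\pi$ on $\mathrm{LCC}([0,1];M)$ is an initial test plan if for some $T\in(0,1)$, $C>0$ we have $(\mathsf e_t)_*\boldsymbol\pi\le C\mathfrak m$ for all $t\in[0,T]$, and $(\mathsf e_t)_*\boldsymbol\pi\to(\mathsf e_0)_*\boldsymbol\pi$ narrowly as $t\downarrow0$. It stays initially in a Borel set $E$ if for some $T\in(0,1]$ the measure $(\mathsf e_t)_*\boldsymbol\pi$ is concentrated on $E$ for all $t\in[0,T]$. Let $\frac1p+\frac1q=1$. An initial test plan $\boldsymbol\pi$ represents the initial $p$-gradient of $f$ on the Borel set $E$ if $\boldsymbol\pi$ stays initially in $E$, $|\mathrm df|^p\in L^1(E,\mathfrak m|_E)$, $\limsup_{t\downarrow0}\frac1t\iint_0^t|\dot\gamma_r|^q\,\mathrm dr\,\mathrm d\boldsymbol\pi<+\infty$, and $\limsup_{t\downarrow0}\int\frac{f(\gamma_t)-f(\gamma_0)}t\mathrm d\boldsymbol\pi\le\frac1p\int|\mathrm df|^p(\gamma_0)\,\mathrm d\boldsymbol\pi+\liminf_{t\downarrow0}\frac1{tq}\iint_0^t|\dot\gamma_r|^q\,\mathrm dr\,\mathrm d\boldsymbol\pi$.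
   Formalization: In (i) and (ii), g is also assumed finite m-a.e. where f is finite (both fail for g identically +∞ under the stated conventions); test plans and initial test plans are required to have jointly measurable causal speed, so that the double integrals make sense. *)

(* Defs.v *)
From HB Require Import structures.
From mathcomp Require Import all_boot all_order all_algebra.
From mathcomp Require Import all_classical all_reals all_analysis.
From mathcomp Require Import measurable_realfun.

Set Implicit Arguments.
Unset Strict Implicit.
Unset Printing Implicit Defensive.

Import Order.TTheory GRing.Theory Num.Theory.
Import numFieldNormedType.Exports.

Local Open Scope classical_set_scope.
Local Open Scope ring_scope.
Local Open Scope ereal_scope.

Section ExtendedReals.
Variable R : realType.
Implicit Types (x y z : \bar R) (r s : R).

(* Not commutative: an infinite left summand wins, so +oo + -oo = +oo and
   -oo + +oo = -oo, whereas the library has +oo + -oo = -oo. *)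
Definition addx x y : \bar R := if x \is a fin_num then x + y else x.

(* Not [addx x (- y)]: here -oo - -oo = +oo. *)
Definition subx x y : \bar R :=
  if (x == y) && (x \isn't a fin_num) then +oo else addx x (- y).

(* The library's [poweR] has 0 `^ s = 0 and +oo `^ s = +oo for s < 0, where we
   need the opposite values. Negative bases play no role. *)
Definition epow x s : \bar R :=
  match x with
  | r%:E => if (r == 0%R) && (s < 0)%R then +oo else (r `^ s)%:E
  | +oo => if (s < 0)%R then 0 else +oo
  | -oo => 0
  end.

Definition u_ s x : \bar R := if x < 0 then -oo else (s^-1)%:E * epow x s.

End ExtendedReals.

Section Topology.
Variables (R : realType) (M : ptopologicalType).

Definition metrizes (d : M -> M -> R) : Prop :=
  [/\ forall x y, d x y = 0%R <-> x = y,
      forall x y, d x y = d y x,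
      forall x y z, (d x z <= d x y + d y z)%R &
      forall x (A : set M),
        nbhs x A <-> exists2 e : R, (0 < e)%R & [set y | (d x y < e)%R] `<=` A].

Definition complete_dist (d : M -> M -> R) : Prop :=
  forall v : nat -> M,
    (forall e : R, (0 < e)%R -> exists N : nat,
       forall i j, (N <= i)%N -> (N <= j)%N -> (d (v i) (v j) < e)%R) ->
    exists x : M, v @ \oo --> x.

Definition polish : Prop :=
  (exists2 d : M -> M -> R, metrizes d & complete_dist d) /\
  (exists2 D : set M, countable D & dense D).

Definition borel := g_sigma_algebraType (@open M).

Definition radon (m : {measure set borel -> \bar R}) : Prop :=
  (forall x : M, exists U : set M, [/\ open U, U x & m U < +oo]) /\
  (forall A : set M, measurable (A : set borel) ->
     m A = ereal_sup [set m K | K in [set K : set M | compact K /\ K `<=` A]]).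

End Topology.

Definition time_separation (R : realType) (M : Type) (ell : M -> M -> \bar R) :
    Prop :=
  [/\ forall x y, ell x y = -oo \/ 0 <= ell x y,
      forall x, ell x x = 0 &
      forall x y z,
        Order.min (addx (ell x y) (ell y z)) (addx (ell y z) (ell x y))
          <= ell x z].

(* Forward metric measure spacetimes. The bounded distance [bdist] is auxiliary:
   it serves to topologize the space of curves, and the resulting topology does
   not depend on it. Pointedness of the carrier is no restriction, since the
   reference measure is non-zero. *)
Record fmmst (R : realType) := Fmmst {
  carrier :> ptopologicalType;
  tsep : carrier -> carrier -> \bar R;
  refm : {measure set (borel carrier) -> \bar R};
  bdist : carrier -> carrier -> R;
  carrier_polish : polish R carrier;
  tsepP : time_separation tsep;
  tsep_antisym : forall x y, 0 <= tsep x y -> 0 <= tsep y x -> x = y;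
  tsep_trans : forall x y z, 0 <= tsep x y -> 0 <= tsep y z -> 0 <= tsep x z;
  tsep_closed : closed [set xy : carrier * carrier | 0 <= tsep xy.1 xy.2];
  forward_complete : forall (v : nat -> carrier) (b : carrier),
    (forall n, 0 <= tsep (v n) (v n.+1)) -> (forall n, 0 <= tsep (v n) b) ->
    exists x : carrier, v @ \oo --> x;
  refm_neq0 : refm setT != 0;
  refm_radon : radon refm;
  bdist_metrizes : metrizes bdist;
  bdist_bounded : exists K : R, forall x y, (bdist x y <= K)%R
}.

Section Curves.
Variables (R : realType) (S : fmmst R).
Let leb := @lebesgue_measure R.

(* A curve on [0, 1] is encoded by its extension to R that is constant on
   ]-oo, 0] and on [1, +oo[. *)
Definition is_lcc (c : R -> S) : Prop :=
  [/\ forall s t : R, (0 <= s)%R -> (s <= t)%R -> (t <= 1)%R ->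
        0 <= tsep (c s) (c t),
      forall t : R, (0 < t)%R -> (t <= 1)%R -> c s @[s --> t^'-] --> c t,
      forall t : R, (t <= 0)%R -> c t = c 0%R &
      forall t : R, (1 <= t)%R -> c t = c 1%R].

Record LCC := MkLCC { curve :> R -> S; curveP : is_lcc curve }.

Lemma cst_is_lcc (x : S) : is_lcc (fun=> x).
Proof.
split => //; last by move=> t _ _; exact: cvg_cst.
by move=> s t _ _ _; have [_ -> _] := tsepP S.
Qed.

HB.instance Definition _ := gen_eqMixin LCC.
HB.instance Definition _ := gen_choiceMixin LCC.
HB.instance Definition _ := isPointed.Build LCC (MkLCC (cst_is_lcc point)).

Definition lcc_dist (c e : LCC) : \bar R :=
  (bdist (c 0%R) (e 0%R))%:E +
  \int[leb]_(t in `[0%R, 1%R]) (bdist (c t) (e t))%:E.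

Definition lcc_open (U : set LCC) : Prop :=
  forall c, U c ->
    exists2 r : R, (0 < r)%R & [set e | lcc_dist c e < r%:E] `<=` U.

Definition curves := g_sigma_algebraType lcc_open.

Definition ev (t : R) (c : curves) : borel S := (c : LCC) t.

Definition le01 (m1 m2 : {measure set R -> \bar R}) : Prop :=
  forall A : set R, measurable A -> A `<=` `[0%R, 1%R] -> m1 A <= m2 A.

Definition below_tsep (c : LCC) (nu : {measure set R -> \bar R}) : Prop :=
  forall a b : R, (0 <= a)%R -> (a < b)%R -> (b <= 1)%R ->
    nu [set` `]a, b[] <= tsep (c a) (c b).

(* [nu] may fail to be sigma-finite (when tsep is infinite along the curve), so
   its absolutely continuous part is taken to be the largest absolutely
   continuous measure below it; for sigma-finite [nu] this is the one given by
   the Lebesgue decomposition. *)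
Definition below_ac (nu rho : {measure set R -> \bar R}) : Prop :=
  le01 rho nu /\
  forall A : set R, measurable A -> A `<=` `[0%R, 1%R] -> leb A = 0 ->
    rho A = 0.

Definition is_causal_speed (c : LCC) (v : R -> \bar R) : Prop :=
  exists nu rho : {measure set R -> \bar R},
    [/\ below_tsep c nu /\ (forall nu', below_tsep c nu' -> le01 nu' nu),
        below_ac nu rho /\ (forall rho', below_ac nu rho' -> le01 rho' rho),
        measurable_fun [set: R] v /\ (forall t, 0 <= v t) &
        forall A : set R, measurable A -> A `<=` `[0%R, 1%R] ->
          rho A = \int[leb]_(t in A) v t].

Definition causal_speed (c : LCC) : R -> \bar R :=
  xget (cst 0) [set v | is_causal_speed c v].

(* Joint measurability of the causal speed, in the completion of
   pi \x Lebesgue on curves times [0, T]; it is what gives a meaning to the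
   double integrals in the definitions below. It is automatic when tsep is a
   Borel function. *)
Definition measurable_speed (pi : probability curves R) (T : R) : Prop :=
  exists2 w : curves * R -> \bar R, measurable_fun [set: curves * R] w &
    {ae pi, forall c, {ae leb, forall t,
       (0 <= t)%R -> (t <= T)%R -> w (c, t) = causal_speed c t}}.

End Curves.

Section Subslopes.
Variables (R : realType) (S : fmmst R).
Let leb := @lebesgue_measure R.
Let m := refm S.
Implicit Types (f g : S -> \bar R).

Definition refm_measurable f : Prop :=
  forall B : set (\bar R), measurable B ->
    exists2 A : set (borel S), measurable A & m.-negligible (A `+` f @^-1` B).

Definition causal_fun f : Prop :=
  refm_measurable f /\ forall x y, 0 <= tsep x y -> f x <= f y.

Definition compression_le (pi : probability (curves S) R) (T : R) : Prop :=
  exists2 C : R, (0 < C)%R &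
    forall t : R, (0 <= t)%R -> (t <= T)%R ->
    forall A : set (borel S), measurable A ->
      pushforward pi (ev t) A <= C%:E * m A.

Definition test_plan (pi : probability (curves S) R) : Prop :=
  compression_le pi 1 /\ measurable_speed pi 1.

Definition weak_subslope f (G : S -> \bar R) : Prop :=
  [/\ measurable_fun (setT : set (borel S)) G,
      forall x, 0 <= G x &
      forall pi, test_plan pi ->
        \int[pi]_c \int[leb]_(t in `[0%R, 1%R])
            (G (ev t c) * causal_speed c t)
          <= \int[pi]_c subx (f (ev 1 c)) (f (ev 0 c))].

Definition largest_weak_subslope f (G : S -> \bar R) : Prop :=
  weak_subslope f G /\
  forall G', weak_subslope f G' -> {ae m, forall x, G' x <= G x}.

(* |df|, or rather a representative of it *)
Definition subslope f : S -> \bar R :=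
  xget (cst 0) [set G | largest_weak_subslope f G].

Definition fadd f g : S -> \bar R := fun x => addx (f x) (g x).
Definition fscale (a : R) f : S -> \bar R := fun x => a%:E * f x.
Definition fopp f : S -> \bar R := fun x => - f x.

Definition inf_minkowskian : Prop :=
  forall f g, causal_fun f -> causal_fun g ->
    {ae m, forall x,
      2%:E * subslope (fadd f g) x ^+ 2 + 2%:E * subslope f x ^+ 2
        = subslope g x ^+ 2 + subslope (fadd (fscale 2 f) g) x ^+ 2}.

Definition pert f : set (S -> \bar R) :=
  [set g | refm_measurable g /\
           exists2 e : R, (0 < e)%R & causal_fun (fadd f (fscale e g))].

(* Each |d(f + e g)| is only defined almost everywhere and e ranges over an
   uncountable set; the almost everywhere limit is hence taken along arbitrary
   sequences. *)
Definition is_vderiv (p : R) g f (D : S -> \bar R) : Prop :=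
  forall eps : nat -> R, (forall n, (0 < eps n)%R) -> eps @ \oo --> (0%R : R) ->
    {ae m, forall x,
      (subslope f x < +oo ->
         (fun n => ((eps n)^-1)%:E *
            subx (u_ p (subslope (fadd f (fscale (eps n) g)) x))
                 (u_ p (subslope f x))) @ \oo --> D x) /\
      (subslope f x = +oo -> D x = 0)}.

(* the single symbol d^+g(nabla f)|df|^(p-2) *)
Definition vderiv (p : R) g f : S -> \bar R :=
  xget (cst 0) [set D | is_vderiv p g f D].

(* d^+g(nabla f), meant on {0 < |df| < +oo} *)
Definition dplus (p : R) g f : S -> \bar R :=
  fun x => epow (subslope f x) (2 - p) * vderiv p g f x.

Definition initial_test_plan (pi : probability (curves S) R) : Prop :=
  (exists T : R, [/\ (0 < T)%R, (T < 1)%R,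
     compression_le pi T & measurable_speed pi T]) /\
  (forall phi : S -> R, continuous phi ->
     (exists K : R, forall x, (`|phi x| <= K)%R) ->
     (fun t : R => \int[pi]_c (phi (ev t c))%:E) @ 0^'+
       --> \int[pi]_c (phi (ev 0 c))%:E).

Definition stays_initially (pi : probability (curves S) R)
    (E : set (borel S)) : Prop :=
  exists T : R, [/\ (0 < T)%R, (T <= 1)%R &
    forall t : R, (0 <= t)%R -> (t <= T)%R -> pushforward pi (ev t) (~` E) = 0].

Definition represents_gradient (p q : R) f (E : set (borel S))
    (pi : probability (curves S) R) : Prop :=
  let energy (t : R) : \bar R :=
    \int[pi]_c \int[leb]_(r in `[0%R, t]) epow (causal_speed c r) q in
  [/\ initial_test_plan pi,
      stays_initially pi E,
      m.-integrable E (fun x => epow (subslope f x) p),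
      limf_esup (fun t : R => (t^-1)%:E * energy t) 0^'+ < +oo &
      limf_esup (fun t : R =>
          \int[pi]_c ((t^-1)%:E * subx (f (ev t c)) (f (ev 0 c)))) 0^'+
        <= (p^-1)%:E * \int[pi]_c epow (subslope f (ev 0 c)) p
           + limf_einf (fun t : R => ((t * q)^-1)%:E * energy t) 0^'+].

End Subslopes.

(* Main.v *)
(* Write N f for |df|. Superadditivity N(f + g) >= N f + N g and the parallelogram
   identity make b |-> N(u + b v)^2 a quadratic polynomial on [0, oo[ wherever
   N(u + v) is finite, and likewise for two parameters. Hence the vertical derivative
   of f along g is N f^(p - 2) / 2 times the linear coefficient of N(f + e g)^2 in e;
   this coefficient is odd in g when both signs are admissible, is symmetric and
   bilinear for causal functions, and does not involve p.

   N f exists because the class of weak subslopes is closed under maxima and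
   increasing limits. This requires the subslope inequality along almost every curve
   and subinterval, and thus the stability of test plans under restriction to a
   subinterval. There the joint measurability of the causal speed has to be
   transported to the image plan; since a curve is determined by its values at
   rational times, whose laws are tight, compact inner approximation does this
   without assuming tsep Borel.

   For the gradient limit, the laws of the evaluations at small times are dominated by
   a multiple of the reference measure, so they converge setwise and the integrals of
   N(f + e g)^p converge. The reverse Young inequality for f + e g, subtracted from
   the asymptotic equality for f, bounds the lower limit of the increments of g from
   below by a difference quotient in e; let e decrease to 0 and repeat with -g. *)

Require Import Defs.
From HB Require Import structures.
From mathcomp Require Import all_boot all_order all_algebra.
From mathcomp Require Import all_classical all_reals all_analysis.
From mathcomp Require Import measurable_realfun ring lra.

Set Implicit Arguments.
Unset Strict Implicit.
Unset Printing Implicit Defensive.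

Import Order.TTheory GRing.Theory Num.Theory.
Import numFieldNormedType.Exports.

Local Open Scope classical_set_scope.
Local Open Scope ring_scope.
Local Open Scope ereal_scope.

(** * Integrals without measurability and largest functions *)

(** Addition of extended functions lets an infinite left summand win, so it is associative but not
    commutative. The remedy is [feq]: an increment is [+oo] as soon as an end value is infinite,
    hence the subslope sees only the finite values, and on these sums commute. The same convention
    explains the condition that [g] be finite where [f] is: otherwise the multiples of [g] in a
    combination of [f + e g] and [f - e g] need not cancel back to [f]. A perturbation [g] is not
    causal, while superadditivity and the quadratic expansion concern causal functions. With
    [v = f + e0 g] causal, [f + e g] is [1 - e / e0] times a point of the half-line from [f] in the
    direction [v]; this transports the expansion to [g]. Causal functions are measurable only up to
    null sets, so increments along curves need not be Borel; integrals are compared through simple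
    functions or measurable versions. For maxima of weak subslopes, increments of [f] are merely
    superadditive in the interval and cannot be split along a measurable set; the largest measure
    below them can. *)

Section IntegralNonMeasurable.
Context d (T : measurableType d) (R : realType).
Variable mu : {measure set T -> \bar R}.
Implicit Types (f g : T -> \bar R) (D : set T).
Import HBNNSimple.

(** The integral of a nonnegative function is the supremum of the integrals of the simple functions
    below it. Cutting such a simple function off on the exceptional null set keeps its integral and
    puts it below [g]. This form serves for increments of functions that are measurable only up to
    null sets. *)
Lemma ae_le_integral_nm D f g : measurable D ->
  (forall x, D x -> 0 <= f x) -> (forall x, D x -> 0 <= g x) ->
  {ae mu, forall x, D x -> f x <= g x} ->
  \int[mu]_(x in D) f x <= \int[mu]_(x in D) g x.
Proof.
move=> mD f0 g0 [N [mN N0 fgN]].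
rewrite integral_mkcond [leRHS]integral_mkcond.
have f'0 x : 0 <= (f \_ D) x by rewrite patchE; case: ifPn => // /set_mem/f0.
have g'0 x : 0 <= (g \_ D) x by rewrite patchE; case: ifPn => // /set_mem/g0.
rewrite ge0_integralTE// [leRHS]ge0_integralTE//.
apply: ge_ereal_sup => _ [h /= hf <-].
have mNc : measurable (~` N) by exact: measurableC.
apply: le_ereal_sup_tmp; exists (sintegral mu (proj_nnsfun h mNc)).
  exists (proj_nnsfun h mNc) => //= x; rewrite mindicE.
  have [xN|] := boolP (x \in ~` N); last by rewrite mulr0.
  rewrite mulr1 (le_trans (hf x))// !patchE; case: ifPn => // /set_mem Dx.
  apply: contrapT => fgx; move: xN; rewrite inE; apply; apply: fgN => /=.
  by move=> H; apply/fgx/H.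
rewrite -!integralT_nnsfun.
rewrite (@ge0_ae_eq_integral _ _ _ mu setT (fun x => (h x)%:E)
  (fun x => (proj_nnsfun h mNc x)%:E))//.
- exact/measurable_EFinP/measurable_funP.
- exact/measurable_EFinP/measurable_funP.
- by move=> x _; rewrite lee_fin.
- by move=> x _; rewrite lee_fin.
- exists N; split => // x /= hx; apply: contrapT => xN; apply: hx => _.
  by rewrite /= mindicE mem_set// mulr1.
Qed.

Lemma ae_eq_integral_nm D f g : measurable D ->
  {ae mu, forall x, D x -> f x = g x} ->
  \int[mu]_(x in D) f x = \int[mu]_(x in D) g x.
Proof.
move=> mD fg; rewrite integralE [RHS]integralE; congr (_ - _).
  apply/eqP; rewrite eq_le; apply/andP; split; apply: ae_le_integral_nm => //;
  by apply: filterS fg => x /[apply]; rewrite !funeposE => ->.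
apply/eqP; rewrite eq_le; apply/andP; split; apply: ae_le_integral_nm => //;
by apply: filterS fg => x /[apply]; rewrite !funenegE => ->.
Qed.

End IntegralNonMeasurable.

Section Density.
Context d (T : measurableType d) (R : realType).
Variable mu : {measure set T -> \bar R}.

(** The truncation at 0 makes this a measure for every measurable [v], so that the structure carries
    no sign proof; it is invisible for [v >= 0]. *)
Definition mdens (v : T -> \bar R) (A : set T) : \bar R :=
  \int[mu]_(x in A) Order.max 0 (v x).

End Density.

Section DensityMeasure.
Context d (T : measurableType d) (R : realType).
Variables (mu : {measure set T -> \bar R}) (v : T -> \bar R).
Hypothesis mv : measurable_fun setT v.

Let mv0 : measurable_fun setT (fun x => Order.max 0 (v x)).
Proof. by apply: measurable_maxe => //; exact: measurable_cst. Qed.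

Let v0 x : 0 <= Order.max 0 (v x). Proof. by rewrite le_max lexx. Qed.

Let mdens0 : mdens mu v set0 = 0.
Proof. exact: integral_set0. Qed.

Let mdens_ge0 A : 0 <= mdens mu v A.
Proof. by apply: integral_ge0. Qed.

Let mdens_sigma : semi_sigma_additive (mdens mu v).
Proof. by apply: semi_sigma_additive_nng_induced. Qed.

Definition mdens_measure :=
  HB.pack_for {measure set T -> \bar R} (mdens mu v)
    (isMeasure.Build _ _ _ (mdens mu v) mdens0 mdens_ge0 mdens_sigma).

Lemma mdens_measureE A : (forall x, 0 <= v x) ->
  mdens_measure A = \int[mu]_(x in A) v x.
Proof. by move=> ?; apply: eq_integral => x _; rewrite max_r. Qed.

End DensityMeasure.

Section MeasurableLemmas.
Context d (T : measurableType d) (R : realType).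
Implicit Types (f g : T -> \bar R) (D : set T).

Lemma emeasurable_le_set D f g : measurable D ->
  measurable_fun D f -> measurable_fun D g ->
  measurable (D `&` [set x | f x <= g x]).
Proof.
move=> mD mf mg; have := measurable_fun_lee mf mg mD (Y := [set true]).
by apply.
Qed.

Lemma emeasurable_fun_ray f :
  (forall r : R, measurable [set x | r%:E < f x]) -> measurable_fun setT f.
Proof.
move=> H; apply: (measurability _ (ErealGenOInfty.measurableE R)) => //.
move=> _ [_ [r ->]] <-; rewrite setTI.
rewrite (_ : _ @^-1` _ = [set x | r%:E < f x])//.
by apply/seteqP; split => x /=; rewrite in_itv/= andbT.
Qed.

Lemma measurable_contract : measurable_fun setT (@contract R).
Proof.
apply: (measurability _ (RGenOInfty.measurableE R)) => //.
move=> _ [_ [r ->]] <-; rewrite setTI.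
have [r1|r1] := ltP r (-1)%R.
  rewrite (_ : _ @^-1` _ = setT)//; apply/seteqP; split => x //= _.
  rewrite in_itv/= andbT (lt_le_trans r1)//.
  by have := contract_le1 x; rewrite ler_norml => /andP[].
have [r2|r2] := ltP 1%R r.
  rewrite (_ : _ @^-1` _ = set0)//; apply/seteqP; split => x //=.
  rewrite in_itv/= andbT => /(lt_trans r2); rewrite ltNge.
  by have := contract_le1 x; rewrite ler_norml => /andP[_ ->].
rewrite (_ : _ @^-1` _ = `]expand r, +oo[%classic)//.
  exact: emeasurable_itv.
have rr : contract (expand r) = r by rewrite expandK// inE ler_norml r1.
apply/seteqP; split => x /=; rewrite !in_itv/= !andbT.
  by rewrite -{1}rr (leW_mono (@le_contract R)).
by rewrite -{2}rr (leW_mono (@le_contract R)).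
Qed.

(** A function is the supremum of the rationals strictly below it. Replacing each rational
    superlevel set by the measurable [H q] gives a measurable supremum, and only countably many null
    sets are discarded. *)
Lemma measurable_version (mu : {measure set T -> \bar R}) f (H : rat -> set T) :
  (forall q, measurable (H q)) ->
  (forall q, {ae mu, forall x, H q x <-> (ratr q)%:E < f x}) ->
  exists2 h : T -> \bar R, measurable_fun setT h & {ae mu, forall x, h x = f x}.
Proof.
move=> mH Hf; pose h x := ereal_sup [set ((ratr q : R)%:E) | q in [set q | H q x]].
exists h.
  apply: emeasurable_fun_ray => r.
  rewrite (_ : [set x | _] = \bigcup_(q in [set q : rat | (r < ratr q)%R]) H q).
    rewrite bigcup_mkcond; apply: countable_bigcupT_measurable => // q.
    by case: ifP => _; [exact: mH|exact: measurable0].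
  apply/seteqP; split => x /=.
    move=> /ereal_sup_gt[_ [q Hq <-]]; rewrite lte_fin => rq; by exists q.
  move=> [q /= rq Hq]; apply: (@lt_le_trans _ _ (ratr q)%:E); first by rewrite lte_fin.
  by apply: ereal_sup_ubound; exists q.
have : {ae mu, forall x, forall q, H q x <-> (ratr q)%:E < f x}.
  have [e [e' eK]] : exists e : nat -> rat, exists e', cancel e' e.
    have /card_esym/ppcard_eqP[e] := card_rat.
    by exists e, (e^-1)%FUN => q; rewrite invK// inE.
  have := ae_foralln (fun n => Hf (e n)); apply: filterS => x Hx q.
  by have := Hx (e' q); rewrite eK.
apply: filterS => x Hx; apply/eqP; rewrite eq_le; apply/andP; split.
  by apply: ge_ereal_sup => _ [q /= /Hx/ltW qf <-].
rewrite leNgt; apply/negP => hf.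
have [q /andP[hq qf]] : exists q : rat, (h x < (ratr q)%:E < f x).
  have [r /andP[hr rf]] : exists r : R, h x < r%:E < f x.
    case: (h x) (f x) hf => [a| |] [b| |]//=.
    - rewrite lte_fin => ab; exists ((a + b) / 2)%R; rewrite !lte_fin; lra.
    - by move=> _; exists (a + 1)%R; rewrite ltry lte_fin ltrDl ltr01.
    - by move=> _; exists (b - 1)%R; rewrite ltNyr lte_fin ltrBlDr ltrDl ltr01.
    - by move=> _; exists 0%R; rewrite ltNyr ltry.
  case: (f x) rf => [b| |]//.
  - rewrite lte_fin => /rat_in_itvoo[q]; rewrite in_itv/= => /andP[rq qb].
    by exists q; rewrite (lt_trans hr) ?lte_fin//.
  - move=> _; have /rat_in_itvoo[q] : (r < r + 1)%R by rewrite ltrDl ltr01.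
    rewrite in_itv/= => /andP[rq _].
    by exists q; rewrite (lt_trans hr) ?lte_fin// ltry.
suff : (ratr q)%:E <= h x by rewrite leNgt hq.
by apply: ereal_sup_ubound; exists q => //; exact/Hx.
Qed.

End MeasurableLemmas.

Section LargestAE.
Context d (T : measurableType d) (R : realType).
Variable mu : {measure set T -> \bar R}.
Implicit Types (f g : T -> \bar R) (D : set T).

(** On [E k] the function [f] exceeds [g] by at least [1 / (k + 1)] while [g <= k]. The second bound
    makes the integral of [g] over [E k] finite, hence cancellable, and the excess forces [E k] to
    be null. *)
Lemma ae_le_of_integral D f g : measurable D -> mu D < +oo ->
  measurable_fun setT f -> measurable_fun setT g ->
  (forall x, 0 <= f x) -> (forall x, 0 <= g x) ->
  (forall A, measurable A -> A `<=` D ->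
    \int[mu]_(x in A) f x <= \int[mu]_(x in A) g x) ->
  {ae mu, forall x, D x -> f x <= g x}.
Proof.
move=> mD Doo mf mg f0 g0 fg.
pose E k := (D `&` [set x | g x <= k%:R%:E]) `&`
   [set x | g x + (k.+1%:R^-1)%:E <= f x].
have mE k : measurable (E k).
  rewrite /E -setIA (_ : _ `&` [set x | _ <= f x] =
    (setT `&` [set x | g x <= cst k%:R%:E x]) `&` (setT `&` [set x | g x + (k.+1%:R^-1)%:E <= f x])).
    apply: measurableI => //; apply: measurableI.
      by apply: emeasurable_le_set => //.
    by apply: emeasurable_le_set => //; apply: emeasurable_funD => //.
  by rewrite !setTI.
have E0 k : mu (E k) = 0.
  have ED : E k `<=` D by move=> x [[]].
  have Efin : mu (E k) \is a fin_num.
    by rewrite ge0_fin_numE// (le_lt_trans _ Doo)// le_measure// inE.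
  have := fg _ (mE k) ED.
  have gfin : \int[mu]_(x in E k) g x \is a fin_num.
    rewrite ge0_fin_numE ?integral_ge0//.
    apply: (@le_lt_trans _ _ (\int[mu]_(x in E k) (k%:R)%:E)).
      apply: ge0_le_integral => //; first exact: measurable_funTS.
      by move=> x [[_]].
    by rewrite integral_cst// ltey_eq fin_numM.
  move=> /(le_trans _); move/(_ (\int[mu]_(x in E k) (g x + (k.+1%:R^-1)%:E))).
  have -> : \int[mu]_(x in E k) (g x + (k.+1%:R^-1)%:E) =
     \int[mu]_(x in E k) g x + (k.+1%:R^-1)%:E * mu (E k).
    by rewrite ge0_integralD ?integral_cst//; exact: measurable_funTS.
  have H : \int[mu]_(x in E k) (g x + (k.+1%:R^-1)%:E) <= \int[mu]_(x in E k) f x.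
    apply: ge0_le_integral => //.
    - by move=> x _; rewrite adde_ge0.
    - by apply: emeasurable_funD => //; exact: measurable_funTS.
    - exact: measurable_funTS.
    - by move=> x [].
  move: H; rewrite ge0_integralD ?integral_cst//; last exact: measurable_funTS.
  move=> /[swap] /[apply].
  rewrite -[leRHS]adde0 leeD2lE// => H; apply/eqP; rewrite eq_le measure_ge0 andbT.
  by rewrite -(@lee_pmul2l _ (k.+1%:R^-1)%:E) ?mule0// lte_fin invr_gt0.
apply: (@negligibleS _ _ _ _ (\bigcup_k E k)).
  move=> x /= /not_implyP[Dx]; move/negP; rewrite -ltNge => gf.
  have gfin : g x \is a fin_num by rewrite ge0_fin_numE// (lt_le_trans gf)// leey.
  have [k gk kf] : exists2 k : nat, (fine (g x) <= k%:R)%R &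
      (g x + (k.+1%:R^-1)%:E <= f x).
    have g0' : (0 <= fine (g x))%R by exact: fine_ge0.
    case fE : (f x) => [s| |]//; last 2 first.
    - exists (Num.bound (fine (g x))); last exact: leey.
      by rewrite ltW// archi_boundP.
    - by move: gf; rewrite fE ltNge leNye.
    have : (fine (g x) < s)%R by rewrite -lte_fin fineK// -fE.
    rewrite -subr_gt0 => gs.
    pose k := maxn (Num.bound (fine (g x))) (Num.bound (s - fine (g x))^-1).
    exists k.
      by rewrite (le_trans (ltW (archi_boundP g0')))// ler_nat leq_maxl.
    rewrite -(fineK gfin) -EFinD lee_fin -lerBrDl.
    rewrite invf_ple ?posrE ?ltr0n//.
    have is0 : (0 <= (s - fine (g x))^-1)%R by rewrite invr_ge0 ltW.
    rewrite (le_trans (ltW (archi_boundP is0)))// ler_nat.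
    by rewrite ltnW// ltnS leq_maxr.
  by exists k => //; split => //; split => //=; rewrite -(fineK gfin) lee_fin.
apply/negligible_bigcup => k; by apply/negligibleP; [exact: mE|exact: E0].
Qed.

Let I D (G : T -> \bar R) := \int[mu]_(x in D) (contract (G x))%:E.

Let contract_ge0 (x : \bar R) : 0 <= x -> (0 <= contract x)%R.
Proof. by move=> x0; rewrite -(@contract0 R) le_contract. Qed.

Let mcontract D (G : T -> \bar R) : measurable_fun setT G ->
  measurable_fun D (fun x => (contract (G x))%:E).
Proof.
move=> mG; apply/measurable_EFinP/measurable_funTS.
exact: (measurableT_comp (@measurable_contract R)).
Qed.

Let le_I D G H : measurable D -> measurable_fun setT G -> measurable_fun setT H ->
  (forall x, 0 <= G x) -> (forall x, G x <= H x) -> I D G <= I D H.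
Proof.
move=> mD mG mH G0 GH; apply: ge0_le_integral => //.
- by move=> x _; rewrite lee_fin contract_ge0.
- exact: mcontract.
- exact: mcontract.
- by move=> x _; rewrite lee_fin le_contract.
Qed.

(** Essential supremum by maximising a functional: [contract] is strictly increasing and bounded, so
    [I D] is finite even where members of [W] are infinite. Stability under maxima makes a
    maximising sequence increasing, stability under limits puts its limit [L] in [W], and [max L G']
    cannot have a larger integral than [L]. *)
Lemma largest_ae_fin (W : set (T -> \bar R)) D : measurable D -> mu D < +oo ->
  W !=set0 ->
  (forall G, W G -> measurable_fun setT G /\ forall x, 0 <= G x) ->
  (forall G H, W G -> W H -> W (fun x => Order.max (G x) (H x))) ->
  (forall G : nat -> T -> \bar R, (forall n, W (G n)) ->
    (forall x, nondecreasing_seq (G^~ x)) -> W (fun x => limn (G^~ x))) ->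
  exists2 G, W G & forall G', W G' -> {ae mu, forall x, D x -> G' x <= G x}.
Proof.
move=> mD Doo [W0 WW0] Wm Wmax Wlim.
have Ioo G : W G -> I D G <= mu D.
  move=> /Wm[mG G0]; rewrite -[leRHS]mul1e -integral_cst//.
  apply: ge0_le_integral => //.
  - by move=> x _; rewrite lee_fin contract_ge0.
  - exact: mcontract.
  - by move=> x _; rewrite lee_fin (le_trans (ler_norm _))// contract_le1.
have I0 G : W G -> 0 <= I D G.
  by move=> /Wm[mG G0]; apply: integral_ge0 => x _; rewrite lee_fin contract_ge0.
pose s := ereal_sup [set I D G | G in W].
have sub G : W G -> I D G <= s by move=> WG; apply: ereal_sup_ubound; exists G.
have sfin : s \is a fin_num.
  rewrite ge0_fin_numE; last exact: (le_trans (I0 _ WW0) (sub _ WW0)).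
  by apply: (le_lt_trans _ Doo); apply: ge_ereal_sup => _ [G WG <-]; exact: Ioo.
have [G_ HG_] : {G_ : nat -> T -> \bar R & forall n,
    W (G_ n) /\ s - (n.+1%:R^-1)%:E < I D (G_ n)}.
  apply: (@choice _ _ (fun n G => W G /\ s - (n.+1%:R^-1)%:E < I D G)) => n.
  have n0 : (0 < n.+1%:R^-1 :> R)%R by rewrite invr_gt0.
  by have [_ [G WG <-] ?] := ub_ereal_sup_adherent n0 sfin; exists G.
pose H := fix H n := if n is k.+1 then (fun x => Order.max (H k x) (G_ n x)) else G_ 0%N.
have WH n : W (H n).
  by elim: n => [|n IH] /=; [exact: (HG_ 0%N).1|apply: Wmax => //; exact: (HG_ n.+1).1].
have ndH x : nondecreasing_seq (H^~ x).
  by apply/nondecreasing_seqP => n /=; rewrite le_max lexx.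
have GH n x : G_ n x <= H n x by case: n => //= n; rewrite le_max lexx orbT.
pose L x := limn (H^~ x).
have WL : W L by exact: Wlim.
have [mL L0] := Wm _ WL.
have HL n x : H n x <= L x.
  have := ereal_nondecreasing_cvgn (ndH x) => /cvg_lim => /(_ (@ereal_hausdorff R)).
  by rewrite /L => ->; apply: ereal_sup_ubound; exists n.
have sL : I D L = s.
  apply/eqP; rewrite eq_le sub//=; apply/lee_addgt0Pr => e e0.
  have [n ne] : exists n : nat, (n.+1%:R^-1 < e)%R.
    exists (Num.bound e^-1); rewrite invf_plt ?posrE//.
    have ie0 : (0 <= e^-1)%R by rewrite invr_ge0 ltW.
    by rewrite (lt_le_trans (archi_boundP ie0))// ler_nat.
  have [WG sG] := HG_ n.
  have GL : I D (G_ n) <= I D L.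
    have [mG G0] := Wm _ WG.
    by apply: le_I => // x; exact: le_trans (GH n x) (HL n x).
  move: (lt_le_trans sG GL); rewrite lteBlDr// => /ltW/le_trans; apply.
  by rewrite leeD2l// lee_fin ltW.
exists L => // G' WG'.
pose M x := Order.max (L x) (G' x).
have WM : W M by exact: Wmax.
have [mM M0] := Wm _ WM.
have LM x : L x <= M x by rewrite /M le_max lexx.
have IM : I D M = s.
  by apply/eqP; rewrite eq_le sub//= -sL; exact: le_I.
have finL A : measurable A -> A `<=` D -> I A L \is a fin_num.
  move=> mA AD; rewrite ge0_fin_numE; last first.
    by apply: integral_ge0 => x _; rewrite lee_fin contract_ge0.
  apply: (@le_lt_trans _ _ s); last by rewrite ltey_eq sfin.
  rewrite -sL; apply: ge0_subset_integral => //; first exact: mcontract.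
  by move=> x _; rewrite lee_fin contract_ge0.
(* The integrals of [L <= M] over [D] are equal and finite; subtracting the part over [D \ A]
   localises the comparison to every [A]. *)
have : {ae mu, forall x, D x -> (contract (M x))%:E <= (contract (L x))%:E}.
  apply: ae_le_of_integral => //; [exact: mcontract|exact: mcontract| | |].
  - by move=> x; rewrite lee_fin contract_ge0.
  - by move=> x; rewrite lee_fin contract_ge0.
  move=> A mA AD.
  have mDA : measurable (D `\` A) by exact: measurableD.
  have split G : W G -> I D G = I A G + I (D `\` A) G.
    move=> /Wm[mG G0]; rewrite -{1}(setDUK AD) {1}/I ge0_integral_setU//.
    - exact: mcontract.
    - by move=> x _; rewrite lee_fin contract_ge0.
    - by apply/disj_set2P; apply/seteqP; split => // x [Ax [_ /(_ Ax)]].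
  have : I A M + I (D `\` A) M <= I A L + I (D `\` A) L.
    by rewrite -!split// sL IM.
  have finM : I (D `\` A) M \is a fin_num.
    rewrite ge0_fin_numE; last first.
      by apply: integral_ge0 => x _; rewrite lee_fin contract_ge0.
    apply: (@le_lt_trans _ _ s); last by rewrite ltey_eq sfin.
    rewrite -IM; apply: ge0_subset_integral => //; first exact: mcontract.
    by move=> x _; rewrite lee_fin contract_ge0.
  move=> MLle; rewrite -(leeD2rE _ _ finM); apply: (le_trans MLle).
  by apply: leeD2l; exact: le_I.
apply: filterS => x /[apply]; rewrite lee_fin le_contract; apply: le_trans.
by rewrite /M le_max lexx orbT.
Qed.

(** Each piece of finite measure has its own maximiser. Running maxima of these stay in [W] and
    increase, and their limit dominates on all pieces at once. *)
Lemma largest_ae (W : set (T -> \bar R)) : sigma_finite setT mu ->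
  W !=set0 ->
  (forall G, W G -> measurable_fun setT G /\ forall x, 0 <= G x) ->
  (forall G H, W G -> W H -> W (fun x => Order.max (G x) (H x))) ->
  (forall G : nat -> T -> \bar R, (forall n, W (G n)) ->
    (forall x, nondecreasing_seq (G^~ x)) -> W (fun x => limn (G^~ x))) ->
  exists2 G, W G & forall G', W G' -> {ae mu, forall x, G' x <= G x}.
Proof.
move=> [F FT mF] Wne Wm Wmax Wlim.
have [G_ HG_] : {G_ : nat -> T -> \bar R & forall n,
    W (G_ n) /\ forall G', W G' -> {ae mu, forall x, F n x -> G' x <= G_ n x}}.
  apply: (@choice _ _ (fun n G => W G /\ forall G', W G' -> {ae mu, forall x, F n x -> G' x <= G x})) => n.
  have [mFn Fnoo] := mF n.
  by have [G WG HG] := largest_ae_fin mFn Fnoo Wne Wm Wmax Wlim; exists G.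
pose H := fix H n := if n is k.+1 then (fun x => Order.max (H k x) (G_ n x)) else G_ 0%N.
have WH n : W (H n).
  by elim: n => [|n IH] /=; [exact: (HG_ 0%N).1|apply: Wmax => //; exact: (HG_ n.+1).1].
have ndH x : nondecreasing_seq (H^~ x).
  by apply/nondecreasing_seqP => n /=; rewrite le_max lexx.
have GH n x : G_ n x <= H n x by case: n => //= n; rewrite le_max lexx orbT.
exists (fun x => limn (H^~ x)); first exact: Wlim.
move=> G' WG'.
have := ae_foralln (fun n => (HG_ n).2 _ WG'); apply: filterS => x Hx.
have [n _ Fnx] : (\bigcup_i F i) x by rewrite -FT.
rewrite (le_trans (Hx n Fnx))// (le_trans (GH n x))//.
have := ereal_nondecreasing_cvgn (ndH x) => /cvg_lim => /(_ (@ereal_hausdorff R)) ->.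
by apply: ereal_sup_ubound; exists n.
Qed.

End LargestAE.

(** * Affine changes of variable for Lebesgue measure *)

Section Affine.
Variable R : realType.
Let leb := @lebesgue_measure R.
Variables (s k : R).
Hypothesis k0 : (0 < k)%R.
Let th (r : measurableTypeR R) : measurableTypeR R := (s + k * r)%R.

Let mth : measurable_fun [set: measurableTypeR R] th.
Proof. by apply: measurable_funD => //; exact: mulrl_measurable. Qed.

Lemma measurable_affine : measurable_fun [set: R] (fun r : R => (s + k * r)%R).
Proof. exact: mth. Qed.

Lemma preimage_affine_itv (a b : R) ba bb :
  (fun r : R => (s + k * r)%R) @^-1` [set` Interval (BSide ba a) (BSide bb b)] =
  [set` Interval (BSide ba ((a - s) / k)%R) (BSide bb ((b - s) / k)%R)].
Proof.
apply/seteqP; split => r /=; rewrite !in_itv/=; case: ba; case: bb => /=;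
  rewrite ?ler_pdivrMr ?ler_pdivlMr ?ltr_pdivrMr ?ltr_pdivlMr//;
  move=> /andP[? ?]; apply/andP; split; lra.
Qed.

Lemma lebesgue_measure_affine (A : set R) : measurable A ->
  k%:E * leb ((fun r : R => (s + k * r)%R) @^-1` A) = leb A.
Proof.
pose mthf : {mfun measurableTypeR R >-> measurableTypeR R} := HB.pack th (isMeasurableFun.Build _ _ _ _ th mth).
pose kn := NngNum (ltW k0).
move=> mA; rewrite /leb (@lebesgue_measure_unique _ (mscale kn (pushforward lebesgue_measure mthf)) _ A)//.
move=> X [[a b] /= _ <-]; rewrite /mscale/= /pushforward/= preimage_affine_itv.
rewrite /leb !lebesgue_measure_itv/= !lte_fin ltr_pM2r ?invr_gt0// ltrD2r.
case: ifPn => _; last by rewrite mule0.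
rewrite -!EFinD -EFinM; congr EFin; field; exact: lt0r_neq0.
Qed.

Lemma ge0_integral_affine (D : set R) (f : R -> \bar R) : measurable D ->
  measurable_fun setT f -> (forall x, 0 <= f x) ->
  k%:E * \int[leb]_(x in (fun r : R => (s + k * r)%R) @^-1` D) f (s + k * x)%R
   = \int[leb]_(y in D) f y.
Proof.
move=> mD mf f0.
pose mthf : {mfun measurableTypeR R >-> measurableTypeR R} := HB.pack th (isMeasurableFun.Build _ _ _ _ th mth).
pose kn := NngNum (ltW k0).
rewrite [RHS](eq_measure_integral (mscale kn (pushforward lebesgue_measure mthf))); last first.
  by move=> A mA _; exact/esym/lebesgue_measure_affine.
rewrite ge0_integral_mscale//; last exact: measurable_funTS.
congr (_ * _); rewrite ge0_integral_pushforward//; exact: measurable_funTS.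
Qed.

Lemma ae_affine (P : R -> Prop) : {ae leb, forall x, P x} ->
  {ae leb, forall x, P (s + k * x)%R}.
Proof.
move=> [N [mN N0 PN]]; exists (th @^-1` N); split.
- by rewrite -(setTI (_ @^-1` _)); exact: mth.
- have := lebesgue_measure_affine mN; rewrite -/leb in N0; rewrite N0 => /eqP.
  by rewrite mule_eq0 eqe (gt_eqF k0)/= => /eqP.
- by move=> x /= Px; apply: PN.
Qed.

End Affine.

Lemma adde_ereal_sup_le (R : realType) (t M : \bar R) (S : set (\bar R)) :
  S !=set0 -> 0 <= t -> (forall z, S z -> 0 <= z) -> (forall z, S z -> t + z <= M) ->
  t + ereal_sup S <= M.
Proof.
move=> [z0 Sz0] t0 S0 tM; case: t t0 tM => [t| |]// t0 tM.
  rewrite addeC -leeBrDr//; apply: ge_ereal_sup => z Sz.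
  by rewrite leeBrDr// addeC tM.
have := tM _ Sz0; rewrite addye; last by rewrite -ltNye (lt_le_trans _ (S0 _ Sz0)).
by rewrite leye_eq => /eqP ->; exact: leey.
Qed.

(** * The largest measure below a superadditive function *)

Section HahnGreedy.
Context d (T : measurableType d) (R : realType).
Variables kappa rho : {measure set T -> \bar R}.

(** Hahn decomposition of [kappa - rho] where [rho] may be infinite. From [A] one removes, again and
    again, a set on which [kappa] exceeds [rho] by at least half of the largest excess still
    available; since [kappa A] is finite, what remains contains no set with [kappa > rho]. *)
Lemma greedy_positive_part (A : set T) : measurable A -> kappa A < +oo ->
  kappa A < rho A ->
  exists B, [/\ measurable B, B `<=` A, kappa B < rho B &
    forall C, measurable C -> C `<=` B -> kappa C <= rho C].
Proof.
move=> mA Aoo kr.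
have kfin X : measurable X -> X `<=` A -> kappa X \is a fin_num.
  move=> mX XA; rewrite ge0_fin_numE//; apply: le_lt_trans Aoo.
  by apply: le_measure => //; rewrite inE.
pose sub (X C : set T) := [/\ measurable C, C `<=` X & rho C <= kappa C].
pose ds (X : set T) := ereal_sup [set kappa C - rho C | C in sub X].
have sub0 X : sub X set0 by split => //; rewrite !measure0.
have ds0 X : 0 <= ds X.
  by apply: ereal_sup_ubound; exists set0 => //; rewrite !measure0 sube0.
have [f Hf] : {f : set T -> set T & forall X, measurable X -> X `<=` A ->
    sub X (f X) /\ ds X <= 2%:E * kappa (f X)}.
  apply: (@choice _ _ (fun X C => measurable X -> X `<=` A ->
    sub X C /\ ds X <= 2%:E * kappa C)) => X.
  have [[mX XA]|nX] := pselect (measurable X /\ X `<=` A); last first.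
    by exists set0 => mX XA; exfalso; apply: nX.
  have [d0|d0] := eqVneq (ds X) 0.
    by exists set0 => _ _; split => //; rewrite d0 measure0 mule0.
  have dgt0 : 0 < ds X by rewrite lt_neqAle eq_sym d0 ds0.
  have dfin : ds X \is a fin_num.
    rewrite ge0_fin_numE//; apply: le_lt_trans Aoo.
    apply: ge_ereal_sup => _ [C [mC CX rkC] <-].
    have CA : C `<=` A by exact: subset_trans CX XA.
    rewrite leeBlDr; last first.
      by rewrite ge0_fin_numE// (le_lt_trans rkC)// ltey_eq kfin.
    by rewrite -[leLHS]adde0 leeD// le_measure// inE.
  have : (2^-1)%:E * ds X < ds X.
    by rewrite -{2}(mul1e (ds X)) lte_pmul2r// lte_fin; lra.
  move=> /ereal_sup_gt[_ [C sC <-] HC]; exists C => _ _; split => //.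
  rewrite -lee_pdivrMl// (le_trans (ltW HC))//.
  case: sC => mC CX rC; rewrite leeBlDr; last first.
    rewrite ge0_fin_numE// (le_lt_trans rC)// ltey_eq kfin//.
    exact: subset_trans CX XA.
  by rewrite -[leLHS]adde0 leeD.
pose X := fix X n := if n is k.+1 then X k `\` f (X k) else A.
have HX n : measurable (X n) /\ X n `<=` A.
  elim: n => [|n [mX XA]] /=; first by split.
  have [[mC CX _] _] := Hf _ mX XA.
  by split; [exact: measurableD|apply: subset_trans XA => x []].
pose C n := f (X n).
have HC n : sub (X n) (C n) /\ ds (X n) <= 2%:E * kappa (C n).
  by have [mX XA] := HX n; exact: Hf.
have mC n : measurable (C n) by have [[]] := HC n.
have Xdec n m : (n <= m)%N -> X m `<=` X n.
  elim: m => [|m IH]; first by rewrite leqn0 => /eqP ->.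
  rewrite leq_eqVlt => /orP[/eqP -> //|]; rewrite ltnS => /IH.
  by apply: subset_trans => x [].
have CA n : C n `<=` A.
  by have [[_ CX _] _] := HC n; apply: (subset_trans CX); exact: (HX n).2.
have tC : trivIset setT C.
  have aux n m : (n < m)%N -> C n `&` C m = set0.
    move=> nm; apply/seteqP; split => // x [Cn Cm].
    have [[_ CX _] _] := HC m; have := Xdec _ _ nm _ (CX _ Cm).
    by move=> /= [].
  apply/trivIsetP => n m _ _; rewrite neq_ltn => /orP[/aux //|/aux].
  by rewrite setIC.
pose B := A `\` \bigcup_n C n.
have mUC : measurable (\bigcup_n C n) by exact: bigcupT_measurable.
have mB : measurable B by exact: measurableD.
have UCA : \bigcup_n C n `<=` A by move=> x [n _]; exact: CA.
have BX n : B `<=` X n.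
  move=> x [Ax nC]; elim: n => //= n Xn; split => // Cn.
  by apply: nC; exists n.
have splitA (m : {measure set T -> \bar R}) : m A = m B + m (\bigcup_n C n).
  rewrite -measureU//.
    by congr (m _); rewrite setUC /B setDUK.
  by apply/seteqP; split => // x [[_]].
exists B; split => //.
- by move=> x [].
- rewrite ltNge; apply/negP => rk; move: kr; rewrite ltNge => /negP; apply.
  rewrite (splitA rho) (splitA kappa) leeD//.
  rewrite !measure_bigcup//; apply: lee_nneseries => // n _.
  by have [[]] := HC n.
move=> D mD DB; rewrite leNgt; apply/negP => rkD.
have DA : D `<=` A by apply: (subset_trans DB) => x [].
have kD := kfin _ mD DA.
have rD : rho D \is a fin_num by rewrite ge0_fin_numE// (lt_trans rkD)// ltey_eq kD.
pose e := (fine (kappa D) - fine (rho D))%R.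
have e0 : (0 < e)%R by rewrite subr_gt0 fine_lt.
(* A bad set [D] inside [B] would have been available at every stage, so each removed set would
   carry [kappa] at least [e / 2]; infinitely many disjoint such sets do not fit into [A]. *)
have eC n : (e / 2)%:E <= kappa (C n).
  have : e%:E <= ds (X n).
    apply: ereal_sup_ubound; exists D; last by rewrite /e EFinB !fineK.
    by split => //; [exact: subset_trans DB (BX n)|exact: ltW].
  move=> /le_trans /(_ (HC n).2).
  by rewrite -lee_pdivrMl// -EFinM mulrC.
have kn n : (e / 2 *+ n)%:E <= kappa A.
  have : \sum_(i < n) (e / 2)%:E <= \sum_(i < n) kappa (C i).
    by apply: lee_sum => i _; exact: eC.
  rewrite sumEFin sumr_const card_ord => /le_trans; apply.
  rewrite -measure_bigsetU//.
  apply: le_measure; rewrite ?inE//.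
    exact: bigsetU_measurable.
  by rewrite -bigcup_mkord => x [i _]; exact: CA.
have := kn (Num.bound (fine (kappa A) / (e / 2))).
have kA := kfin _ mA (@subset_refl _ A).
rewrite -(fineK kA) lee_fin leNgt => /negP; apply.
rewrite -mulr_natl -ltr_pdivrMr ?divr_gt0//.
by apply: archi_boundP; rewrite divr_ge0 ?fine_ge0// ltW// divr_gt0.
Qed.

End HahnGreedy.
Section LargestMeasure.
Variable R : realType.
Variable L : R -> R -> \bar R.

Definition superadditive01 :=
  (forall a b : R, (0 <= a)%R -> (a <= b)%R -> (b <= 1)%R -> 0 <= L a b) /\
  (forall a b c : R, (0 <= a)%R -> (a <= b)%R -> (b <= c)%R -> (c <= 1)%R ->
    L a b + L b c <= L a c).

Hypothesis HL : superadditive01.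

Let L0 := HL.1.
Let Lsup := HL.2.

Let Lmono a b a' b' : (0 <= a)%R -> (a <= a')%R -> (a' <= b')%R -> (b' <= b)%R ->
  (b <= 1)%R -> L a' b' <= L a b.
Proof.
move=> a0 aa' ab' bb' b1.
have H1 : L a' b' <= L a b'.
  rewrite (le_trans _ (Lsup a0 aa' ab' (le_trans bb' b1)))// leeDr//.
  by apply: L0 => //; rewrite (le_trans _ (le_trans bb' b1)).
rewrite (le_trans H1)// (le_trans _ (Lsup a0 (le_trans aa' ab') bb' b1))// leeDl//.
by apply: L0 => //; rewrite (le_trans a0)// (le_trans aa').
Qed.

(* Replacing [L] by its inner regularization removes the mass that [L] puts at
   the endpoints, where a measure of open intervals cannot see it. *)
Let L' (a b : R) := ereal_sup
  (0 |` [set L x.1 x.2 | x in [set x : R * R | [/\ (a < x.1)%R, (x.1 <= x.2)%R & (x.2 < b)%R]]]).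

Let L'0 a b : 0 <= L' a b.
Proof. by apply: ereal_sup_ubound; left. Qed.

Let L'le a b : (0 <= a)%R -> (a <= b)%R -> (b <= 1)%R -> L' a b <= L a b.
Proof.
move=> a0 ab b1; apply: ge_ereal_sup => _ [->|[[x y] /= [ax xy yb] <-]].
  exact: L0.
by apply: Lmono => //; exact: ltW.
Qed.

Let L'E a b : (b <= a)%R -> L' a b = 0.
Proof.
move=> ba; apply/eqP; rewrite eq_le L'0 andbT; apply: ge_ereal_sup.
move=> _ [->//|[[x y] /= [ax xy yb] <-]].
by have := lt_le_trans (lt_le_trans ax xy) (le_trans (ltW yb) ba); rewrite ltxx.
Qed.

Let L'super a b : (0 <= a)%R -> (b <= 1)%R -> forall x y, (a < x)%R -> (x <= y)%R ->
  (y < b)%R -> L' a x + L x y <= L' a b.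
Proof.
move=> a0 b1 x y ax xy yb; rewrite addeC.
apply: adde_ereal_sup_le.
- by exists 0; left.
- by apply: L0 => //; [rewrite ltW// (le_lt_trans a0)|rewrite ltW// (lt_le_trans yb)].
- move=> _ [->//|[[u v] /= [au uv vx] <-]].
  apply: L0 => //; first by rewrite ltW// (le_lt_trans a0).
  by rewrite ltW// (lt_le_trans vx)// (le_trans xy)// ltW// (lt_le_trans yb).
- move=> _ [->|[[u v] /= [au uv vx] <-]].
    by rewrite adde0; apply: ereal_sup_ubound; right; exists (x, y).
  rewrite addeC; apply: (@le_trans _ _ (L u y)).
    have vy : (v <= y)%R by rewrite (le_trans (ltW vx)).
    apply: (@le_trans _ _ (L u v + L v y)).
      apply: leeD => //; apply: Lmono => //; rewrite ?(ltW vx) ?(ltW (lt_le_trans yb b1))//.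
      by rewrite (le_trans a0)// (le_trans (ltW au)).
    apply: Lsup => //; first by rewrite (le_trans a0)// ltW.
    by rewrite ltW// (lt_le_trans yb).
  apply: ereal_sup_ubound; right; exists (u, y) => //; split => //=.
  by rewrite (le_trans uv)// (le_trans (ltW vx)).
Qed.

(** The gauge of Carathéodory's construction. The infimum over no interval is [+oo], so a set that
    is not contained in []0, 1[] costs [+oo]; no constraint on open subintervals bears there, and a
    largest measure must be infinite there. *)
Let cost (A : set R) := ereal_inf [set L' x.1 x.2 | x in
  [set x : R * R | [/\ (0 <= x.1)%R, (x.2 <= 1)%R & A `<=` `]x.1, x.2[]]].

Let cost_ge0 A : 0 <= cost A.
Proof. by apply: le_ereal_inf_tmp => _ [x _ <-]. Qed.

Let cost0 : cost set0 = 0.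
Proof.
apply/eqP; rewrite eq_le cost_ge0 andbT; apply: ereal_inf_lbound.
by exists (0%R, 0%R); [split => //=|exact: L'E].
Qed.

Let out : set R -> \bar R := mu_ext cost.

Let outm : {outer_measure set R -> \bar R} := HB.pack_for {outer_measure set R -> \bar R} out
  (isOuterMeasure.Build R R out (mu_ext0 cost0 cost_ge0) (mu_ext_ge0 cost_ge0)
     (le_mu_ext cost) (mu_ext_sigma_subadditive cost_ge0)).

Let out_itv a b : (0 <= a)%R -> (b <= 1)%R -> out `]a, b[%classic <= L' a b.
Proof.
move=> a0 b1; apply: (@le_trans _ _ (cost `]a, b[%classic)); last first.
  by apply: ereal_inf_lbound; exists (a, b) => //=; split.
apply: ereal_inf_lbound; exists (fun n => if n is 0%N then `]a, b[%classic else set0).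
  split; first by case.
  by move=> x abx; exists 0%N.
rewrite nneseries_recl//= eseries0 ?adde0// => -[|n]//= _ _; exact: cost0.
Qed.

(** The part of [A] up to and including [c] is covered only by intervals []a, x[] with [x > c]. As
    [L' c b] is a supremum over pairs [x <= y] strictly inside []c, b[], each pair leaves that room,
    and [L' a x + L x y <= L' a b] closes the estimate. This is where the inner regularization is
    used. *)
Let out_cut c (A : set R) : out (A `&` `]-oo, c]) + out (A `&` ~` `]-oo, c]) <= cost A.
Proof.
apply: le_ereal_inf_tmp => _ [[a b] /= [a0 b1 Aab] <-].
have outS X Y : X `<=` Y -> out X <= out Y by exact: le_mu_ext.
have out0 : out set0 = 0 by exact: (mu_ext0 cost0 cost_ge0).
have [ca|ac] := leP c a.
  rewrite (_ : A `&` `]-oo, c] = set0); last first.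
    apply/seteqP; split => // x [/Aab]; rewrite /= !in_itv/= => /andP[ax _] xc.
    by have := lt_le_trans ax (le_trans xc ca); rewrite ltxx.
  rewrite out0 add0e (le_trans _ (out_itv a0 b1))//; apply: outS => x [Ax _].
  exact: Aab.
have [bc|cb] := leP b c.
  rewrite (_ : A `&` ~` `]-oo, c] = set0); last first.
    apply/seteqP; split => // x [/Aab]; rewrite /= !in_itv/= => /andP[_ xb].
    by apply; rewrite ltW// (lt_le_trans xb).
  rewrite out0 adde0 (le_trans _ (out_itv a0 b1))//; apply: outS => x [Ax _].
  exact: Aab.
apply: (@le_trans _ _ (out (A `&` `]-oo, c]) + L' c b)).
  apply: leeD2l; apply: (@le_trans _ _ (out `]c, b[%classic)).
    apply: outS => x [/Aab]; rewrite /= !in_itv/= => /andP[_ ->] /negP.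
    by rewrite -ltNge andbT.
  by apply: out_itv => //; rewrite ltW// (le_lt_trans a0).
have outc x : (c < x)%R -> (x < b)%R -> out (A `&` `]-oo, c]) <= L' a x.
  move=> cx xb; apply: (@le_trans _ _ (out `]a, x[%classic)).
    apply: outS => y [/Aab]; rewrite /= !in_itv/= => /andP[-> _] /= yc.
    exact: le_lt_trans cx.
  by apply: out_itv => //; rewrite ltW// (lt_le_trans xb).
apply: adde_ereal_sup_le.
- by exists 0; left.
- exact: mu_ext_ge0.
- move=> _ [->//|[[u v] /= [au uv vx] <-]].
  apply: L0 => //; first by rewrite (le_trans a0)// ltW// (lt_trans ac).
  by rewrite ltW// (lt_le_trans vx).
move=> _ [->|[[x y] /= [cx xy yb] <-]].
  rewrite adde0 (le_trans _ (out_itv a0 b1))//; apply: outS => x [Ax _].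
  exact: Aab.
apply: (@le_trans _ _ (L' a x + L x y)).
  by apply: leeD2r; apply: outc => //; exact: le_lt_trans yb.
by apply: L'super => //; exact: lt_trans cx.
Qed.

Let out_caratheodory c : out.-caratheodory `]-oo, c]%classic.
Proof.
apply: (@le_caratheodory_measurable _ _ outm) => X.
apply: le_ereal_inf_tmp => _ [F [mF XF] <-].
apply: (@le_trans _ _ (\sum_(k <oo) (out (F k `&` `]-oo, c]) + out (F k `&` ~` `]-oo, c])))).
  rewrite nneseriesD; try by move=> *; exact: mu_ext_ge0.
  apply: leeD.
    apply: le_trans (outer_measure_sigma_subadditive outm _).
    by apply: le_mu_ext; rewrite -setI_bigcupl; exact: setSI.
  apply: le_trans (outer_measure_sigma_subadditive outm _).
  by apply: le_mu_ext; rewrite -setI_bigcupl; exact: setSI.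
apply: lee_nneseries => n _.
  by rewrite adde_ge0//; exact: mu_ext_ge0.
exact: out_cut.
Qed.

Let measurable_out (A : set R) : measurable A -> out.-caratheodory A.
Proof.
move=> mA; have : (@RGenOInfty.G R).-sigma.-measurable A.
  by rewrite -RGenOInfty.measurableE.
apply: smallest_sub.
  split; first exact: (caratheodory_measurable_set0 outm).
    by move=> B mB; rewrite setTD; exact: (@caratheodory_measurable_setC _ _ outm).
  by move=> F mF; exact: (@caratheodory_measurable_bigcup _ _ outm).
move=> _ [r ->]; rewrite -setCitvl.
exact/(@caratheodory_measurable_setC _ _ outm)/out_caratheodory.
Qed.

Let out_sigma : semi_sigma_additive (out : set R -> \bar R).
Proof.
move=> F mF tF mUF.
apply: (@caratheodory_measure_sigma_additive _ _ outm F) => //.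
  by move=> i; exact: (measurable_out (mF i)).
exact: (measurable_out mUF).
Qed.

Let nu : {measure set R -> \bar R} :=
  HB.pack_for {measure set R -> \bar R} out
    (isMeasure.Build _ _ _ out (mu_ext0 cost0 cost_ge0) (mu_ext_ge0 cost_ge0) out_sigma).

Lemma largest_measure : exists nu : {measure set R -> \bar R},
  (forall a b : R, (0 <= a)%R -> (a < b)%R -> (b <= 1)%R -> nu `]a, b[%classic <= L a b) /\
  (forall nu' : {measure set R -> \bar R},
    (forall a b : R, (0 <= a)%R -> (a < b)%R -> (b <= 1)%R -> nu' `]a, b[%classic <= L a b) ->
    forall A, measurable A -> nu' A <= nu A).
Proof.
exists nu; split.
  by move=> a b a0 ab b1; rewrite (le_trans (out_itv a0 b1))// L'le// ltW.
move=> nu' Hnu' A mA.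
apply: le_ereal_inf_tmp => _ [F [mF AF] <-].
have nuF B : measurable B -> nu' B <= cost B.
  move=> mB; apply: le_ereal_inf_tmp => _ [[a b] /= [a0 b1 Bab] <-].
  apply: (@le_trans _ _ (nu' `]a, b[%classic)); first by rewrite le_measure// inE.
  (* [nu'] of the open interval is the limit over shrunken intervals; their endpoints lie strictly
     inside, so [L'] sees the bound that [L] imposes on each. *)
  pose G n := `](a + n.+1%:R^-1)%R, (b - n.+1%:R^-1)%R[%classic : set R.
  have GU : \bigcup_n G n = `]a, b[%classic.
    apply/seteqP; split => x.
      move=> [n _]; rewrite /G/= !in_itv/= => /andP[ax xb].
      have : (0 < n.+1%:R^-1 :> R)%R by rewrite invr_gt0.
      by move: ax xb; move: (n.+1%:R^-1 : R)%R => u *; apply/andP; split; lra.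
    rewrite /= in_itv/= => /andP[ax xb].
    pose e := Num.min (x - a)%R (b - x)%R.
    have e0 : (0 < e)%R by rewrite lt_min !subr_gt0 ax.
    have ie0 : (0 <= e^-1)%R by rewrite invr_ge0 ltW.
    exists (Num.bound e^-1) => //.
    have : ((Num.bound e^-1).+1%:R^-1 < e)%R.
      by rewrite invf_plt ?posrE// (lt_le_trans (archi_boundP ie0))// ler_nat.
    rewrite lt_min /G/= in_itv/=; move: (_%:R^-1 : R)%R => u /andP[h1 h2].
    by apply/andP; split; lra.
  have ndG : nondecreasing_seq G.
    move=> n m nm; apply/subsetPset => x; rewrite /G/= !in_itv/=.
    have : (m.+1%:R^-1 <= n.+1%:R^-1 :> R)%R by rewrite lef_pV2 ?posrE// ler_nat.
    move: (_%:R^-1 : R)%R (_%:R^-1 : R)%R => u w h /andP[ax xb].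
    by apply/andP; split; lra.
  have mG n : measurable (G n) by exact: measurable_itv.
  have := nondecreasing_cvg_mu (mu := nu') mG _ ndG.
  rewrite GU => /(_ (measurable_itv _)) cv.
  rewrite -(cvg_lim _ cv)//; apply: lime_le; first by apply/cvg_ex; eexists; exact: cv.
  apply: nearW => n /=.
  have n0 : (0 < n.+1%:R^-1 :> R)%R by rewrite invr_gt0.
  have [ab|ba] := ltP (a + n.+1%:R^-1)%R (b - n.+1%:R^-1)%R; last first.
    by rewrite /G set_itv_ge -?leNgt ?bnd_simp// measure0.
  move: ab n0; rewrite /G; move: (_%:R^-1 : R)%R => u ab u0.
  apply: (le_trans (Hnu' _ _ _ ab _)); [lra|lra|].
  apply: ereal_sup_ubound; right.
  by exists (a + u, b - u)%R => //=; split; lra.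
apply: (@le_trans _ _ (\sum_(k <oo) nu' (F k))).
  exact: measure_sigma_subadditive.
by apply: lee_nneseries => // n _; exact: nuF.
Qed.

End LargestMeasure.

Section TransferR.
Variable R : realType.

(* [R] and [measurableTypeR R] carry the same sigma-algebra under different
   displays, so that measures on one are not syntactically measures on the other. *)
Definition measTR (nu : {measure set R -> \bar R}) :
    {measure set (measurableTypeR R) -> \bar R} :=
  HB.pack_for {measure set (measurableTypeR R) -> \bar R} (nu : set R -> \bar R)
    (isMeasure.Build _ (measurableTypeR R) R (nu : set R -> \bar R) (measure0 nu) (measure_ge0 nu)
      (@measure_semi_sigma_additive _ _ _ nu)).

Definition measRT (nu : {measure set (measurableTypeR R) -> \bar R}) :
    {measure set R -> \bar R} :=
  HB.pack_for {measure set R -> \bar R} (nu : set (measurableTypeR R) -> \bar R)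
    (isMeasure.Build _ R R (nu : set (measurableTypeR R) -> \bar R) (measure0 nu) (measure_ge0 nu)
      (@measure_semi_sigma_additive _ _ _ nu)).

Definition lebdens (v : R -> \bar R) (mv : measurable_fun [set: R] v) :
    {measure set (measurableTypeR R) -> \bar R} :=
  @mdens_measure _ (measurableTypeR R) R lebesgue_measure v mv.

Lemma lebdensE (v : R -> \bar R) (mv : measurable_fun [set: R] v) (A : set R) :
  (forall t, 0 <= v t) -> lebdens mv A = \int[@lebesgue_measure R]_(t in A) v t.
Proof. by move=> v0; exact: mdens_measureE. Qed.

End TransferR.

#[global] Instance leb_ae_filter (R : realType) :
  Filter (nbhs (almost_everywhere (@lebesgue_measure R))).
Proof. exact: (@ae_filter_ringOfSetsType _ (measurableTypeR R) R lebesgue_measure). Qed.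

Section LargestDensity.
Variable R : realType.
Local Notation leb := (@lebesgue_measure R).
Implicit Types (v g : R -> \bar R).

Lemma lebesgue_measure_sub01 (A : set R) : measurable A -> A `<=` `[0%R, 1%R] ->
  leb A < +oo.
Proof.
move=> mA A01; apply: (@le_lt_trans _ _ (leb `[0%R, 1%R]%classic)).
  by apply: le_measure; rewrite ?inE.
by rewrite lebesgue_measure_itv/= lte_fin ltr01 ltry.
Qed.

(** Split [A] along [v <= w]: on either part the maximum is one of the two functions, and [nu] is
    additive. *)
Lemma below_measure_max d (T : measurableType d) (mu nu : {measure set T -> \bar R})
    (v w : T -> \bar R) A :
  measurable_fun setT v -> measurable_fun setT w ->
  (forall x, 0 <= v x) -> (forall x, 0 <= w x) -> measurable A ->
  (forall B, measurable B -> B `<=` A -> \int[mu]_(x in B) v x <= nu B) ->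
  (forall B, measurable B -> B `<=` A -> \int[mu]_(x in B) w x <= nu B) ->
  \int[mu]_(x in A) Order.max (v x) (w x) <= nu A.
Proof.
move=> mv mw v0 w0 mA Hv Hw.
pose B := A `&` [set x | v x <= w x].
have mB : measurable B.
  by apply: emeasurable_le_set => //; exact: measurable_funTS.
have BA : B `<=` A by move=> x [].
have AE : A = B `|` (A `\` B) by rewrite setDUK.
rewrite [in leLHS]AE ge0_integral_setU//; last 4 first.
- exact: measurableD.
- by apply: measurable_maxe; exact: measurable_funTS.
- by move=> x _; rewrite le_max v0.
- by apply/disj_set2P; apply/seteqP; split => // x [Bx [_ /(_ Bx)]].
rewrite (eq_integral w); last first.
  by move=> x; rewrite inE => -[_ /= vw]; rewrite max_r.
rewrite (eq_integral v (D := A `\` B)); last first.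
  move=> x; rewrite inE => -[Ax nB]; rewrite max_l// leNgt; apply/negP => vw.
  by apply: nB; split => //=; exact: ltW.
rewrite [leRHS](_ : _ = nu B + nu (A `\` B)); last first.
  rewrite -measureU//; first by rewrite -AE.
    exact: measurableD.
  by apply/seteqP; split => // x [Bx [_ /(_ Bx)]].
apply: leeD; first exact: Hw.
by apply: Hv; [exact: measurableD|move=> x []].
Qed.

(** Take the largest density [v] whose integrals stay below [nu], which need not be sigma-finite. If
    an absolutely continuous [rho <= nu] had more mass than [v] on some [A], the greedy
    decomposition would give [B] with [v + e] below [rho], hence below [nu], on all subsets of [B].
    Then [v + e] restricted to [B] competes with [v], although [B] is not Lebesgue null because
    [rho B > 0]. *)
Lemma largest_ac_below (nu : {measure set R -> \bar R}) :
  exists v, [/\ measurable_fun setT v, forall t, 0 <= v t,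
    forall A : set R, measurable A -> A `<=` `[0%R, 1%R] -> \int[leb]_(t in A) v t <= nu A &
    forall rho : {measure set R -> \bar R},
      (forall A : set R, measurable A -> A `<=` `[0%R, 1%R] -> rho A <= nu A) ->
      (forall A : set R, measurable A -> A `<=` `[0%R, 1%R] -> leb A = 0 -> rho A = 0) ->
      forall A : set R, measurable A -> A `<=` `[0%R, 1%R] -> rho A <= \int[leb]_(t in A) v t].
Proof.
pose W := [set v : R -> \bar R | [/\ measurable_fun setT v, forall t, 0 <= v t &
   forall A : set R, measurable A -> A `<=` `[0%R, 1%R] -> \int[leb]_(t in A) v t <= nu A]].
have [v [mv v0 vnu] vmax] : exists2 v, W v & forall v', W v' -> {ae leb, forall x, v' x <= v x}.
  apply: (@largest_ae _ (measurableTypeR R) R lebesgue_measure W).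
  - exact: sigma_finiteT.
  - exists (cst 0); split => // A mA _.
    by rewrite integral0.
  - by move=> G [].
  - move=> v w [mv v0 Hv] [mw w0 Hw]; split.
    + exact: measurable_maxe.
    + by move=> t; rewrite le_max v0.
    + move=> A mA A01; apply: (@below_measure_max _ (measurableTypeR R) lebesgue_measure (measTR nu)) => //.
      * by move=> B mB BA; apply: Hv => //; exact: subset_trans A01.
      * by move=> B mB BA; apply: Hw => //; exact: subset_trans A01.
  - move=> G WG ndG; split.
    + apply: (@emeasurable_fun_cvg _ _ _ _ G); first by move=> n; have [] := WG n.
      by move=> x _; exact: ereal_nondecreasing_is_cvgn.
    + move=> t; apply: lime_ge; first exact: ereal_nondecreasing_is_cvgn.
      by apply: nearW => n; have [] := WG n.
    + move=> A mA A01; rewrite monotone_convergence//; last 2 first.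
      * by move=> n; apply: measurable_funTS; have [] := WG n.
      * by move=> n x _; have [] := WG n.
      apply: lime_le.
        apply: ereal_nondecreasing_is_cvgn => n m nm; apply: ge0_le_integral => //.
        * by move=> x _; have [] := WG n.
        * by apply: measurable_funTS; have [] := WG n.
        * by apply: measurable_funTS; have [] := WG m.
        * by move=> x _; exact: ndG.
      by apply: nearW => n; have [_ _] := WG n; exact.
exists v; split => // rho rhonu rhoac A mA A01.
rewrite leNgt; apply/negP => lt.
have lebA := lebesgue_measure_sub01 mA A01.
have vA : \int[leb]_(t in A) v t \is a fin_num.
  rewrite ge0_fin_numE; last by apply: integral_ge0.
  by apply: (lt_le_trans lt); exact: leey.
have [e e0 lte] : exists2 e : R, (0 < e)%R & \int[leb]_(t in A) v t + e%:E * leb A < rho A.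
  have [r r0 rA] : exists2 r : R, (0 < r)%R & \int[leb]_(t in A) v t + r%:E < rho A.
    move: lt; rewrite -(fineK vA); case: (rho A) => [b| |]//.
      rewrite lte_fin => ab; exists ((b - fine (\int[leb]_(t in A) v t)) / 2)%R; first lra.
      by rewrite -EFinD lte_fin; lra.
    by move=> _; exists 1%R => //; rewrite -EFinD ltry.
  have lebfin : leb A \is a fin_num by rewrite ge0_fin_numE.
  (* The total increase [e * leb A] stays below the gap [r]; the [1 +] keeps the denominator
     positive when [leb A = 0]. *)
  pose e := (r / (1 + fine (leb A)))%R.
  have d0 : (0 < 1 + fine (leb A))%R by rewrite ltr_pwDl// fine_ge0.
  exists e; first by rewrite divr_gt0.
  apply: le_lt_trans rA; apply: leeD2l.
  rewrite -(fineK lebfin) -EFinM lee_fin /e mulrAC ler_pdivrMr// ler_pM2l//.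
  by rewrite lerDr.
pose ve t := v t + e%:E.
have mve : measurable_fun setT ve by apply: emeasurable_funD.
have ve0 t : 0 <= ve t by rewrite adde_ge0// lee_fin ltW.
pose kappa := lebdens mve.
have kE B : kappa B = \int[leb]_(t in B) ve t by exact: lebdensE.
have kA : kappa A = \int[leb]_(t in A) v t + e%:E * leb A.
  rewrite kE ge0_integralD ?integral_cst//; first exact: measurable_funTS.
  by move=> *; rewrite lee_fin ltW.
have [B [mB BA kB HB]] : exists B, [/\ measurable B, B `<=` A, kappa B < rho B &
    forall C, measurable C -> C `<=` B -> kappa C <= rho C].
  apply: (@greedy_positive_part _ (measurableTypeR R) R kappa (measTR rho)) => //; last by rewrite kA.
  by rewrite kA (lt_le_trans lte)// leey.
have B01 := subset_trans BA A01.
have lebB : leb B != 0.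
  by apply/eqP => /(rhoac _ mB B01) rB; move: kB; rewrite rB ltNge measure_ge0.
have : W (ve \_ B).
  split.
  - by apply/(measurable_restrictT _ mB); exact: measurable_funTS.
  - by move=> t; rewrite patchE; case: ifP.
  - move=> C mC C01; rewrite -integral_mkcondr -kE.
    apply: (@le_trans _ _ (rho (C `&` B))).
      by apply: HB; [exact: measurableI|move=> x []].
    apply: (@le_trans _ _ (rho C)); last exact: rhonu.
    by rewrite le_measure ?inE//; exact: measurableI.
move=> /vmax Hv.
have : {ae leb, forall x, ~ B x}.
  have vfin : leb.-integrable A v.
    apply/integrableP; split; first exact: measurable_funTS.
    have -> : (fun x => `|v x|) = v by apply/funext => x; rewrite gee0_abs.
    by rewrite -ge0_fin_numE// integral_ge0.
  have := @integrable_ae _ (measurableTypeR R) R lebesgue_measure A mA v vfin.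
  apply: filterS2 Hv => t.
  rewrite patchE; case: ifPn => [|/negP]; last by move=> nB _ _ Bt; apply: nB; rewrite inE.
  rewrite inE => Bt; rewrite /ve => le /(_ (BA _ Bt)) vt.
  by move: le; rewrite -[leRHS]adde0 leeD2lE// lee_fin leNgt e0.
move=> [N [mN N0 BN]]; move/eqP: lebB; apply.
apply: subset_measure0 N0 => //.
by move=> x Bx; apply: BN => /=; exact.
Qed.

(** [L] cannot be evaluated on the set where [g1 <= g2], so the bounds on intervals are first turned
    into bounds by the largest measure below [L], which hold on all Borel sets. *)
Lemma integral_max_below (L : R -> R -> \bar R) g1 g2 : superadditive01 L ->
  measurable_fun setT g1 -> measurable_fun setT g2 ->
  (forall t, 0 <= g1 t) -> (forall t, 0 <= g2 t) ->
  (forall a b : R, (0 <= a)%R -> (a < b)%R -> (b <= 1)%R ->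
     \int[leb]_(t in `]a, b[) g1 t <= L a b) ->
  (forall a b : R, (0 <= a)%R -> (a < b)%R -> (b <= 1)%R ->
     \int[leb]_(t in `]a, b[) g2 t <= L a b) ->
  \int[leb]_(t in `]0%R, 1%R[) Order.max (g1 t) (g2 t) <= L 0%R 1%R.
Proof.
move=> HL m1 m2 g10 g20 H1 H2.
have [nu [nuL nuM]] := largest_measure HL.
apply: (@le_trans _ _ (nu `]0%R, 1%R[%classic)); last exact: nuL.
apply: (@below_measure_max _ (measurableTypeR R) lebesgue_measure (measTR nu)) => //.
  move=> B mB _; rewrite -(lebdensE m1)//.
  by apply: (nuM (measRT (lebdens m1))) => // a b a0 ab b1; rewrite -[leLHS]/(lebdens m1 _) lebdensE//; exact: H1.
move=> B mB _; rewrite -(lebdensE m2)//.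
by apply: (nuM (measRT (lebdens m2))) => // a b a0 ab b1; rewrite -[leLHS]/(lebdens m2 _) lebdensE//; exact: H2.
Qed.

End LargestDensity.

(** * Measurability on the space of curves *)

Section MetricFacts.
Variables (R : realType) (S : fmmst R).
Local Notation dist := (@bdist R S).
Implicit Types (x y z : S).

Lemma bdistxx x : dist x x = 0%R.
Proof. by have [H _ _ _] := bdist_metrizes S; apply/H. Qed.

Lemma bdist_eq0 x y : dist x y = 0%R -> x = y.
Proof. by have [H _ _ _] := bdist_metrizes S; move/H. Qed.

Lemma bdistC x y : dist x y = dist y x.
Proof. by have [_ H _ _] := bdist_metrizes S. Qed.

Lemma bdist_triangle x y z : (dist x z <= dist x y + dist y z)%R.
Proof. by have [_ _ H _] := bdist_metrizes S. Qed.

Lemma bdist_ge0 x y : (0 <= dist x y)%R.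
Proof.
have := bdist_triangle x y x; rewrite bdistxx [X in (_ + X)%R]bdistC; lra.
Qed.

Lemma nbhs_bdist x (A : set S) :
  nbhs x A <-> exists2 e : R, (0 < e)%R & [set y | (dist x y < e)%R] `<=` A.
Proof. by have [_ _ _ H] := bdist_metrizes S. Qed.

Lemma open_bdist (U : set S) :
  open U <-> forall x, U x -> exists2 e : R, (0 < e)%R & [set y | (dist x y < e)%R] `<=` U.
Proof.
rewrite openE; split => [oU x Ux|H x Ux].
  by have /nbhs_bdist := oU _ Ux.
by apply/nbhs_bdist; exact: H.
Qed.

Lemma open_ball_bdist x (e : R) : open [set y | (dist x y < e)%R].
Proof.
apply/open_bdist => y /= xy; exists (e - dist x y)%R; first by rewrite subr_gt0.
move=> z /= yz; have := bdist_triangle x y z; lra.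
Qed.

Lemma lipschitz_gt_open (phi : S -> R) (r : R) :
  (forall x y, (`|phi x - phi y| <= dist x y)%R) -> open [set x | (r < phi x)%R].
Proof.
move=> lip; apply/open_bdist => x /= rx; exists (phi x - r)%R; first by rewrite subr_gt0.
move=> y /= xy; have := lip x y; rewrite ler_norml => /andP[_ ?]; lra.
Qed.

Lemma lipschitz_continuous (phi : S -> R) :
  (forall x y, (`|phi x - phi y| <= dist x y)%R) -> continuous phi.
Proof.
move=> lip x; apply/cvgrPdist_lt => e e0.
suff : nbhs x [set y | (dist x y < e)%R].
  by apply: filterS => y /= xy; rewrite (le_lt_trans (lip _ _)).
by apply/nbhs_bdist; exists e.
Qed.

(* Capped distance to the complement of [U], without assuming the latter nonempty. *)
Lemma open_lipschitz (U : set S) : open U -> exists phi : S -> R,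
  [/\ forall x y, (`|phi x - phi y| <= dist x y)%R,
      forall x, (0 <= phi x <= 1)%R & forall x, U x <-> (0 < phi x)%R].
Proof.
move=> oU; pose E x := [set e : R | (0 <= e <= 1)%R /\ [set y | (dist x y < e)%R] `<=` U].
have E0 x : E x 0%R.
  split; first by rewrite lexx ler01.
  by move=> y /=; rewrite ltNge bdist_ge0.
have Eub x : has_ubound (E x) by exists 1%R => e [/andP[]].
have Eh x : has_sup (E x) by split; [exists 0%R|].
have E1 x e : E x e -> (e <= sup (E x))%R by move=> He; exact: ub_le_sup.
have Elip x y : (sup (E x) <= sup (E y) + dist x y)%R.
  apply: ge_sup; first by exists 0%R.
  move=> e [/andP[e0 e1] eU]; rewrite -lerBlDr.
  have [ed|ed] := leP (e - dist x y)%R 0%R.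
    by rewrite (le_trans ed)// E1.
  apply: E1; split; first by rewrite ltW//=; have := bdist_ge0 x y; lra.
  by move=> z /= yz; apply: eU => /=; have := bdist_triangle x y z; lra.
exists (fun x => sup (E x)); split.
- move=> x y; rewrite ler_norml; have := Elip x y; have := Elip y x.
  by rewrite bdistC => ? ?; apply/andP; split; lra.
- move=> x; rewrite E1//=; apply: ge_sup; first by exists 0%R.
  by move=> e [/andP[]].
- move=> x; split.
    move=> /(proj1 (open_bdist U) oU)[e e0 eU]; apply: (@lt_le_trans _ _ (Num.min e 1%R)).
      by rewrite lt_min e0 ltr01.
    apply: E1; split; first by rewrite le_min ltW// ler01 ge_min lexx orbT.
    by move=> y /= xy; apply: eU => /=; rewrite (lt_le_trans xy)// ge_min lexx.
  move=> /(@sup_gt _ _ 0%R) H; have [|e [/andP[_ _] eU] e0] := H.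
    by exists 0%R.
  by apply: eU => /=; rewrite bdistxx.
Qed.

Lemma dense_sequence : exists pt : nat -> S, forall x (e : R), (0 < e)%R ->
  exists i, (dist x (pt i) < e)%R.
Proof.
have [_ [D cD dD]] := carrier_polish S.
have : $| {surjfun [set: nat] >-> D} |.
  have /pfcard_geP[D0|//] := cD.
  have [|x [_]] := dD setT _ openT; first by exists point.
  by rewrite D0.
move=> /unsquash f; exists f => x e e0.
have [|y [/= xy Dy]] := dD [set y | (dist x y < e)%R] _ (open_ball_bdist x e).
  by exists x => /=; rewrite bdistxx.
have [i _ fi] := @surj _ _ _ _ f y Dy.
by exists i; rewrite fi.
Qed.

End MetricFacts.

Section BorelMeasurability.
Variables (R : realType) (S : fmmst R).
Local Notation dist := (@bdist R S).
Context d (T : measurableType d).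

Lemma borel_open (U : set S) : open U -> measurable (U : set (borel S)).
Proof. by move=> oU; exact: sub_sigma_algebra. Qed.

Lemma measurable_to_borel (F : T -> borel S) :
  (forall U : set S, open U -> measurable (F @^-1` U)) -> measurable_fun setT F.
Proof.
move=> H; apply: (measurability _ (erefl (@measurable _ (borel S)))) => //.
by move=> _ [U oU <-]; rewrite setTI; exact: H.
Qed.

Lemma lipschitz_borel (phi : S -> R) :
  (forall x y, (`|phi x - phi y| <= dist x y)%R) ->
  measurable_fun (setT : set (borel S)) phi.
Proof.
move=> lip; apply: (measurability _ (RGenOInfty.measurableE R)) => //.
move=> _ [_ [r ->]] <-; rewrite setTI; apply: borel_open.
rewrite (_ : _ @^-1` _ = [set x | (r < phi x)%R]).
  exact: lipschitz_gt_open.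
by apply/seteqP; split => x /=; rewrite in_itv/= andbT.
Qed.

(** Every open set is [phi > 0] for a 1-Lipschitz [phi] into [[0, 1]]. Testing with real functions
    allows pointwise limits and integral averages. *)
Lemma measurable_to_borel_lip (F : T -> borel S) :
  (forall phi : S -> R, (forall x y, (`|phi x - phi y| <= dist x y)%R) ->
    (forall x, (0 <= phi x <= 1)%R) -> measurable_fun setT (phi \o F)) ->
  measurable_fun setT F.
Proof.
move=> H; apply: measurable_to_borel => U /open_lipschitz[phi [lip phi01 Uphi]].
rewrite (_ : _ @^-1` _ = (phi \o F) @^-1` `]0%R, +oo[%classic).
  by rewrite -[X in measurable X]setTI; apply: H.
by apply/seteqP; split => x /=; rewrite in_itv/= andbT => /Uphi.
Qed.

Lemma lipschitz_comp_measurable (F : T -> borel S) (phi : S -> R) :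
  (forall x y, (`|phi x - phi y| <= dist x y)%R) -> measurable_fun setT F ->
  measurable_fun setT (phi \o F).
Proof. by move=> lip mF; apply: measurableT_comp => //; exact: lipschitz_borel. Qed.

Lemma bdist_lip (x : S) : forall y z, (`|dist y x - dist z x| <= dist y z)%R.
Proof.
move=> y z; rewrite ler_norml; have := bdist_triangle y z x; have := bdist_triangle z y x.
by rewrite (bdistC z y) => ? ?; apply/andP; split; lra.
Qed.

End BorelMeasurability.

Lemma measurable_fun_pieces d d' (T : measurableType d) (U : measurableType d')
    (z : T -> int) (g : int -> T -> U) :
  (forall k, measurable (z @^-1` [set k])) ->
  (forall k, measurable_fun setT (g k)) ->
  measurable_fun setT (fun x => g (z x) x).
Proof.
move=> mz mg _ B mB; rewrite setTI.
rewrite (_ : _ @^-1` _ = \bigcup_k (z @^-1` [set k] `&` g k @^-1` B)).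
  apply: countable_bigcupT_measurable; first exact: countableP.
  by move=> k; apply: measurableI => //; rewrite -[X in measurable X]setTI; exact: mg.
apply/seteqP; split => x /=; first by move=> gB; exists (z x).
by move=> [k _ [/= -> ?]].
Qed.

Section LeftDiscretization.
Variable R : realType.

(** [lgrid n (lceil n t)] is the largest point strictly below [t] of the grid of step [1 / (n + 1)].
    Approaching from strictly below fits left-continuous curves. *)
Definition lgrid (n : nat) (k : int) : R := ((k%:~R - 1) / n.+1%:R)%R.
Definition lceil (n : nat) (t : R) : int := Num.ceil (t * n.+1%:R)%R.

Let lceilP n (t : R) : ((lceil n t)%:~R - 1 < t * n.+1%:R <= (lceil n t)%:~R)%R.
Proof. by have := ceil_itv (t * n.+1%:R)%R; rewrite intrB. Qed.

Lemma lgrid_lt n t : (lgrid n (lceil n t) < t)%R.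
Proof. by rewrite /lgrid ltr_pdivrMr ?ltr0n//; have /andP[] := lceilP n t. Qed.

Lemma lgrid_ge n t : (t - n.+1%:R^-1 <= lgrid n (lceil n t))%R.
Proof.
rewrite /lgrid ler_pdivlMr ?ltr0n// mulrBl mulVf ?pnatr_eq0// lerD2r.
by have /andP[] := lceilP n t.
Qed.

Lemma lceil_preimage n k : lceil n @^-1` [set k] =
  `]((k%:~R - 1) / n.+1%:R)%R, (k%:~R / n.+1%:R)%R]%classic.
Proof.
apply/seteqP; split => t /=; rewrite in_itv/= ltr_pdivrMr ?ltr0n// ler_pdivlMr ?ltr0n//.
  by move=> <-; exact: lceilP.
by move=> H; apply: ceil_def; rewrite intrB.
Qed.

Lemma lgrid_cvg t : lgrid n (lceil n t) @[n --> \oo] --> t.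
Proof.
apply: (@squeeze_cvgr _ _ _ _ (fun n => t - n.+1%:R^-1)%R (cst t)).
- by apply: nearW => n; rewrite lgrid_ge/= ltW// lgrid_lt.
- rewrite -[X in _ --> X]subr0; apply: cvgB; first exact: cvg_cst.
  exact: cvg_harmonic.
- exact: cvg_cst.
Qed.

End LeftDiscretization.

Section CurveFacts.
Variables (R : realType) (S : fmmst R).
Local Notation dist := (@bdist R S).
Local Notation leb := (@lebesgue_measure R).
Implicit Types (c e : LCC S).

Definition clip01 (t : R) : R := (Num.max 0 (Num.min t 1))%R.

Lemma clip01_ge0 t : (0 <= clip01 t)%R. Proof. by rewrite le_max lexx. Qed.

Lemma clip01_le1 t : (clip01 t <= 1)%R.
Proof. by rewrite ge_max ler01 ge_min lexx orbT. Qed.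

Lemma clip01_mono : {homo clip01 : s t / (s <= t)%R}.
Proof.
move=> s t st; rewrite /clip01 ge_max !le_max lexx/=; apply/orP.
have [t0|t0] := leP (Num.min t 1)%R 0%R; last first.
  by right; rewrite le_min !ge_min st lexx orbT.
by left; rewrite (le_trans _ t0)// le_min !ge_min st lexx orbT.
Qed.

Lemma clip01_id t : (0 <= t)%R -> (t <= 1)%R -> clip01 t = t.
Proof. by move=> t0 t1; rewrite /clip01 min_l// max_r. Qed.

Lemma clip01_lip s t : (s <= t)%R -> (clip01 t - clip01 s <= t - s)%R.
Proof.
move=> st; rewrite /clip01 /Order.max /Order.min.
by do !(case: ifPn); rewrite -?leNgt; lra.
Qed.

Lemma curve_clip c t : c t = c (clip01 t).
Proof.
have [_ _ c0 c1] := curveP c.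
have [t0|t0] := leP t 0%R.
  by rewrite c0// /clip01 min_l ?max_l// (le_trans t0).
have [t1|t1] := leP 1%R t; last by rewrite clip01_id// ltW.
by rewrite c1// /clip01 min_r// max_r.
Qed.

Lemma curve_causal c s t : (s <= t)%R -> 0 <= tsep (c s) (c t).
Proof.
move=> st; rewrite curve_clip (curve_clip c t); have [H _ _ _] := curveP c.
by apply: H; rewrite ?clip01_ge0 ?clip01_le1 ?clip01_mono.
Qed.

Lemma curve_left c t (e : R) : (0 < e)%R -> exists2 del : R, (0 < del)%R &
  forall s, (t - del < s)%R -> (s <= t)%R -> (dist (c s) (c t) < e)%R.
Proof.
move=> e0; have [_ cl c0 c1] := curveP c.
have [t0|t0] := leP t 0%R.
  by exists 1%R => // s _ st; rewrite c0 ?(le_trans st)// (c0 t)// bdistxx.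
have [t1|t1] := leP t 1%R; last first.
  exists (t - 1)%R; first by rewrite subr_gt0.
  by move=> s s1 _; rewrite c1 ?(c1 t) ?bdistxx//; lra.
have : nbhs (c t) [set y | (dist (c t) y < e)%R] by apply/nbhs_bdist; exists e.
move=> /(cl t t0 t1); rewrite /at_left /nbhs/= /within/= => /nbhs_ballP[del /= del0 H].
exists del => // s ts; rewrite le_eqVlt => /predU1P[->|st]; first by rewrite bdistxx.
by rewrite bdistC; apply: H => //; rewrite /ball/= gtr0_norm; lra.
Qed.

Lemma curve_lgrid c t (phi : S -> R) : (forall x y, (`|phi x - phi y| <= dist x y)%R) ->
  phi (c (lgrid R n (lceil n t))) @[n --> \oo] --> phi (c t).
Proof.
move=> lip; apply/cvgrPdist_lt => e e0.
have [del del0 H] := curve_left c t e0.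
have /cvgrPdist_lt/(_ _ del0) := @lgrid_cvg R t; apply: filterS => n.
move=> tn; rewrite (le_lt_trans (lip _ _))// bdistC; apply: H; last by rewrite ltW// lgrid_lt.
by move: tn; rewrite ger0_norm ?subr_ge0 ?ltW ?lgrid_lt//; lra.
Qed.

End CurveFacts.

Section JointMeasurability.
Variables (R : realType) (S : fmmst R).
Local Notation dist := (@bdist R S).
Local Notation leb := (@lebesgue_measure R).
Context d (X : measurableType d).
Variable F : X -> LCC S.
Hypothesis mF : forall q : rat, (0 <= q <= 1)%R ->
  measurable_fun setT (fun x => F x (ratr q) : borel S).

Let mFgrid n k : measurable_fun setT (fun x => F x (clip01 (lgrid R n k)) : borel S).
Proof.
have E : exists2 q : rat, (0 <= q <= 1)%R & clip01 (lgrid R n k) = ratr q.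
  exists (Num.max 0 (Num.min ((k%:~R - 1) / n.+1%:R) 1))%R.
    by rewrite le_max lexx/= ge_max ler01 ge_min lexx orbT.
  have rr : lgrid R n k = ratr ((k%:~R - 1) / n.+1%:R)%R.
    by rewrite rmorphM/= fmorphV/= rmorphB/= rmorph1 ratr_int ratr_nat.
  rewrite rr /clip01; set z := (_ / _)%R.
  have h1 (y : rat) : (ratr y <= 1 :> R)%R = (y <= 1)%R.
    by rewrite -(rmorph1 (ratr : rat -> R)) ler_rat.
  have [z1|z1] := leP z 1%R.
    rewrite min_l ?h1//; have [z0|z0] := leP 0%R z; first by rewrite max_r ?ler0q.
    by rewrite max_l ?lerq0 ?(ltW z0)// rmorph0.
  rewrite min_r; first by rewrite !max_r ?ler01// rmorph1.
  by rewrite ltW// ltNge h1 -ltNge.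
by have [q q01 ->] := E; exact: mF.
Qed.

(** By left-continuity [F x t] is the limit of the values at the grid points below [t]. On each cell
    of the grid that value depends on [x] alone, and the clipped grid points are rationals in
    [[0, 1]], where the hypothesis applies. *)
Lemma measurable_joint_eval :
  measurable_fun setT (fun x : X * measurableTypeR R => F x.1 x.2 : borel S).
Proof.
apply: measurable_to_borel_lip => phi lip _.
apply: (@measurable_fun_cvg _ _ _ _ (fun n x => phi (F x.1 (clip01 (lgrid R n (lceil n x.2)))))).
  move=> n; apply: (@measurable_fun_pieces _ _ _ _ (fun x : X * measurableTypeR R => lceil n x.2)
     (fun k x => phi (F x.1 (clip01 (lgrid R n k))))).
    move=> k; rewrite -[X in measurable X]setTI.
    rewrite (_ : _ @^-1` _ = snd @^-1` (lceil n @^-1` [set k])); last by [].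
    by apply: measurable_snd => //; rewrite lceil_preimage; exact: measurable_itv.
  move=> k; apply: (measurableT_comp (lipschitz_borel lip)).
  exact: (measurableT_comp (mFgrid n k) measurable_fst).
move=> [x t] _ /=; under eq_fun do rewrite -curve_clip.
exact: curve_lgrid.
Qed.

Lemma measurable_eval_at (t : R) : measurable_fun setT (fun x => F x t : borel S).
Proof.
have := measurableT_comp measurable_joint_eval (pair2_measurable (t : measurableTypeR R)).
exact.
Qed.

End JointMeasurability.

Section EvalMeasurable.
Variables (R : realType) (S : fmmst R).
Local Notation dist := (@bdist R S).
Local Notation leb := (@lebesgue_measure R).
Implicit Types (c e : LCC S).

Lemma measurable_lip_curve c (phi : S -> R) :
  (forall x y, (`|phi x - phi y| <= dist x y)%R) ->
  measurable_fun [set: R] (fun t => phi (c t)).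
Proof.
move=> lip.
have H := @measurable_joint_eval R S _ unit (fun=> c) (fun q _ => measurable_cst _).
have := measurableT_comp (lipschitz_borel lip) (measurableT_comp H (pair1_measurable tt)).
exact.
Qed.

Lemma measurable_curve c : measurable_fun [set: R] (c : R -> borel S).
Proof.
by apply: measurable_to_borel_lip => phi lip _; exact: measurable_lip_curve.
Qed.

Lemma measurable_bdist_curve c e : measurable_fun [set: R] (fun t => dist (c t) (e t)).
Proof.
apply: (@measurable_fun_cvg _ _ _ _ (fun n t => dist (c t) (e (lgrid R n (lceil n t))))).
  move=> n; apply: (@measurable_fun_pieces _ _ R _ (lceil n)
     (fun k t => dist (c t) (e (lgrid R n k)))).
    by move=> k; rewrite lceil_preimage; exact: measurable_itv.
  move=> k; apply: (@measurable_lip_curve c (fun x => dist x (e (lgrid R n k)))).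
  exact: bdist_lip.
move=> t _; under eq_fun do rewrite bdistC; rewrite bdistC.
exact: (@curve_lgrid _ _ e t (fun x => dist x (c t)) (bdist_lip _)).
Qed.

Let energy_le_dist c e (a b : R) (phi : S -> R) : (0 <= a)%R -> (b <= 1)%R ->
  (forall x y, (`|phi x - phi y| <= dist x y)%R) -> (forall x, (0 <= phi x <= 1)%R) ->
  \int[leb]_(t in `]a, b[) (phi (c t))%:E <=
  \int[leb]_(t in `]a, b[) (phi (e t))%:E + lcc_dist c e.
Proof.
move=> a0 b1 lip phi01.
have sub : (`]a, b[%classic : set R) `<=` `[0%R, 1%R].
  by move=> t /=; rewrite !in_itv/= => /andP[? ?]; apply/andP; split; lra.
have m1 c' D : measurable_fun D (fun t : R => (phi (c' t))%:E).
  by apply/measurable_EFinP/measurable_funTS; exact: measurable_lip_curve.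
have m2 D : measurable_fun D (fun t : R => (dist (c t) (e t))%:E).
  by apply/measurable_EFinP/measurable_funTS; exact: measurable_bdist_curve.
have p0 c' t : 0 <= (phi (c' t))%:E.
  by rewrite lee_fin; have /andP[] := phi01 (c' t).
have d0 t : 0 <= (dist (c t) (e t))%:E by rewrite lee_fin bdist_ge0.
apply: (@le_trans _ _ (\int[leb]_(t in `]a, b[) ((phi (e t))%:E + (dist (c t) (e t))%:E))).
  apply: ge0_le_integral => //.
  - exact: m1.
  - by apply: emeasurable_funD; [exact: m1|exact: m2].
  - move=> t _; rewrite -EFinD lee_fin.
    have := lip (c t) (e t); rewrite ler_norml => /andP[_]; lra.
rewrite ge0_integralD//; [|exact: m1|exact: m2].
apply: leeD2l; rewrite /lcc_dist.
apply: (@le_trans _ _ (\int[leb]_(t in `[0%R, 1%R]) (dist (c t) (e t))%:E)).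
  by apply: ge0_subset_integral => //; exact: m2.
by rewrite leeDr// lee_fin bdist_ge0.
Qed.

Lemma lcc_open_measurable (U : set (LCC S)) : lcc_open U -> measurable (U : set (curves S)).
Proof. by move=> oU; exact: sub_sigma_algebra. Qed.

(** The average moves by at most [lcc_dist] between two curves, so its superlevel sets are open. *)
Let measurable_avg (a b : R) (phi : S -> R) : (0 <= a)%R -> (b <= 1)%R ->
  (forall x y, (`|phi x - phi y| <= dist x y)%R) -> (forall x, (0 <= phi x <= 1)%R) ->
  measurable_fun [set: curves S] (fun c : LCC S => \int[leb]_(t in `]a, b[) (phi (c t))%:E).
Proof.
move=> a0 b1 lip phi01; apply: emeasurable_fun_ray => r.
apply: lcc_open_measurable => c /=.
set I := fun c : LCC S => \int[leb]_(t in `]a, b[) (phi (c t))%:E; rewrite -/(I c) => rI.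
have Ifin e : I e \is a fin_num.
  rewrite ge0_fin_numE; last first.
    by apply: integral_ge0 => t _; rewrite lee_fin; have /andP[] := phi01 (e t).
  apply: (@le_lt_trans _ _ (\int[leb]_(t in `]a, b[) 1%:E)).
    apply: ge0_le_integral => //.
    - by move=> t _; rewrite lee_fin; have /andP[] := phi01 (e t).
    - by apply/measurable_EFinP/measurable_funTS; exact: measurable_lip_curve.
    - by move=> t _; rewrite lee_fin; have /andP[] := phi01 (e t).
  rewrite integral_cst//= mul1e; apply: lebesgue_measure_sub01 => //.
  by move=> t /=; rewrite !in_itv/= => /andP[? ?]; apply/andP; split; lra.
exists (fine (I c) - r)%R; first by rewrite subr_gt0 -lte_fin fineK.
move=> e /= ce; rewrite -/(I e).
have := @energy_le_dist c e a b phi a0 b1 lip phi01; rewrite -/(I c) -/(I e) => H.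
have D0 : 0 <= lcc_dist c e.
  by rewrite /lcc_dist adde_ge0 ?integral_ge0 ?lee_fin ?bdist_ge0// => t _; rewrite lee_fin bdist_ge0.
have Dfin : lcc_dist c e \is a fin_num by rewrite ge0_fin_numE// (lt_trans ce)// ltry.
move: H ce; rewrite -(fineK (Ifin c)) -(fineK (Ifin e)) -(fineK Dfin) -EFinD.
rewrite lee_fin !lte_fin; lra.
Qed.

Let measurable_ev0 : measurable_fun [set: curves S] (fun c : LCC S => c 0%R : borel S).
Proof.
apply: measurable_to_borel => U oU; apply: lcc_open_measurable => c /=.
move=> /(proj1 (open_bdist U) oU)[e e0 eU]; exists e => // g /= cg; apply: eU => /=.
rewrite -lte_fin (le_lt_trans _ cg)// /lcc_dist leeDl// integral_ge0// => t _.
by rewrite lee_fin bdist_ge0.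
Qed.

(** Evaluation at [t > 0] is not continuous for an integral distance. By left-continuity it is the
    limit of the averages over []t - 1 / (n + 1), t[], which are measurable; time 0 enters
    [lcc_dist] directly and is treated apart. *)
Lemma measurable_ev (t : R) : measurable_fun [set: curves S] (ev t : curves S -> borel S).
Proof.
have [t0|t0] := leP t 0%R.
  rewrite (_ : ev t = (fun c : LCC S => c 0%R))//.
  by apply/funext => c; rewrite /ev curve_clip /clip01 min_l ?max_l// (le_trans t0).
wlog t1 : t t0 / (t <= 1)%R.
  move=> H; have [|t1] := leP t 1%R; first exact: H.
  rewrite (_ : ev t = (ev 1%R : curves S -> borel S)); first by apply: H.
  by apply/funext => c; rewrite /ev curve_clip /clip01 min_r ?max_r// ltW.
apply: measurable_to_borel_lip => phi lip phi01.
pose h n (c : curves S) : R := (n.+1%:R * fine (\int[leb]_(s in `](t - n.+1%:R^-1)%R, t[)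
   (phi ((c : LCC S) s))%:E))%R.
(* From [N] on the averaging window stays inside [[0, 1]]. *)
pose N := Num.bound t^-1.
have ht n : (N <= n)%N -> (0 <= t - n.+1%:R^-1)%R.
  move=> Nn; rewrite subr_ge0 invf_ple ?posrE//.
  have it0 : (0 <= t^-1)%R by rewrite invr_ge0 ltW.
  by rewrite (le_trans (ltW (archi_boundP it0)))// ler_nat ltnW.
apply: (@measurable_fun_cvg _ _ _ _ (fun n => h (n + N)%N)).
  move=> n; apply: measurable_funM => //; apply: measurableT_comp => //.
  by apply: measurable_avg => //; apply: ht; rewrite leq_addl.
move=> c _; apply: (@cvg_comp _ _ _ (fun n => (n + N)%N) (h ^~ c) _ \oo).
  exact: cvg_addnr.
apply/cvgrPdist_le => e e0.
have [del del0 H] := curve_left c t e0.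
exists (maxn N (Num.bound del^-1)) => // n /=; rewrite geq_max => /andP[Nn deln].
have ndel : (n.+1%:R^-1 < del)%R.
  rewrite invf_plt ?posrE//.
  have id0 : (0 <= del^-1)%R by rewrite invr_ge0 ltW.
  by rewrite (lt_le_trans (archi_boundP id0))// ler_nat ltnW.
have n0 : (0 < n.+1%:R^-1 :> R)%R by rewrite invr_gt0.
set A := `](t - n.+1%:R^-1)%R, t[%classic.
have lebA : leb A = (n.+1%:R^-1)%:E.
  rewrite lebesgue_measure_itv/= lte_fin ltrBlDr ltrDl n0 -EFinD.
  by congr EFin; rewrite opprB addrC subrK.
have mA : measurable A by exact: measurable_itv.
have mphi : measurable_fun A (fun s => (phi ((c : LCC S) s))%:E).
  by apply/measurable_EFinP/measurable_funTS; exact: measurable_lip_curve.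
have phi0 s : 0 <= (phi ((c : LCC S) s))%:E.
  by rewrite lee_fin; have /andP[] := phi01 ((c : LCC S) s).
have close s : A s -> (`|phi ((c : LCC S) s) - phi ((c : LCC S) t)| <= e)%R.
  rewrite /A/= in_itv/= => /andP[ts st]; rewrite (le_trans (lip _ _))// ltW//.
  by apply: H; [apply: lt_trans ts; rewrite ltrD2l ltrN2|exact: ltW].
have up : \int[leb]_(s in A) (phi ((c : LCC S) s))%:E <= ((phi ((c : LCC S) t) + e) / n.+1%:R)%:E.
  rewrite EFinM -lebA -integral_cst//; apply: ge0_le_integral => //.
  by move=> s /close; rewrite ler_norml lee_fin => /andP[]; lra.
have lo : ((phi ((c : LCC S) t) - e) / n.+1%:R)%:E <= \int[leb]_(s in A) (phi ((c : LCC S) s))%:E.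
  have [pe|pe] := leP (phi ((c : LCC S) t) - e)%R 0%R.
    by apply: (@le_trans _ _ 0); rewrite ?integral_ge0// lee_fin pmulr_lle0.
  rewrite EFinM -lebA -integral_cst//; apply: ge0_le_integral => //.
    by move=> s _; rewrite lee_fin ltW.
  by move=> s /close; rewrite ler_norml lee_fin => /andP[]; lra.
have Ifin : \int[leb]_(s in A) (phi ((c : LCC S) s))%:E \is a fin_num.
  by rewrite ge0_fin_numE ?integral_ge0// (le_lt_trans up)// ltry.
rewrite /h -/A; move: up lo; rewrite -(fineK Ifin) !lee_fin/= ler_pdivlMr// ler_pdivrMr//.
rewrite ![(_ * n.+1%:R)%R]mulrC; set x := (n.+1%:R * _)%R; move=> ? ?.
by rewrite ler_norml; apply/andP; split; rewrite /comp/=; lra.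
Qed.

End EvalMeasurable.

Section IntoCurves.
Variables (R : realType) (S : fmmst R).
Local Notation dist := (@bdist R S).
Local Notation leb := (@lebesgue_measure R).
Implicit Types (c e : LCC S).

(* The Borel sets of curves are generated by the evaluations at rational times:
   an open set is a countable union of balls around step functions with values
   in a countable dense set. These centres need not be causal curves. *)
Lemma measurable_into_curves d (X : measurableType d) (F : X -> LCC S) :
  (forall q : rat, (0 <= q <= 1)%R ->
     measurable_fun setT (fun x => F x (ratr q) : borel S)) ->
  measurable_fun setT (F : X -> curves S).
Proof.
move=> mF; have [pt Hpt] := dense_sequence S.
have mJ := measurable_joint_eval mF.
(* A step function is coded by a list of indices into the dense sequence. [nth] and the absolute
   value only supply arbitrary values on cells that do not meet [[0, 1]]. *)
pose step (n : nat) (l : seq nat) (k : int) := pt (nth 0%N l `|k|%N).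
pose E (n : nat) (l : seq nat) (c : LCC S) : \bar R :=
  \int[leb]_(t in `[0%R, 1%R]) (dist (c t) (step n l (lceil n t)))%:E.
pose D (i n : nat) (l : seq nat) (c : LCC S) : \bar R := (dist (c 0%R) (pt i))%:E + E n l c.
have mjd n l : measurable_fun setT (fun x : X * measurableTypeR R =>
    dist (F x.1 x.2) (step n l (lceil n x.2))).
  apply: (@measurable_fun_pieces _ _ _ _ (fun x : X * measurableTypeR R => lceil n x.2)
     (fun k x => dist (F x.1 x.2) (step n l k))).
    move=> k; rewrite -[X in measurable X]setTI.
    rewrite (_ : _ @^-1` _ = snd @^-1` (lceil n @^-1` [set k])); last by [].
    by apply: measurable_snd => //; rewrite lceil_preimage; exact: measurable_itv.
  move=> k; apply: (lipschitz_comp_measurable _ mJ (phi := fun y => dist y (step n l k))).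
  exact: bdist_lip.
have mstep n l c : measurable_fun [set: R] (fun t => dist (c t) (step n l (lceil n t))).
  apply: (@measurable_fun_pieces _ _ R _ (lceil n) (fun k t => dist (c t) (step n l k))).
    by move=> k; rewrite lceil_preimage; exact: measurable_itv.
  move=> k; apply: (@measurable_lip_curve _ _ c (fun y => dist y (step n l k))).
  exact: bdist_lip.
have mE n l : measurable_fun setT (fun x => E n l (F x)).
  pose f (z : X * measurableTypeR R) : \bar R :=
    (dist (F z.1 z.2) (step n l (lceil n z.2)))%:E * (\1_(`[0%R, 1%R]%classic : set R) z.2)%:E.
  have H : measurable_fun setT (fubini_F lebesgue_measure f).
    apply: measurable_fun_fubini_tonelli_F; last first.
      by move=> z; rewrite mule_ge0// lee_fin ?bdist_ge0.
    apply: emeasurable_funM; first by apply/measurable_EFinP; exact: (mjd n l).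
    apply/measurable_EFinP; apply: (measurableT_comp _ measurable_snd).
    exact: measurable_indic.
  apply: eq_measurable_fun H => x _; rewrite /E [RHS]integral_mkcond.
  by apply: eq_integral => t _; rewrite /f patchE/= indicE; case: ifPn => _; rewrite ?mule1 ?mule0.
have mD i n l : measurable_fun setT (fun x => D i n l (F x)).
  apply: emeasurable_funD => //; apply/measurable_EFinP.
  apply: (lipschitz_comp_measurable (bdist_lip (pt i)) (measurable_eval_at mF 0%R)).
have E0 n l c : 0 <= E n l c by apply: integral_ge0 => t _; rewrite lee_fin bdist_ge0.
have mde c e : measurable_fun (`[0%R, 1%R]%classic : set R) (fun t => (dist (c t) (e t))%:E).
  by apply/measurable_EFinP/measurable_funTS; exact: measurable_bdist_curve.
have mse n l c : measurable_fun (`[0%R, 1%R]%classic : set R) (fun t => (dist (c t) (step n l (lceil n t)))%:E).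
  exact/measurable_EFinP/measurable_funTS.
have tri i n l c e : lcc_dist c e <= D i n l c + D i n l e.
  rewrite /lcc_dist /D addeACA -EFinD; apply: leeD.
    by rewrite lee_fin (bdistC (e 0%R)) bdist_triangle.
  rewrite /E -ge0_integralD//;
    do ?[exact: mse|by move=> t _; rewrite lee_fin bdist_ge0].
  apply: ge0_le_integral => //; do ?[exact: mse|exact: mde|by move=> t _; rewrite lee_fin bdist_ge0].
  - by apply: emeasurable_funD; exact: mse.
  - by move=> t _; rewrite -EFinD lee_fin (bdistC (e t)) bdist_triangle.
have approx c (r : R) : (0 < r)%R -> exists i n l, D i n l c < r%:E.
  move=> r0; have r2 : (0 < r / 2)%R by rewrite divr_gt0.
  have [i Hi] := Hpt (c 0%R) _ r2.
  have [pi Hpi] : {f : R -> S -> nat & forall (u : R) x, (0 < u)%R -> (dist x (pt (f u x)) < u)%R}.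
    have [f Hf] : {f : R * S -> nat & forall z, (0 < z.1)%R -> (dist z.2 (pt (f z)) < z.1)%R}.
      apply: (@choice _ _ (fun z i => (0 < z.1)%R -> (dist z.2 (pt i) < z.1)%R)) => -[u x] /=.
      have [e0|e0] := ltP 0%R u; last by exists 0%N.
      by have [j Hj] := Hpt x _ e0; exists j.
    by exists (fun u x => f (u, x)) => u x; exact: (Hf (u, x)).
  (* For [t] in [[0, 1]] the cell number [lceil n t] takes the [n + 2] values from 0 to [n + 1]. On
     each cell the centre is chosen within [1 / (n + 1)] of the value of [c] at the left grid
     point. *)
  pose l n := mkseq (fun k => pi n.+1%:R^-1%R (c (lgrid R n k%:Z))) n.+2.
  have lE n (t : R) : (0 <= t)%R -> (t <= 1)%R ->
      (dist (c (lgrid R n (lceil n t))) (step n (l n) (lceil n t)) < n.+1%:R^-1)%R.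
    move=> t0 t1.
    have k0 : (0 <= lceil n t)%R.
      by rewrite ceil_ge0 (@lt_le_trans _ _ 0%R) ?ltrN10// mulr_ge0.
    have [k kE] : exists k : nat, lceil n t = k%:Z.
      by exists `|lceil n t|%N; rewrite gez0_abs.
    have kn : (k < n.+2)%N.
      have : (t * n.+1%:R <= n.+1%:R)%R by rewrite ler_piMl.
      by rewrite ltnS -lez_nat -kE ceil_le_int.
    by rewrite kE /step /l absz_nat nth_mkseq//; apply: Hpi; rewrite invr_gt0.
  have [K HK] := bdist_bounded S.
  have : \int[leb]_(t in `[0%R, 1%R]) (dist (c t) (step n (l n) (lceil n t)))%:E @[n --> \oo] -->
      \int[leb]_(t in `[0%R, 1%R]) cst 0 t.
    have [] // := @dominated_convergence _ (measurableTypeR R) R lebesgue_measure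
      (`[0%R, 1%R]%classic : set R) (measurable_itv _)
      (fun n t => (dist (c t) (step n (l n) (lceil n t)))%:E) (cst 0) (cst K%:E).
    - by move=> n; exact: mse.
    - apply: aeW => t; rewrite /= in_itv/= => /andP[t0 t1].
      apply: cvg_EFin; first exact: nearW.
      apply/cvgr0Pnorm_lt => e e0.
      have e2 : (0 < e / 2)%R by rewrite divr_gt0.
      have /cvgrPdist_lt/(_ _ e2) H1 := @curve_lgrid _ _ c t (fun y => dist y (c t)) (bdist_lip _).
      have /cvgrPdist_lt/(_ _ e2) H2 := @cvg_harmonic R.
      near=> n => /=; rewrite ger0_norm ?bdist_ge0//.
      have h1 : (dist (c (lgrid R n (lceil n t))) (c t) < e / 2)%R.
        have : (`|dist (c t) (c t) - dist (c (lgrid R n (lceil n t))) (c t)| < e / 2)%R by near: n.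
        by rewrite bdistxx sub0r normrN ger0_norm ?bdist_ge0.
      have h2 : (n.+1%:R^-1 < e / 2)%R.
        have : (`|0 - harmonic n| < e / 2 :> R)%R by near: n.
        by rewrite sub0r normrN /harmonic/= ger0_norm// invr_ge0.
      have h3 := lE n t t0 t1.
      have := bdist_triangle (c t) (c (lgrid R n (lceil n t))) (step n (l n) (lceil n t)).
      rewrite (bdistC (c t) (c (lgrid R n (lceil n t)))) => h4.
      by rewrite (splitr e) (le_lt_trans h4)// ltrD// (lt_trans h3).
    - apply/integrableP; split => //; rewrite integral_cst//= lte_mul_pinfty//.
      exact: lebesgue_measure_sub01.
    - apply: aeW => t n _; rewrite /= lee_fin ger0_norm ?bdist_ge0//.
  rewrite integral0 => /fine_cvgP[[N1 _ Efin]] /cvgrPdist_lt /(_ _ r2) [N2 _ HN].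
  exists i, (maxn N1 N2), (l (maxn N1 N2)); rewrite /D.
  have {}Efin := Efin (maxn N1 N2) (leq_maxl _ _).
  have := HN (maxn N1 N2) (leq_maxr _ _); rewrite /= sub0r normrN ger0_norm ?fine_ge0 ?E0//.
  by rewrite -[E _ _ _](fineK Efin) -EFinD lte_fin /E; lra.
apply: (measurability _ (erefl (@measurable _ (curves S)))) => //.
move=> _ [U oU <-]; rewrite setTI.
pose I := (nat * nat * seq nat * nat)%type.
pose B (z : I) := [set c | D z.1.1.1 z.1.1.2 z.1.2 c < (z.2.+1%:R^-1)%:E].
rewrite (_ : F @^-1` U = \bigcup_(z in [set z : I | B z `<=` U]) (F @^-1` (B z))).
  rewrite bigcup_mkcond; apply: countable_bigcupT_measurable; first exact: countableP.
  move=> z; case: ifPn => _; last exact: measurable0.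
  have := emeasurable_fun_infty_o measurableT (mD z.1.1.1 z.1.1.2 z.1.2) (z.2.+1%:R^-1)%:E.
  by rewrite setTI.
apply/seteqP; split => x /=; last by move=> [z /= BU Bz]; exact: BU.
move=> /oU[r r0 rU].
(* Two curves within [1 / (m + 1)] of the same centre are closer than [r], so the chosen ball around
   [F x] stays in [U]. *)
pose m := Num.bound (r / 2)^-1.
have r2 : (0 < r / 2)%R by rewrite divr_gt0.
have mr : (m.+1%:R^-1 < r / 2)%R.
  rewrite invf_plt ?posrE//.
  have ir0 : (0 <= (r / 2)^-1)%R by rewrite invr_ge0 ltW.
  by rewrite (lt_le_trans (archi_boundP ir0))// ler_nat.
have m0 : (0 < m.+1%:R^-1 :> R)%R by rewrite invr_gt0.
have [i [n [l Hl]]] := approx (F x) _ m0.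
exists (i, n, l, m) => //= c /= Hc; apply: rU => /=.
apply: (le_lt_trans (tri i n l (F x) c)).
have : D i n l (F x) + D i n l c < (m.+1%:R^-1)%:E + (m.+1%:R^-1)%:E.
  by apply: lteD.
move=> /lt_le_trans; apply; rewrite -EFinD lee_fin.
by rewrite [leRHS](splitr r) lerD// ltW.
Unshelve. all: by end_near. Qed.

End IntoCurves.

Section Restriction.
Variables (R : realType) (S : fmmst R).
Local Notation dist := (@bdist R S).
Implicit Types (c e : LCC S).

(** The absolute value keeps the time change monotone for every [k], so that [restr] is a total
    function; clipping freezes the new curve outside [[0, 1]]. *)
Lemma restr_is_lcc (s k : R) c : is_lcc (fun r => c (s + `|k| * clip01 r)%R).
Proof.
have mono : {homo (fun r => s + `|k| * clip01 r)%R : a b / (a <= b)%R}.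
  by move=> a b ab; rewrite lerD2l ler_wpM2l ?clip01_mono.
split.
- by move=> a b _ ab _; apply: curve_causal; exact: mono.
- move=> t _ _ A /nbhs_bdist[e e0 eA].
  have [del del0 H] := curve_left c (s + `|k| * clip01 t)%R e0.
  have d0 : (0 < del / (`|k| + 1))%R by rewrite divr_gt0// ltr_pwDr.
  apply/nbhs_ballP; exists (del / (`|k| + 1))%R => //= r; rewrite /ball/= => tr rt.
  apply: eA => /=; rewrite bdistC; apply: H; last by apply: mono; exact: ltW.
  rewrite ltrBlDr -ltrBlDl opprD addrACA subrr add0r -mulrBr.
  apply: (@le_lt_trans _ _ (`|k| * (t - r))%R).
    by rewrite ler_wpM2l// clip01_lip// ltW.
  rewrite gtr0_norm ?subr_gt0// ltr_pdivlMr ?ltr_pwDr// in tr.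
  by rewrite (le_lt_trans _ tr)// mulrC ler_wpM2l ?subr_ge0 ?(ltW rt)// lerDl ler01.
- by move=> t t0; rewrite /clip01 !min_l ?ler01// ?(le_trans t0)// !max_l.
- by move=> t t1; rewrite /clip01 !min_r.
Qed.

Definition restr (s k : R) c : LCC S := MkLCC (restr_is_lcc s k c).

Lemma restrE s k c r : (0 <= k)%R -> restr s k c r = c (s + k * clip01 r)%R.
Proof. by move=> k0; rewrite /= ger0_norm. Qed.

Lemma measurable_restr s k : measurable_fun setT (restr s k : curves S -> curves S).
Proof.
apply: measurable_into_curves => q _.
exact: (@measurable_ev R S (s + `|k| * clip01 (ratr q))%R).
Qed.

End Restriction.

(** * Causal speed and its behaviour under restriction of curves *)

Section CausalSpeed.
Variables (R : realType) (S : fmmst R).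
Local Notation leb := (@lebesgue_measure R).
Implicit Types (c e : LCC S).

Lemma addx_ge0E (x y : \bar R) : 0 <= x -> 0 <= y -> addx x y = x + y.
Proof.
rewrite /addx; case: x => [x| |]//= _ y0.
by rewrite addye// gt_eqF// (lt_le_trans _ y0).
Qed.

Lemma tsep_superadditive c : superadditive01 (fun a b => tsep (c a) (c b)).
Proof.
split=> [a b _ ab _|a b d _ ab bd _]; first exact: curve_causal.
have ab0 := curve_causal c ab; have bd0 := curve_causal c bd.
have [_ _ /(_ (c a) (c b) (c d))] := tsepP S.
by rewrite !addx_ge0E// [X in Order.min _ X]addeC minxx.
Qed.

Lemma causal_speedP c : is_causal_speed c (causal_speed c).
Proof.
apply: xgetPex.
have [nu [nuL nuM]] := largest_measure (tsep_superadditive c).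
have [v [mv v0 vnu vM]] := largest_ac_below nu.
exists v, nu, (measRT (lebdens mv)).
have rE (A : set R) : measRT (lebdens mv) A = \int[leb]_(t in A) v t by exact: lebdensE.
split => //.
- by split=> // nu' Hnu' A mA _; exact: nuM.
- split; first split.
  + by move=> A mA A01; rewrite rE; exact: vnu.
  + move=> A mA A01 A0; rewrite rE; apply: null_set_integral => //.
    exact: measurable_funTS.
  + by move=> rho [rhonu rhoac] A mA A01; rewrite rE; exact: vM.
Qed.

Lemma measurable_speedf c : measurable_fun [set: R] (causal_speed c).
Proof. by have [nu [rho [_ _ [mv _] _]]] := causal_speedP c. Qed.

Lemma causal_speed_ge0 c t : 0 <= causal_speed c t.
Proof. by have [nu [rho [_ _ [_ v0] _]]] := causal_speedP c. Qed.

Lemma integral_speed_le c (a b : R) : (0 <= a)%R -> (a < b)%R -> (b <= 1)%R ->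
  \int[leb]_(t in `]a, b[) causal_speed c t <= tsep (c a) (c b).
Proof.
move=> a0 ab b1; have [nu [rho [[nuL _] [[rhonu _] _] _ rE]]] := causal_speedP c.
have sub : (`]a, b[%classic : set R) `<=` `[0%R, 1%R].
  by move=> t /=; rewrite !in_itv/= => /andP[? ?]; apply/andP; split; lra.
by rewrite -rE// (le_trans (rhonu _ _ sub))// nuL.
Qed.

Lemma causal_speed_largest c (v : R -> \bar R) :
  measurable_fun [set: R] v -> (forall t, 0 <= v t) ->
  (forall a b : R, (0 <= a)%R -> (a < b)%R -> (b <= 1)%R ->
    \int[leb]_(t in `]a, b[) v t <= tsep (c a) (c b)) ->
  {ae leb, forall t, `[0%R, 1%R]%classic t -> v t <= causal_speed c t}.
Proof.
move=> mv v0 Hv; have [nu [rho [[_ nuM] [_ rhoM] [ms s0] rE]]] := causal_speedP c.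
have vE (A : set R) : measRT (lebdens mv) A = \int[leb]_(t in A) v t by exact: lebdensE.
apply: (@ae_le_of_integral _ (measurableTypeR R) R lebesgue_measure) => //.
  exact: lebesgue_measure_sub01.
move=> A mA A01; rewrite -rE// -vE.
apply: (rhoM (measRT (lebdens mv))) => //; split.
  by apply: nuM => a b a0 ab b1; rewrite vE; exact: Hv.
move=> B mB B01 B0; rewrite vE; apply: null_set_integral => //.
exact: measurable_funTS.
Qed.

(** Both inequalities come from maximality. The rescaled speed of [c] is an admissible density for
    the restricted curve; conversely the speed of the restricted curve, scaled back to []s, s + k[]
    and extended by 0, is admissible for [c]. *)
Lemma causal_speed_restr (s k : R) c : (0 <= s)%R -> (0 < k)%R -> (s + k <= 1)%R ->
  {ae leb, forall r, `[0%R, 1%R]%classic r ->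
     causal_speed (restr s k c) r = k%:E * causal_speed c (s + k * r)%R}.
Proof.
move=> s0 k0 sk1; have k0' := ltW k0.
set e := restr s k c; set y := causal_speed e; set v := causal_speed c.
have mv : measurable_fun [set: R] v by exact: measurable_speedf.
have my : measurable_fun [set: R] y by exact: measurable_speedf.
have v0 t : 0 <= v t by exact: causal_speed_ge0.
have y0 t : 0 <= y t by exact: causal_speed_ge0.
pose z r := k%:E * v (s + k * r)%R.
have mz : measurable_fun [set: R] z.
  apply: emeasurable_funM => //; apply: (measurableT_comp mv).
  exact: measurable_affine.
have eE r : (0 <= r)%R -> (r <= 1)%R -> e r = c (s + k * r)%R.
  by move=> r0 r1; rewrite /e restrE// clip01_id.
have le1 : {ae leb, forall r, `[0%R, 1%R]%classic r -> z r <= y r}.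
  apply: causal_speed_largest => //.
    by move=> t; rewrite mule_ge0// lee_fin.
  have mvk : measurable_fun [set: R] (fun r => v (s + k * r)%R).
    by apply: (measurableT_comp mv); exact: measurable_affine.
  move=> a b a0 ab b1; rewrite ge0_integralZl//; last exact: (@measurable_funTS _ _ _ _ _ _ mvk).
  rewrite (_ : `]a, b[%classic = (fun r : R => (s + k * r)%R) @^-1` `](s + k * a)%R, (s + k * b)%R[).
    rewrite ge0_integral_affine//.
    have a1 : (a <= 1)%R by rewrite ltW// (lt_le_trans ab).
    have b00 : (0 <= b)%R by rewrite ltW// (le_lt_trans a0).
    rewrite !eE//.
    apply: integral_speed_le.
    - by rewrite addr_ge0// mulr_ge0.
    - by rewrite ltrD2l ltr_pM2l.
    - by rewrite (le_trans _ sk1)// lerD2l ger_pMr.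
  apply/seteqP; split => r /=; rewrite !in_itv/= !ltrD2l !ltr_pM2l//.
pose kn := (k^-1)%R.
(* The speed of the restricted curve carried back to the original time. An interval []a, b[] meets
   its support in the image of []a', b'[], and superadditivity of [tsep] along [c] absorbs the
   remaining ends. *)
pose y' t := (y ((t - s) / k)%R * (k^-1)%:E) * (\1_(`]s, (s + k)%R[%classic : set R) t)%:E.
have my' : measurable_fun [set: R] y'.
  apply: emeasurable_funM; last first.
    by apply/measurable_EFinP; exact: measurable_indic.
  apply: emeasurable_funM => //; apply: (measurableT_comp my).
  by apply: measurable_funM => //; exact: measurable_funB.
have le2 : {ae leb, forall t, `[0%R, 1%R]%classic t -> y' t <= v t}.
  apply: causal_speed_largest => //.
    move=> t; apply: mule_ge0; last by rewrite lee_fin.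
    by rewrite mule_ge0// lee_fin invr_ge0.
  move=> a b a0 ab b1.
  pose a' := Num.max ((a - s) / k)%R 0%R; pose b' := Num.min ((b - s) / k)%R 1%R.
  have : \int[leb]_(t in `]a, b[) y' t = \int[leb]_(r in `]a', b'[) y r.
    rewrite -(ge0_integral_affine s k0)//; last first.
      by move=> x; apply: mule_ge0; rewrite ?lee_fin// mule_ge0// lee_fin invr_ge0.
    rewrite preimage_affine_itv//.
    have -> : \int[leb]_(x in `]((a - s) / k)%R, ((b - s) / k)%R[) y' (s + k * x)%R =
        \int[leb]_(x in `]((a - s) / k)%R, ((b - s) / k)%R[) 
          ((k^-1)%:E * (y x * (\1_(`]0%R, 1%R[%classic : set R) x)%:E)).
      apply: eq_integral => x _; rewrite /y'.
      have -> : ((s + k * x - s) / k)%R = x by field; exact: lt0r_neq0.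
      have -> : \1_(`]s, (s + k)%R[%classic : set R) (s + k * x)%R = \1_(`]0%R, 1%R[%classic : set R) x :> R.
        rewrite !indicE; congr (_ : bool)%:R; apply/idP/idP; rewrite !inE/= !in_itv/=.
          by rewrite ltrDl pmulr_rgt0// ltrD2l gtr_pMr.
        by rewrite ltrDl pmulr_rgt0// ltrD2l gtr_pMr.
      by rewrite -muleA muleCA.
    rewrite ge0_integralZl//; last 3 first.
    - apply: emeasurable_funM; first exact: (@measurable_funTS _ _ _ _ _ _ my).
      by apply/measurable_EFinP; exact: measurable_indic.
    - by move=> x _; rewrite mule_ge0// lee_fin.
    - by rewrite lee_fin invr_ge0.
    rewrite muleA -EFinM divff ?gt_eqF// mul1e.
    have -> : \int[leb]_(x in `]((a - s) / k)%R, ((b - s) / k)%R[)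
        (y x * (\1_(`]0%R, 1%R[%classic : set R) x)%:E) =
      \int[leb]_(x in `]((a - s) / k)%R, ((b - s) / k)%R[ `&` `]0%R, 1%R[) y x.
      by rewrite integral_mkcondr; apply: eq_integral => x _; rewrite epatch_indic.
    congr (integral _ _ _); apply/seteqP; split => r /=; rewrite !in_itv/= gt_max lt_min.
      by move=> [/andP[-> ->] /andP[-> ->]].
    by move=> /andP[/andP[-> ->] /andP[-> ->]].
  move=> ->.
  have [a'b'|b'a'] := ltP a' b'; last first.
    rewrite set_itv_ge ?bnd_simp -?leNgt// integral_set0.
    by apply: curve_causal; exact: ltW.
  have a'0 : (0 <= a')%R by rewrite le_max lexx orbT.
  have b'1 : (b' <= 1)%R by rewrite ge_min lexx orbT.
  apply: (le_trans (integral_speed_le e a'0 a'b' b'1)).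
  rewrite !eE//; [|exact: (ltW (le_lt_trans a'0 a'b'))|exact: (ltW (lt_le_trans a'b' b'1))].
  have H1 : (a <= s + k * a')%R.
    have : ((a - s) / k <= a')%R by rewrite le_max lexx.
    by rewrite ler_pdivrMr//; lra.
  have H2 : (s + k * b' <= b)%R.
    have : (b' <= (b - s) / k)%R by rewrite ge_min lexx.
    by rewrite ler_pdivlMr//; lra.
  have H3 : (s + k * a' <= s + k * b')%R by rewrite lerD2l ler_pM2l// ltW.
  have [L0 Ls] := tsep_superadditive c.
  have b0 := le_trans a0 (ltW ab).
  apply: (@le_trans _ _ (tsep (c a) (c (s + k * b')%R))).
    apply: (le_trans _ (Ls a (s + k * a')%R _ a0 H1 H3 _)); last by rewrite (le_trans H2).
    by rewrite leeDr//; apply: curve_causal.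
  apply: (le_trans _ (Ls a _ b a0 (le_trans H1 H3) H2 b1)).
  by rewrite leeDl//; apply: curve_causal.
have {}le2 := ae_affine s k0 le2.
(* At the times 0 and 1 the indicator in [y'] vanishes; they form a null set. *)
have ne1 : {ae leb, forall r : R, r \notin [:: 0%R; 1%R]}.
  exists ([set 0%R] `|` [set 1%R]); split.
  - exact: measurableU.
  - apply: countable_lebesgue_measure0; exact: finite_set_countable.
  - move=> r /= /negP; rewrite negbK !inE => /orP[] /eqP ->; [by left|by right].
apply: filterS3 le1 ne1 le2 => r yz r01 yv /[dup] r01' /=; rewrite in_itv/= => /andP[r0 r1].
apply/eqP; rewrite eq_le; apply/andP; split; last exact: yz.
have {r0}r0 : (0 < r)%R by rewrite lt0r r0 andbT; apply: contraNN r01 => /eqP ->; rewrite inE eqxx.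
have {r1}r1 : (r < 1)%R by rewrite lt_neqAle r1 andbT; apply: contraNN r01 => /eqP ->; rewrite !inE eqxx orbT.
have : y' (s + k * r)%R <= v (s + k * r)%R.
  apply: yv => /=; rewrite in_itv/=; apply/andP; split.
    by rewrite addr_ge0// mulr_ge0// ltW.
  by rewrite (le_trans _ sk1)// lerD2l ger_pMr// ltW.
rewrite /y' (_ : \1_ _ _ = 1%R); last first.
  by rewrite indicE mem_set//= in_itv/= ltrDl pmulr_rgt0// r0/= ltrD2l gtr_pMr.
rewrite (_ : ((s + k * r - s) / k)%R = r); last by field; exact: lt0r_neq0.
by rewrite mule1 lee_pdivrMr// muleC.
Qed.

End CausalSpeed.

(** * Compact inner approximation in a countable product *)

Section ProductSpace.
Variables (R : realType) (S : fmmst R).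
Local Notation dist := (@bdist R S).
Local Notation PS := (prod_topology (fun _ : nat => (S : topologicalType))).

Lemma continuous_coord i : continuous (fun z : PS => z i).
Proof. exact: (@proj_continuous nat (fun=> (S : topologicalType)) i). Qed.

Lemma cvg_coord (F : set_system PS) (z : PS) : Filter F ->
  (forall i, (fun w : PS => w i) @ F --> z i) -> F --> z.
Proof.
move=> FF Fz; apply/cvg_sup => i U [V [[W oW <-] Wz] WU].
apply: (filterS WU); apply: Fz; exact: open_nbhs_nbhs.
Qed.

(** A triple lists a coordinate, the index of a centre in the dense sequence and the index of a
    radius. Lists of triples form a countable type, so unions over them are countable. *)
Definition cylinder (pt : nat -> S) (l : seq (nat * nat * nat)) : set PS :=
  [set z | forall a, a \in l -> (dist (z a.1.1) (pt a.1.2) < a.2.+1%:R^-1)%R].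

(** The cylinders through [z] generate a filter that converges to [z] in each coordinate, hence in
    the product; so some cylinder through [z] lies in [U]. *)
Lemma open_cylinder pt (U : set PS) :
  (forall x (e : R), (0 < e)%R -> exists i, (dist x (pt i) < e)%R) ->
  open U -> U = \bigcup_(l in [set l | cylinder pt l `<=` U]) cylinder pt l.
Proof.
move=> Hpt oU; apply/seteqP; split => [z Uz|z [l /= lU]]; last exact: lU.
pose F : set_system PS := [set A | exists2 l, cylinder pt l z & cylinder pt l `<=` A].
have FF : Filter F.
  split.
  - by exists [::].
  - move=> A B [l lz lA] [l' lz' lB]; exists (l ++ l').
      by move=> a; rewrite mem_cat => /orP[]; [exact: lz|exact: lz'].
    by move=> w lw; split; [apply: lA|apply: lB] => a al; apply: lw;
      rewrite mem_cat al ?orbT.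
  - by move=> A B AB [l lz lA]; exists l => //; exact: subset_trans AB.
have Fz : F --> z.
  apply: cvg_coord => i A /nbhs_bdist[e e0 eA].
  have e20 : (0 < e / 2)%R by rewrite divr_gt0.
  have [m _ /(_ m (leqnn m))] : \forall n \near \oo, (n.+1%:R^-1 < e / 2 :> R)%R.
    exact: near_infty_natSinv_lt (PosNum e20).
  move=> /= me.
  have [j zj] := Hpt (z i) m.+1%:R^-1%R ltac:(by rewrite invr_gt0 ltr0n).
  exists [:: (i, j, m)]; first by move=> a; rewrite inE => /eqP ->.
  move=> w /(_ (i, j, m)); rewrite inE eqxx => /(_ isT)/= wj.
  apply: eA => /=; apply: le_lt_trans (bdist_triangle _ (pt j) _) _.
  rewrite (bdistC (pt j)); move: zj wj me; move: (_%:R^-1 : R)%R => u; lra.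
have [l lz lU] : F U by apply: Fz; exact: open_nbhs_nbhs.
by exists l.
Qed.

Lemma continuous_coord_dist i j : continuous (fun z : PS => dist (z i) (z j)).
Proof.
move=> z; apply/cvgrPdist_lt => e e0.
have e20 : (0 < e / 2)%R by rewrite divr_gt0.
have H k : \forall w \near nbhs z, (dist (z k) ((w : PS) k) < e / 2)%R.
  have := @continuous_coord k z [set y | (dist (z k) y < e / 2)%R].
  by apply; apply/nbhs_bdist; exists (e / 2)%R.
near=> w.
have h1 : (dist (z i) (w i) < e / 2)%R by near: w; exact: H.
have h2 : (dist (z j) (w j) < e / 2)%R by near: w; exact: H.
rewrite ltr_norml; apply/andP; split.
  have := bdist_triangle (w i) (z i) (w j); have := bdist_triangle (z i) (z j) (w j).
  rewrite (bdistC (w i) (z i)); lra.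
have := bdist_triangle (z i) (w i) (z j); have := bdist_triangle (w i) (w j) (z j).
rewrite (bdistC (w j) (z j)); lra.
Unshelve. all: by end_near. Qed.

Lemma continuous_coord_pt i x : continuous (fun z : PS => dist (z i) x).
Proof.
move=> z; apply: (@continuous_comp _ _ _ (fun z : PS => z i) (fun y => dist y x)).
  exact: continuous_coord.
by apply: lipschitz_continuous; exact: bdist_lip.
Qed.

Lemma hausdorff_carrier : hausdorff_space S.
Proof.
rewrite open_hausdorff => x y xy.
have d0 : (0 < dist x y / 2)%R.
  by rewrite divr_gt0// lt_neqAle bdist_ge0 andbT eq_sym; apply: contraNneq xy => /bdist_eq0 ->.
exists ([set z | (dist x z < dist x y / 2)%R], [set z | (dist y z < dist x y / 2)%R]).
  by rewrite /= !inE/= !bdistxx.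
split; [exact: open_ball_bdist|exact: open_ball_bdist|].
apply/eqP; rewrite -subset0 => z [/= xz yz].
have := bdist_triangle x z y; rewrite (bdistC z); lra.
Qed.

Lemma hausdorff_PS : hausdorff_space PS.
Proof.
by apply: (@hausdorff_product nat (fun=> (S : topologicalType))) => _; exact: hausdorff_carrier.
Qed.

End ProductSpace.

Section Tight.
Variables (R : realType) (S : fmmst R).
Local Notation dist := (@bdist R S).
Local Notation PS := (prod_topology (fun _ : nat => (S : topologicalType))).
Context d (X : measurableType d).
Variable P : probability X R.

(** Ulam's theorem. At scale [n], finitely many closed balls of radius [1 / (n + 1)] miss mass at
    most [eps / 2 ^ (n + 1)]; the intersection over all scales is closed and totally bounded. The
    balls are those of the complete distance [d'], since [bdist] need not be complete. *)
Lemma ulam (F : X -> borel S) (eps : R) : measurable_fun setT F -> (0 < eps)%R ->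
  exists K : set S, [/\ compact K, closed K & P (~` (F @^-1` K)) <= eps%:E].
Proof.
move=> mF eps0.
have [[d' [d0 dC dT dN] dcomp] _] := carrier_polish S.
have [pt Hpt] := dense_sequence S.
have d'0 x y : (0 <= d' x y)%R.
  have := dT x y x; rewrite (proj2 (d0 x x) erefl) (dC y x); lra.
have Hpt' x e : (0 < e)%R -> exists i, (d' (pt i) x < e)%R.
  move=> e0.
  have /nbhs_bdist[r r0 rA] : nbhs x [set y | (d' x y < e)%R] by apply/dN; exists e.
  by have [i /rA/=] := Hpt x r r0; rewrite dC; exists i.
have lipc x : continuous (d' x).
  move=> y; apply/cvgrPdist_lt => e e0; apply/dN; exists e => //= z /= yz.
  rewrite ltr_norml; have := dT x y z; have := dT x z y; rewrite (dC z y) => ? ?.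
  by apply/andP; split; lra.
pose B n i := [set y | (d' (pt i) y <= n.+1%:R^-1)%R].
have cB n i : closed (B n i).
  by apply: (@preimage_closed _ _ (d' (pt i)) [set r | (r <= n.+1%:R^-1)%R]) => [y _|]; [exact: lipc|exact: closed_le].
pose U n N := \big[setU/set0]_(i < N) B n i.
have cU n N : closed (U n N) by apply: closed_bigsetU => i _; exact: cB.
have mU n N : measurable (F @^-1` (U n N)).
  rewrite -[X in measurable X]setTI; apply: mF => //.
  rewrite -(setCK (U n N)); apply: measurableC; apply: borel_open.
  by rewrite openC; exact: cU.
have Uto n : exists N, P (~` (F @^-1` U n N)) <= (eps / (2 ^ n.+1)%:R)%:E.
  have : P (~` (F @^-1` U n N)) @[N --> \oo] --> P (\bigcap_N ~` (F @^-1` U n N)).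
    apply: nonincreasing_cvg_mu.
    - by rewrite (le_lt_trans (probability_le1 _ _))// ?ltry//; exact: measurableC.
    - by move=> N; exact: measurableC.
    - by apply: bigcapT_measurable => N; exact: measurableC.
    - move=> N N' NN'; apply/subsetPset; apply: subsetC => x.
      rewrite /U /= -!bigcup_mkord => -[i /= iN Bi]; exists i => //=.
      exact: leq_trans NN'.
  rewrite (_ : \bigcap_N _ = set0); last first.
    apply/seteqP; split => // x /(_ _ I) H.
    have n0 : (0 < n.+1%:R^-1 :> R)%R by rewrite invr_gt0 ltr0n.
    have [i Hi] := Hpt' (F x) _ n0.
    apply: (H i.+1); rewrite /= /U -bigcup_mkord; exists i => //=.
    by rewrite /B/= ltW.
  rewrite measure0 => /fine_cvgP[fU].
  have e0 : (0 < eps / (2 ^ n.+1)%:R)%R by rewrite divr_gt0// ltr0n expn_gt0.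
  move=> /cvgrPdist_lt/(_ _ e0) H.
  have [N _ /(_ N (leqnn N))[f1 /= f2]] := filterI fU H.
  exists N; rewrite -(fineK f1) lee_fin ltW//.
  by move: f2; rewrite sub0r normrN ger0_norm// fine_ge0.
have [N HN] := choice Uto.
pose K := \bigcap_n U n (N n).
have cK : closed K by apply: closed_bigI => n _; exact: cU.
exists K; split => //; last first.
  rewrite preimage_bigcap setC_bigcap.
  pose A n := ~` (F @^-1` U n (N n)).
  have mA n : measurable (A n) by exact: measurableC.
  have := @measure_sigma_subadditive _ _ _ P (\bigcup_n A n) A mA (bigcupT_measurable _ mA).
  move=> /(_ (@subset_refl _ _))/le_trans; apply; apply: (@le_trans _ _ (\sum_(0 <= n <oo) (eps / (2 ^ n.+1)%:R)%:E)).
    by apply: lee_nneseries => // n _; exact: HN.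
  by apply: epsilon_trick0; exact: ltW.
(* An ultrafilter containing [K] contains one ball [B n (i n)] at each scale. Points chosen in the
   successive finite intersections form a Cauchy sequence, and the ultrafilter converges to its
   limit. *)
rewrite compact_ultra => G GU GK.
have Gn n : exists i, G (B n i).
  have : G (U n (N n)) by apply: filterS GK => x; exact.
  rewrite /U; elim: (N n) => [|k IH]; first by rewrite big_ord0 => /filter_ex[].
  rewrite big_ord_recr/= => GB.
  have [|GC] := in_ultra_setVsetC (B n k) GU; first by exists k.
  by apply: IH; apply: filterS (filterI GB GC) => x [[]].
have [i Gi] := choice Gn.
pose W n := K `&` \bigcap_(k in [set k | (k <= n)%N]) B k (i k).
have GW n : G (W n).
  have GB : G (\bigcap_(k < n.+1) B k (i k)).
    rewrite bigcap_mkord; elim/big_ind: _ => //; first exact: filterT.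
    by move=> C D GC GD; exact: filterI.
  by apply: filterS (filterI GK GB) => x [Kx Bx]; split => // k /= kn; exact: Bx.
have [x Wx] : {x : nat -> S & forall n, W n (x n)}.
  by apply: choice => n; have [y] := filter_ex (GW n); exists y.
have BB n y z : B n (i n) y -> B n (i n) z -> (d' y z <= 2 * n.+1%:R^-1)%R.
  rewrite /B/= => h1 h2; have := dT y (pt (i n)) z; rewrite (dC y (pt (i n))).
  by move: h1 h2; move: (_%:R^-1 : R)%R => u; lra.
have inv_small (e : R) : (0 < e)%R -> exists n : nat, (2 * n.+1%:R^-1 < e)%R.
  move=> e0; have e20 : (0 < e / 2)%R by rewrite divr_gt0.
  have [m _ /(_ m (leqnn m))] : \forall n \near \oo, (n.+1%:R^-1 < e / 2 :> R)%R.
    exact: near_infty_natSinv_lt (PosNum e20).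
  by move=> /= me; exists m; move: me; move: (_%:R^-1 : R)%R => u; lra.
have [y xy] : exists y : S, x @ \oo --> y.
  apply: dcomp => e /inv_small[n ne]; exists n => j k nj nk.
  apply: le_lt_trans ne; apply: BB; [have [_] := Wx j|have [_] := Wx k]; exact.
have Gy : G --> y.
  move=> A /dN[e e0 eA].
  have e20 : (0 < e / 2)%R by rewrite divr_gt0.
  have [n ne] := inv_small _ e20.
  have [m _ Hm] : \forall k \near \oo, (d' y (x k) < e / 2)%R.
    by apply: (xy [set w | (d' y w < e / 2)%R]); apply/dN; exists (e / 2)%R.
  apply: filterS (Gi n) => z Bz; apply: eA => /=.
  have h1 := Hm (maxn m n) (leq_maxl _ _).
  have h2 : (d' (x (maxn m n)) z <= 2 * n.+1%:R^-1)%R.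
    apply: BB => //; have [_] := Wx (maxn m n); apply; exact: leq_maxr.
  have := dT y (x (maxn m n)) z; move: h1 h2 ne => /=; move: (n.+1%:R^-1 : R)%R => u; lra.
exists y; split => //.
apply: (@closed_cvg _ _ G _ id K) => //; exact: GK.
Qed.


Variable e : X -> PS.
Hypothesis me : forall i, measurable_fun setT (fun x => e x i : borel S).

Lemma measurable_cylinder pt l : measurable (e @^-1` cylinder pt l).
Proof.
rewrite (_ : _ @^-1` _ = \bigcap_(a in [set` l])
    (fun x => e x a.1.1 : borel S) @^-1` [set y | (dist y (pt a.1.2) < a.2.+1%:R^-1)%R]); last first.
  by apply/seteqP; split => x.
apply: fin_bigcap_measurable; first exact: finite_seq.
move=> a _; rewrite -[X in measurable X]setTI; apply: (me a.1.1) => //; apply: borel_open.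
rewrite (_ : mkset _ = [set y | (dist (pt a.1.2) y < a.2.+1%:R^-1)%R]); first exact: open_ball_bdist.
by apply/seteqP; split => y; rewrite /= bdistC.
Qed.

Lemma measurable_preimage_open (U : set PS) : open U -> measurable (e @^-1` U).
Proof.
move=> oU; have [pt Hpt] := dense_sequence S.
rewrite (open_cylinder Hpt oU) preimage_bigcup.
rewrite bigcup_mkcond; apply: countable_bigcupT_measurable => [|l]; first exact: countableP.
by case: ifP => // _; exact: measurable_cylinder.
Qed.

Lemma measurable_preimage_closed (C : set PS) : closed C -> measurable (e @^-1` C).
Proof.
move=> cC; rewrite -(setCK C) preimage_setC; apply: measurableC.
by apply: (@measurable_preimage_open (~` C)); rewrite openC.
Qed.

(** A product of compact sets, the one in coordinate [i] missing mass at most [eps / 2 ^ (i + 1)],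
    is compact by Tychonoff's theorem. *)
Lemma box_tight (eps : R) : (0 < eps)%R ->
  exists K : set PS, [/\ compact K, closed K & P (~` (e @^-1` K)) <= eps%:E].
Proof.
move=> eps0.
have H i : exists K : set S, [/\ compact K, closed K & P (~` ((fun x => e x i : borel S) @^-1` K)) <= (eps / (2 ^ i.+1)%:R)%:E].
  by apply: ulam => //; rewrite divr_gt0// ltr0n expn_gt0.
have {H}[K HK] := choice H.
have cK : compact [set z : PS | forall i, K i (z i)].
  by apply: (@tychonoff nat (fun=> (S : topologicalType)) K) => i; have [] := HK i.
have clK : closed [set z : PS | forall i, K i (z i)].
  by apply: compact_closed cK; exact: hausdorff_PS.
exists [set z | forall i, K i (z i)]; split => //.
pose A i := ~` ((fun x => e x i : borel S) @^-1` K i).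
have mA i : measurable (A i).
  apply: measurableC; rewrite -[X in measurable X]setTI; apply: me => //.
  by rewrite -(setCK (K i)); apply: measurableC; apply: borel_open; rewrite openC; have [] := HK i.
have mE : measurable (~` (e @^-1` [set z : PS | forall i, K i (z i)])).
  by apply: measurableC; exact: measurable_preimage_closed.
have sub : ~` (e @^-1` [set z : PS | forall i, K i (z i)]) `<=` \bigcup_n A n.
  by move=> x /= /existsNP[i Ki]; exists i.
apply: le_trans (@measure_sigma_subadditive _ _ _ P _ A mA mE sub) _.
apply: (@le_trans _ _ (\sum_(0 <= n <oo) (eps / (2 ^ n.+1)%:R)%:E)).
  by apply: lee_nneseries => // n _; have [] := HK n.
by apply: epsilon_trick0; exact: ltW.
Qed.

(* Both the set and its complement are approximated from inside by compact sets, so the class is a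
   sigma-algebra and no measurability of the preimage is presupposed. *)
Definition biregular (A : set PS) : Prop := forall eps : R, (0 < eps)%R ->
  exists K1 K2 : set PS, [/\ compact K1, compact K2, K1 `<=` A, K2 `<=` ~` A &
    P (~` (e @^-1` (K1 `|` K2))) <= eps%:E].

Lemma compact_closed_PS (K : set PS) : compact K -> closed K.
Proof. by apply: compact_closed; exact: hausdorff_PS. Qed.

Lemma measurable_preimage_compact (K : set PS) : compact K -> measurable (e @^-1` K).
Proof. by move=> /compact_closed_PS; exact: measurable_preimage_closed. Qed.

Lemma biregularC A : biregular A -> biregular (~` A).
Proof.
move=> HA eps /HA[K1 [K2 [c1 c2 s1 s2 H]]]; exists K2, K1; split => //.
  by rewrite setCK.
by rewrite setUC.
Qed.

(** The complement [G] is closed and the set itself is exhausted by the closed sets [L n].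
    Intersecting with one compact set of nearly full mass makes both approximations compact. *)
Lemma biregular_lt (phi : PS -> R) (r : R) : continuous phi ->
  biregular [set z | (phi z < r)%R].
Proof.
move=> cphi eps eps0; have e20 : (0 < eps / 2)%R by rewrite divr_gt0.
have [K [cK clK HK]] := box_tight e20.
pose L n := [set z : PS | (phi z <= r - n.+1%:R^-1)%R].
have clL n : closed (L n).
  by apply: (@preimage_closed _ _ phi [set y | (y <= r - n.+1%:R^-1)%R]) => [z _|]; [exact: cphi|exact: closed_le].
pose G := [set z : PS | (r <= phi z)%R].
have clG : closed G.
  by apply: (@preimage_closed _ _ phi [set y | (r <= y)%R]) => [z _|]; [exact: cphi|exact: closed_ge].
have mL n : measurable (~` (e @^-1` (L n `|` G))).
  by apply: measurableC; apply: measurable_preimage_closed; exact: closedU.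
have : P (~` (e @^-1` (L n `|` G))) @[n --> \oo] --> P (\bigcap_n ~` (e @^-1` (L n `|` G))).
  apply: nonincreasing_cvg_mu => //.
  - by rewrite (le_lt_trans (probability_le1 _ _))// ltry.
  - exact: bigcapT_measurable.
  - move=> n m nm; apply/subsetPset; apply: subsetC => x /= [Lx|]; [left|by right].
    apply: le_trans Lx _; rewrite lerD2l lerN2 lef_pV2 ?posrE ?ltr0n// ler_nat//.
rewrite (_ : \bigcap_n _ = set0); last first.
  apply/seteqP; split => // x H.
  have [rx|xr] := leP r (phi (e x)); first by apply: (H 0%N I); right.
  have d0 : (0 < r - phi (e x))%R by rewrite subr_gt0.
  have [m _ /(_ m (leqnn m))/= Hm] : \forall n \near \oo, (n.+1%:R^-1 < r - phi (e x) :> R)%R.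
    exact: near_infty_natSinv_lt (PosNum d0).
  by apply: (H m I); left; rewrite /L/=; move: Hm; move: (_%:R^-1 : R)%R => u; lra.
rewrite measure0 => /fine_cvgP[fU] /cvgrPdist_lt/(_ _ e20) H.
have [N _ /(_ N (leqnn N))[f1 /= f2]] := filterI fU H.
have PN : P (~` (e @^-1` (L N `|` G))) <= (eps / 2)%:E.
  by rewrite -(fineK f1) lee_fin ltW//; move: f2; rewrite sub0r normrN ger0_norm// fine_ge0.
exists (K `&` L N), (K `&` G); split.
- exact: compact_closedI.
- exact: compact_closedI.
- move=> z [_] /= /le_lt_trans; apply.
  by rewrite ltrBlDr ltrDl invr_gt0 ltr0n.
- by move=> z [_ Gz] /= zr; move: Gz; rewrite /G/= leNgt zr.
apply: (@le_trans _ _ (P (~` (e @^-1` K) `|` ~` (e @^-1` (L N `|` G))))).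
  apply: le_measure; rewrite ?inE.
  - by apply: measurableC; apply: measurable_preimage_closed; rewrite -setIUr; apply: closedI => //; exact: closedU.
  - by apply: measurableU => //; apply: measurableC; exact: measurable_preimage_closed.
  - by rewrite -setCI -preimage_setI -setIUr.
apply: le_trans (measureU2 _ _ _) _ => //.
  by apply: measurableC; exact: measurable_preimage_closed.
by apply: le_trans (leeD HK PN) _; rewrite -EFinD -splitr.
Qed.

(** Compact sets are stable under finite unions and under all intersections. So the compact sets
    outside every [A n] are intersected, while those inside are united up to a finite stage that
    loses at most another [eps / 2]. *)
Lemma biregular_bigcup (A : nat -> set PS) : (forall n, biregular (A n)) ->
  biregular (\bigcup_n A n).
Proof.
move=> HA eps eps0; have e20 : (0 < eps / 2)%R by rewrite divr_gt0.
have H n : exists KK : set PS * set PS, [/\ compact KK.1, compact KK.2, KK.1 `<=` A n, KK.2 `<=` ~` A n &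
    P (~` (e @^-1` (KK.1 `|` KK.2))) <= (eps / 2 / (2 ^ n.+1)%:R)%:E].
  have [K1 [K2 HK]] := HA n (eps / 2 / (2 ^ n.+1)%:R)%R ltac:(by rewrite divr_gt0// ltr0n expn_gt0).
  by exists (K1, K2).
have {H}[K HK] := choice H.
have cK1 n : compact (K n).1 by have [] := HK n.
have cK2 n : compact (K n).2 by have [] := HK n.
pose K2 := \bigcap_n (K n).2.
have clK2 : closed K2 by apply: closed_bigI => n _; exact: compact_closed_PS.
pose L N := \big[setU/set0]_(i < N) (K i).1.
have cL N : compact (L N).
  by rewrite /L; elim/big_ind: _ => //; [exact: compact0|exact: compactU].
pose D N := ~` (e @^-1` (L N `|` K2)).
have mD N : measurable (D N).
  apply: measurableC; apply: measurable_preimage_closed; apply: closedU => //.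
  exact: compact_closed_PS.
have mB n : measurable (~` (e @^-1` ((K n).1 `|` (K n).2))).
  by apply: measurableC; apply: measurable_preimage_compact; exact: compactU.
have : P (D n) @[n --> \oo] --> P (\bigcap_n D n).
  apply: nonincreasing_cvg_mu => //.
  - by rewrite (le_lt_trans (probability_le1 _ _))// ltry.
  - exact: bigcapT_measurable.
  - move=> n m nm; apply/subsetPset; apply: subsetC; apply: preimage_subset; apply: setUSS => //.
    rewrite /L -!(bigcup_mkord _ (fun i => (K i).1)) => z [i /= iN Bi]; exists i => //=; exact: leq_trans nm.
have PD : P (\bigcap_n D n) <= (eps / 2)%:E.
  apply: le_trans (@measure_sigma_subadditive _ _ _ P _ (fun n => ~` (e @^-1` ((K n).1 `|` (K n).2))) mB _ _) _.
  - exact: bigcapT_measurable.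
  - move=> x Dx; apply: contrapT => /= H.
    have {}H n : ((K n).1 `|` (K n).2) (e x) by apply: contrapT => nH; apply: H; exists n.
    have [[n Kn]|H1] := pselect (exists n, (K n).1 (e x)).
      apply: (Dx n.+1 I); left; suff : L n.+1 (e x) by [].
      by rewrite /L -(bigcup_mkord _ (fun i => (K i).1)); exists n => //=.
    apply: (Dx 0%N I); right => n _; have [Kn|//] := H n.
    by exfalso; apply: H1; exists n.
  apply: (@le_trans _ _ (\sum_(0 <= n <oo) (eps / 2 / (2 ^ n.+1)%:R)%:E)).
    by apply: lee_nneseries => // n _; have [] := HK n.
  by apply: epsilon_trick0; exact: ltW.
have fD : P (\bigcap_n D n) \is a fin_num.
  by rewrite ge0_fin_numE// (le_lt_trans PD)// ltry.
rewrite -(fineK fD) => /fine_cvgP[fU] /cvgrPdist_lt/(_ _ e20) H.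
have [N _ /(_ N (leqnn N))[f1 /= f2]] := filterI fU H.
exists (L N), K2; split => //.
- exact: (subclosed_compact clK2 (cK2 0%N) (fun z Hz => Hz 0%N I)).
- rewrite /L -(bigcup_mkord _ (fun i => (K i).1)) => z [i _ Ki]; exists i => //.
  by have [_ _ + _ _] := HK i; apply.
- move=> z Kz [i _ Ai]; have [_ _ _ + _] := HK i; move=> /(_ z (Kz i I)); exact.
rewrite -(fineK f1) lee_fin; move: f2; rewrite ltr_norml => /andP[f2 _].
by move: PD; rewrite -(fineK fD) lee_fin; rewrite -/(D N); lra.
Qed.

Lemma biregular_bigcap (A : nat -> set PS) : (forall n, biregular (A n)) ->
  biregular (\bigcap_n A n).
Proof.
move=> HA; rewrite -(setCK (\bigcap_n A n)) setC_bigcap; apply: biregularC.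
by apply: biregular_bigcup => n; exact: biregularC.
Qed.

Lemma biregular0 : biregular set0.
Proof.
have := biregular_lt (- 1) (@continuous_coord_pt R S 0%N point).
rewrite (_ : mkset _ = set0)//; apply/seteqP; split => // z /=.
by have := bdist_ge0 (z 0%N) point; lra.
Qed.

Lemma biregularI A B : biregular A -> biregular B -> biregular (A `&` B).
Proof.
move=> HA HB; rewrite (_ : A `&` B = \bigcap_n (if n is 0%N then A else B)).
  by apply: biregular_bigcap => -[|n].
apply/seteqP; split => [z [Az Bz] [|n] _//|z H]; split; [exact: (H 0%N)|exact: (H 1%N)].
Qed.

Lemma biregular_open (U : set PS) : open U -> biregular U.
Proof.
move=> oU; have [pt Hpt] := dense_sequence S.
rewrite (open_cylinder Hpt oU).
have Hcyl l : biregular (cylinder pt l).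
  elim: l => [|a l IH].
    rewrite (_ : cylinder _ _ = ~` set0); first exact: (biregularC biregular0).
    by apply/seteqP; split => z // _ a.
  rewrite (_ : cylinder _ _ = [set z | (dist (z a.1.1) (pt a.1.2) < a.2.+1%:R^-1)%R] `&` cylinder pt l).
    by apply: biregularI => //; apply: biregular_lt; exact: continuous_coord_pt.
  apply/seteqP; split => z.
    move=> Hz; split; first by apply: Hz; rewrite inE eqxx.
    by move=> b bl; apply: Hz; rewrite inE bl orbT.
  by move=> [h1 h2] b; rewrite inE => /predU1P[->|/h2].
pose un n : seq (nat * nat * nat) := odflt [::] (unpickle n).
rewrite (_ : \bigcup_(_ in _) _ = \bigcup_n
  (if `[< cylinder pt (un n) `<=` U >] then cylinder pt (un n) else set0)).
  apply: biregular_bigcup => n.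
  by case: ifP => _; [exact: Hcyl|exact: biregular0].
apply/seteqP; split => z.
  by move=> [l /= lU lz]; exists (pickle l) => //; rewrite /un pickleK; case: asboolP.
by move=> [n _]; case: asboolP => // lU lz; exists (un n).
Qed.

Lemma biregular_closed (C : set PS) : closed C -> biregular C.
Proof.
by move=> cC; rewrite -(setCK C); apply: biregularC; apply: biregular_open; rewrite openC.
Qed.

(** The Borel sets [B] with the stated property form a sigma-algebra containing the open sets. *)
Lemma biregular_coord i (B : set (borel S)) : measurable B -> biregular [set z | B (z i)].
Proof.
pose F := [set B : set S | biregular [set z | B (z i)]].
have : <<s (@open S) >> `<=` F; last exact.
apply: smallest_sub => [|U oU]; last first.
  apply: biregular_open; apply: (@open_comp _ _ (fun z : PS => z i) U) => // z _.
  exact: continuous_coord.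
split.
- rewrite /F/= (_ : [set z | _] = set0); [exact: biregular0|by apply/seteqP; split].
- move=> A HA; rewrite /F/= (_ : [set z | _] = ~` [set z | A (z i)]).
    exact: biregularC.
  by apply/seteqP; split => z; [move=> []|].
- move=> A HA; rewrite /F/= (_ : [set z | _] = \bigcup_n [set z | A n (z i)])//.
  exact: biregular_bigcup.
Qed.

End Tight.

(** * Left limits and reconstruction of causal curves from samples *)

Section LeftLimits.
Variables (R : realType) (S : fmmst R).
Local Notation dist := (@bdist R S).
Implicit Types (x y : S).

Lemma causal_lim_l x y : (forall eps : R, (0 < eps)%R ->
  exists2 x', (dist x' x < eps)%R & 0 <= tsep x' y) -> 0 <= tsep x y.
Proof.
move=> H.
have cl : closed [set x' : S | 0 <= tsep x' y].
  apply: (@preimage_closed _ _ (fun x' : S => (x', y)) [set xy | 0 <= tsep xy.1 xy.2]) => [z _|].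
    by apply: cvg_pair; [exact: cvg_id|exact: cvg_cst].
  exact: tsep_closed.
apply: cl => B /nbhs_bdist[e e0 eB]; have [x' xx' xy] := H e e0.
by exists x'; split => //; apply: eB => /=; rewrite bdistC.
Qed.

Lemma causal_lim_r x y : (forall eps : R, (0 < eps)%R ->
  exists2 y', (dist y' y < eps)%R & 0 <= tsep x y') -> 0 <= tsep x y.
Proof.
move=> H.
have cl : closed [set y' : S | 0 <= tsep x y'].
  apply: (@preimage_closed _ _ (fun y' : S => (x, y')) [set xy | 0 <= tsep xy.1 xy.2]) => [z _|].
    by apply: cvg_pair; [exact: cvg_cst|exact: cvg_id].
  exact: tsep_closed.
apply: cl => B /nbhs_bdist[e e0 eB]; have [x' xx' xy] := H e e0.
by exists x'; split => //; apply: eB => /=; rewrite bdistC.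
Qed.

Lemma increasing_to (Q : set R) (t : R) :
  (forall u : R, (u < t)%R -> exists2 s, Q s & (u < s < t)%R) ->
  exists r : nat -> R, forall n, [/\ Q (r n), (r n < r n.+1)%R, (r n < t)%R &
    (t - n.+1%:R^-1 < r n)%R].
Proof.
move=> HQ.
have H (p : R * nat) : exists s, (p.1 < t)%R -> [/\ Q s, (p.1 < s)%R, (s < t)%R & (t - p.2.+1%:R^-1 < s)%R].
  have [pt|] := ltP p.1 t; last by exists t; lra.
  have m : (Num.max p.1 (t - p.2.+1%:R^-1) < t)%R.
    by rewrite gt_max pt/= ltrBlDr ltrDl invr_gt0 ltr0n.
  have [s Qs /andP[+ st]] := HQ _ m; rewrite gt_max => /andP[ps ts].
  by exists s.
have [f Hf] := choice H.
pose r := fix r n := if n is n'.+1 then f (r n', n) else f ((t - 1)%R, 0%N).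
have rt n : (r n < t)%R.
  elim: n => [|n IH] /=; last by have [] := Hf (r n, n.+1) IH.
  by have /= [|_ _ ->//] := Hf ((t - 1)%R, 0%N); lra.
exists r => n; split => //.
- case: n => [|n] /=; last by have [] := Hf (r n, n.+1) (rt n).
  by have /= [|//] := Hf ((t - 1)%R, 0%N); lra.
- by have [] := Hf (r n, n.+1) (rt n).
- case: n => [|n] /=; last by have [] := Hf (r n, n.+1) (rt n).
  by have /= [|//] := Hf ((t - 1)%R, 0%N); lra.
Qed.

Definition left_limit (D : set R) (c : R -> S) (t : R) x :=
  forall e : R, (0 < e)%R -> exists2 u : R, (u < t)%R &
    forall s, D s -> (u < s < t)%R -> (dist (c s) x < e)%R.

(** Forward completeness gives a limit along any increasing sequence of times, and closedness of the
    order makes it the least upper bound of all earlier values. Limits along different sequences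
    then bound each other and agree by antisymmetry, so the full left limit exists. *)
Lemma left_limitP (D : set R) (c : R -> S) (t : R) b :
  (forall u : R, (u < t)%R -> exists2 s, D s & (u < s < t)%R) ->
  (forall s s', D s -> D s' -> (s <= s')%R -> (s' < t)%R -> 0 <= tsep (c s) (c s')) ->
  (forall s, D s -> (s < t)%R -> 0 <= tsep (c s) b) ->
  exists x, [/\ left_limit D c t x,
    forall s, D s -> (s < t)%R -> 0 <= tsep (c s) x &
    forall y, (forall s, D s -> (s < t)%R -> 0 <= tsep (c s) y) -> 0 <= tsep x y].
Proof.
move=> HD mono bnd.
have lim Q : Q `<=` D -> (forall u : R, (u < t)%R -> exists2 s, Q s & (u < s < t)%R) ->
    exists x, [/\ forall s, D s -> (s < t)%R -> 0 <= tsep (c s) x,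
      forall y, (forall s, D s -> (s < t)%R -> 0 <= tsep (c s) y) -> 0 <= tsep x y &
      forall e : R, (0 < e)%R -> exists2 s, Q s & (dist (c s) x < e)%R].
  move=> QD HQ; have [r Hr] := increasing_to HQ.
  have rQ n : Q (r n) by have [] := Hr n.
  have rt n : (r n < t)%R by have [] := Hr n.
  have rr n : (r n <= r n.+1)%R by have [_ /ltW] := Hr n.
  have [x rx] : exists x, (fun n => c (r n)) @ \oo --> x.
    apply: (@forward_complete _ S _ b) => n.
      by apply: mono => //; exact: QD.
    by apply: bnd => //; exact: QD.
  have near_x e : (0 < e)%R -> exists N : nat, forall n, (N <= n)%N -> (dist (c (r n)) x < e)%R.
    move=> e0; have [N _ HN] : \forall n \near \oo, (dist x (c (r n)) < e)%R.
      by apply: (rx [set y | (dist x y < e)%R]); apply/nbhs_bdist; exists e.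
    by exists N => n /HN/=; rewrite bdistC.
  exists x; split.
  - move=> s Ds st; apply: causal_lim_r => e /near_x[N HN].
    have st0 : (0 < t - s)%R by rewrite subr_gt0.
    have [m _ /(_ (maxn m N) (leq_maxl _ _))/= Hm] : \forall n \near \oo, (n.+1%:R^-1 < t - s :> R)%R.
      exact: near_infty_natSinv_lt (PosNum st0).
    exists (c (r (maxn m N))); first by apply: HN; exact: leq_maxr.
    apply: mono => //; first exact: QD.
    have [_ _ _] := Hr (maxn m N); move: Hm; move: (_%:R^-1 : R)%R => u; lra.
  - move=> y Hy; apply: causal_lim_l => e /near_x[N HN].
    by exists (c (r N)); [exact: HN|apply: Hy => //; exact: QD].
  - by move=> e /near_x[N HN]; exists (r N) => //; exact: HN.
have [x [x1 x2 _]] := lim D (@subset_refl _ _) HD.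
exists x; split => // e e0; apply: contrapT => nu.
(* If the left limit failed, times whose values stay at distance at least [e] from [x] would
   accumulate at [t]; the limit along them would again be the least upper bound, hence [x]. *)
have HQ (u : R) : (u < t)%R -> exists2 s, (D `&` [set s | (e <= dist (c s) x)%R]) s & (u < s < t)%R.
  move=> ut; apply: contrapT => ns; apply: nu; exists u => // s Ds us.
  by rewrite ltNge; apply/negP => es; apply: ns; exists s.
have [y [y1 y2 y3]] := lim _ (@subIsetl _ _ _) HQ.
have xy : x = y by apply: tsep_antisym; [exact: x2|exact: y2].
by have [s [_ /=]] := y3 e e0; rewrite xy leNgt => /negP.
Qed.

End LeftLimits.

Section CurveReconstruction.
Variables (R : realType) (S : fmmst R).
Local Notation dist := (@bdist R S).

(** The curve is defined at [t > 0] as the least upper bound of the samples at earlier times, which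
    is their left limit. The last hypothesis says that each sample is approached by earlier ones, so
    that the curve passes through it. *)
Lemma curve_of_samples (tm : nat -> R) (z : nat -> S) :
  (forall i, 0 <= tm i <= 1)%R ->
  (exists i, tm i = 0)%R -> (exists i, tm i = 1)%R ->
  (forall u v : R, (0 <= u)%R -> (u < v)%R -> (v <= 1)%R -> exists i, (u < tm i < v)%R) ->
  (forall i j, (tm i <= tm j)%R -> 0 <= tsep (z i) (z j)) ->
  (forall i m, (0 < tm i)%R -> exists2 j, (tm j < tm i)%R & (dist (z j) (z i) < m.+1%:R^-1)%R) ->
  exists c : LCC S, forall i, c (tm i) = z i.
Proof.
move=> tm01 [i0 tmi0] [i1 tmi1] dns mono lft.
have zE i j : tm i = tm j -> z i = z j.
  by move=> ij; apply: tsep_antisym; apply: mono; rewrite ij.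
pose zz s := z (xget 0%N [set i | tm i = s]).
have zzE i : zz (tm i) = z i.
  by apply: zE; apply: (xgetPex 0%N (P := [set j | tm j = tm i])); exists i.
have Ht t : exists x, (0 < t)%R -> (t <= 1)%R ->
    (forall i, (tm i < t)%R -> 0 <= tsep (z i) x) /\
    (forall y, (forall i, (tm i < t)%R -> 0 <= tsep (z i) y) -> 0 <= tsep x y).
  have [t0|t0] := ltP 0%R t; last by exists point.
  have [t1|t1] := leP t 1%R; last by exists point.
  have [u ut|s s' [i _ <-] [j _ <-] ij _|s [i _ <-] _|x [_ x1 x2]] := @left_limitP _ S (range tm) zz t (z i1).
  - have [i /andP[ui it]] := dns (Num.max u 0%R) t ltac:(by rewrite le_max lexx orbT) ltac:(by rewrite gt_max ut) t1.
    by exists (tm i) => //; move: ui; rewrite gt_max it andbT => /andP[].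
  - by rewrite !zzE; exact: mono.
  - by rewrite zzE; apply: mono; rewrite tmi1; have /andP[] := tm01 i.
  exists x => _ _; split=> [i it|y Hy].
    by rewrite -zzE; apply: x1.
  by apply: x2 => s [i _ <-] it; rewrite zzE; exact: Hy.
have {Ht}[f Hf] := choice Ht.
have f1 t i : (0 < t)%R -> (t <= 1)%R -> (tm i < t)%R -> 0 <= tsep (z i) (f t).
  by move=> t0 t1; have [h _] := Hf t t0 t1; exact: h.
have f2 t y : (0 < t)%R -> (t <= 1)%R ->
    (forall i, (tm i < t)%R -> 0 <= tsep (z i) y) -> 0 <= tsep (f t) y.
  by move=> t0 t1; have [_ h] := Hf t t0 t1; exact: h.
have f3 t i : (0 < t)%R -> (t <= 1)%R -> (t <= tm i)%R -> 0 <= tsep (f t) (z i).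
  by move=> t0 t1 ti; apply: f2 => // j jt; apply: mono; rewrite ltW// (lt_le_trans jt).
have refl (x : S) : 0 <= tsep x x.
  by have [_ -> _] := tsepP S.
have ff s t : (0 < s)%R -> (s <= t)%R -> (t <= 1)%R -> 0 <= tsep (f s) (f t).
  move=> s0; rewrite le_eqVlt => /predU1P[-> _|st t1]; first exact: refl.
  have [i /andP[si it]] := dns s t (ltW s0) st t1.
  apply: (tsep_trans (y := z i)); last exact: f1 (lt_trans s0 st) t1 it.
  by apply: f3 => //; [rewrite ltW// (lt_le_trans st)|exact: ltW].
pose c t := if (t <= 0)%R then z i0 else f (Num.min t 1%R).
have c0 t : (t <= 0)%R -> c t = z i0 by rewrite /c => ->.
have cf t : (0 < t)%R -> (t <= 1)%R -> c t = f t.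
  by move=> t0 t1; rewrite /c leNgt t0/= min_l.
have cc s t : (0 <= s)%R -> (s <= t)%R -> (t <= 1)%R -> 0 <= tsep (c s) (c t).
  move=> s0 st t1; have [t0|t0] := leP t 0%R.
    by rewrite !c0// (le_trans st).
  rewrite (cf t)//; move: s0; rewrite le_eqVlt => /predU1P[<-|s0].
    by rewrite c0//; apply: f1 => //; rewrite tmi0.
  by rewrite cf//; [exact: ff|exact: le_trans t1].
have lcc : is_lcc c.
  split=> //.
  - move=> t t0 t1 A.
    have [u ut|s s' s0 s'0 ss' st|s s0 st|y [y1 y2 y3]] := @left_limitP _ S [set s | (0 < s)%R] c t (c t).
    + exists ((Num.max u 0%R + t) / 2)%R.
        by rewrite /= divr_gt0// ltr_wpDl// le_max lexx orbT.
      have m : (Num.max u 0%R < t)%R by rewrite gt_max ut.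
      have : (u <= Num.max u 0%R)%R by rewrite le_max lexx.
      by move: m; move: (Num.max u 0%R) => v ? ?; apply/andP; split; lra.
    + by apply: cc => //; [exact: ltW|exact: ltW (lt_le_trans st t1)].
    + by apply: cc => //; exact: ltW.
    (* Both are least upper bounds, one over all earlier times and the other over the dense sample
       times, and these interlace. *)
    have <- : y = c t.
      apply: tsep_antisym; first by apply: y3 => s s0 st; apply: cc => //; exact: ltW.
      rewrite cf//; apply: f2 => // i it.
      have [i' /andP[ii' i't]] := dns (tm i) t ltac:(by have /andP[] := tm01 i) it t1.
      have i'0 : (0 < tm i')%R by rewrite (le_lt_trans _ ii')//; have /andP[] := tm01 i.
      apply: (tsep_trans (y := c (tm i'))); last exact: y2.
      rewrite cf//; last by have /andP[] := tm01 i'.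
      by apply: f1 => //; have /andP[] := tm01 i'.
    move=> /nbhs_bdist[e e0 eA]; have [u ut Hu] := y1 e e0.
    have : \forall s \near t^'-, [/\ (0 < s)%R, (u < s)%R & (s < t)%R].
      near=> s; split; near: s; [exact: nbhs_left_gt|exact: nbhs_left_gt|exact: nbhs_left_lt].
    apply: filterS => s [s0 us st]; apply: eA => /=; rewrite bdistC; apply: Hu => //.
    by rewrite us.
  - by move=> t t0; rewrite !c0.
  - move=> t t1; rewrite /c leNgt (lt_le_trans _ t1)//= min_r// leNgt ltr01/= min_l//.
exists (MkLCC lcc) => i /=.
have /andP[] := tm01 i; rewrite le_eqVlt => /predU1P[i0E i1'|i0' i1'].
  by rewrite c0 -?i0E//; apply: zE; rewrite tmi0.
rewrite cf//; apply: tsep_antisym; first exact: f3.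
apply: causal_lim_l => e e0.
have [m _ /(_ m (leqnn m))/= Hm] : \forall n \near \oo, (n.+1%:R^-1 < e :> R)%R.
  exact: near_infty_natSinv_lt (PosNum e0).
have [j ji jd] := lft i m i0'.
exists (z j); first exact: lt_trans Hm.
by apply: f1.
Unshelve. all: by end_near. Qed.

End CurveReconstruction.

(** * Curves as points of a countable product *)

Section Samples.
Variables (R : realType) (S : fmmst R).
Local Notation dist := (@bdist R S).
Local Notation PS := (prod_topology (fun _ : nat => (S : topologicalType))).
Implicit Types c : LCC S.

Lemma LCC_ext c c' : (forall t, c t = c' t) -> c = c'.
Proof.
case: c c' => [c cP] [c' c'P] /= /funext E; move: cP c'P; rewrite E => cP c'P.
by congr MkLCC; exact: Prop_irrelevance.
Qed.

Lemma rat_between (u v : R) : (u < v)%R -> exists q : rat, (u < ratr q < v)%R.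
Proof.
move=> uv; have [q] := rat_in_itvoo uv; rewrite in_itv/= => ?; by exists q.
Qed.

Lemma LCC_ext_rat c c' : (forall q : rat, c (clip01 (ratr q)) = c' (clip01 (ratr q))) -> c = c'.
Proof.
move=> H; apply: LCC_ext => t; apply: contrapT => ne.
have d0 : (0 < dist (c t) (c' t) / 2)%R.
  by rewrite divr_gt0// lt_neqAle bdist_ge0 andbT eq_sym; apply/eqP => /bdist_eq0.
have [d1 d10 H1] := curve_left c t d0; have [d2 d20 H2] := curve_left c' t d0.
have m0 : (0 < Num.min d1 d2)%R by rewrite lt_min d10.
have [q /andP[q1 q2]] := @rat_between (t - Num.min d1 d2) t ltac:(by lra).
have m1 : (Num.min d1 d2 <= d1)%R by rewrite ge_min lexx.
have m2 : (Num.min d1 d2 <= d2)%R by rewrite ge_min lexx orbT.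
have h1 := H1 (ratr q) ltac:(lra) (ltW q2).
have h2 := H2 (ratr q) ltac:(lra) (ltW q2).
have E : c (ratr q) = c' (ratr q) by rewrite (curve_clip c) (curve_clip c').
move: h1; rewrite E bdistC => h1.
by have := bdist_triangle (c t) (c' (ratr q)) (c' t); lra.
Qed.

Variables (s k : R).
Hypotheses (s0 : (0 <= s)%R) (k0 : (0 < k)%R) (sk1 : (s + k <= 1)%R).

(* rational times, together with their images under the time change r |-> s + k r *)
Definition stime (n : nat) : R :=
  let bq : bool * rat := odflt (false, 0%R) (unpickle n) in
  let r : R := clip01 (ratr bq.2) in if bq.1 then (s + k * r)%R else r.

Definition samples c : PS := fun n => c (stime n).

Definition rtime (n : nat) : R := clip01 (ratr (odflt 0%R (unpickle n) : rat)).

Definition rsamples c : PS := fun n => c (rtime n).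

(** Selects, among the samples of [c], those that sample the restricted curve at rational times. On
    the product, restriction of curves thus becomes a continuous map that forgets and relabels
    coordinates. *)
Definition sub_index (n : nat) : nat := pickle (true, odflt 0%R (unpickle n) : rat).

Lemma stime_pickle b (q : rat) :
  stime (pickle (b, q)) = if b then (s + k * clip01 (ratr q))%R else clip01 (ratr q).
Proof. by rewrite /stime pickleK. Qed.

Lemma samples_sub c n : samples c (sub_index n) = rsamples (restr s k c) n.
Proof.
rewrite /samples /rsamples /sub_index stime_pickle restrE ?ltW//.
by rewrite [in RHS]clip01_id ?clip01_ge0 ?clip01_le1.
Qed.

Lemma rsamples_inj : injective rsamples.
Proof.
move=> c c' cc'; apply: LCC_ext_rat => q.
have := congr1 (fun f : PS => f (pickle q)) cc'.
by rewrite /rsamples /rtime pickleK.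
Qed.

Lemma stime01 n : (0 <= stime n <= 1)%R.
Proof.
rewrite /stime; case: ifP => _; rewrite ?clip01_ge0 ?clip01_le1//.
move: (clip01_ge0 (ratr (odflt (false, 0%R) (unpickle n) : bool * rat).2 : R)).
move: (clip01_le1 (ratr (odflt (false, 0%R) (unpickle n) : bool * rat).2 : R)).
move: (clip01 _) => r r1 r0; rewrite addr_ge0 ?mulr_ge0 ?(ltW k0)//=.
by rewrite (le_trans _ sk1)// lerD2l ger_pMr.
Qed.

Lemma stime_dense (u v : R) : (0 <= u)%R -> (u < v)%R -> (v <= 1)%R ->
  exists i, (u < stime i < v)%R.
Proof.
move=> u0 uv v1; have [q /andP[uq qv]] := rat_between uv.
exists (pickle (false, q)); rewrite stime_pickle clip01_id ?uq//.
  by rewrite (le_trans u0)// ltW.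
by rewrite (le_trans (ltW qv)).
Qed.

Lemma continuous_sub_index : continuous (fun z : PS => (fun n => z (sub_index n)) : PS).
Proof.
move=> z; apply: cvg_coord => n.
exact: (@continuous_coord R S (sub_index n) z).
Qed.

Let tsepC i j : set PS := [set z | 0 <= tsep (z i) (z j)].

Lemma closed_tsep_coord i j : closed (tsepC i j).
Proof.
apply: (@preimage_closed _ _ (fun z : PS => (z i, z j)) [set xy | 0 <= tsep xy.1 xy.2]) => [z _|].
  by apply: cvg_pair; exact: (@continuous_coord R S _ z).
exact: tsep_closed.
Qed.

Variable P : probability (curves S) R.

Lemma measurable_samples i : measurable_fun setT (fun c : curves S => samples c i : borel S).
Proof. exact: measurable_ev. Qed.

Lemma measurable_rsamples i : measurable_fun setT (fun c : curves S => rsamples c i : borel S).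
Proof. exact: measurable_ev. Qed.

Local Notation bireg := (@biregular R S _ (curves S) P samples).

Lemma biregularT : bireg setT.
Proof.
have -> : [set: PS] = ~` set0 by rewrite setC0.
by apply: biregularC; apply: biregular0; exact: measurable_samples.
Qed.

(** By the reconstruction of curves from samples, the range is described by countably many
    conditions: monotonicity, which is closed since the causal order is, and approximation of each
    sample at a positive time by earlier ones, a countable combination of conditions
    [dist < 1 / (m + 1)]. *)
Lemma biregular_range : bireg (range samples).
Proof.
have ms := measurable_samples.
pose M := \bigcap_i \bigcap_j (if (stime i <= stime j)%R then tsepC i j else setT).
pose L := \bigcap_i \bigcap_m (if (0 < stime i)%R then
  \bigcup_j (if (stime j < stime i)%R then [set z : PS | (dist (z j) (z i) < m.+1%:R^-1)%R] else set0)
  else setT).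
have -> : range samples = M `&` L.
  apply/seteqP; split => [_ [c _ <-]|z [Mz Lz]].
    split => i _ j _; case: ifP => // ij; first exact: curve_causal.
    have e0 : (0 < j.+1%:R^-1 :> R)%R by rewrite invr_gt0 ltr0n.
    have [d d0 Hd] := curve_left c (stime i) e0.
    have /andP[_ i1] := stime01 i.
    have [h /andP[h1 h2]] := @stime_dense (Num.max 0%R (stime i - d)%R) (stime i)
      ltac:(by rewrite le_max lexx) ltac:(by rewrite gt_max ij/= ltrBlDr ltrDl) i1.
    exists h => //; rewrite h2; apply: Hd; last exact: ltW.
    by move: h1; rewrite gt_max => /andP[].
  have [|||i j ij|i m i0|c Hc] := @curve_of_samples R S stime z stime01.
  - by exists (pickle (false, 0%R : rat)); rewrite stime_pickle rmorph0 clip01_id.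
  - by exists (pickle (false, 1%R : rat)); rewrite stime_pickle rmorph1 clip01_id.
  - exact: stime_dense.
  - by have := Mz i I j I; rewrite ij.
  - have := Lz i I m I; rewrite i0 => -[j _]; case: ifP => // ji Hj.
    by exists j.
  by exists c => //; apply/funext.
have b0 : bireg set0 by exact: biregular0.
apply: biregularI => //.
  apply: (biregular_bigcap ms) => i; apply: (biregular_bigcap ms) => j; case: ifP => _; last exact: biregularT.
  by apply: biregular_closed => //; exact: closed_tsep_coord.
apply: (biregular_bigcap ms) => i; apply: (biregular_bigcap ms) => m; case: ifP => _; last exact: biregularT.
apply: (biregular_bigcup ms) => // j; case: ifP => _ //.
by apply: biregular_lt => //; exact: continuous_coord_dist.
Qed.

(** The preimages of biregular sets form a sigma-algebra for which evaluation at each rational time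
    in [[0, 1]] is measurable; these evaluations already generate the Borel sets of curves. *)
Lemma measurable_biregular (A : set (curves S)) : measurable A ->
  exists2 A' : set PS, bireg A' & A = samples @^-1` A'.
Proof.
have ms := measurable_samples.
pose G := [set A : set (LCC S) | exists2 A' : set PS, bireg A' & A = samples @^-1` A'].
have sG : sigma_algebra setT G.
  split.
  - by exists set0; [exact: biregular0|].
  - move=> B [A' A'r ->]; exists (~` A'); first exact: biregularC.
    by apply/seteqP; split => c; [move=> []|].
  - move=> F HF; have [F' F'r F'E] : exists2 F' : nat -> set PS, (forall n, bireg (F' n)) &
      (forall n, F n = samples @^-1` (F' n)).
      have H n : exists A', bireg A' /\ F n = samples @^-1` A' by have [A' ? ?] := HF n; exists A'.
      by have [F' HF'] := choice H; exists F' => n; have [] := HF' n.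
    exists (\bigcup_n F' n); first exact: biregular_bigcup.
    by rewrite preimage_bigcup; apply: eq_bigcup.
have mid : measurable_fun setT (id : g_sigma_algebraType G -> curves S).
  apply: (@measurable_into_curves R S _ (g_sigma_algebraType G) id) => q q01.
  move=> _ B mB; rewrite setTI; apply: sub_sigma_algebra.
  have [q0 q1] : (0 <= ratr q :> R)%R /\ (ratr q <= 1 :> R)%R.
    by move/andP: q01 => [? ?]; split; rewrite ?ler0q// -(rmorph1 (@ratr R)) ler_rat.
  exists [set z | B (z (pickle (false, q)))].
    by apply: biregular_coord.
  apply/seteqP; split => c; rewrite /preimage/= /samples stime_pickle clip01_id//.
move=> mA; have := mid measurableT A mA; rewrite setTI preimage_id.
by rewrite /measurable/= (sigma_algebra_id sG).
Qed.

(* An instance of the perfectness of P: the set B itself need not be measurable. *)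
Lemma saturated_inner (B A N : set (curves S)) : measurable A -> measurable N -> P N = 0 ->
  (forall c, ~ N c -> (A c <-> B (restr s k c))) ->
  exists B' : set (curves S), [/\ measurable B',
    B' `<=` B & P (A `\` (restr s k @^-1` B')) = 0].
Proof.
move=> mA mN N0 AB; have ms := measurable_samples.
have mAN : measurable (A `\` N) by exact: measurableD.
have [A' A'r A'E] := measurable_biregular mAN.
have A'r' : bireg (A' `&` range samples) by apply: biregularI => //; exact: biregular_range.
have H (n : nat) : exists K : set PS, [/\ compact K, K `<=` A' `&` range samples &
    P ((A `\` N) `\` (samples @^-1` K)) <= (n.+1%:R^-1)%:E].
  have [K1 [K2 [c1 c2 s1 s2 HK]]] := A'r' n.+1%:R^-1%R ltac:(by rewrite invr_gt0 ltr0n).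
  exists K1; split => //; apply: le_trans HK; apply: le_measure; rewrite ?inE.
  - by apply: measurableD => //; exact: measurable_preimage_compact.
  - by apply: measurableC; apply: measurable_preimage_compact => //; exact: compactU.
  - move=> c [Ac K1c] /= [//|/s2]; apply; split; last by exists c.
    by move: Ac; rewrite A'E.
have {H}[K HK] := choice H.
(* The step that needs compactness: a continuous image of a compact set is compact, hence closed
   with measurable preimage, whereas the projection of a Borel set need not be Borel. *)
pose L n := (fun z : PS => (fun i => z (sub_index i)) : PS) @` K n.
have cL n : compact (L n).
  apply: continuous_compact; last by have [] := HK n.
  by apply: continuous_subspaceT => z; exact: continuous_sub_index.
have mL n : measurable (rsamples @^-1` L n : set (curves S)).
  by apply: (measurable_preimage_compact measurable_rsamples).
exists (\bigcup_n (rsamples @^-1` L n)); split.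
- exact: bigcupT_measurable.
- move=> y [n _ [z Kz]].
  have [_ /(_ _ Kz)[A'z [c0 _ c0z]] _] := HK n.
  move=> zE; suff <- : restr s k c0 = y.
    have : (A `\` N) c0 by rewrite A'E /preimage/= c0z.
    by move=> [Ac0 Nc0]; apply/AB.
  apply: rsamples_inj; rewrite -zE; apply/funext => i.
  by rewrite -samples_sub c0z.
- have mB' : measurable (restr s k @^-1` (\bigcup_n (rsamples @^-1` L n)) : set (curves S)).
    rewrite -[X in measurable X]setTI; apply: measurable_restr => //.
    exact: bigcupT_measurable.
  apply/eqP; rewrite eq_le measure_ge0 andbT.
  apply: (@le_trans _ _ (P ((A `\` N) `\` (restr s k @^-1` (\bigcup_n (rsamples @^-1` L n)))))).
    have -> : P ((A `\` N) `\` (restr s k @^-1` (\bigcup_n (rsamples @^-1` L n)))) =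
      P ((A `\` (restr s k @^-1` (\bigcup_n (rsamples @^-1` L n)))) `\` N).
      by congr (P _); apply/seteqP; split => c [[? ?] ?].
    rewrite [leRHS]measureD//; last 2 first.
    - exact: measurableD.
    - by rewrite (le_lt_trans (probability_le1 _ _)) ?ltry//; exact: measurableD.
    rewrite [X in _ - X](_ : _ = 0) ?sube0//.
    by apply: (subset_measure0 _ mN _ N0) => //; apply: measurableI => //; exact: measurableD.
  apply/lee_addgt0Pr => e e0; rewrite add0e.
  have [m _ /(_ m (leqnn m))/= Hm] : \forall n \near \oo, (n.+1%:R^-1 < e :> R)%R.
    exact: near_infty_natSinv_lt (PosNum e0).
  apply: (@le_trans _ _ (m.+1%:R^-1)%:E); last by rewrite lee_fin ltW.
  have [_ _] := HK m; apply: le_trans; apply: le_measure; rewrite ?inE.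
  - exact: measurableD.
  - by apply: measurableD => //; apply: measurable_preimage_compact => //; have [] := HK m.
  - move=> c [Ac Bc]; split => // Kc; apply: Bc; exists m => //.
    by exists (samples c) => //; apply/funext => i; rewrite samples_sub.
Qed.

End Samples.

(** * Recovering the speed of restricted curves from countably many integrals *)

Section Differentiate.
Variable R : realType.
Local Notation leb := (@lebesgue_measure R).

Definition ratn (n : nat) : rat := odflt 0%R (unpickle n).

(** For [h >= 0], the supremum of [h q] over the rationals [q < r]. Replacing the other terms by 0
    through an indicator leaves a supremum of a fixed sequence, which is measurable jointly in [r]
    and in any parameter of [h]. *)
Definition left_sup (h : rat -> \bar R) (r : R) : \bar R :=
  esups (fun n => h (ratn n) * (\1_(`]ratr (ratn n), +oo[%classic : set R) r)%:E) 0%N.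

Definition right_slope (h : rat -> \bar R) (r : R) : \bar R :=
  limn_esup (fun n => (n.+1%:R)%:E *
    (left_sup h (r + n.+1%:R^-1)%R - left_sup h r)).

(** The primitive of a density with values in [[0, 1]] is nondecreasing and 1-Lipschitz, so its
    values at the rationals determine it, and its difference quotients return the density almost
    everywhere. Joint measurability of a density thus reduces to measurability of countably many
    integrals. *)
Lemma right_slopeP (psi : R -> R) : measurable_fun setT psi ->
  (forall r, 0 <= psi r <= 1)%R -> leb.-integrable setT (EFin \o psi) ->
  {ae leb, forall r,
    right_slope (fun q => \int[leb]_(x in `]-oo, ratr q]) (psi x)%:E) r = (psi r)%:E}.
Proof.
move=> mpsi psi01 ipsi.
have psi0 r : (0 <= psi r)%R by have /andP[] := psi01 r.
pose G (x : R) := (\int[leb]_(t in [set` `]-oo, x]]) (psi t))%R.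
have iy (D : set R) : measurable D -> leb.-integrable D (EFin \o psi).
  by move=> mD; exact: (integrableS _ _ _ ipsi).
have GE x : \int[leb]_(t in `]-oo, x]) (psi t)%:E = (G x)%:E.
  by rewrite /G /Rintegral fineK//; apply: integrable_fin_num => //; exact: iy.
have G0 x : (0 <= G x)%R by rewrite -lee_fin -GE; apply: integral_ge0 => t _; rewrite lee_fin.
have Glip a b : (a <= b)%R -> (G a <= G b /\ G b <= G a + (b - a))%R.
  move=> ab.
  have E : (G b)%:E = (G a)%:E + \int[leb]_(t in `]a, b]) (psi t)%:E.
    rewrite -!GE -ge0_integral_setU//=.
    - congr (integral _ _ _); apply/seteqP; split => t /=; rewrite !in_itv/=.
        by move=> tb; have [ta|ta] := leP t a; [left|right]; rewrite ?ta.
      by move=> [ta|/andP[]//]; exact: le_trans ab.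
    - exact/measurable_EFinP/measurable_funTS.
    - by move=> t _; rewrite lee_fin.
    - by apply/disj_setPS => t /=; rewrite !in_itv/= => -[ta /andP[]]; rewrite ltNge ta.
  rewrite -!lee_fin E EFinD; split; first by rewrite leeDl// integral_ge0// => t _; rewrite lee_fin.
  apply: leeD2l; apply: (@le_trans _ _ (\int[leb]_(t in `]a, b]) 1)).
    apply: ge0_le_integral => //.
    - by move=> t _; rewrite lee_fin.
    - exact/measurable_EFinP/measurable_funTS.
    - by move=> t _; rewrite lee_fin; have /andP[] := psi01 t.
  by rewrite integral_cst//= mul1e lebesgue_measure_itv/= lte_fin; case: ifPn => // _; rewrite lee_fin subr_ge0.
have LE r : left_sup (fun q => \int[leb]_(x in `]-oo, ratr q]) (psi x)%:E) r = (G r)%:E.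
  apply/eqP; rewrite eq_le; apply/andP; split.
    apply: ge_ereal_sup => _ [n _ <-]; rewrite GE indicE.
    have [qr|qr] := ltP (ratr (ratn n)) r.
      by rewrite mem_set ?mule1 ?lee_fin//= ?in_itv/= ?qr//; have [] := Glip _ _ (ltW qr).
    by rewrite memNset ?mule0 ?lee_fin//= in_itv/= andbT ltNge qr.
  apply/lee_addgt0Pr => e e0.
  have [q] := @rat_in_itvoo R (r - e)%R r ltac:(by rewrite ltrBlDr ltrDl); rewrite in_itv/= => /andP[q1 q2].
  apply: (@le_trans _ _ ((G (ratr q))%:E + e%:E)).
    by rewrite -EFinD lee_fin; have [_] := Glip _ _ (ltW q2); lra.
  apply: leeD2r; apply: ereal_sup_ubound; exists (pickle q) => //; rewrite /ratn pickleK /=.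
  by rewrite GE indicE mem_set ?mule1//= in_itv/= q2.
have lpsi : locally_integrable setT psi.
  by apply: open_integrable_locally => //; exact: openT.
have := FTC1Ny (fun y => iy `]-oo, y]%classic (measurable_itv _)) lpsi.
apply: filterS => r [dG Gr]; rewrite /right_slope.
suff : (fun n => (n.+1%:R)%:E *
    (left_sup (fun q => \int[leb]_(x in `]-oo, ratr q]) (psi x)%:E) (r + n.+1%:R^-1)%R -
     left_sup (fun q => \int[leb]_(x in `]-oo, ratr q]) (psi x)%:E) r)) @ \oo --> (psi r)%:E.
  by move=> /cvg_limn_einf_sup[_ ->].
under eq_fun do rewrite !LE -EFinB -EFinM.
apply: cvg_EFin; first by near=> n.
rewrite -Gr derive1E.
have h0 : (fun n : nat => (n.+1%:R^-1)%R : R) @ \oo --> (0 : R)%R^'.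
  move=> A A0.
  have H : \forall n \near \oo, (@harmonic R n != 0)%R -> A (harmonic n) := @cvg_harmonic R _ A0.
  by apply: filterS H => n; apply; apply/lt0r_neq0/harmonic_gt0.
have := cvg_comp _ _ h0 dG.
apply: cvg_trans; apply: near_eq_cvg; near=> n => /=.
rewrite invrK (_ : (n.+1%:R^-1)%:A + r = r + n.+1%:R^-1 :> R)%R//.
by rewrite addrC /GRing.scale/= mulr1.
Unshelve. all: by end_near. Qed.

End Differentiate.
Lemma measurable_expand (R : realType) : measurable_fun setT (@expand R).
Proof.
apply: emeasurable_fun_ray => q; apply: is_interval_measurable.
move=> a b /= qa _ r /andP[ar _]; apply: lt_le_trans qa _; exact: le_expand.
Qed.

Section SpeedOfRestriction.
Variables (R : realType) (S : fmmst R).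
Local Notation leb := (@lebesgue_measure R).
Variables (s k : R).
Hypotheses (s0 : (0 <= s)%R) (k0 : (0 < k)%R) (sk1 : (s + k <= 1)%R).
Variable P : probability (curves S) R.

HB.instance Definition _ := isMeasurableFun.Build _ _ _ _ (restr s k : curves S -> curves S)
  (@measurable_restr R S s k).

Definition restr_law : probability (curves S) R :=
  distribution P (restr s k : {mfun curves S >-> curves S}).

Lemma restr_lawE A : restr_law A = P (restr s k @^-1` A).
Proof. by []. Qed.

Lemma ae_restr_law (Q : curves S -> Prop) : {ae restr_law, forall y, Q y} ->
  {ae P, forall c, Q (restr s k c)}.
Proof.
move=> [N [mN N0 QN]]; exists (restr s k @^-1` N); split => //.
  by rewrite -[X in measurable X]setTI; exact: measurable_restr.
by move=> c /= nQ; apply: QN.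
Qed.

(** [W] is measurable on the source and factors through the restriction up to a null set. Each
    superlevel set of the factor [f], and its complement, then contains a measurable set whose
    preimage has full mass in the corresponding set for [W]; the two inner sets leave only a null
    gap for the image law. *)
Lemma descend (W f : curves S -> \bar R) : measurable_fun setT W ->
  {ae P, forall c, W c = f (restr s k c)} ->
  exists2 h : curves S -> \bar R, measurable_fun setT h & {ae restr_law, forall y, h y = f y}.
Proof.
move=> mW [N [mN N0 WN]].
have H (q : rat) : exists2 H : set (curves S), measurable H &
    {ae restr_law, forall y, H y <-> (ratr q)%:E < f y}.
  have mA : measurable [set c : curves S | (ratr q)%:E < W c].
    rewrite -[X in measurable X]setTI; exact: emeasurable_fun_o_infty.
  have NE c : ~ N c -> W c = f (restr s k c) by move=> Nc; apply: contrapT => /WN.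
  have [B1 [m1 B1f B1A]] := saturated_inner s0 k0 sk1 (B := [set y | (ratr q)%:E < f y])
    mA mN N0 (fun c Nc => ltac:(by rewrite /= -NE)).
  have [B2 [m2 B2f B2A]] := saturated_inner s0 k0 sk1 (B := ~` [set y | (ratr q)%:E < f y])
    (measurableC mA) mN N0 (fun c Nc => ltac:(by rewrite /= -NE)).
  exists B1 => //; exists (~` (B1 `|` B2)); split; first by apply: measurableC; exact: measurableU.
    rewrite restr_lawE; apply/eqP; rewrite eq_le measure_ge0 andbT.
    have mF (B : set (curves S)) : measurable B -> measurable (restr s k @^-1` B : set (curves S)).
      by move=> mB; rewrite -[X in measurable X]setTI; exact: measurable_restr.
    have mA1 : measurable ([set c : curves S | (ratr q)%:E < W c] `\` restr s k @^-1` B1).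
      by apply: measurableD => //; exact: mF.
    have mA2 : measurable (~` [set c : curves S | (ratr q)%:E < W c] `\` restr s k @^-1` B2).
      by apply: measurableD; [exact: measurableC|exact: mF].
    apply: (@le_trans _ _ (P (([set c | (ratr q)%:E < W c] `\` restr s k @^-1` B1) `|`
       (~` [set c | (ratr q)%:E < W c] `\` restr s k @^-1` B2)))).
      apply: le_measure; rewrite ?inE.
      - by apply: mF; apply: measurableC; exact: measurableU.
      - exact: measurableU.
      - move=> c /= /not_orP[n1 n2]; have [Ac|Ac] := pselect ((ratr q)%:E < W c); [by left|by right].
    apply: le_trans (measureU2 _ mA1 mA2) _.
    by rewrite [X in X + _]B1A [X in _ + X]B2A adde0.
  move=> y /= nB [B1y|B2y]; apply: nB; split => [|fy]; [exact: B1f|by []|exact: B1f|by have := B2f _ B2y].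
have {H}[H HH] : {H : rat -> set (curves S) & forall q, measurable (H q) /\
    {ae restr_law, forall y, H q y <-> (ratr q)%:E < f y}}.
  have H' q : exists A : set (curves S), measurable A /\
    {ae restr_law, forall y, A y <-> (ratr q)%:E < f y} by have [A ? ?] := H q; exists A.
  exact: choice H'.
by apply: (@measurable_version _ _ R restr_law f H) => q; have [] := HH q.
Qed.



(** The primitives at rational times of the contracted speed of the restricted curve are measurable
    functions of the original curve, by the formula for the speed under restriction. They descend to
    the image law, and differentiating them in time gives the jointly measurable version. *)
Lemma measurable_speed_restr (T : R) : (s + k <= T)%R -> measurable_speed P T ->
  measurable_speed restr_law 1.
Proof.
move=> skT [w mw hw].
have mw' : measurable_fun [set: curves S * measurableTypeR R] w by exact: mw.
pose J : set R := `[0%R, 1%R]%classic.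
(* Contraction bounds the speed by 1 even where it is infinite, which the differentiation requires;
   [max 0] and the indicator make the function nonnegative and integrable in time everywhere, not
   just almost everywhere. *)
pose g (cr : curves S * measurableTypeR R) : R :=
  (Num.max 0 (contract (k%:E * w (cr.1, s + k * cr.2)%R)) * \1_J cr.2)%R.
have mI (D : set R) : measurable (D : set (measurableTypeR R)) ->
    measurable_fun setT (fun cr : curves S * measurableTypeR R => (\1_D cr.2 : R)).
  move=> mD; have mD' : measurable_fun [set: measurableTypeR R] (\1_D : _ -> R) by exact: measurable_indic.
  exact: (measurableT_comp mD' measurable_snd).
have mJ : measurable (J : set (measurableTypeR R)) by exact: measurable_itv.
have mg : measurable_fun setT g.
  apply: measurable_funM; last exact: mI.
  apply: measurable_maxr; first exact: measurable_cst.
  apply: (measurableT_comp (@measurable_contract R)); apply: emeasurable_funM => //.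
  apply: (measurableT_comp mw'); apply: measurable_fun_pair; first exact: measurable_fst.
  have maff : measurable_fun [set: measurableTypeR R] (fun r : measurableTypeR R => (s + k * r)%R : R).
    exact: measurable_affine.
  exact: (measurableT_comp maff measurable_snd).
have g0 cr : (0 <= g cr)%R by rewrite mulr_ge0// le_max lexx.
pose phi (y : curves S) (r : R) : R := (contract (causal_speed y r) * \1_J r)%R.
pose K (q : rat) (y : curves S) := \int[leb]_(r in `]-oo, ratr q]) (phi y r)%:E.
pose W (q : rat) (c : curves S) := \int[leb]_(r in `]-oo, ratr q]) (g (c, r))%:E.
have mW q : measurable_fun setT (W q).
  pose f (cr : curves S * measurableTypeR R) := (g cr)%:E * (\1_(`]-oo, ratr q]%classic : set R) cr.2)%:E.
  rewrite (_ : W q = fubini_F (lebesgue_measure : measure (measurableTypeR R) R) f).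
    apply: measurable_fun_fubini_tonelli_F; last by move=> cr; rewrite mule_ge0// lee_fin.
    apply: emeasurable_funM; apply/measurable_EFinP => //.
    by apply: mI; exact: measurable_itv.
  apply/funext => c; rewrite /W /fubini_F [LHS]integral_mkcond; congr (integral _ _ _); apply/funext => r.
  by rewrite epatch_indic.
have WK : {ae P, forall c, forall q, W q c = K q (restr s k c)}.
  apply: filterS hw => c hw q; apply: ae_eq_integral_nm => //.
  have := ae_affine s k0 hw; have := causal_speed_restr c s0 k0 sk1.
  apply: filterS2 => r Er wr _; rewrite /g /phi/=.
  have [Jr|Jr] := pselect (J r); last by rewrite !indicE memNset// !mulr0.
  have r01 := Jr; move: r01; rewrite /J/= in_itv/= => /andP[r0 r1].
  rewrite Er// wr; [|by rewrite addr_ge0// mulr_ge0// ltW|].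
    rewrite max_r// -(@contract0 R) le_contract mule_ge0//; first by rewrite lee_fin ltW.
    exact: causal_speed_ge0.
  by rewrite (le_trans _ skT)// lerD2l ger_pMr.
have [h mh hK] : exists2 h : rat -> curves S -> \bar R, (forall q, measurable_fun setT (h q)) &
    (forall q, {ae restr_law, forall y, h q y = K q y}).
  have H q : exists h : curves S -> \bar R, measurable_fun setT h /\ {ae restr_law, forall y, h y = K q y}.
    have [h mh hK] := descend (mW q) (filterS (fun c (H : forall q, _) => H q) WK).
    by exists h.
  by have [h Hh] := choice H; exists h => q; have [] := Hh q.
have phi01 y r : (0 <= phi y r <= 1)%R.
  rewrite /phi indicE; case: (_ \in _); rewrite ?mulr0 ?lexx ?ler01// mulr1.
  rewrite -(@contract0 R) le_contract causal_speed_ge0/=.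
  by have := contract_le1 (causal_speed y r); rewrite ler_norml => /andP[].
have mphi y : measurable_fun setT (phi y).
  apply: measurable_funM; last exact: measurable_indic.
  by apply: (measurableT_comp (@measurable_contract R)); exact: measurable_speedf.
have iphi y : leb.-integrable setT (EFin \o phi y).
  have mE : measurable_fun [set: measurableTypeR R] (phi y) := mphi y.
  apply/integrableP; split; first by apply/measurable_EFinP.
  apply: (@le_lt_trans _ _ (\int[leb]_(r in setT) (\1_J r)%:E)).
    apply: ge0_le_integral => //.
    - by apply: measurableT_comp => //; apply/measurable_EFinP.
    - by apply/measurable_EFinP; exact: measurable_indic.
    - move=> r _ /=; rewrite lee_fin ger0_norm; last by have /andP[] := phi01 y r.
      rewrite /phi ler_piMl//.
      by have := contract_le1 (causal_speed y r); rewrite ler_norml => /andP[].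
  by rewrite integral_indic//= setIT lebesgue_measure_itv/= lte_fin ltr01 oppr0 adde0 ltry.
have mleft : measurable_fun setT (fun yr : curves S * measurableTypeR R => left_sup (fun q => h q yr.1) yr.2).
  apply: measurable_fun_esups => n; apply: emeasurable_funM.
    exact: (measurableT_comp (mh _) measurable_fst).
  by apply/measurable_EFinP; apply: mI; exact: measurable_itv.
exists (fun yr : curves S * R => expand (fine (right_slope (fun q => h q yr.1) yr.2))).
  suff : measurable_fun setT (fun yr : curves S * measurableTypeR R => expand (fine (right_slope (fun q => h q yr.1) yr.2))) by [].
  apply: (measurableT_comp (@measurable_expand R)).
  apply: (measurableT_comp (@fine_measurable R _ measurableT)).
  apply: measurable_fun_limn_esup => n; apply: emeasurable_funM; first exact: measurable_cst.
  apply: emeasurable_funB; last exact: mleft.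
  pose sh (yr : curves S * measurableTypeR R) : curves S * measurableTypeR R := (yr.1, (yr.2 + n.+1%:R^-1)%R).
  have msh : measurable_fun setT sh.
    apply: measurable_fun_pair; first exact: measurable_fst.
    have mr : measurable_fun [set: measurableTypeR R] (fun r : measurableTypeR R => (r + n.+1%:R^-1)%R : measurableTypeR R).
      suff : measurable_fun [set: R] (fun r : R => (r + n.+1%:R^-1)%R) by [].
      by apply: measurable_funD; [exact: measurable_id|exact: measurable_cst].
    exact: (measurableT_comp mr measurable_snd).
  exact: (measurableT_comp mleft msh).
have : {ae restr_law, forall y, forall n, h (ratn n) y = K (ratn n) y}.
  by apply: ae_foralln => n; exact: hK.
apply: filterS => y hy; have := right_slopeP (mphi y) (phi01 y) (iphi y).
apply: filterS => r Er r0 r1 /=.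
have -> : right_slope (fun q => h q y) r = right_slope (K^~ y) r.
  have LE r' : left_sup (fun q => h q y) r' = left_sup (K^~ y) r'.
    by rewrite /left_sup; congr (esups _ _); apply/funext => n; rewrite hy.
  by rewrite /right_slope; congr limn_esup; apply/funext => n; rewrite !LE.
rewrite Er/= /phi indicE mem_set ?mulr1 ?contractK//.
by rewrite /J/= in_itv/= r0.
Qed.

End SpeedOfRestriction.

Lemma integral_mrestr d (T : measurableType d) (R : realType) (mu : {measure set T -> \bar R})
    (B : set T) (mB : measurable B) (h : T -> \bar R) :
  measurable_fun setT h -> (forall x, 0 <= h x) ->
  \int[mrestr mu mB]_x h x = \int[mu]_(x in B) h x.
Proof.
move=> mh h0; pose nu := mrestr mu mB; pose nu' := mrestr mu (measurableC mB).
rewrite [RHS]integral_mkcond (eq_measure_integral (measure_add nu nu')); last first.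
  move=> A mA _; rewrite [RHS]measure_addE; transitivity (mu (A `&` B) + mu (A `&` ~` B)) => //.
  rewrite -measureU.
  - by rewrite -setIUr setUv setIT.
  - exact: measurableI.
  - by apply: measurableI => //; exact: measurableC.
  - by rewrite setIACA setICr setI0.
have mhB : measurable_fun setT (h \_ B) by apply/(measurable_restrictT h mB); exact: measurable_funTS.
have hB0 x : 0 <= (h \_ B) x by rewrite patchE; case: ifP.
rewrite ge0_integral_measure_add//.
have -> : \int[nu']_x (h \_ B) x = 0.
  rewrite -(integral0 nu' setT); apply: ae_eq_integral_nm => //.
  exists B; split => //; first by change (mu (B `&` ~` B) = 0); rewrite setICr measure0.
  by move=> x /= nx; apply: contrapT => Bx; apply: nx => _; rewrite patchE memNset.
rewrite adde0; apply: ae_eq_integral_nm => //; exists (~` B); split => //; first exact: measurableC.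
  by change (mu (~` B `&` B) = 0); rewrite setICl measure0.
by move=> x /= nx Bx; apply: nx => _; rewrite patchE mem_set.
Qed.

(** * Existence and calculus of subslopes *)

Section ExtendedArithmetic.
Variable R : realType.
Implicit Types x y z : \bar R.

Lemma addx_fin x y : (addx x y \is a fin_num) = (x \is a fin_num) && (y \is a fin_num).
Proof. by rewrite /addx; case: ifPn => [xf|/negbTE //]; rewrite fin_numD xf. Qed.

Lemma addx_le x x' y y' : x <= x' -> y <= y' -> addx x y <= addx x' y'.
Proof.
rewrite /addx; case: x x' => [x| |] [x'| |]//=; rewrite ?leey ?leNye//.
by move=> xx' yy'; exact: leeD.
Qed.

Lemma subxE x y : y <= x -> subx x y = if (x \is a fin_num) && (y \is a fin_num) then x - y else +oo.
Proof. by rewrite /subx /addx; case: x y => [x| |] [y| |]//=; rewrite ?andbF//=. Qed.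

Lemma subx_ge0 x y : y <= x -> 0 <= subx x y.
Proof.
move=> yx; rewrite subxE//; case: ifPn => [/andP[xf yf]|_]; last exact: leey.
by rewrite sube_ge0// yf.
Qed.

Lemma subx_superadditive x y z : x <= y -> y <= z -> subx y x + subx z y <= subx z x.
Proof.
move=> xy yz; have xz := le_trans xy yz; rewrite !subxE//.
case: x y z xy yz xz => [x| |] [y| |] [z| |]//= _ _ _.
by rewrite -!EFinB -EFinD lee_fin; lra.
Qed.

Lemma subx_mono x x' y y' : x' <= x -> x <= y -> y <= y' -> subx y x <= subx y' x'.
Proof.
move=> x'x xy yy'; rewrite !subxE//; last by rewrite (le_trans x'x)// (le_trans xy).
case: x x' y y' x'x xy yy' => [x| |] [x'| |] [y| |] [y'| |]//=; rewrite ?leey//.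
by rewrite !lee_fin; lra.
Qed.

Lemma fscale_fin (a : R) x : a != 0%R -> (a%:E * x \is a fin_num) = (x \is a fin_num).
Proof.
move=> a0; case: x => [x| |]//=.
  by rewrite mulry fin_num_abs; case: sgrP a0 => //; rewrite ?mul1e ?mulN1e.
by rewrite mulrNy fin_num_abs; case: sgrP a0 => //; rewrite ?mul1e ?mulN1e.
Qed.

Lemma measurable_addx d (T : measurableType d) (f g : T -> \bar R) :
  measurable_fun setT f -> measurable_fun setT g -> measurable_fun setT (fun t => addx (f t) (g t)).
Proof.
move=> mf mg; rewrite /addx.
have -> : (fun t => if f t \is a fin_num then f t + g t else f t) =
   (fun t => if `|f t| < +oo then f t + g t else f t).
  by apply/funext => t; rewrite fin_num_abs.
apply: measurable_fun_ifT => //; last exact: emeasurable_funD.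
apply: measurable_fun_lte => //; exact: measurableT_comp.
Qed.

Lemma measurable_subx d (T : measurableType d) (f g : T -> \bar R) :
  measurable_fun setT f -> measurable_fun setT g -> (forall t, g t <= f t) ->
  measurable_fun setT (fun t => subx (f t) (g t)).
Proof.
move=> mf mg gf.
have -> : (fun t => subx (f t) (g t)) =
   (fun t => if (`|f t| < +oo) && (`|g t| < +oo) then f t - g t else +oo).
  by apply/funext => t; rewrite subxE// !fin_num_abs.
apply: measurable_fun_ifT => //; last exact: emeasurable_funB.
by apply: measurable_and; apply: measurable_fun_lte => //; exact: measurableT_comp.
Qed.

End ExtendedArithmetic.

Section ReferenceMeasure.
Variables (R : realType) (S : fmmst R).
Local Notation m := (refm S).
Local Notation dist := (@bdist R S).
Implicit Types f g : S -> \bar R.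

#[global] Instance refm_ae_filter : Filter (nbhs (almost_everywhere m)).
Proof. exact: ae_filter_ringOfSetsType. Qed.

(** Local finiteness: every point lies in a ball of the countable base that is small enough to have
    finite measure; the other balls are replaced by the empty set. *)
Lemma refm_open_cover : exists F : nat -> set S,
  [/\ forall n, open (F n), forall n, m (F n) < +oo & \bigcup_n F n = setT].
Proof.
have [pt Hpt] := dense_sequence S; have [lf _] := refm_radon S.
pose B (ij : nat * nat) : set S := [set y | (dist (pt ij.1) y < ij.2.+1%:R^-1)%R].
pose F n := let ij := odflt (0%N, 0%N) (unpickle n : option (nat * nat)) in
  if m (B ij) < +oo then B ij else set0.
have oB ij : open (B ij) by exact: open_ball_bdist.
exists F; split.
- by move=> n; rewrite /F; case: ifP => // _; exact: open0.
- by move=> n; rewrite /F; case: ifP => // _; rewrite measure0.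
apply/seteqP; split => // x _.
have [U [oU Ux mU]] := lf x.
have [e e0 eU] := (open_bdist U).1 oU x Ux.
have e20 : (0 < e / 2)%R by rewrite divr_gt0.
have [j _ /(_ j (leqnn j))/= je] : \forall n \near \oo, (n.+1%:R^-1 < e / 2 :> R)%R.
  exact: near_infty_natSinv_lt (PosNum e20).
have [i xi] := Hpt x (j.+1%:R^-1)%R ltac:(by rewrite invr_gt0 ltr0n).
have BU : B (i, j) `<=` U.
  move=> y; rewrite /B/= => yi; apply: eU => /=; have := bdist_triangle x (pt i) y.
  by move: xi yi je; move: (j.+1%:R^-1 : R)%R => u; lra.
exists (pickle (i, j)) => //; rewrite /F pickleK/= ifT; first by rewrite /B/= bdistC.
by rewrite (le_lt_trans _ mU)// le_measure ?inE//; exact: borel_open.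
Qed.

Lemma sigma_finite_refm : sigma_finite setT m.
Proof.
have [F [oF mF FT]] := refm_open_cover.
by exists F => // n; split; [exact: borel_open|exact: mF].
Qed.

Lemma refm_version f : refm_measurable f ->
  exists2 f' : S -> \bar R, measurable_fun (setT : set (borel S)) f' & {ae m, forall x, f' x = f x}.
Proof.
move=> mf.
have H (q : rat) : exists A : set (borel S), measurable A /\
    {ae m, forall x, A x <-> (ratr q)%:E < f x}.
  have [A mA [N [mN N0 AN]]] := mf `](ratr q)%:E, +oo]%classic (emeasurable_itv _).
  exists A; split => //; exists N; split => // x /= nA; apply: AN.
  have [Ax|Ax] := pselect (A x).
    by left; split => //= qf; apply: nA; split => // _; move: qf; rewrite in_itv/= leey andbT.
  right; split => //=; rewrite in_itv/= leey andbT; apply: contrapT => nq; apply: nA; split=> //.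
have [H' HH'] := choice H.
by apply: (@measurable_version _ (borel S) R m f H') => q; have [] := HH' q.
Qed.

Lemma version_refm f f' : measurable_fun (setT : set (borel S)) f' -> {ae m, forall x, f' x = f x} ->
  refm_measurable f.
Proof.
move=> mf' [N [mN N0 fN]] B mB; exists (f' @^-1` B).
  by rewrite -[X in measurable X]setTI; exact: mf'.
exists N; split => // x /= [[f'B fB]|[fB f'B]]; apply: fN => /= E; [apply: fB|apply: f'B];
  by rewrite /preimage/= ?E// -E.
Qed.

Lemma refm_measurable_fadd f g : refm_measurable f -> refm_measurable g ->
  refm_measurable (fadd f g).
Proof.
move=> /refm_version[f' mf' ff'] /refm_version[g' mg' gg'].
apply: (@version_refm _ (fadd f' g')); first exact: measurable_addx.
by apply: filterS2 ff' gg' => x; rewrite /fadd => -> ->.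
Qed.

Lemma refm_measurable_fscale (a : R) f : refm_measurable f -> refm_measurable (fscale a f).
Proof.
move=> /refm_version[f' mf' ff'].
apply: (@version_refm _ (fscale a f')); first exact: emeasurable_funM.
by apply: filterS ff' => x; rewrite /fscale => ->.
Qed.

Lemma causal_fadd f g : causal_fun f -> causal_fun g -> causal_fun (fadd f g).
Proof.
move=> [mf cf] [mg cg]; split; first exact: refm_measurable_fadd.
by move=> x y xy; apply: addx_le; [exact: cf|exact: cg].
Qed.

Lemma causal_fscale (a : R) f : (0 <= a)%R -> causal_fun f -> causal_fun (fscale a f).
Proof.
move=> a0 [mf cf]; split; first exact: refm_measurable_fscale.
by move=> x y xy; apply: lee_wpmul2l; [rewrite lee_fin|exact: cf].
Qed.

End ReferenceMeasure.

Section TestPlans.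
Variables (R : realType) (S : fmmst R).
Local Notation m := (refm S).
Local Notation leb := (@lebesgue_measure R).
Implicit Types (f g : S -> \bar R) (pi : probability (curves S) R).

#[global] Instance curves_ae_filter pi : Filter (nbhs (almost_everywhere pi)).
Proof. exact: ae_filter_ringOfSetsType. Qed.

Lemma test_plan_restr pi (s k T : R) (s0 : (0 <= s)%R) (k0 : (0 < k)%R) :
  (s + k <= T)%R -> (s + k <= 1)%R -> compression_le pi T -> measurable_speed pi T ->
  test_plan (restr_law s k pi).
Proof.
move=> skT sk1 [C C0 HC] ms; split; last exact: (measurable_speed_restr s0 k0 sk1 skT ms).
exists C => // t t0 t1 A mA; rewrite /pushforward restr_lawE.
have -> : restr s k @^-1` (ev t @^-1` A) = ev (s + k * clip01 t)%R @^-1` A.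
  by apply/funext => c; rewrite /preimage /ev; congr (A _); rewrite restrE// ltW.
apply: HC => //; first by rewrite addr_ge0// mulr_ge0 ?clip01_ge0// ltW.
by rewrite (le_trans _ skT)// lerD2l ger_pMr// clip01_le1.
Qed.

Lemma compression_ae pi (T t : R) (Q : S -> Prop) : compression_le pi T ->
  (0 <= t)%R -> (t <= T)%R -> {ae m, forall x, Q x} -> {ae pi, forall c, Q (ev t c)}.
Proof.
move=> [C C0 HC] t0 tT [N [mN N0 QN]]; exists (ev t @^-1` N); split.
- by rewrite -[X in measurable X]setTI; exact: measurable_ev.
- by apply/eqP; rewrite eq_le measure_ge0 andbT (le_trans (HC _ t0 tT _ mN))// N0 mule0.
- by move=> c /= nQ; exact: QN.
Qed.

(** Conditioning multiplies the compression constant by the inverse of [pi B] and preserves null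
    sets. It turns an inequality between integrals over all test plans into one between integrals
    over every measurable set of curves. *)
Lemma test_plan_cond pi (B : set (curves S)) : measurable B -> 0 < pi B -> test_plan pi ->
  exists pi' : probability (curves S) R, [/\ test_plan pi',
    forall Q : curves S -> Prop, {ae pi, forall c, Q c} -> {ae pi', forall c, Q c} &
    forall h : curves S -> \bar R, measurable_fun setT h -> (forall c, 0 <= h c) ->
      \int[pi']_c h c = ((fine (pi B))^-1)%:E * \int[pi]_(c in B) h c].
Proof.
move=> mB B0 [[C C0 HC] [w mw hw]].
have Bf : pi B \is a fin_num by exact: fin_num_measure.
have b0 : (0 < fine (pi B))%R by rewrite fine_gt0// B0 ltey_eq Bf.
pose pi' := mnormalize (mrestr pi mB) pi.
have piE A : measurable A -> pi' A = ((fine (pi B))^-1)%:E * pi (A `&` B).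
  move=> mA; rewrite /pi' /mnormalize/= /mrestr setTI ifF; first by rewrite muleC.
  by apply/negbTE; rewrite negb_or gt_eqF//= ; move: Bf; rewrite fin_numE => /andP[].
have ae_pi' Q : {ae pi, forall c, Q c} -> {ae pi', forall c, Q c}.
  move=> [N [mN N0 HN]]; exists N; split => //.
  rewrite [LHS]piE// [X in _ * X](_ : _ = 0) ?mule0//.
  by apply: (subset_measure0 _ mN _ N0) => //; exact: measurableI.
exists pi'; split => //.
- split.
    exists ((fine (pi B))^-1 * C)%R; first by rewrite mulr_gt0// invr_gt0.
    move=> t t0 t1 A mA; rewrite /pushforward [leLHS]piE; last first.
      by rewrite -[X in measurable X]setTI; exact: measurable_ev.
    rewrite EFinM -muleA lee_wpmul2l//; first by rewrite lee_fin invr_ge0 ltW.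
    apply: le_trans (HC t t0 t1 A mA); apply: le_measure; rewrite ?inE//.
      by apply: measurableI => //; rewrite -[X in measurable X]setTI; exact: measurable_ev.
    by rewrite -[X in measurable X]setTI; exact: measurable_ev.
  by exists w => //; exact: ae_pi'.
- move=> h mh h0.
  have bi0 : (0 <= (fine (pi B))^-1)%R by rewrite invr_ge0 ltW.
  pose nu := mscale (NngNum bi0) (mrestr pi mB).
  rewrite (eq_measure_integral nu); last first.
    by move=> A mA _; exact: piE.
  rewrite ge0_integral_mscale//=; congr (_ * _).
  exact: integral_mrestr.
Qed.

End TestPlans.
Lemma maxe_nneMl (R : realType) (x y z : \bar R) : 0 <= z -> maxe x y * z = maxe (x * z) (y * z).
Proof.
move=> z0; have [xy|/ltW yx] := leP x y.
  by rewrite max_r// lee_wpmul2r.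
by rewrite max_l// lee_wpmul2r.
Qed.

(** The limit 0 is treated apart, because [0 * +oo = 0] makes multiplication by [+oo] discontinuous
    at 0. *)
Lemma limn_nneMr (R : realType) (u : nat -> \bar R) (z : \bar R) : (forall n, 0 <= u n) -> 0 <= z ->
  nondecreasing_seq u -> limn u * z = limn (fun n => u n * z).
Proof.
move=> u0 z0 ndu; have cu := ereal_nondecreasing_is_cvgn ndu.
have [l0|l0] := eqVneq (limn u) 0.
  have uz n : u n = 0.
    apply/eqP; rewrite eq_le u0 andbT -l0 (cvg_lim _ (ereal_nondecreasing_cvgn ndu))//.
    by apply: ereal_sup_ubound; exists n.
  rewrite l0 mul0e; apply/esym/cvg_lim => //; under eq_fun do rewrite uz mul0e; exact: cvg_cst.
have lpos : 0 < limn u by rewrite lt_neqAle eq_sym l0/=; apply: lime_ge => //; exact: nearW.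
have [fz|] := boolP (z \is a fin_num); first by rewrite limeMr.
rewrite ge0_fin_numE// -leNgt leye_eq => /eqP ->.
apply/esym/cvg_lim => //; apply: cvgeM => //; last exact: cvg_cst.
by rewrite mule_def_neq0_infty ?gt_eqF.
Qed.

Section PathwiseSubslope.
Variables (R : realType) (S : fmmst R).
Local Notation m := (refm S).
Local Notation leb := (@lebesgue_measure R).
Implicit Types (f g : S -> \bar R) (pi : probability (curves S) R).

Lemma curve_causal_fun f (c : LCC S) (s t : R) : causal_fun f -> (s <= t)%R -> f (c s) <= f (c t).
Proof. by move=> [_ cf] st; apply: cf; exact: curve_causal. Qed.

Lemma measurable_slope_integrand (G : S -> \bar R) (c : LCC S) : measurable_fun (setT : set (borel S)) G ->
  measurable_fun [set: R] (fun t => G (c t) * causal_speed c t).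
Proof.
move=> mG; apply: emeasurable_funM; last exact: measurable_speedf.
exact: (measurableT_comp mG (measurable_curve c)).
Qed.

Lemma slope_integrand_ge0 (G : S -> \bar R) (c : LCC S) t : (forall x, 0 <= G x) ->
  0 <= G (c t) * causal_speed c t.
Proof. by move=> G0; rewrite mule_ge0// causal_speed_ge0. Qed.

Lemma measurable_slope_integral pi (G : S -> \bar R) : measurable_fun (setT : set (borel S)) G ->
  (forall x, 0 <= G x) -> measurable_speed pi 1 ->
  exists J : curves S -> \bar R, [/\ measurable_fun setT J, forall c, 0 <= J c &
    {ae pi, forall c, J c = \int[leb]_(t in `[0%R, 1%R]) (G (ev t c) * causal_speed c t)}].
Proof.
move=> mG G0 [w mw hw].
have mw' : measurable_fun [set: curves S * measurableTypeR R] w by exact: mw.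
pose F (cr : curves S * measurableTypeR R) :=
  G (ev cr.2 cr.1) * maxe 0 (w cr) * (\1_(`[0%R, 1%R]%classic : set R) cr.2)%:E.
have F0 cr : 0 <= F cr.
  by rewrite mule_ge0 ?lee_fin// mule_ge0// le_max lexx.
have mF : measurable_fun setT F.
  apply: emeasurable_funM; last first.
    apply/measurable_EFinP.
    have mI : measurable_fun [set: measurableTypeR R] (\1_(`[0%R, 1%R]%classic : set R) : _ -> R).
      by apply: measurable_indic; exact: measurable_itv.
    exact: (measurableT_comp mI measurable_snd).
  apply: emeasurable_funM; last by apply: measurable_maxe => //; exact: measurable_cst.
  have mj := @measurable_joint_eval R S _ (curves S) id (fun q _ => measurable_ev (ratr q)).
  exact: (measurableT_comp mG mj).
exists (fubini_F (lebesgue_measure : measure (measurableTypeR R) R) F); split.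
- exact: measurable_fun_fubini_tonelli_F.
- by move=> c; apply: integral_ge0.
apply: filterS hw => c hw; rewrite /fubini_F [RHS]integral_mkcond.
apply: (@ae_eq_integral_nm _ (measurableTypeR R) R lebesgue_measure) => //.
apply: filterS hw => t wt _; rewrite epatch_indic /F/= indicE.
have [t01|t01] := boolP (t \in _); last by rewrite !mule0.
move: t01; rewrite inE/= in_itv/= => /andP[t0 t1].
by rewrite wt// !mule1 max_r// causal_speed_ge0.
Qed.

(** The defining inequality holds for [pi] conditioned on any set [A] of positive mass, so the two
    integrands compare on every [A], hence almost everywhere. *)
Lemma weak_subslope_path f (G : S -> \bar R) pi : causal_fun f -> weak_subslope f G ->
  test_plan pi -> {ae pi, forall c,
    \int[leb]_(t in `[0%R, 1%R]) (G (ev t c) * causal_speed c t) <= subx (f (ev 1 c)) (f (ev 0 c))}.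
Proof.
move=> cf [mG G0 HG] tp.
have [J [mJ J0 HJ]] := measurable_slope_integral mG G0 (proj2 tp).
have [f' mf' ff'] := refm_version (proj1 cf).
(* A measurable version of the increment. The maximum makes it nonnegative for every curve, although
   the Borel version [f'] need not be monotone along all of them. *)
pose h (c : curves S) := subx (maxe (f' (ev 1 c)) (f' (ev 0 c))) (f' (ev 0 c)).
have mfe t : measurable_fun setT (fun c : curves S => f' (ev t c)).
  exact: (measurableT_comp mf' (measurable_ev t)).
have h0 c : 0 <= h c by apply: subx_ge0; rewrite le_max lexx orbT.
have mh : measurable_fun setT h.
  by apply: measurable_subx => //; [exact: measurable_maxe|move=> c; rewrite le_max lexx orbT].
have hE (pi' : probability (curves S) R) : test_plan pi' ->
    {ae pi', forall c, h c = subx (f (ev 1 c)) (f (ev 0 c))}.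
  move=> [cp _]; have e1 := compression_ae cp ler01 (lexx 1%R) ff'.
  have e0 := compression_ae cp (lexx 0%R) ler01 ff'.
  apply: filterS2 e1 e0 => c E1 E0; rewrite /h E1 E0 max_l//.
  exact: curve_causal_fun.
have Jh : {ae pi, forall c, setT c -> J c <= h c}.
  apply: ae_le_of_integral => //; first exact: (fin_num_fun_lty (@fin_num_measure _ _ _ pi)).
  move=> A mA _; have [A0|A0] := eqVneq (pi A) 0.
    rewrite null_set_integral//; last exact: measurable_funTS.
    by rewrite null_set_integral//; exact: measurable_funTS.
  have {}A0 : 0 < pi A by rewrite lt_neqAle eq_sym A0 measure_ge0.
  have [pi' [tp' aepi' E]] := test_plan_cond mA A0 tp.
  have Af : pi A \is a fin_num by exact: fin_num_measure.
  have a0 : (0 < (fine (pi A))^-1)%R by rewrite invr_gt0 fine_gt0// A0 ltey_eq Af.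
  rewrite -(@lee_pmul2l _ ((fine (pi A))^-1)%:E)// -!E//.
  rewrite (@ae_eq_integral_nm _ _ _ pi' setT J _ measurableT (filterS (fun c H _ => H) (aepi' _ HJ))).
  rewrite (@ae_eq_integral_nm _ _ _ pi' setT h _ measurableT (filterS (fun c H _ => H) (hE _ tp'))).
  exact: HG.
by apply: filterS3 Jh HJ (hE _ tp) => c /(_ I) + E1 E2; rewrite E1 E2.
Qed.

End PathwiseSubslope.

Section Subslope.
Variables (R : realType) (S : fmmst R).
Local Notation m := (refm S).
Local Notation leb := (@lebesgue_measure R).
Implicit Types (f g : S -> \bar R) (pi : probability (curves S) R).

Lemma ae_integral_itv_oo (f : R -> \bar R) (a b : R) : measurable_fun [set: R] f ->
  (forall t, 0 <= f t) -> \int[leb]_(t in `[a, b]) f t = \int[leb]_(t in `]a, b[) f t.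
Proof.
move=> mf f0.
rewrite [LHS]integral_mkcond [RHS]integral_mkcond.
apply: (@ae_eq_integral_nm _ (measurableTypeR R) R lebesgue_measure) => //.
exists ([set a] `|` [set b]); split.
- exact: measurableU.
- by apply: countable_lebesgue_measure0; exact: finite_set_countable.
- move=> t /= nt; apply: contrapT => /not_orP[ta tb]; apply: nt => _.
  rewrite !patchE; congr (if _ then _ else _); apply/idP/idP; rewrite !inE/= !in_itv/=.
    by rewrite !lt_neqAle => /andP[-> ->]; rewrite !andbT eq_sym; apply/andP; split; apply/eqP.
  by move=> /andP[/ltW -> /ltW ->].
Qed.

(** The inequality on the unit interval is applied to the law of the restricted curves and
    transported back by the change of variable. Since [b <= T], compression on [[0, T]] is enough,
    which is what an initial test plan offers. *)
Lemma weak_subslope_sub f (G : S -> \bar R) pi (a b T : R) : causal_fun f -> weak_subslope f G ->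
  compression_le pi T -> measurable_speed pi T -> (0 <= a)%R -> (a < b)%R -> (b <= T)%R -> (b <= 1)%R ->
  {ae pi, forall c, \int[leb]_(t in `]a, b[) (G (ev t c) * causal_speed c t)
    <= subx (f (ev b c)) (f (ev a c))}.
Proof.
move=> cf wG cp ms a0 ab bT b1; have [mG G0 HG] := wG.
have k0 : (0 < b - a)%R by rewrite subr_gt0.
have abT : (a + (b - a) <= T)%R by rewrite addrC subrK.
have ab1 : (a + (b - a) <= 1)%R by rewrite addrC subrK.
have tp := test_plan_restr a0 k0 abT ab1 cp ms.
have := ae_restr_law (weak_subslope_path cf wG tp).
apply: filterS => c; rewrite /ev !restrE ?(ltW k0)//.
rewrite !clip01_id// mulr0 addr0 mulr1 (_ : a + (b - a) = b)%R; last by lra.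
apply: le_trans.
pose F y := G (c y) * causal_speed c y.
have mF : measurable_fun [set: R] F by exact: measurable_slope_integrand.
have F0 t : 0 <= F t by exact: slope_integrand_ge0.
have maff : measurable_fun [set: R] (fun x => F (a + (b - a) * x)%R).
  by apply: (measurableT_comp mF); exact: measurable_affine.
rewrite -(ge0_integral_affine a k0 _ mF F0)// preimage_affine_itv// subrr mul0r divff ?gt_eqF//.
rewrite ae_integral_itv_oo; last 2 first.
- exact: measurable_slope_integrand.
- by move=> t; exact: slope_integrand_ge0.
rewrite -ge0_integralZl//; last 2 first.
- exact: (@measurable_funTS _ _ _ _ _ _ maff).
- by rewrite lee_fin ltW.
apply: (@ae_le_integral_nm _ (measurableTypeR R) R lebesgue_measure) => //.
- by move=> t _; rewrite mule_ge0 ?lee_fin ?(ltW k0).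
- by move=> t _; exact: slope_integrand_ge0.
have := causal_speed_restr c a0 k0 ab1.
apply: filterS => t Et t01.
have t01' : `[0%R, 1%R]%classic t by move: t01 => /=; rewrite !in_itv/= => /andP[/ltW -> /ltW ->].
have /andP[t0 t1] : (0 <= t <= 1)%R by move: t01'; rewrite /= in_itv.
have -> : restr a (b - a) c t = c (a + (b - a) * t)%R by rewrite restrE ?(ltW k0)// clip01_id.
by rewrite Et// /F muleCA.
Qed.

Lemma subx_superadditive01 f (c : LCC S) : causal_fun f ->
  superadditive01 (fun a b => subx (f (c b)) (f (c a))).
Proof.
move=> cf; split=> [a b _ ab _|a b d _ ab bd _].
  by apply: subx_ge0; exact: curve_causal_fun.
by apply: subx_superadditive; exact: curve_causal_fun.
Qed.

(** A single null set serves all rational subintervals. A real interval is exhausted from inside by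
    rational ones: the left side converges by monotone convergence, and the increment of [f], which
    need not be continuous, grows with the interval. *)
Lemma weak_subslope_all f (G : S -> \bar R) pi : causal_fun f -> weak_subslope f G ->
  test_plan pi -> {ae pi, forall c, forall a b : R, (0 <= a)%R -> (a < b)%R -> (b <= 1)%R ->
    \int[leb]_(t in `]a, b[) (G (ev t c) * causal_speed c t) <= subx (f (ev b c)) (f (ev a c))}.
Proof.
move=> cf wG [cp ms]; have [mG G0 HG] := wG.
pose un n : rat * rat := odflt (0%R, 0%R) (unpickle n).
have H n : {ae pi, forall c, (0 <= (un n).1)%R -> ((un n).1 < (un n).2)%R -> ((un n).2 <= 1)%R ->
   \int[leb]_(t in `]ratr (un n).1, ratr (un n).2[) (G (ev t c) * causal_speed c t)
    <= subx (f (ev (ratr (un n).2) c)) (f (ev (ratr (un n).1) c))}.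
  case: (un n) => p q /=.
  have [p0|p0] := boolP (0 <= p)%R; last by apply: aeW.
  have [pq|pq] := boolP (p < q)%R; last by apply: aeW.
  have [q1|q1] := boolP (q <= 1)%R; last by apply: aeW.
  have q1' : (ratr q <= 1 :> R)%R by rewrite -(rmorph1 (@ratr R)) ler_rat.
  have := @weak_subslope_sub f G pi (ratr p) (ratr q) 1 cf wG cp ms.
  by rewrite ler0q ltr_rat => /(_ p0 pq q1' q1'); apply: filterS.
apply: filterS (ae_foralln H) => c {}H a b a0 ab b1.
have [v [mv vE]] : exists v : R -> \bar R, measurable_fun [set: R] v /\
    (forall t, v t = G (ev t c) * causal_speed c t).
  by exists (fun t => G (ev t c) * causal_speed c t); split => //; exact: measurable_slope_integrand.
have v0 t : 0 <= v t by rewrite vE; exact: slope_integrand_ge0.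
have [al Hal] : exists al : nat -> rat, forall n, (a < ratr (al n) < a + (b - a) / 2 * n.+1%:R^-1)%R.
  have Hn n : exists q : rat, (a < ratr q < a + (b - a) / 2 * n.+1%:R^-1)%R.
    by apply: rat_between; rewrite ltrDl mulr_gt0 ?invr_gt0// divr_gt0// subr_gt0.
  by have [al ?] := choice Hn; exists al.
have [be Hbe] : exists be : nat -> rat, forall n, (b - (b - a) / 2 * n.+1%:R^-1 < ratr (be n) < b)%R.
  have Hn n : exists q : rat, (b - (b - a) / 2 * n.+1%:R^-1 < ratr q < b)%R.
    by apply: rat_between; rewrite ltrBlDr ltrDl mulr_gt0 ?invr_gt0// divr_gt0// subr_gt0.
  by have [be ?] := choice Hn; exists be.
(* Margins of half the length over [n + 1]: [J n] lies between the rational endpoints [al n] and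
   [be n], and these remain in the right order. *)
pose h n : R := ((b - a) / 2 * n.+1%:R^-1)%R.
pose J n : set R := `](a + h n)%R, (b - h n)%R[%classic.
have h0 n : (0 < h n)%R by rewrite mulr_gt0 ?invr_gt0// divr_gt0// subr_gt0.
have hle n k : (n <= k)%N -> (h k <= h n)%R.
  move=> nk; rewrite ler_pM2l ?divr_gt0 ?subr_gt0//.
  by rewrite lef_pV2 ?posrE ?ltr0n// ler_nat.
have hmid n : (h n <= (b - a) / 2)%R.
  by have := hle 0%N n (leq0n n); rewrite {2}/h invr1 mulr1.
have JE : \bigcup_n J n = `]a, b[%classic.
  apply/seteqP; split => [t [n _]|t]; rewrite /J/= !in_itv/=.
    by have := h0 n => ? /andP[? ?]; apply/andP; split; lra.
  move=> /andP[at_ tb].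
  have d0 : (0 < Num.min (t - a) (b - t) / (b - a))%R.
    by rewrite divr_gt0 ?subr_gt0// lt_min !subr_gt0 at_.
  have [n _ /(_ n (leqnn n))/= Hn] : \forall n \near \oo, (n.+1%:R^-1 < Num.min (t - a) (b - t) / (b - a) :> R)%R.
    exact: near_infty_natSinv_lt (PosNum d0).
  exists n => //; rewrite /J/= in_itv/=.
  have ba0 : (0 < b - a)%R by rewrite subr_gt0.
  have hn : (h n < Num.min (t - a) (b - t))%R.
    move: Hn; rewrite ltr_pdivlMr// mulrC => Hn; apply: le_lt_trans Hn.
    rewrite /h ler_pM2r ?invr_gt0 ?ltr0n//; lra.
  by move: hn; rewrite lt_min => /andP[? ?]; apply/andP; split; lra.
have mv' : measurable_fun [set: measurableTypeR R] v := mv.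
have := @ge0_nondecreasing_set_cvg_integral _ (measurableTypeR R) R J v lebesgue_measure.
rewrite JE => cvgJ.
under eq_integral do rewrite -vE.
have {}cvgJ := cvgJ _ (fun n => measurable_itv _) (fun n => @measurable_funTS _ _ _ _ _ _ mv') (fun n x _ => v0 x).
have /cvgJ{}cvgJ : nondecreasing_seq J.
  move=> n k nk; apply/subsetPset => t; rewrite /J/= !in_itv/=.
  by have := hle _ _ nk => ? /andP[? ?]; apply/andP; split; lra.
rewrite -(cvg_lim _ cvgJ)//; apply: lime_le; first by apply/cvg_ex; eexists; exact: cvgJ.
apply: nearW => n; have /andP[al1 al2] := Hal n; have /andP[be1 be2] := Hbe n.
have ab' : (ratr (al n) < ratr (be n) :> R)%R.
  by have := hmid n; move: al2 be1; rewrite -/(h n); lra.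
apply: (@le_trans _ _ (\int[leb]_(t in `]ratr (al n), ratr (be n)[) v t)).
  apply: (@ge0_subset_integral _ (measurableTypeR R) R lebesgue_measure) => //.
  - exact: measurable_itv.
  - exact: (@measurable_funTS _ _ _ _ _ _ mv').
  - move: al2 be1; rewrite -/(h n) => ? ?.
    by move=> t; rewrite /J/= !in_itv/= => /andP[? ?]; apply/andP; split; lra.
under eq_integral do rewrite vE.
have := H (pickle (al n, be n)); rewrite /un pickleK/=.
rewrite -(ltr_rat R) -(ler0q R) -(ler_rat R (be n)) rmorph1 => /(_ ltac:(lra) ab' ltac:(lra)).
move=> /le_trans; apply; apply: subx_mono; apply: curve_causal_fun => //; exact: ltW.
Qed.

(** Almost every curve satisfies both inequalities on all its subintervals, and the increments of
    [f] are superadditive in the interval; the largest measure below them then dominates the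
    maximum. *)
Lemma weak_subslope_max f (G1 G2 : S -> \bar R) : causal_fun f -> weak_subslope f G1 ->
  weak_subslope f G2 -> weak_subslope f (fun x => maxe (G1 x) (G2 x)).
Proof.
move=> cf w1 w2; have [m1 g1 _] := w1; have [m2 g2 _] := w2; split.
- exact: measurable_maxe.
- by move=> x; rewrite le_max g1.
move=> pi tp; apply: ae_le_integral_nm => //.
- by move=> c _; apply: integral_ge0 => t _; rewrite mule_ge0 ?causal_speed_ge0// le_max g1.
- by move=> c _; apply: subx_ge0; exact: curve_causal_fun.
apply: filterS2 (weak_subslope_all cf w1 tp) (weak_subslope_all cf w2 tp) => c H1 H2 _.
rewrite ae_integral_itv_oo; last 2 first.
- by apply: (@measurable_slope_integrand R S (fun x => maxe (G1 x) (G2 x)) c); exact: measurable_maxe.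
- by move=> t; rewrite mule_ge0 ?causal_speed_ge0// le_max g1.
under eq_integral do rewrite maxe_nneMl ?causal_speed_ge0//.
apply: (integral_max_below (subx_superadditive01 c cf)) => //.
- exact: measurable_slope_integrand.
- exact: measurable_slope_integrand.
- by move=> t; exact: slope_integrand_ge0.
- by move=> t; exact: slope_integrand_ge0.
Qed.



Lemma weak_subslope_lim f (G : nat -> S -> \bar R) : causal_fun f -> (forall n, weak_subslope f (G n)) ->
  (forall x, nondecreasing_seq (G^~ x)) -> weak_subslope f (fun x => limn (G^~ x)).
Proof.
move=> cf wG ndG; have mG n : measurable_fun (setT : set (borel S)) (G n) by have [] := wG n.
have G0 n x : 0 <= G n x by have [] := wG n.
have cG x : cvgn (G^~ x) by exact: ereal_nondecreasing_is_cvgn.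
have L0 x : 0 <= limn (G^~ x) by apply: lime_ge => //; exact: nearW.
split => //.
  by apply: (@emeasurable_fun_cvg _ (borel S) R setT G) => // x _; exact: cG.
move=> pi tp; apply: ae_le_integral_nm => //.
- by move=> c _; apply: integral_ge0 => t _; rewrite mule_ge0 ?causal_speed_ge0.
- by move=> c _; apply: subx_ge0; exact: curve_causal_fun.
apply: filterS (ae_foralln (fun n => weak_subslope_path cf (wG n) tp)) => c H _.
pose F n t := G n (ev t c) * causal_speed c t.
have mF n : measurable_fun [set: R] (F n) by exact: measurable_slope_integrand.
have F0 n t : 0 <= F n t by exact: slope_integrand_ge0.
have mF' n : measurable_fun [set: measurableTypeR R] (F n) := mF n.
have ndF t : nondecreasing_seq (F^~ t).
  by move=> n k nk; apply: lee_wpmul2r; [exact: causal_speed_ge0|exact: ndG].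
have -> : \int[leb]_(t in `[0%R, 1%R]) (limn (G^~ (ev t c)) * causal_speed c t) =
    \int[leb]_(t in `[0%R, 1%R]) limn (F^~ t).
  by apply: eq_integral => t _; rewrite /F limn_nneMr// causal_speed_ge0.
rewrite monotone_convergence//; last by move=> n; exact: (@measurable_funTS _ _ _ _ _ _ (mF' n)).
apply: lime_le; last by apply: nearW => n; exact: H.
apply: ereal_nondecreasing_is_cvgn => n k nk; apply: ge0_le_integral => //.
- exact: (@measurable_funTS _ _ _ _ _ _ (mF' n)).
- exact: (@measurable_funTS _ _ _ _ _ _ (mF' k)).
- by move=> t _; exact: ndF.
Qed.

Lemma subslopeP f : causal_fun f -> largest_weak_subslope f (subslope f).
Proof.
move=> cf; apply: xgetPex.
have [||||G wG HG] := @largest_ae _ (borel S) R m (weak_subslope f) (sigma_finite_refm S).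
- exists (cst 0); split => // pi tp.
  rewrite (_ : \int[pi]_c _ = 0); first by apply: integral_ge0 => c _; apply: subx_ge0; exact: curve_causal_fun.
  rewrite -[RHS](integral0 pi setT); apply: eq_integral => c _.
  rewrite -[RHS](integral0 leb `[0%R, 1%R]%classic); apply: eq_integral => t _.
  by rewrite mul0e.
- by move=> G [].
- by move=> G H; exact: weak_subslope_max.
- by move=> G; exact: weak_subslope_lim.
by exists G; split.
Qed.

End Subslope.
Section SubslopeCalculus.
Variables (R : realType) (S : fmmst R).
Local Notation m := (refm S).
Local Notation leb := (@lebesgue_measure R).
Implicit Types (f g : S -> \bar R) (pi : probability (curves S) R).

Lemma subslope_ge0 f x : causal_fun f -> 0 <= subslope f x.
Proof. by move=> /subslopeP[[]]. Qed.

Lemma measurable_subslope f : causal_fun f -> measurable_fun (setT : set (borel S)) (subslope f).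
Proof. by move=> /subslopeP[[]]. Qed.

(** Along a causal curve [subx] is [+oo] as soon as one end value is infinite, of either sign. Where
    both functions are infinite they need not agree, and compression carries the almost everywhere
    agreement to both ends of the curve. *)
Lemma weak_subslope_le f1 f2 (G : S -> \bar R) : causal_fun f1 -> causal_fun f2 ->
  {ae m, forall x, f1 x \is a fin_num \/ f2 x \is a fin_num -> f1 x = f2 x} ->
  weak_subslope f1 G -> weak_subslope f2 G.
Proof.
move=> c1 c2 f12 [mG G0 HG]; split => // pi tp; apply: le_trans (HG pi tp) _.
have [cp _] := tp.
rewrite (@ae_eq_integral_nm _ _ _ pi setT _ (fun c => subx (f2 (ev 1 c)) (f2 (ev 0 c))))//.
have e1 := compression_ae cp ler01 (lexx 1%R) f12.
have e0 := compression_ae cp (lexx 0%R) ler01 f12.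
apply: filterS2 e1 e0 => c E1 E0 _.
rewrite !subxE; try exact: curve_causal_fun.
have [/andP[a b]|n1] := boolP ((f1 (ev 1 c) \is a fin_num) && (f1 (ev 0 c) \is a fin_num)).
  by rewrite -(E1 (or_introl a)) -(E0 (or_introl b)) a b.
case: ifPn => // /andP[a b]; move: n1.
by rewrite (E1 (or_intror a)) (E0 (or_intror b)) a b.
Qed.

Lemma subslope_eq f1 f2 : causal_fun f1 -> causal_fun f2 ->
  {ae m, forall x, f1 x \is a fin_num \/ f2 x \is a fin_num -> f1 x = f2 x} ->
  subslope f1 = subslope f2.
Proof.
move=> c1 c2 f12.
have f21 : {ae m, forall x, f2 x \is a fin_num \/ f1 x \is a fin_num -> f2 x = f1 x}.
  by apply: filterS f12 => x H Hx; rewrite H//; case: Hx; [right|left].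
have W : weak_subslope f1 = weak_subslope f2.
  apply/funext => G; apply/propext; split; exact: weak_subslope_le.
by rewrite /subslope /largest_weak_subslope W.
Qed.

Lemma weak_subslope_scale f (G : S -> \bar R) (a : R) : (0 < a)%R -> causal_fun f ->
  weak_subslope f G -> weak_subslope (fscale a f) (fun x => a%:E * G x).
Proof.
move=> a0 cf wG; have [mG G0 HG] := wG; have a0' : 0 <= a%:E by rewrite lee_fin ltW.
have caf : causal_fun (fscale a f) by apply: causal_fscale => //; exact: ltW.
split.
- exact: emeasurable_funM.
- by move=> x; rewrite mule_ge0.
move=> pi tp; apply: ae_le_integral_nm => //.
- by move=> c _; apply: integral_ge0 => t _; rewrite mule_ge0 ?causal_speed_ge0// mule_ge0.
- by move=> c _; apply: subx_ge0; exact: curve_causal_fun.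
apply: filterS (weak_subslope_path cf wG tp) => c Hc _.
rewrite (_ : subx _ _ = a%:E * subx (f (ev 1 c)) (f (ev 0 c))); last first.
  rewrite !subxE; try exact: curve_causal_fun.
  rewrite !fscale_fin ?gt_eqF//; case: ifPn => [/andP[f1 f0]|_].
    by rewrite /fscale muleBr// fin_num_adde_defr.
  by rewrite gt0_muley.
apply: le_trans (lee_wpmul2l a0' Hc).
have mF := @measurable_slope_integrand R S G c mG.
rewrite -ge0_integralZl//.
- by rewrite le_eqVlt; apply/orP; left; apply/eqP; apply: eq_integral => t _; rewrite muleA.
- exact: (@measurable_funTS _ _ _ _ _ _ mF).
- by move=> t _; exact: slope_integrand_ge0.
Qed.

Lemma fscaleK (a b : R) f : (a * b = 1)%R -> fscale a (fscale b f) = f.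
Proof. by move=> ab; apply/funext => x; rewrite /fscale muleA -EFinM ab mul1e. Qed.

Lemma subslope_scale f (a : R) : (0 < a)%R -> causal_fun f ->
  {ae m, forall x, subslope (fscale a f) x = a%:E * subslope f x}.
Proof.
move=> a0 cf; have caf : causal_fun (fscale a f) by apply: causal_fscale => //; exact: ltW.
have ai0 : (0 < a^-1)%R by rewrite invr_gt0.
have aa : (a^-1 * a = 1)%R by rewrite mulVf// gt_eqF.
have [wf Mf] := subslopeP cf; have [waf Maf] := subslopeP caf.
have h1 := Maf _ (weak_subslope_scale a0 cf wf).
have := weak_subslope_scale ai0 caf waf; rewrite fscaleK// => /Mf h2.
apply: filterS2 h1 h2 => x h1 h2; apply/eqP; rewrite eq_le h1 andbT.
by rewrite -lee_pdivrMl.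
Qed.

Lemma subx_addx (x0 x1 y0 y1 : \bar R) : x0 <= x1 -> y0 <= y1 ->
  subx x1 x0 + subx y1 y0 <= subx (addx x1 y1) (addx x0 y0).
Proof.
move=> x01 y01; rewrite !subxE ?addx_le// !addx_fin.
case: x0 x1 y0 y1 x01 y01 => [x0| |] [x1| |] [y0| |] [y1| |]//= _ _; rewrite ?leey//.
by rewrite /addx/= -!EFinB -!EFinD lee_fin; lra.
Qed.

Lemma weak_subslope_add f g (F G : S -> \bar R) : causal_fun f -> causal_fun g ->
  weak_subslope f F -> weak_subslope g G -> weak_subslope (fadd f g) (fun x => F x + G x).
Proof.
move=> cf cg wF wG; have [mF F0 _] := wF; have [mG G0 _] := wG.
have cfg := causal_fadd cf cg; split.
- exact: emeasurable_funD.
- by move=> x; rewrite adde_ge0.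
move=> pi tp; apply: ae_le_integral_nm => //.
- by move=> c _; apply: integral_ge0 => t _; rewrite mule_ge0 ?causal_speed_ge0// adde_ge0.
- by move=> c _; apply: subx_ge0; exact: curve_causal_fun.
apply: filterS2 (weak_subslope_path cf wF tp) (weak_subslope_path cg wG tp) => c Fc Gc _.
apply: (@le_trans _ _ (subx (f (ev 1 c)) (f (ev 0 c)) + subx (g (ev 1 c)) (g (ev 0 c)))); last first.
  by apply: subx_addx; exact: curve_causal_fun.
apply: le_trans (leeD Fc Gc); rewrite -ge0_integralD//.
- by rewrite le_eqVlt; apply/orP; left; apply/eqP; apply: eq_integral => t _; rewrite ge0_muleDl.
- by move=> t _; exact: slope_integrand_ge0.
- exact: (@measurable_funTS _ _ _ _ _ _ (@measurable_slope_integrand R S F c mF)).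
- by move=> t _; exact: slope_integrand_ge0.
- exact: (@measurable_funTS _ _ _ _ _ _ (@measurable_slope_integrand R S G c mG)).
Qed.

Lemma subslope_superadditive f g : causal_fun f -> causal_fun g ->
  {ae m, forall x, subslope f x + subslope g x <= subslope (fadd f g) x}.
Proof.
move=> cf cg; have [wf _] := subslopeP cf; have [wg _] := subslopeP cg.
by have [_] := subslopeP (causal_fadd cf cg); apply; exact: weak_subslope_add.
Qed.

End SubslopeCalculus.

(** * The squared subslope is quadratic along half-lines *)

Section ConeAlgebra.
Variables (R : realType) (S : fmmst R).
Local Notation m := (refm S).
Implicit Types (f g h u v w : S -> \bar R) (a b k : R).

Lemma addxA (x y z : \bar R) : addx x (addx y z) = addx (addx x y) z.
Proof. by rewrite /addx; case: x y z => [x| |] [y| |] [z| |]//=; rewrite addrA. Qed.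

Lemma mul_addx (a : R) (x y : \bar R) : (0 <= a)%R -> a%:E * addx x y = addx (a%:E * x) (a%:E * y).
Proof.
rewrite le_eqVlt => /predU1P[<-|a0]; first by rewrite !mul0e /addx/= adde0.
case: x => [x| |]; last 2 first.
- by rewrite gt0_muley ?lte_fin.
- by rewrite gt0_muleNy ?lte_fin.
case: y => [y| |]; rewrite /addx /= ?gt0_muley ?gt0_muleNy ?lte_fin//.
exact: (congr1 EFin (mulrDr a x y)).
Qed.

Lemma addx_mul (a b : R) (x : \bar R) : (0 <= a)%R -> (0 <= b)%R ->
  (a + b)%:E * x = addx (a%:E * x) (b%:E * x).
Proof.
rewrite le_eqVlt => /predU1P[<-|a0]; first by rewrite add0r mul0e /addx/= add0e.
rewrite le_eqVlt => /predU1P[<-|b0].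
  by rewrite addr0 mul0e /addx adde0; case: ifP.
case: x => [x| |]; first exact: (congr1 EFin (mulrDl a b x)).
  by rewrite !gt0_muley ?lte_fin ?addr_gt0.
by rewrite !gt0_muleNy ?lte_fin ?addr_gt0.
Qed.

Lemma faddA f g h : fadd f (fadd g h) = fadd (fadd f g) h.
Proof. by apply/funext => x; exact: addxA. Qed.

Lemma fscaleDr a f g : (0 <= a)%R -> fscale a (fadd f g) = fadd (fscale a f) (fscale a g).
Proof. by move=> a0; apply/funext => x; exact: mul_addx. Qed.

Lemma fscaleDl a b f : (0 <= a)%R -> (0 <= b)%R ->
  fscale (a + b) f = fadd (fscale a f) (fscale b f).
Proof. by move=> a0 b0; apply/funext => x; exact: addx_mul. Qed.

Lemma fscaleA a b f : fscale a (fscale b f) = fscale (a * b) f.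
Proof. by apply/funext => x; rewrite /fscale muleA EFinM. Qed.

Lemma fscale1 f : fscale 1 f = f.
Proof. by apply/funext => x; rewrite /fscale mul1e. Qed.

Lemma fscale0 f g : fadd f (fscale 0 g) = f.
Proof. by apply/funext => x; rewrite /fadd /fscale mul0e /addx adde0; case: ifP. Qed.

(** The agreement that determines the subslope. It is a congruence for [fadd], and up to it [fadd]
    is commutative. *)
Definition feq f g := {ae m, forall x, f x \is a fin_num \/ g x \is a fin_num -> f x = g x}.

Lemma feq_refl f : feq f f.
Proof. by apply: aeW. Qed.

Lemma feq_fadd f f' g g' : feq f f' -> feq g g' -> feq (fadd f g) (fadd f' g').
Proof.
apply: filterS2 => x ff' gg'; rewrite /fadd !addx_fin.
by move=> [/andP[a b]|/andP[a b]]; [rewrite (ff' (or_introl a)) (gg' (or_introl b))|rewrite (ff' (or_intror a)) (gg' (or_intror b))].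
Qed.

Lemma feq_faddC f g : feq (fadd f g) (fadd g f).
Proof.
apply: aeW => x; rewrite /fadd !addx_fin => H.
have [a b] : f x \is a fin_num /\ g x \is a fin_num by case: H => /andP[].
by rewrite /addx a b addeC.
Qed.

Lemma feq_subslope f g : causal_fun f -> causal_fun g -> feq f g -> subslope f = subslope g.
Proof. exact: subslope_eq. Qed.

End ConeAlgebra.

(** The hypothesis prescribes the second difference [2 h^2 V], so [phi] is quadratic along the
    multiples of any step [h]. For [q = n / d] the step is [1 / d], and the unknown [phi (1 / d)] is
    eliminated through the value at 1. *)
Lemma quadratic_on_rat (R : realType) (phi : rat -> R) (V : R) :
  (forall k h : rat, 0 <= k -> 0 < h -> phi (k + h + h) + phi k = 2 * phi (k + h) + 2 * (ratr h) ^+ 2 * V)%R ->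
  forall q : rat, (0 <= q)%R ->
    phi q = (phi 0 + ratr q * (phi 1 - phi 0 - V) + (ratr q) ^+ 2 * V)%R.
Proof.
move=> H.
have Hn (h : rat) (n : nat) : (0 < h)%R ->
    (phi (n%:R * h) = phi 0 + n%:R * (phi h - phi 0 - (ratr h) ^+ 2 * V) + n%:R ^+ 2 * (ratr h) ^+ 2 * V)%R.
  move=> h0; elim/ltn_ind: n => -[|[|n]] IH.
  - by rewrite mul0r; ring.
  - by rewrite mul1r; ring.
  - have nh0 : (0 <= n%:R * h)%R by rewrite mulr_ge0// ltW.
    have := H (n%:R * h)%R h nh0 h0.
    rewrite (_ : n%:R * h + h + h = n.+2%:R * h)%R; last by rewrite -(natr1 n.+1) -(natr1 n); ring.
    rewrite (_ : n%:R * h + h = n.+1%:R * h)%R; last by rewrite -(natr1 n); ring.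
    rewrite (IH n)// (IH n.+1)// -(@natr1 R n.+1) -(@natr1 R n).
    move: (phi _) (n%:R : R)%R => z N; set t := (ratr h : R).
    by move=> /(congr1 (fun z => z - (phi 0 + N * (phi h - phi 0 - t ^+ 2 * V) + N ^+ 2 * t ^+ 2 * V))%R); rewrite addrK => ->; ring.
move=> q q0.
have [d [n [d0 qE]]] : exists d n : nat, (0 < d)%N /\ q = (n%:R * d%:R^-1)%R.
  exists `|denq q|%N, `|numq q|%N; split; first by rewrite absz_gt0 denq_neq0.
  rewrite -[LHS]divq_num_den; congr (_ / _)%R.
    by rewrite -[in LHS](@gez0_abs (numq q)) ?numq_ge0// -pmulrn.
  by rewrite -[in LHS](@gez0_abs (denq q)) ?denq_ge0// -pmulrn.
have h0 : (0 < d%:R^-1 :> rat)%R by rewrite invr_gt0 ltr0n.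
have := Hn _ d h0; have := Hn _ n h0; rewrite -qE => ->.
have dn0 : (d%:R != 0 :> R)%R by rewrite pnatr_eq0 -lt0n.
rewrite mulfV ?pnatr_eq0 -?lt0n// fmorphV/= ratr_nat => E.
have -> : (ratr q = n%:R / d%:R :> R)%R by rewrite qE rmorphM/= fmorphV/= !ratr_nat.
move: E; set y := phi d%:R^-1%R => E.
have -> : (y = phi 0 + d%:R^-1 * (phi 1 - phi 0 - V) + d%:R^-1 ^+ 2 * V)%R by rewrite E; field.
by field.
Qed.

(** Rationals on both sides of [b] pinch [y] between values of a continuous polynomial. For [b = 0]
    no nonnegative rational lies strictly below, and the lower bound is the one at [q = 0]
    itself. *)
Lemma quadratic_squeeze (R : realType) (A B V b y : R) : (0 <= b)%R ->
  (forall q : rat, (0 <= q)%R -> (ratr q <= b)%R -> (A + ratr q * B + ratr q ^+ 2 * V <= y)%R) ->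
  (forall q : rat, (b <= ratr q)%R -> (y <= A + ratr q * B + ratr q ^+ 2 * V)%R) ->
  y = (A + b * B + b ^+ 2 * V)%R.
Proof.
move=> b0 lo hi.
(* Bounds the slope [B + V (r + b)] of the polynomial between [r] and [b] when [r] is within 1 of
   [b]. *)
pose C := (`|B| + `|V| * (2 * b + 1) + 1)%R.
have C0 : (0 < C)%R by rewrite ltr_pwDr// addr_ge0// mulr_ge0// addr_ge0// mulr_ge0.
have close (r e : R) : (0 <= r)%R -> (0 < e)%R -> (`|r - b| < Num.min 1 (e / C))%R ->
    (`|(A + r * B + r ^+ 2 * V) - (A + b * B + b ^+ 2 * V)| < e)%R.
  rewrite lt_min => r0 e0 /andP[q1 qe].
  have -> : (A + r * B + r ^+ 2 * V - (A + b * B + b ^+ 2 * V) = (r - b) * (B + V * (r + b)))%R by ring.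
  rewrite normrM; apply: (@le_lt_trans _ _ (`|r - b| * C)%R); last by rewrite -ltr_pdivlMr.
  apply: ler_wpM2l => //; apply: le_trans (ler_normD _ _) _; rewrite /C -addrA lerD2l.
  rewrite normrM; apply: (@le_trans _ _ (`|V| * (2 * b + 1))%R); last by rewrite lerDl.
  apply: ler_wpM2l => //; move: q1; rewrite ltr_norml ler_norml => /andP[? ?]; apply/andP; split; lra.
apply/eqP; rewrite eq_le; apply/andP; split; apply/ler_addgt0Pr => e e0.
  have d0 : (0 < Num.min 1 (e / C))%R by rewrite lt_min ltr01 divr_gt0.
  have [q /andP[bq qd]] := @rat_between R b (b + Num.min 1 (e / C))%R ltac:(by rewrite ltrDl).
  have q0 := le_trans b0 (ltW bq).
  have nq : (`|ratr q - b| < Num.min 1 (e / C))%R by rewrite ger0_norm ?subr_ge0 ?ltW// ltrBlDl.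
  have := close _ _ q0 e0 nq; rewrite ltr_norml => /andP[_].
  have := hi q (ltW bq); move: (_ + _ ^+ 2 * _)%R => P; lra.
have [b00|bpos] := eqVneq b 0%R.
  by have := lo 0%R (lexx _); rewrite rmorph0 b00 => /(_ (lexx _)); lra.
have {}bpos : (0 < b)%R by rewrite lt_neqAle eq_sym bpos.
have d0 : (0 < Num.min b (Num.min 1 (e / C)))%R by rewrite !lt_min ltr01 divr_gt0// bpos.
have [q /andP[bq qd]] := @rat_between R (b - Num.min b (Num.min 1 (e / C)))%R b ltac:(by rewrite ltrBlDr ltrDl).
have mb : (Num.min b (Num.min 1 (e / C)) <= b)%R by rewrite ge_min lexx.
have q0' : (0 <= ratr q :> R)%R by move: bq mb; move: (Num.min b _) => ? ? ?; lra.
have nq : (`|ratr q - b| < Num.min b (Num.min 1 (e / C)))%R by rewrite distrC ger0_norm ?subr_ge0 ?ltW// ltrBlDl -ltrBlDr.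
move: nq; rewrite lt_min => /andP[_ nq].
have := close _ _ q0' e0 nq; rewrite ltr_norml => /andP[+ _].
have := lo q ltac:(by rewrite -(ler0q R)) (ltW qd); move: (A + ratr q * B + _)%R => P; lra.
Qed.

(** Both sides of the hypothesis are the square at [u + 2 v + 2 w = 2 ((v + w) + u / 2)]: on the
    left by homogeneity and the expansion along one half-line, on the right by the expansion in two
    parameters at [(2, 2)]. Comparison shows that the mixed coefficient does not involve [u]. *)
Lemma quad3_coef (R : realType) (U V W UV UW VW UVW : R) :
  (2 ^+ 2 * (VW + 2^-1 * (UVW - VW - U) + 2^-1 ^+ 2 * U) =
   U + 2 ^+ 2 * V + 2 ^+ 2 * W + 2 * (UV - U - V) + 2 * (UW - U - W) +
     2 * 2 * (UVW - UV - UW + U) ->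
   VW - V - W = UVW - UV - UW + U)%R.
Proof. lra. Qed.

Section Line.
Variables (R : realType) (S : fmmst R).
Implicit Types u v : S -> \bar R.

Definition sl u x : R := fine (subslope u x).

Definition line u v (b : R) := fadd u (fscale b v).

Lemma lineE u v b : line u v b = fadd u (fscale b v).
Proof. by []. Qed.

Definition sq u x : R := (sl u x ^+ 2)%R.

Lemma sqE u x : sq u x = (sl u x ^+ 2)%R.
Proof. by []. Qed.

Lemma sq_eq u v : subslope u = subslope v -> sq u = sq v.
Proof. by rewrite /sq /sl => ->. Qed.

Lemma sl_eq u v : subslope u = subslope v -> sl u = sl v.
Proof. by rewrite /sl => ->. Qed.

Lemma slE u x : causal_fun u -> subslope u x < +oo -> subslope u x = (sl u x)%:E.
Proof.
move=> cf fx; rewrite fineK// ge0_fin_numE; [exact: fx|exact: subslope_ge0].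
Qed.

Lemma sl_ge0 u x : causal_fun u -> (0 <= sl u x)%R.
Proof. by move=> cf; apply: fine_ge0; exact: subslope_ge0. Qed.

Lemma sl_fine u (y : \bar R) x : subslope u x = y -> sl u x = fine y.
Proof. by rewrite /sl => ->. Qed.

End Line.

Lemma faddE (R : realType) (S : fmmst R) (f g : S -> \bar R) x : fadd f g x = addx (f x) (g x).
Proof. by []. Qed.

Lemma fscaleE (R : realType) (S : fmmst R) a (f : S -> \bar R) x : fscale a f x = a%:E * f x.
Proof. by []. Qed.

#[local] Opaque subslope fadd fscale line sl sq.

Section Quadratic.
Variables (R : realType) (S : fmmst R).
Local Notation m := (refm S).
Hypothesis mink : inf_minkowskian S.
Implicit Types (f g u v w : S -> \bar R) (a b k : R).

Lemma sl_le f g x : causal_fun f -> causal_fun g -> subslope g x < +oo ->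
  subslope f x <= subslope g x -> (sl f x <= sl g x)%R.
Proof.
move=> cf cg gx fg; have fx := le_lt_trans fg gx.
by move: fg; rewrite (slE cf fx) (slE cg gx) lee_fin.
Qed.

Lemma subslope_le_fadd u v : causal_fun u -> causal_fun v ->
  {ae m, forall x, subslope u x <= subslope (fadd u v) x}.
Proof.
move=> cu cv; apply: filterS (subslope_superadditive cu cv) => x; apply: le_trans.
by rewrite leeDl// subslope_ge0.
Qed.

Lemma causal_line u v b : causal_fun u -> causal_fun v -> (0 <= b)%R -> causal_fun (line u v b).
Proof. by move=> cu cv b0; rewrite lineE; apply: causal_fadd => //; exact: causal_fscale. Qed.

Lemma lineD u v a b : (0 <= a)%R -> (0 <= b)%R -> line u v (a + b) = fadd (line u v a) (fscale b v).
Proof. by move=> a0 b0; rewrite !lineE -faddA -fscaleDl. Qed.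

Lemma subslope_line_mono u v a b : causal_fun u -> causal_fun v -> (0 <= a)%R -> (a <= b)%R ->
  {ae m, forall x, subslope (line u v a) x <= subslope (line u v b) x}.
Proof.
move=> cu cv a0 ab; have ba0 : (0 <= b - a)%R by rewrite subr_ge0.
rewrite (_ : b = a + (b - a))%R ?lineD//; last by rewrite addrC subrK.
by apply: subslope_le_fadd; [exact: causal_line|exact: causal_fscale].
Qed.

(** The Minkowski identity for [h v] and [u + k v], after exchanging summands up to [feq]. *)
Lemma line_parallelogram u v k h : causal_fun u -> causal_fun v -> (0 <= k)%R -> (0 < h)%R ->
  {ae m, forall x, 2%:E * subslope (line u v (k + h)) x ^+ 2 + 2%:E * (h%:E * subslope v x) ^+ 2 =
     subslope (line u v k) x ^+ 2 + subslope (line u v (k + h + h)) x ^+ 2}.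
Proof.
move=> cu cv k0 h0; have h0' := ltW h0; have kh0 : (0 <= k + h)%R by rewrite addr_ge0.
have chv : causal_fun (fscale h v) by exact: causal_fscale.
have cl b : (0 <= b)%R -> causal_fun (line u v b) by exact: causal_line.
have := mink chv (cl k k0).
have -> : subslope (fadd (fscale h v) (line u v k)) = subslope (line u v (k + h)).
  apply: feq_subslope; [exact: causal_fadd (cl k k0)|exact: cl|].
  by rewrite lineD//; exact: feq_faddC.
have -> : subslope (fadd (fscale 2 (fscale h v)) (line u v k)) = subslope (line u v (k + h + h)).
  apply: feq_subslope; [|by apply: cl; rewrite addr_ge0|].
    by apply: causal_fadd (cl k k0); exact: causal_fscale.
  rewrite fscaleA (_ : 2 * h = h + h)%R; last by ring.
  by rewrite -(addrA k) lineD ?addr_ge0//; exact: feq_faddC.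
by apply: filterS2 (subslope_scale h0 cv) => x -> .
Qed.

(** All identities and monotonicity relations with rational parameters hold outside one null set. At
    each remaining point they are a difference equation for [q |-> N(u + q v)^2] once the values are
    known to be finite. *)
Lemma quad_rat u v : causal_fun u -> causal_fun v ->
  {ae m, forall x, subslope (fadd u v) x < +oo -> forall q : rat, (0 <= q)%R ->
    subslope (line u v (ratr q)) x < +oo /\
    (sq (line u v (ratr q)) x = sq u x +
       ratr q * (sq (fadd u v) x - sq u x - sq v x) + ratr q ^+ 2 * sq v x)%R}.
Proof.
move=> cu cv.
have uv1 : line u v 1 = fadd u v by rewrite !lineE fscale1.
have uv0 : line u v 0 = u by rewrite lineE fscale0.
pose un n : rat * rat := odflt (0%R, 0%R) (unpickle n).
have Hpar n : {ae m, forall x, (0 <= (un n).1)%R -> (0 < (un n).2)%R ->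
   2%:E * subslope (line u v (ratr (un n).1 + ratr (un n).2)) x ^+ 2 + 2%:E * ((ratr (un n).2)%:E * subslope v x) ^+ 2 =
     subslope (line u v (ratr (un n).1)) x ^+ 2 + subslope (line u v (ratr (un n).1 + ratr (un n).2 + ratr (un n).2)) x ^+ 2}.
  case: (un n) => k h /=.
  have [k0|k0] := boolP (0 <= k)%R; last by apply: aeW => x f; discriminate f.
  have [h0|h0] := boolP (0 < h)%R; last by apply: aeW => x _ f; discriminate f.
  have k0' : (0 <= ratr k :> R)%R by rewrite ler0q.
  have h0' : (0 < ratr h :> R)%R by rewrite ltr0q.
  by apply: filterS (line_parallelogram cu cv k0' h0').
have Hmono n : {ae m, forall x, (0 <= (un n).1)%R -> ((un n).1 <= (un n).2)%R ->
   subslope (line u v (ratr (un n).1)) x <= subslope (line u v (ratr (un n).2)) x}.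
  case: (un n) => k h /=.
  have [k0|k0] := boolP (0 <= k)%R; last by apply: aeW => x f; discriminate f.
  have [h0|h0] := boolP (k <= h)%R; last by apply: aeW => x _ f; discriminate f.
  have k0' : (0 <= ratr k :> R)%R by rewrite ler0q.
  have h0' : (ratr k <= ratr h :> R)%R by rewrite ler_rat.
  by apply: filterS (subslope_line_mono cu cv k0' h0').
have Hv : {ae m, forall x, subslope v x <= subslope (fadd u v) x}.
  by apply: filterS (subslope_superadditive cu cv) => x; apply: le_trans; rewrite leeDr// subslope_ge0.
apply: filterS3 (ae_foralln Hpar) (ae_foralln Hmono) Hv => x {}Hpar {}Hmono {}Hv fin.
have unE (kh : rat * rat) : un (pickle kh) = kh by rewrite /un pickleK.
have par (k h : rat) : (0 <= k)%R -> (0 < h)%R -> 2%:E * subslope (line u v (ratr (k + h))) x ^+ 2 + 2%:E * ((ratr h)%:E * subslope v x) ^+ 2 =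
     subslope (line u v (ratr k)) x ^+ 2 + subslope (line u v (ratr (k + h + h))) x ^+ 2.
  by move=> k0 h0; have := Hpar (pickle (k, h)); rewrite unE -!rmorphD; apply.
have mono (k h : rat) : (0 <= k)%R -> (k <= h)%R -> subslope (line u v (ratr k)) x <= subslope (line u v (ratr h)) x.
  by move=> k0 h0; have := Hmono (pickle (k, h)); rewrite unE; apply.
have ge0 b : (0 <= b)%R -> 0 <= subslope (line u v b) x.
  by move=> b0; apply: subslope_ge0; exact: causal_line.
have fv : subslope v x \is a fin_num.
  by rewrite ge0_fin_numE ?subslope_ge0// (le_lt_trans Hv).
(* With step 1 the identity bounds the value at [n + 2] by those at [n + 1] and at [v], so
   finiteness at 1 propagates to all integers, and by monotonicity to all rationals. *)
have finn n : subslope (line u v (ratr n%:R)) x < +oo.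
  elim/ltn_ind: n => -[|[|n]] IH.
  - by apply: le_lt_trans (mono 0%R 1%R (lexx _) ler01) _; rewrite rmorph1 uv1.
  - by rewrite rmorph1 uv1.
  have := par n%:R%R 1%R (ler0n _ _) ltr01.
  have -> : (n%:R + 1 = n.+1%:R :> rat)%R by rewrite natr1.
  have -> : (n.+1%:R + 1 = n.+2%:R :> rat)%R by rewrite natr1.
  have f1 : subslope (line u v (ratr n.+1%:R)) x \is a fin_num.
    rewrite ge0_fin_numE; first exact: IH.
    by apply: ge0; rewrite ler0q; exact: ler0n.
  move=> E; rewrite ltNge leye_eq; apply/negP => /eqP oo; move: E; rewrite oo.
  rewrite -(fineK f1) -(fineK fv) -EFinM -!EFin_expe -!EFinM -EFinD /=.
  have n0 : 0 <= subslope (line u v (ratr n%:R)) x by apply: ge0; rewrite ler0q; exact: ler0n.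
  by rewrite mulyy addey// gt_eqF// (lt_le_trans ltNy0)// mule_ge0.
have finq (q : rat) : (0 <= q)%R -> subslope (line u v (ratr q)) x < +oo.
  move=> q0; have [n qn] : exists n : nat, (q <= n%:R)%R.
    by exists (Num.truncn q).+1; apply/ltW/truncnS_gt.
  by apply: le_lt_trans (finn n); exact: mono.
have finK (q : rat) : (0 <= q)%R -> subslope (line u v (ratr q)) x = (sl (line u v (ratr q)) x)%:E.
  by move=> q0; apply: slE; [apply: causal_line => //; rewrite ler0q|exact: finq].
have H := @quadratic_on_rat R (fun q => sq (line u v (ratr q)) x)%R (sq v x)%R.
move=> q q0; split; first exact: finq.
rewrite H; [by rewrite rmorph0 uv0 rmorph1 uv1| |exact: q0].
move=> k h k0 h0; have kh0 : (0 <= k + h)%R by apply: addr_ge0 => //; exact: ltW.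
have khh0 : (0 <= k + h + h)%R by apply: addr_ge0 => //; exact: ltW.
have := par k h k0 h0; rewrite (finK _ k0) (finK _ kh0) (finK _ khh0) (slE cv (le_lt_trans Hv fin)).
rewrite !sqE; move: (sl (line u v (ratr (k + h))) x) (sl (line u v (ratr k)) x) (sl (line u v (ratr (k + h + h))) x).
move: (sl v x) (ratr h : R) => V r A B C /(congr1 fine)/= E.
by rewrite addrC !expr2 -E; ring.
Qed.

(* Quadratic on the rationals by the parallelogram identity, then on the reals
   because the subslope increases along the half-line. *)
Lemma quad u v b : causal_fun u -> causal_fun v -> (0 <= b)%R ->
  {ae m, forall x, subslope (fadd u v) x < +oo -> subslope (line u v b) x < +oo /\
    (sq (line u v b) x = sq u x +
       b * (sq (fadd u v) x - sq u x - sq v x) + b ^+ 2 * sq v x)%R}.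
Proof.
move=> cu cv b0.
pose un n : rat := odflt 0%R (unpickle n).
have Hlo n : {ae m, forall x, (0 <= un n)%R -> (ratr (un n) <= b)%R ->
   subslope (line u v (ratr (un n))) x <= subslope (line u v b) x}.
  move: (un n) => k.
  have [k0|k0] := boolP (0 <= k)%R; last by apply: aeW => x f; discriminate f.
  have [h0|h0] := boolP (ratr k <= b)%R; last by apply: aeW => x _ f; discriminate f.
  have k0' : (0 <= ratr k :> R)%R by rewrite ler0q.
  by apply: filterS (subslope_line_mono cu cv k0' h0).
have Hhi n : {ae m, forall x, (b <= ratr (un n))%R ->
   subslope (line u v b) x <= subslope (line u v (ratr (un n))) x}.
  move: (un n) => k.
  have [h0|h0] := boolP (b <= ratr k)%R; last by apply: aeW => x f; discriminate f.
  by apply: filterS (subslope_line_mono cu cv b0 h0).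
apply: filterS3 (quad_rat cu cv) (ae_foralln Hlo) (ae_foralln Hhi) => x Hq {}Hlo {}Hhi fin.
have unE (q : rat) : un (pickle q) = q by rewrite /un pickleK.
have lo (q : rat) : (0 <= q)%R -> (ratr q <= b)%R -> subslope (line u v (ratr q)) x <= subslope (line u v b) x.
  by move=> q0 qb; have := Hlo (pickle q); rewrite unE; apply.
have hi (q : rat) : (b <= ratr q)%R -> subslope (line u v b) x <= subslope (line u v (ratr q)) x.
  by move=> qb; have := Hhi (pickle q); rewrite unE; apply.
have pos_rat (q : rat) : (b <= ratr q)%R -> (0 <= q)%R by move=> bq; rewrite -(ler0q R); exact: le_trans bq.
have ge0 c : (0 <= c)%R -> 0 <= subslope (line u v c) x.
  by move=> c0; apply: subslope_ge0; exact: causal_line.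
have fb : subslope (line u v b) x < +oo.
  have [q /andP[bq _]] := @rat_between R b (b + 1)%R ltac:(by rewrite ltrDl).
  have [fq _] := Hq fin q (pos_rat _ (ltW bq)).
  by apply: le_lt_trans fq; apply: hi; exact: ltW.
split; first exact: fb.
have sl_le2 c c' : (0 <= c)%R -> (0 <= c')%R -> subslope (line u v c') x < +oo ->
    subslope (line u v c) x <= subslope (line u v c') x -> (sq (line u v c) x <= sq (line u v c') x)%R.
  move=> c0 c'0 f' le; have cc := causal_line cu cv c0; have cc' := causal_line cu cv c'0.
  rewrite !sqE ler_sqr ?nnegrE; [exact: sl_le|exact: sl_ge0|exact: sl_ge0].
apply: quadratic_squeeze => // [q q0 qb|q bq].
- have [_ <-] := Hq fin q q0; apply: (sl_le2 _ _ _ b0 fb); first by rewrite ler0q.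
  exact: lo.
- have q0 := pos_rat _ bq; have [fq <-] := Hq fin q q0.
  by apply: (sl_le2 _ _ b0 _ fq); [rewrite ler0q|exact: hi].
Qed.

(** The one-parameter expansion, used for [u + v] and for [u] along [w], and then along [v], gives a
    polynomial whose mixed coefficient is a third difference involving [u]. A second computation at
    one point replaces it by the coefficient belonging to [v] and [w] alone, which is what linearity
    requires. *)
Lemma quad3 u v w a b : causal_fun u -> causal_fun v -> causal_fun w -> (0 <= a)%R -> (0 <= b)%R ->
  {ae m, forall x, subslope (fadd (fadd u v) w) x < +oo ->
    subslope (line (line u v a) w b) x < +oo /\
    (sq (line (line u v a) w b) x = sq u x + a ^+ 2 * sq v x + b ^+ 2 * sq w x +
       a * (sq (fadd u v) x - sq u x - sq v x) +
       b * (sq (fadd u w) x - sq u x - sq w x) +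
       a * b * (sq (fadd v w) x - sq v x - sq w x))%R}.
Proof.
move=> cu cv cw a0 b0.
have cuv := causal_fadd cu cv; have cuw := causal_fadd cu cw; have cvw := causal_fadd cv cw.
have cl f g c : causal_fun f -> causal_fun g -> (0 <= c)%R -> causal_fun (line f g c) by exact: causal_line.
have swap c d : (0 <= c)%R -> (0 <= d)%R ->
    subslope (line (line u w d) v c) = subslope (line (line u v c) w d).
  move=> c0 d0; apply: feq_subslope; [by apply: (cl) => //; exact: cl|by apply: (cl) => //; exact: cl|].
  rewrite !lineE -!faddA; apply: feq_fadd; [exact: feq_refl|exact: feq_faddC].
have line1 f g : line f g 1 = fadd f g by rewrite !lineE fscale1.
have psi c d : (0 <= c)%R -> (0 <= d)%R -> {ae m, forall x, subslope (fadd (fadd u v) w) x < +oo ->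
    subslope (line (line u v c) w d) x < +oo /\
    (sq (line (line u v c) w d) x = sq u x + c ^+ 2 * sq v x + d ^+ 2 * sq w x +
       c * (sq (fadd u v) x - sq u x - sq v x) +
       d * (sq (fadd u w) x - sq u x - sq w x) +
       c * d * (sq (fadd (fadd u v) w) x - sq (fadd u v) x - sq (fadd u w) x + sq u x))%R}.
  move=> c0 d0.
  have e1 := quad cuv cw d0; have e2 := quad cu cw d0.
  have e3 := quad (cl _ _ _ cu cw d0) cv c0.
  have e4 := subslope_le_fadd cuw cv.
  have h1 : subslope (fadd (line u w d) v) = subslope (line (fadd u v) w d).
    by have := swap 1%R d ler01 d0; rewrite !line1.
  have h2 : subslope (fadd (fadd u w) v) = subslope (fadd (fadd u v) w).
    by have := swap 1%R 1%R ler01 ler01; rewrite !line1.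
  have h3 := swap c d c0 d0.
  apply: filterS2 (filterI e1 e2) (filterI e3 e4) => x [] {}e1 {}e2 [] {}e3 {}e4 fin.
  have [f1 E1] := e1 fin.
  have [f2 E2] : subslope (line u w d) x < +oo /\ (sq (line u w d) x = sq u x +
       d * (sq (fadd u w) x - sq u x - sq w x) + d ^+ 2 * sq w x)%R.
    by apply: e2; rewrite h2 in e4; exact: le_lt_trans e4 fin.
  have [] : subslope (line (line u w d) v c) x < +oo /\ (sq (line (line u w d) v c) x = sq (line u w d) x +
       c * (sq (fadd (line u w d) v) x - sq (line u w d) x - sq v x) + c ^+ 2 * sq v x)%R.
    by apply: e3; rewrite h1; exact: f1.
  rewrite h3 (sq_eq h3) (sq_eq h1) E1 E2.
  move=> f3 E3; split; first exact: f3.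
  rewrite E3; move: (sq _ _) (sq _ _) (sq _ _) (sq _ _) (sq _ _) (sq _ _); clear => *; ring.
have two0 : (0 <= 2 :> R)%R by [].
have half0 : (0 <= 2^-1 :> R)%R by rewrite invr_ge0.
have pos2 : (0 < 2 :> R)%R by [].
(* The point [u + 2 v + 2 w], written as twice a point of the half-line from [v + w] in the
   direction [u]. *)
have E : subslope (line (line u v 2) w 2) = subslope (fscale 2 (line (fadd v w) u 2^-1)).
  apply: feq_subslope; [by apply: (cl) => //; exact: cl|by apply: causal_fscale => //; exact: cl|].
  rewrite !lineE fscaleDr// fscaleA mulfV// fscale1 fscaleDr// -faddA; exact: feq_faddC.
have sc := subslope_scale pos2 (cl _ _ _ cvw cu half0).
have qd := quad cvw cu half0.
have h5 : subslope (fadd (fadd v w) u) = subslope (fadd (fadd u v) w).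
  apply: feq_subslope; [exact: causal_fadd|exact: causal_fadd|].
  by rewrite -[X in feq _ X]faddA; exact: feq_faddC.
apply: filterS3 (psi a b a0 b0) (psi 2%R 2%R two0 two0) (filterI sc qd) => x Hab H22 [] {}sc {}qd fin.
have [fab Eab] := Hab fin; have [f22 E22] := H22 fin.
rewrite h5 in qd; have [fq Eq] := qd fin.
split => //; rewrite Eab.
have : (sl (line (line u v 2) w 2) x = 2 * sl (line (fadd v w) u 2^-1) x)%R.
  by rewrite (sl_eq E) (sl_fine sc) (slE (cl _ _ _ cvw cu half0) fq).
move: Eq; rewrite (sq_eq h5) => Eq E2.
move: E22; rewrite (sqE (line _ _ _)) E2 exprMn -sqE Eq.
move: (sq u x) (sq v x) (sq w x) (sq (fadd u v) x) (sq (fadd u w) x) (sq (fadd v w) x) (sq (fadd (fadd u v) w) x) => U V W UV UW VW UVW K.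
have -> : (VW - V - W = UVW - UV - UW + U)%R.
  exact: quad3_coef K.
by [].
Qed.

End Quadratic.

(** * Vertical derivatives *)

Section PowerQuotient.
Variable R : realType.
Implicit Types (p a r : R) (eps : nat -> R).

Lemma u_fin p r : p != 0%R -> (0 <= r)%R -> u_ p r%:E =
  if (r == 0)%R && (p < 0)%R then -oo else (p^-1 * r `^ p)%:E.
Proof.
move=> p0 r0; rewrite /u_ lte_fin ltNge r0/=.
by case: ifPn => // /andP[_ pn]; rewrite lt0_muley// lte_fin invr_lt0.
Qed.

Lemma u_infty p : p != 0%R -> u_ p +oo = if (p < 0)%R then 0 else +oo.
Proof.
move=> p0; rewrite /u_ /epow/=; case: ifPn => [|pn]; first by rewrite mule0.
by rewrite gt0_muley// lte_fin invr_gt0 lt_neqAle eq_sym p0 leNgt.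
Qed.

Lemma sqr_powR r p : (0 <= r)%R -> ((r ^+ 2) `^ (p / 2) = r `^ p)%R.
Proof.
by move=> r0; rewrite -powR_mulrn// -powRrM mulrCA mulfV ?mulr1.
Qed.

Lemma cvg_to_dnbhs eps : (forall n, (0 < eps n)%R) -> eps @ \oo --> (0%R : R) -> eps @ \oo --> (0%R : R)^'.
Proof.
move=> e0 e1 A A0.
have H : \forall n \near \oo, (eps n != 0)%R -> A (eps n) := e1 _ A0.
by apply: filterS H => n; apply; rewrite gt_eqF.
Qed.

Lemma cvg_near_EFin (u : nat -> \bar R) (v : nat -> R) (l : R) : v @ \oo --> l ->
  (\forall n \near \oo, u n = (v n)%:E) -> u @ \oo --> l%:E.
Proof.
move=> vl uv; apply: cvg_trans (cvg_comp _ _ vl (@cvg_id _ (nbhs l%:E) : (EFin @ l) --> l%:E)).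
by apply: near_eq_cvg; apply: filterS uv.
Qed.

Lemma subx_EFin (x y : R) : subx x%:E y%:E = (x - y)%:E.
Proof. by rewrite /subx/= andbF. Qed.

(** For [a > 0] the function [u_p(r)] equals [(r^2)^(p / 2) / p] near [a], which is differentiable
    in [r^2]; the chain rule at [e = 0] gives the value. *)
Lemma quotient_pos p a A1 A2 eps (N : nat -> \bar R) (r : nat -> R) : p != 0%R -> (0 < a)%R ->
  (forall n, (0 < eps n)%R) -> eps @ \oo --> (0%R : R) ->
  (\forall n \near \oo, [/\ N n = (r n)%:E, (0 <= r n)%R & (r n ^+ 2 = a ^+ 2 + eps n * A1 + eps n ^+ 2 * A2)%R]) ->
  (fun n => ((eps n)^-1)%:E * subx (u_ p (N n)) (u_ p a%:E)) @ \oo -->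
    (a `^ (p - 2) * A1 / 2)%:E.
Proof.
move=> p0 a0 eps0 eps_cvg Hr.
pose q (h : R) : R := (a ^+ 2 + h * A1 + h ^+ 2 * A2)%R.
have dq : is_derive (0%R : R) (1%R : R) q A1.
  have -> : q = ((cst (a ^+ 2) + (id : R -> R) * cst A1) + ((id : R -> R) * (id : R -> R)) * cst A2)%R.
    by apply/funext => h; rewrite /q !fctE expr2.
  have d0 (k : R) : is_derive (0%R : R) (1%R : R) (cst k) (0%R : R) by exact: is_derive_cst.
  have d1 : is_derive (0%R : R) (1%R : R) (id : R -> R) (1%R : R) by exact: is_derive_id.
  have d2 := is_deriveD (is_deriveD (d0 (a ^+ 2)%R) (is_deriveM d1 (d0 A1))) (is_deriveM (is_deriveM d1 d1) (d0 A2)).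
  apply: (is_derive_eq d2); by rewrite /GRing.scale/= /cst !fctE !(mul0r,mulr0,add0r,addr0,mulr1).
have q0 : q 0%R = (a ^+ 2)%R by rewrite /q mul0r expr0n/= mul0r !addr0.
have a20 : (0 < a ^+ 2)%R by rewrite exprn_gt0.
pose F (h : R) : R := (q h `^ (p / 2))%R.
have dF : is_derive (0%R : R) (1%R : R) F (A1 * (p / 2 * (a ^+ 2) `^ (p / 2 - 1)))%R.
  rewrite mulrC; apply: (is_derive1_comp (f := fun x => x `^ (p / 2))%R) dq.
  by rewrite q0; exact: is_derive1_powR.
have cF : (fun n => (eps n)^-1 * (F (eps n) - F 0))%R @ \oo --> (A1 * (p / 2 * (a ^+ 2) `^ (p / 2 - 1)))%R.
  have [dF1 dF2] := dF; have := cvg_comp _ _ (cvg_to_dnbhs eps0 eps_cvg) dF1.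
  rewrite -/(derive F 0 1) dF2; apply: cvg_trans; apply: near_eq_cvg; near=> n => /=.
  by rewrite /GRing.scale/= mulr1 addr0.
have qcvg : (fun n => q (eps n)) @ \oo --> (a ^+ 2)%R.
  have E0 : (a ^+ 2 + 0 * A1 + 0 * A2 = a ^+ 2)%R by rewrite !mul0r !addr0.
  rewrite -[X in _ --> X]E0.
  apply: cvgD; first by apply: cvgD; [exact: cvg_cst|apply: cvgM => //; exact: cvg_cst].
  apply: cvgM; last exact: cvg_cst.
  rewrite -[X in _ --> X](mulr0 (0 : R)%R); under eq_fun do rewrite expr2; exact: cvgM.
have qpos : \forall n \near \oo, (0 < q (eps n))%R by apply: (cvgr_gt _ qcvg).
have E : (a `^ (p - 2) * A1 / 2 = p^-1 * (A1 * (p / 2 * (a ^+ 2) `^ (p / 2 - 1))))%R.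
  have -> : ((a ^+ 2) `^ (p / 2 - 1) = a `^ (p - 2))%R.
    by rewrite -[in RHS](sqr_powR _ (ltW a0)) mulrBl mulfV.
  by field.
rewrite E; have cF' : (fun n => p^-1 * ((eps n)^-1 * (F (eps n) - F 0)))%R @ \oo --> (p^-1 * (A1 * (p / 2 * (a ^+ 2) `^ (p / 2 - 1))))%R by apply: cvgMl_tmp.
apply: (cvg_near_EFin cF'); near=> n.
have [-> r0 rE] : [/\ N n = (r n)%:E, (0 <= r n)%R & (r n ^+ 2 = a ^+ 2 + eps n * A1 + eps n ^+ 2 * A2)%R] by near: n.
have rpos : (0 < r n)%R.
  have : (0 < r n ^+ 2)%R by rewrite rE; near: n.
  by rewrite [in X in _ -> X]lt_neqAle r0 andbT; apply: contraTneq => <-; rewrite expr0n/= ltxx.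
rewrite !u_fin ?(ltW a0)// (gt_eqF rpos) (gt_eqF a0)/= subx_EFin.
congr EFin; rewrite /F /q -rE sqr_powR//.
rewrite (_ : (a ^+ 2 + 0 * A1 + 0 ^+ 2 * A2 = a ^+ 2)%R) ?sqr_powR ?(ltW a0)//; first by ring.
Unshelve. all: by end_near. Qed.


Lemma quotient_infty (u : nat -> \bar R) : (\forall n \near \oo, u n = +oo) -> u @ \oo --> +oo.
Proof.
by move=> uoo; apply: cvg_near_cst.
Qed.

Lemma powR_cvgy p eps c : (0 < c)%R -> (p < 1)%R -> (forall n, (0 < eps n)%R) -> eps @ \oo --> (0%R : R) ->
  (fun n => c * eps n `^ (p - 1))%R @ \oo --> +oo%R.
Proof.
move=> c0 p1 eps0 eps_cvg; apply/cvgryPge => M.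
pose K : R := (Num.max M 1 / c)%R.
have K0 : (0 < K)%R by rewrite divr_gt0// lt_max ltr01 orbT.
have : \forall n \near \oo, (eps n < K `^ (p - 1)^-1)%R.
  by apply: (cvgr_lt _ eps_cvg); rewrite powR_gt0.
apply: filterS => n eK.
have : (M <= c * K)%R by rewrite /K mulrC divfK ?gt_eqF// le_max lexx.
move/le_trans; apply; rewrite ler_pM2l//.
have -> : K = ((K `^ (p - 1)^-1) `^ (p - 1))%R by rewrite -powRrM mulVf ?powRr1 ?ltW// subr_eq0 lt_eqF.
rewrite -(opprB 1%R p) !(powRN _ (1 - p)%R) lef_pV2 ?posrE ?powR_gt0//.
by apply: ge0_ler_powR; rewrite ?nnegrE ?powR_ge0 ?(ltW (eps0 n)) ?subr_ge0 ?ltW// opprB.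
Qed.

(* Limit of e^-1 (u_p(r) - u_p(a)) as e decreases to 0, where r^2 = a^2 + e A1 + e^2 A2. *)
Definition vd (p a A1 A2 : R) : \bar R :=
  if (0 < a)%R then (a `^ (p - 2) * A1 / 2)%:E
  else if [|| (p < 0)%R, A1 != 0%R | A2 != 0%R] then +oo else 0.

(** [u_p(0)] is [-oo] for [p < 0], and subtracting [-oo] always yields [+oo], even from [-oo]
    itself. *)
Lemma subx_u0 p (x : \bar R) : (p < 0)%R -> 0 <= x -> subx (u_ p x) (u_ p (0%R : R)%:E) = +oo.
Proof.
move=> p0 x0; have pn0 : p != 0%R by rewrite lt_eqF.
rewrite (@u_fin p 0%R)// eqxx p0/=.
case: x x0 => [x| |] x0 //; last by rewrite u_infty// p0.
by rewrite u_fin//; case: ifP.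
Qed.

Lemma quadratic_lower e A1 A2 r : (0 < e)%R -> (e * `|A2| < `|A1| / 2)%R -> (e < `|A1| / 2)%R ->
  (0 <= r)%R -> (r ^+ 2 = e * A1 + e ^+ 2 * A2)%R -> (e <= r)%R.
Proof.
move=> e0 eA2 eA1 r0 rE.
have rE' : (r ^+ 2 = e * (A1 + e * A2))%R by rewrite rE; ring.
have [Al Au] : (- (`|A1| / 2) < e * A2)%R /\ (e * A2 < `|A1| / 2)%R.
  by apply/andP; rewrite -ltr_norml normrM (gtr0_norm e0).
have : (0 <= A1 + e * A2)%R by rewrite -(pmulr_rge0 _ e0) -rE' sqr_ge0.
have [A1n|A1p _] := ltP A1 0%R; first by move: Au; rewrite ltr0_norm//; lra.
move: Al eA1; rewrite ger0_norm// => Al eA1.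
rewrite -(@ler_pXn2r _ 2)// ?nnegrE ?(ltW e0)// rE' expr2 ler_pM2l//; lra.
Qed.

(** If [A1] is nonzero it is positive, since [r^2 >= 0], and [r] is of order [sqrt (eps A1)],
    eventually above [eps]. If [A1 = 0], then [r = eps sqrt A2]. *)
Lemma quotient_lower A1 A2 eps (r : nat -> R) : (forall n, (0 < eps n)%R) -> eps @ \oo --> (0%R : R) ->
  (\forall n \near \oo, (0 <= r n)%R /\ (r n ^+ 2 = eps n * A1 + eps n ^+ 2 * A2)%R) ->
  (A1 != 0%R) || (A2 != 0%R) ->
  exists2 c, (0 < c)%R & \forall n \near \oo, (c * eps n <= r n)%R.
Proof.
move=> eps0 eps_cvg Hr; have [/eqP A1_0 /= A2_0|A1_0 _] := boolP (A1 == 0%R).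
  exists (Num.sqrt `|A2|); first by rewrite sqrtr_gt0 normr_gt0.
  apply: filterS Hr => n [r0 rE].
  have {}rE : (r n ^+ 2 = eps n ^+ 2 * A2)%R by rewrite rE A1_0 mulr0 add0r.
  have A2p : (0 <= A2)%R by rewrite -(pmulr_rge0 _ (exprn_gt0 2 (eps0 n))) -rE sqr_ge0.
  rewrite -(@ler_pXn2r _ 2)// ?nnegrE ?mulr_ge0 ?sqrtr_ge0 ?(ltW (eps0 n))//.
  by rewrite rE exprMn sqr_sqrtr// (ger0_norm A2p) mulrC.
exists 1%R => //.
have A1p : (0 < `|A1| / 2)%R by rewrite divr_gt0// normr_gt0.
have H1 : \forall n \near \oo, (eps n < `|A1| / 2)%R by apply: (cvgr_lt _ eps_cvg).
have H2 : \forall n \near \oo, (eps n * `|A2| < `|A1| / 2)%R.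
  have C : (fun n => eps n * `|A2|)%R @ \oo --> (0 * `|A2|)%R by apply: cvgMr_tmp.
  by apply: (cvgr_lt _ C); rewrite mul0r.
near=> n; rewrite mul1r; apply: (@quadratic_lower (eps n) A1 A2 (r n)) => //; try by near: n.
- by near: n; apply: filterS Hr => ? [].
- by near: n; apply: filterS Hr => ? [].
Unshelve. all: by end_near. Qed.

(** At [a = 0] the quotient is [+oo] for [p < 0]. For [0 < p < 1] either [r] vanishes eventually, or
    [r >= c eps] and the quotient is at least a constant times [eps^(p - 1)], which diverges because
    [p < 1]. *)
Lemma quotient_cvg p a A1 A2 eps (N : nat -> \bar R) (r : nat -> R) : p != 0%R -> (p < 1)%R -> (0 <= a)%R ->
  (forall n, (0 < eps n)%R) -> eps @ \oo --> (0%R : R) ->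
  (\forall n \near \oo, [/\ N n = (r n)%:E, (0 <= r n)%R & (r n ^+ 2 = a ^+ 2 + eps n * A1 + eps n ^+ 2 * A2)%R]) ->
  (fun n => ((eps n)^-1)%:E * subx (u_ p (N n)) (u_ p a%:E)) @ \oo --> vd p a A1 A2.
Proof.
move=> p0 p1 a0 eps0 eps_cvg Hr; rewrite /vd.
case: ifPn => [apos|]; first exact: quotient_pos Hr.
rewrite -leNgt => ale; have {a0 ale} a0 : a = 0%R by apply/le_anti; rewrite ale.
rewrite {a}a0 in Hr *; have [pn|pp] /= := ltP p 0%R.
  apply: quotient_infty; apply: filterS Hr => n [-> r0 _].
  by rewrite subx_u0// gt0_muley// lte_fin invr_gt0.
have {pp} pp : (0 < p)%R by rewrite lt_neqAle eq_sym p0.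
have E n : N n = (r n)%:E -> (0 <= r n)%R -> ((eps n)^-1)%:E * subx (u_ p (N n)) (u_ p (0%R : R)%:E) = ((eps n)^-1 * (p^-1 * r n `^ p))%:E.
  move=> -> r0; rewrite !u_fin// eqxx/= (ltNge p) (ltW pp) andbF/= powR0// mulr0.
  by rewrite subx_EFin subr0.
have [A12|] := boolP ((A1 != 0%R) || (A2 != 0%R)).
  have [|c c0 rc] := quotient_lower eps0 eps_cvg _ A12 (r := r).
    by apply: filterS Hr => n [_ r0 ->]; rewrite expr0n/= add0r.
  have C : (0 < p^-1 * c `^ p)%R by rewrite mulr_gt0 ?invr_gt0 ?powR_gt0.
  have /cvgryPge L := powR_cvgy C p1 eps0 eps_cvg.
  apply/cvgeyPge => M; have LM := L M; near=> n.
  have [NE r0 _] : [/\ N n = (r n)%:E, (0 <= r n)%R & (r n ^+ 2 = 0 ^+ 2 + eps n * A1 + eps n ^+ 2 * A2)%R] by near: n.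
  rewrite E// lee_fin; apply: (@le_trans _ _ (p^-1 * c `^ p * eps n `^ (p - 1))%R); first by near: n.
  rewrite powRB; last by rewrite (gt_eqF (eps0 n)) implybT.
  rewrite powRr1 ?(ltW (eps0 n))// [leLHS]mulrA [leLHS]mulrC ler_pM2l ?invr_gt0//.
  rewrite -mulrA ler_pM2l ?invr_gt0// -powRM ?(ltW c0) ?(ltW (eps0 n))//.
  by apply: ge0_ler_powR; rewrite ?nnegrE ?(ltW pp)// ?mulr_ge0 ?(ltW c0) ?(ltW (eps0 n))//; near: n.
rewrite negb_or !negbK => /andP[/eqP A1_0 /eqP A2_0].
apply: cvg_near_cst; apply: filterS Hr => n [NE r0 rE]; rewrite E//.
have /eqP : (r n ^+ 2 = 0)%R by rewrite rE A1_0 A2_0 expr0n/= !mulr0 !addr0.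
by rewrite expf_eq0/= => /eqP ->; rewrite powR0// !mulr0.
Unshelve. all: by end_near. Qed.

(** The delicate case is [p < 0 < a], where [u_p(+oo) = 0] is finite: the difference is then the
    positive constant [- u_p(a)], and division by [eps] makes it diverge. *)
Lemma quotient_cvg_infty p a eps (N : nat -> \bar R) : p != 0%R -> (0 <= a)%R ->
  (forall n, (0 < eps n)%R) -> eps @ \oo --> (0%R : R) -> (\forall n \near \oo, N n = +oo) ->
  (fun n => ((eps n)^-1)%:E * subx (u_ p (N n)) (u_ p a%:E)) @ \oo --> +oo.
Proof.
move=> p0 a0 eps0 eps_cvg Noo.
have [pn|pp] := ltP p 0%R; last first.
  apply: quotient_infty; apply: filterS Noo => n ->.
  rewrite u_infty// u_fin// (ltNge p) pp andbF/= /subx/= /addx/=.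
  by rewrite gt0_muley// lte_fin invr_gt0.
have [apos|] := ltP 0%R a; last first.
  move=> ale; have -> : a = 0%R by apply/le_anti; rewrite ale.
  apply: quotient_infty; apply: filterS Noo => n ->.
  by rewrite subx_u0// gt0_muley// lte_fin invr_gt0.
have c0 : (0 < - (p^-1 * a `^ p))%R by rewrite oppr_gt0 nmulr_rlt0 ?powR_gt0 ?invr_lt0.
have eps1 : (fun n => - (p^-1 * a `^ p) * eps n `^ (0 - 1))%R @ \oo --> +oo%R.
  exact: powR_cvgy.
apply/cvgeyPge => M; near=> n.
have -> : N n = +oo by near: n.
rewrite u_infty// pn u_fin// (gt_eqF apos) -[0](erefl (0%R : R)%:E) subx_EFin lee_fin add0r.
rewrite mulrC -(powR_inv1 (ltW (eps0 n))) -[X in (eps n `^ X)%R](sub0r 1%R).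
by near: n; move/cvgryPge : eps1; apply.
Unshelve. all: by end_near. Qed.

End PowerQuotient.

(** The square is a homogeneous quadratic form in the two weights [1 - e / e0] and [e / e0];
    multiplying by [(1 - e / e0)^2] clears all denominators and leaves a quadratic polynomial in
    [e]. *)
Lemma perturbed_square (R : realType) (e e0 k Q QV QK B r y : R) : (0 < e)%R -> (e < e0)%R -> (0 < k)%R ->
  (B = QK - Q - QV)%R ->
  (y ^+ 2 = Q + (e / e0) / (1 - e / e0) / k * B + ((e / e0) / (1 - e / e0) / k) ^+ 2 * QV)%R ->
  (r = (1 - e / e0) * y)%R ->
  (r ^+ 2 = Q + e * ((B / k - 2 * Q) / e0) + e ^+ 2 * ((Q - B / k + QV / k ^+ 2) / e0 ^+ 2))%R.
Proof.
move=> e0' ee0 k0 BE yE ->; rewrite exprMn yE.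
have e00 : (e0 != 0)%R by rewrite gt_eqF// (lt_trans e0').
have : (e0 - e != 0)%R by rewrite subr_eq0 gt_eqF.
move: (gt_eqF k0) => /negbT k00 e0e.
by field; rewrite k00 e00 e0e.
Qed.

Section VerticalDerivative.
Variables (R : realType) (S : fmmst R).
Local Notation m := (refm S).
Hypothesis mink : inf_minkowskian S.
Implicit Types (f g u v w : S -> \bar R) (a b k : R).

(** The coefficient of [e] in [N(f + e g)^2], expressed through [v = f + e0 g]. The parameter [k] is
    there because [N(f + v)] may be infinite at points where [N(f + k v)] is finite for small
    [k]. *)
Definition pcoef1 f v (e0 k : R) x : R :=
  (((sq (line f v k) x - sq f x - sq (fscale k v) x) / k - 2 * sq f x) / e0)%R.

Definition pcoef2 f v (e0 k : R) x : R :=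
  ((sq f x - (sq (line f v k) x - sq f x - sq (fscale k v) x) / k + sq (fscale k v) x / k ^+ 2) / e0 ^+ 2)%R.

(** Substitute [g = (v - f) / e0] with [v = f + e0 g]: the perturbation becomes a convex combination
    of the causal functions [f] and [v], to which the results on half-lines apply. *)
Lemma perturbation_convex f g e0 e : (0 < e)%R -> (e < e0)%R ->
  fadd f (fscale e g) = fscale (1 - e / e0) (line f (fadd f (fscale e0 g)) ((e / e0) / (1 - e / e0))).
Proof.
move=> ep ee; have e00 : (0 < e0)%R by apply: lt_trans ee.
have s0 : (0 < e / e0)%R by rewrite divr_gt0.
have s1 : (0 < 1 - e / e0)%R by rewrite subr_gt0 ltr_pdivrMr// mul1r.
rewrite lineE fscaleDr ?(ltW s1)// fscaleA (mulrC (1 - e / e0)%R) divfK ?gt_eqF//.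
rewrite fscaleDr ?(ltW s0)// fscaleA divfK ?gt_eqF// faddA -fscaleDl ?(ltW s1) ?(ltW s0)//.
by rewrite subrK fscale1.
Qed.

Lemma causal_perturbation f g e0 e : causal_fun f -> causal_fun (fadd f (fscale e0 g)) ->
  (0 < e)%R -> (e < e0)%R -> causal_fun (fadd f (fscale e g)).
Proof.
move=> cf cv ep ee; rewrite (perturbation_convex f g ep ee).
have e00 : (0 < e0)%R by apply: lt_trans ee.
have s1 : (0 < 1 - e / e0)%R by rewrite subr_gt0 ltr_pdivrMr// mul1r.
apply: causal_fscale; first exact: ltW.
by apply: causal_line => //; rewrite ltW// !divr_gt0.
Qed.

Lemma perturbation_quad f g e0 k e : causal_fun f -> causal_fun (fadd f (fscale e0 g)) ->
  (0 < k)%R -> (0 < e)%R -> (e < e0)%R ->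
  {ae m, forall x, subslope (line f (fadd f (fscale e0 g)) k) x < +oo ->
    subslope (fadd f (fscale e g)) x < +oo /\
    (sq (fadd f (fscale e g)) x = sq f x + e * pcoef1 f (fadd f (fscale e0 g)) e0 k x +
      e ^+ 2 * pcoef2 f (fadd f (fscale e0 g)) e0 k x)%R}.
Proof.
move=> cf cv k0 ep ee; rewrite (perturbation_convex f g ep ee).
move: (fadd f (fscale e0 g)) cv => v cv.
have e00 : (0 < e0)%R by apply: lt_trans ee.
have s0 : (0 < e / e0)%R by rewrite divr_gt0.
have s1 : (0 < 1 - e / e0)%R by rewrite subr_gt0 ltr_pdivrMr// mul1r.
have r0 : (0 < e / e0 / (1 - e / e0) / k)%R by rewrite !divr_gt0.
have ckv : causal_fun (fscale k v) by apply: causal_fscale => //; exact: ltW.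
have L : line f v (e / e0 / (1 - e / e0)) = line f (fscale k v) (e / e0 / (1 - e / e0) / k).
  by rewrite !lineE fscaleA divfK ?gt_eqF.
have cL : causal_fun (line f v (e / e0 / (1 - e / e0))) by apply: causal_line => //; rewrite ltW// divr_gt0.
apply: filterS2 (subslope_scale s1 cL) (quad mink cf ckv (ltW r0)) => x sE; rewrite -lineE => /[apply].
rewrite -L => -[LF LE]; have sF : subslope (fscale (1 - e / e0) (line f v (e / e0 / (1 - e / e0)))) x < +oo.
  by rewrite sE (slE cL LF) -EFinM ltry.
split => //.
rewrite /pcoef1 /pcoef2 [LHS]sqE.
apply: (perturbed_square (y := sl (line f v (e / e0 / (1 - e / e0))) x) ep ee k0 erefl).
  by rewrite -sqE.
by rewrite (sl_fine sE) (slE cL LF).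
Qed.

Lemma perturbation_infinite f g e0 e : causal_fun f -> causal_fun (fadd f (fscale e0 g)) ->
  (0 < e)%R -> (e < e0)%R ->
  {ae m, forall x, (forall n, subslope (line f (fadd f (fscale e0 g)) n.+1%:R^-1) x = +oo) ->
    subslope (fadd f (fscale e g)) x = +oo}.
Proof.
move=> cf cv ep ee; rewrite (perturbation_convex f g ep ee).
move: (fadd f (fscale e0 g)) cv => v cv.
have e00 : (0 < e0)%R by apply: lt_trans ee.
have s1 : (0 < 1 - e / e0)%R by rewrite subr_gt0 ltr_pdivrMr// mul1r.
have t0 : (0 < e / e0 / (1 - e / e0))%R by rewrite !divr_gt0.
have cL : causal_fun (line f v (e / e0 / (1 - e / e0))) by apply: causal_line => //; exact: ltW.
have [n nt] : exists n, (n.+1%:R^-1 <= e / e0 / (1 - e / e0))%R.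
  have [n] := ltr_add_invr t0; rewrite add0r => nt.
  by exists n; exact: ltW.
have n0 : (0 <= n.+1%:R^-1 :> R)%R by rewrite invr_ge0.
apply: filterS2 (subslope_scale s1 cL) (subslope_line_mono cf cv n0 nt) => x sE nE oo.
move: nE; rewrite oo leye_eq => /eqP nE; rewrite sE nE gt0_muley//.
Qed.

(** Either some [f + v / (n + 1)] has finite subslope at [x], and [N(f + e g)^2] is quadratic for
    small [e], or none has, and then [N(f + e g)] is infinite for all small [e]. The quantifiers
    place [I], [A1] and [A2] before [p], which is the source of the independence of [p]. *)
Lemma is_vderiv_explicit f g : causal_fun f -> pert f g ->
  exists (I : S -> Prop) (A1 A2 : S -> R), forall p, p != 0%R -> (p < 1)%R ->
    is_vderiv p g f (fun x => if subslope f x == +oo then 0 else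
      if `[< I x >] then vd p (sl f x) (A1 x) (A2 x) else +oo).
Proof.
move=> cf [_ [e0 e00 cv]].
pose v := fadd f (fscale e0 g).
pose fin x n := subslope (line f v n.+1%:R^-1) x < +oo.
pose kx x : nat := xget 0%N [set n | fin x n].
have kxP x : (exists n, fin x n) -> fin x (kx x) by move=> [n fn]; exact: (@xgetPex _ 0%N [set n | fin x n] (ex_intro _ n fn)).
exists (fun x => exists n, fin x n), (fun x => pcoef1 f v e0 (kx x).+1%:R^-1 x),
  (fun x => pcoef2 f v e0 (kx x).+1%:R^-1 x) => p p0 p1 eps eps0 eps_cvg.
have small : \forall n \near \oo, (eps n < e0)%R by apply: (cvgr_lt _ eps_cvg).
have H1 : {ae m, forall x, forall n (k : nat), (eps n < e0)%R -> fin x k ->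
    subslope (fadd f (fscale (eps n) g)) x < +oo /\
    (sq (fadd f (fscale (eps n) g)) x = sq f x + eps n * pcoef1 f v e0 k.+1%:R^-1 x +
      eps n ^+ 2 * pcoef2 f v e0 k.+1%:R^-1 x)%R}.
  apply: ae_foralln => n; apply: ae_foralln => k.
  have [en|en] := ltP (eps n) e0; last by apply: aeW => x F; discriminate F.
  have k0 : (0 < k.+1%:R^-1 :> R)%R by rewrite invr_gt0.
  by apply: filterS (perturbation_quad cf cv k0 (eps0 n) en) => x Hx _ /Hx.
have H2 : {ae m, forall x, forall n, (eps n < e0)%R -> (forall k : nat, subslope (line f v k.+1%:R^-1) x = +oo) ->
    subslope (fadd f (fscale (eps n) g)) x = +oo}.
  apply: ae_foralln => n; have [en|en] := ltP (eps n) e0; last by apply: aeW => x F; discriminate F.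
  by apply: filterS (perturbation_infinite cf cv (eps0 n) en) => x Hx _ /Hx.
apply: filterS2 H1 H2 => x H1 H2; split; last by move=> ->; rewrite eqxx.
move=> fx; rewrite (lt_eqF fx) (slE cf fx).
case: asboolP => [/kxP fk|nf].
  apply: (quotient_cvg (r := fun n => sl (fadd f (fscale (eps n) g)) x)) => //; first exact: sl_ge0.
  apply: filterS small => n en; have [NF NE] := H1 n _ en fk.
  have cn := causal_perturbation cf cv (eps0 n) en.
  by split; [exact: slE|exact: sl_ge0|rewrite -!sqE].
apply: quotient_cvg_infty => //; first exact: sl_ge0.
apply: filterS small => n en; apply: H2 => // k; apply: contrapT => kf; apply: nf.
by exists k; rewrite /fin lt_neqAle leey andbT; apply/eqP.
Qed.

Lemma vderivP p f g : p != 0%R -> (p < 1)%R -> causal_fun f -> pert f g ->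
  is_vderiv p g f (vderiv p g f).
Proof.
move=> p0 p1 cf pg; have [I [A1 [A2 /(_ p p0 p1) HD]]] := is_vderiv_explicit cf pg.
exact: (@xgetPex _ _ [set D | is_vderiv p g f D] (ex_intro _ _ HD)).
Qed.

Lemma is_vderiv_unique p f g D D' : is_vderiv p g f D -> is_vderiv p g f D' -> {ae m, forall x, D x = D' x}.
Proof.
pose eps n : R := n.+1%:R^-1%R => HD HD'.
have eps0 n : (0 < eps n)%R by rewrite invr_gt0.
have eps_cvg : eps @ \oo --> (0%R : R) by exact: cvg_harmonic.
apply: filterS2 (HD eps eps0 eps_cvg) (HD' eps eps0 eps_cvg) => x [D1 D2] [D1' D2'].
have [fx|] := ltP (subslope f x) +oo; first exact: cvg_unique (D1 fx) (D1' fx).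
by rewrite leye_eq => /eqP fx; rewrite D2// D2'.
Qed.

(** Lets the derivative be read off any quadratic expansion that holds for small [e] on [X]. Limits
    are unique, so the single sequence [e1 / (n + 2)], which stays strictly below [e1], is
    enough. *)
Lemma vderiv_quadratic p f g e1 (X : S -> Prop) (A1 A2 : S -> R) : p != 0%R -> (p < 1)%R ->
  causal_fun f -> pert f g -> (0 < e1)%R ->
  (forall e, (0 < e)%R -> (e < e1)%R -> causal_fun (fadd f (fscale e g)) /\
    {ae m, forall x, X x -> subslope (fadd f (fscale e g)) x < +oo /\
      (sq (fadd f (fscale e g)) x = sq f x + e * A1 x + e ^+ 2 * A2 x)%R}) ->
  {ae m, forall x, X x -> subslope f x < +oo -> vderiv p g f x = vd p (sl f x) (A1 x) (A2 x)}.
Proof.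
move=> p0 p1 cf pg e10 H.
pose eps n : R := (e1 / n.+2%:R)%R.
have eps0 n : (0 < eps n)%R by rewrite divr_gt0.
have eps1 n : (eps n < e1)%R by rewrite ltr_pdivrMr// ltr_pMr// ltr1n.
have eps_cvg : eps @ \oo --> (0%R : R).
  rewrite -(mulr0 e1); apply: cvgMl_tmp.
  by have := @cvg_harmonic R; rewrite -cvg_shiftS.
have Hn n := H _ (eps0 n) (eps1 n).
have H1 : {ae m, forall x n, X x -> subslope (fadd f (fscale (eps n) g)) x < +oo /\
      (sq (fadd f (fscale (eps n) g)) x = sq f x + eps n * A1 x + eps n ^+ 2 * A2 x)%R}.
  by apply: ae_foralln => n; have [] := Hn n.
apply: filterS2 H1 (vderivP p0 p1 cf pg eps0 eps_cvg) => x H1 [H2 _] Xx fx.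
apply: cvg_unique (H2 fx) _ => //; rewrite (slE cf fx).
apply: (quotient_cvg (r := fun n => sl (fadd f (fscale (eps n) g)) x)) => //; first exact: sl_ge0.
apply: nearW => n; have [NF NE] := H1 n Xx; have cn := (Hn n).1.
by split; [exact: slE|exact: sl_ge0|rewrite -!sqE].
Qed.

Lemma dplus_vd p f g x A1 A2 : causal_fun f -> 0 < subslope f x -> subslope f x < +oo ->
  vderiv p g f x = vd p (sl f x) A1 A2 -> dplus p g f x = (A1 / 2)%:E.
Proof.
move=> cf f0 fx; rewrite /dplus => ->; move: f0; rewrite (slE cf fx) lte_fin => f0.
rewrite /vd f0 /epow (gt_eqF f0)/= -EFinM; congr EFin.
rewrite !mulrA -(opprB p 2%R) powRN mulVf ?mul1r// gt_eqF// powR_gt0//.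
Qed.

Lemma dplus_independent p p' f g : p != 0%R -> (p < 1)%R -> p' != 0%R -> (p' < 1)%R ->
  causal_fun f -> pert f g ->
  {ae m, forall x, 0 < subslope f x -> subslope f x < +oo -> dplus p g f x = dplus p' g f x}.
Proof.
move=> p0 p1 p'0 p'1 cf pg; have [I [A1 [A2 HD]]] := is_vderiv_explicit cf pg.
have D1 := is_vderiv_unique (vderivP p0 p1 cf pg) (HD p p0 p1).
have D2 := is_vderiv_unique (vderivP p'0 p'1 cf pg) (HD p' p'0 p'1).
apply: filterS2 D1 D2 => x D D' f0 fx.
move: D D'; rewrite (lt_eqF fx); case: asboolP => Ix D D'.
  by rewrite (dplus_vd cf f0 fx D) (dplus_vd cf f0 fx D').
(* Here both derivatives are [+oo], and so are their products with positive finite powers of the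
   subslope. *)
rewrite /dplus D D' (slE cf fx); move: f0; rewrite (slE cf fx) lte_fin => f0.
by rewrite /epow (gt_eqF f0)/= !gt0_muley ?lte_fin ?powR_gt0.
Qed.

Lemma quad2 u v a b : causal_fun u -> causal_fun v -> (0 < a)%R -> (0 <= b)%R ->
  {ae m, forall x, subslope (fadd u v) x < +oo ->
    subslope (fadd (fscale a u) (fscale b v)) x < +oo /\
    (sq (fadd (fscale a u) (fscale b v)) x = a ^+ 2 * sq u x +
       a * b * (sq (fadd u v) x - sq u x - sq v x) + b ^+ 2 * sq v x)%R}.
Proof.
move=> cu cv a0 b0; have ba : (0 <= b / a)%R by rewrite divr_ge0// ltW.
have -> : fadd (fscale a u) (fscale b v) = fscale a (line u v (b / a)).
  by rewrite lineE fscaleDr ?(ltW a0)// fscaleA (mulrC a) divfK ?gt_eqF.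
have cL := causal_line cu cv ba.
apply: filterS2 (subslope_scale a0 cL) (quad mink cu cv ba) => x sE /[apply] -[LF LE].
have sF : subslope (fscale a (line u v (b / a))) x < +oo by rewrite sE (slE cL LF) -EFinM ltry.
split=> //; rewrite [LHS]sqE (sl_fine sE) (slE cL LF)/=.
rewrite exprMn -sqE LE; move: (sq u x) (sq v x) (sq (fadd u v) x) => U V W.
by field; rewrite gt_eqF.
Qed.

Lemma pert_causal f g : causal_fun f -> causal_fun g -> pert f g.
Proof. by move=> cf cg; split; [exact: cg.1|exists 1%R => //; apply: causal_fadd => //; rewrite fscale1]. Qed.

Lemma dplus_causal p f g : p != 0%R -> (p < 1)%R -> causal_fun f -> causal_fun g ->
  {ae m, forall x, 0 < subslope f x -> subslope (fadd f g) x < +oo ->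
    dplus p g f x = ((sq (fadd f g) x - sq f x - sq g x) / 2)%:E}.
Proof.
move=> p0 p1 cf cg.
have H : forall e, (0 < e)%R -> (e < 1)%R -> causal_fun (fadd f (fscale e g)) /\
    {ae m, forall x, subslope (fadd f g) x < +oo -> subslope (fadd f (fscale e g)) x < +oo /\
      (sq (fadd f (fscale e g)) x = sq f x + e * (sq (fadd f g) x - sq f x - sq g x) + e ^+ 2 * sq g x)%R}.
  move=> e e0 _; split; first by apply: causal_fadd => //; exact: causal_fscale (ltW e0) cg.
  by have := quad mink cf cg (ltW e0); rewrite lineE.
have := vderiv_quadratic p0 p1 cf (pert_causal cf cg) ltr01 H.
apply: filterS2 (subslope_le_fadd cf cg) => x fle D f0 fgx.
have fx := le_lt_trans fle fgx.
exact: dplus_vd (D fgx fx).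
Qed.

Lemma dplus_linear p f g h a b : p != 0%R -> (p < 1)%R -> (0 <= a)%R -> (0 <= b)%R ->
  causal_fun f -> causal_fun g -> causal_fun h ->
  {ae m, forall x, 0 < subslope f x -> subslope (fadd (fadd f g) h) x < +oo ->
    dplus p (fadd (fscale a g) (fscale b h)) f x =
      ((a * (sq (fadd f g) x - sq f x - sq g x) + b * (sq (fadd f h) x - sq f x - sq h x)) / 2)%:E}.
Proof.
move=> p0 p1 a0 b0 cf cg ch; have cfg := causal_fadd cf cg.
have cw : causal_fun (fadd (fscale a g) (fscale b h)) by apply: causal_fadd; exact: causal_fscale.
pose A2 x := (a ^+ 2 * sq g x + b ^+ 2 * sq h x + a * b * (sq (fadd g h) x - sq g x - sq h x))%R.
have H : forall e, (0 < e)%R -> (e < 1)%R -> causal_fun (fadd f (fscale e (fadd (fscale a g) (fscale b h)))) /\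
    {ae m, forall x, subslope (fadd (fadd f g) h) x < +oo -> subslope (fadd f (fscale e (fadd (fscale a g) (fscale b h)))) x < +oo /\
      (sq (fadd f (fscale e (fadd (fscale a g) (fscale b h)))) x = sq f x + e * (a * (sq (fadd f g) x - sq f x - sq g x) + b * (sq (fadd f h) x - sq f x - sq h x)) + e ^+ 2 * A2 x)%R}.
  move=> e e0 _; split; first by apply: causal_fadd => //; exact: causal_fscale (ltW e0) cw.
  have -> : fadd f (fscale e (fadd (fscale a g) (fscale b h))) = line (line f g (e * a)) h (e * b).
    by rewrite !lineE (fscaleDr _ _ (ltW e0)) !fscaleA faddA.
  have := quad3 mink cf cg ch (mulr_ge0 (ltW e0) a0) (mulr_ge0 (ltW e0) b0).
  apply: filterS => x /[apply] -[LF ->]; split=> //; rewrite /A2.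
  move: (sq f x) (sq g x) (sq h x) (sq (fadd f g) x) (sq (fadd f h) x) (sq (fadd g h) x) => F G H FG FH GH; ring.
have := vderiv_quadratic p0 p1 cf (pert_causal cf cw) ltr01 H.
apply: filterS3 (subslope_le_fadd cf cg) (subslope_le_fadd cfg ch) => x fle fgle D f0 fgx.
have fx := le_lt_trans (le_trans fle fgle) fgx.
exact: dplus_vd (D fgx fx).
Qed.

Lemma dplus_cone p f g h a b : p != 0%R -> (p < 1)%R -> (0 <= a)%R -> (0 <= b)%R ->
  causal_fun f -> causal_fun g -> causal_fun h ->
  {ae m, forall x,
    0 < Order.min (subslope f x) (Order.min (subslope g x) (subslope h x)) ->
    subslope (fadd (fadd f g) h) x < +oo ->
    dplus p g f x = dplus p f g x /\
    dplus p (fadd (fscale a g) (fscale b h)) f x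
      = addx (a%:E * dplus p g f x) (b%:E * dplus p h f x)}.
Proof.
move=> p0 p1 a0 b0 cf cg ch; have cfg := causal_fadd cf cg; have cfh := causal_fadd cf ch.
have E1 : subslope (fadd g f) = subslope (fadd f g).
  by apply: feq_subslope => //; [exact: causal_fadd|exact: feq_faddC].
have E2 : subslope (fadd (fadd f h) g) = subslope (fadd (fadd f g) h).
  apply: feq_subslope; try exact: causal_fadd.
  by rewrite -!faddA; apply: feq_fadd; [exact: feq_refl|exact: feq_faddC].
move: (dplus_causal p0 p1 cf cg); apply: filter_app; move: (dplus_causal p0 p1 cg cf); apply: filter_app.
move: (dplus_causal p0 p1 cf ch); apply: filter_app.
apply: filterS3 (subslope_le_fadd cfg ch) (subslope_le_fadd cfh cg) (dplus_linear p0 p1 a0 b0 cf cg ch).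
move=> x l1 l2 DL Dfh Dgf Dfg.
rewrite !lt_min => /and3P[f0 g0 h0] fin.
have fgx := le_lt_trans l1 fin; have fhx : subslope (fadd f h) x < +oo by apply: le_lt_trans l2 _; rewrite E2.
have gfx : subslope (fadd g f) x < +oo by rewrite E1.
move: (DL f0 fin) (Dfg f0 fgx) (Dfh f0 fhx) (Dgf g0 gfx) => -> -> -> ->.
rewrite (sq_eq E1) {DL Dfg Dfh Dgf}; split; first by congr EFin; ring.
rewrite /addx/= -!EFinM -EFinD; congr EFin.
by move: (sq f x) (sq g x) (sq h x) (sq (fadd f g) x) (sq (fadd f h) x) => F G H FG FH; ring.
Qed.

Section Opposite.
Variables (f g : S -> \bar R) (e0 e1 : R).
Hypotheses (cf : causal_fun f) (e00 : (0 < e0)%R) (e10 : (0 < e1)%R).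
Hypotheses (cv : causal_fun (fadd f (fscale e0 g))) (cu : causal_fun (fadd f (fscale e1 (fopp g)))).
Hypothesis fg_fin : {ae m, forall x, f x \is a fin_num -> g x \is a fin_num}.

(** The weights are chosen so that in [u + v] the multiples [- e0 e1 / (e0 + e1)] and
    [+ e0 e1 / (e0 + e1)] of [g] cancel and [f] remains. *)
Let u := fscale (e0 / (e0 + e1)) (fadd f (fscale e1 (fopp g))).
Let v := fscale (e1 / (e0 + e1)) (fadd f (fscale e0 g)).

Let e01 : (0 < e0 + e1)%R. Proof. exact: addr_gt0. Qed.

Let cu' : causal_fun u.
Proof. by apply: causal_fscale cu; rewrite ltW// divr_gt0. Qed.

Let cv' : causal_fun v.
Proof. by apply: causal_fscale cv; rewrite ltW// divr_gt0. Qed.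

(** The cancellation takes place in the reals: [fg_fin] provides it at the points where [f] is
    finite, and [feq] asks for nothing where both sides are infinite. *)
Lemma opposite_sum : feq (fadd u v) f.
Proof.
apply: filterS fg_fin => x gf; rewrite /u /v !(faddE, fscaleE) /fopp => H.
have ff : f x \is a fin_num by case: H => //; rewrite addx_fin => /andP[]; rewrite fscale_fin ?addx_fin; [case/andP|rewrite gt_eqF// divr_gt0].
have := gf ff; move: (f x) (g x) ff => [a| |] [b| |] //= _ _.
rewrite /addx/=; congr EFin; field; rewrite gt_eqF//.
Qed.

Lemma opposite_pos s : (0 < s)%R -> (s < e0)%R ->
  feq (fadd f (fscale s g)) (fadd (fscale (1 - s / e0) u) (fscale (1 + s / e1) v)).
Proof.
move=> s0 se; have s1 : (0 < 1 - s / e0)%R by rewrite subr_gt0 ltr_pdivrMr// mul1r.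
apply: filterS fg_fin => x gf; rewrite /u /v !(faddE, fscaleE) /fopp => H.
have ff : f x \is a fin_num.
  case: H; rewrite addx_fin => /andP[]// H _; move: H.
  by rewrite !fscale_fin ?addx_fin ?gt_eqF ?divr_gt0// => /andP[].
have := gf ff; move: (f x) (g x) ff => [a| |] [b| |] //= _ _.
rewrite /addx/=; congr EFin; field.
by rewrite !gt_eqF.
Qed.

Lemma opposite_neg s : (0 < s)%R -> (s < e0)%R -> (s < e1)%R ->
  feq (fadd f (fscale s (fopp g))) (fadd (fscale (1 + s / e0) u) (fscale (1 - s / e1) v)).
Proof.
move=> s0 se se1; have s1 : (0 < 1 + s / e0)%R by rewrite addr_gt0// divr_gt0.
apply: filterS fg_fin => x gf; rewrite /u /v !(faddE, fscaleE) /fopp => H.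
have ff : f x \is a fin_num.
  case: H; rewrite addx_fin => /andP[]// H _; move: H.
  by rewrite !fscale_fin ?addx_fin ?gt_eqF ?divr_gt0// => /andP[].
have := gf ff; move: (f x) (g x) ff => [a| |] [b| |] //= _ _.
rewrite /addx/=; congr EFin; field.
by rewrite !gt_eqF.
Qed.

Let QB x := (sq (fadd u v) x - sq u x - sq v x)%R.

(* f = u + v, and f + s g, f - s g are both combinations of u and v: one and the same
   quadratic polynomial gives |d(f + s g)|^2 on both sides of s = 0. *)
Lemma opposite_quad s : (0 < s)%R -> (s < Num.min e0 e1)%R ->
  (causal_fun (fadd f (fscale s g)) /\ {ae m, forall x, subslope f x < +oo -> subslope (fadd f (fscale s g)) x < +oo /\
    (sq (fadd f (fscale s g)) x = sq f x + s * (2 * (sq v x / e1 - sq u x / e0) + QB x * (e1^-1 - e0^-1)) +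
      s ^+ 2 * (sq u x / e0 ^+ 2 + sq v x / e1 ^+ 2 - QB x / (e0 * e1)))%R}) /\
  (causal_fun (fadd f (fscale s (fopp g))) /\ {ae m, forall x, subslope f x < +oo -> subslope (fadd f (fscale s (fopp g))) x < +oo /\
    (sq (fadd f (fscale s (fopp g))) x = sq f x + s * - (2 * (sq v x / e1 - sq u x / e0) + QB x * (e1^-1 - e0^-1)) +
      s ^+ 2 * (sq u x / e0 ^+ 2 + sq v x / e1 ^+ 2 - QB x / (e0 * e1)))%R}).
Proof.
move=> s0; rewrite lt_min => /andP[se0 se1].
have cp := causal_perturbation cf cv s0 se0.
have cn := causal_perturbation cf cu s0 se1.
have Ef : subslope (fadd u v) = subslope f by apply: feq_subslope opposite_sum => //; exact: causal_fadd.
have s1 : (0 < 1 - s / e0)%R by rewrite subr_gt0 ltr_pdivrMr// mul1r.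
have s2 : (0 < 1 - s / e1)%R by rewrite subr_gt0 ltr_pdivrMr// mul1r.
have s3 : (0 < 1 + s / e0)%R by rewrite addr_gt0// divr_gt0.
have s4 : (0 < 1 + s / e1)%R by rewrite addr_gt0// divr_gt0.
have cs a b : (0 < a)%R -> (0 < b)%R -> causal_fun (fadd (fscale a u) (fscale b v)).
  by move=> a0 b0; apply: causal_fadd; apply: causal_fscale => //; exact: ltW.
have Ep : subslope (fadd f (fscale s g)) = subslope (fadd (fscale (1 - s / e0) u) (fscale (1 + s / e1) v)).
  by apply: feq_subslope (opposite_pos s0 se0) => //; exact: cs.
have En : subslope (fadd f (fscale s (fopp g))) = subslope (fadd (fscale (1 + s / e0) u) (fscale (1 - s / e1) v)).
  by apply: feq_subslope (opposite_neg s0 se0 se1) => //; exact: cs.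
have alg (U V F : R) : (0 < e0)%R -> (0 < e1)%R ->
    ((1 - s / e0) ^+ 2 * U + (1 - s / e0) * (1 + s / e1) * (F - U - V) + (1 + s / e1) ^+ 2 * V =
     F + s * (2 * (V / e1 - U / e0) + (F - U - V) * (e1^-1 - e0^-1)) + s ^+ 2 * (U / e0 ^+ 2 + V / e1 ^+ 2 - (F - U - V) / (e0 * e1)) /\
    (1 + s / e0) ^+ 2 * U + (1 + s / e0) * (1 - s / e1) * (F - U - V) + (1 - s / e1) ^+ 2 * V =
     F + s * - (2 * (V / e1 - U / e0) + (F - U - V) * (e1^-1 - e0^-1)) + s ^+ 2 * (U / e0 ^+ 2 + V / e1 ^+ 2 - (F - U - V) / (e0 * e1)))%R.
  by move=> a0 b0; split; field; rewrite !gt_eqF.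
split; split => //.
  apply: filterS (quad2 cu' cv' s1 (ltW s4)) => x; rewrite Ef => /[apply] -[LF LE].
  rewrite Ep; split=> //; rewrite (sq_eq Ep) LE /QB (sq_eq Ef).
  by have [-> _] := alg (sq u x) (sq v x) (sq f x) e00 e10.
apply: filterS (quad2 cu' cv' s3 (ltW s2)) => x; rewrite Ef => /[apply] -[LF LE].
rewrite En; split=> //; rewrite (sq_eq En) LE /QB (sq_eq Ef).
by have [_ ->] := alg (sq u x) (sq v x) (sq f x) e00 e10.
Qed.

Lemma vderiv_opposite_aux p : p != 0%R -> (p < 1)%R -> pert f g -> pert f (fopp g) ->
  {ae m, forall x, 0 < subslope f x -> - vderiv p (fopp g) f x = vderiv p g f x}.
Proof.
move=> p0 p1 pg pn; have me : (0 < Num.min e0 e1)%R by rewrite lt_min e00.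
have Dp := vderiv_quadratic p0 p1 cf pg me (fun s s0 s1 => (opposite_quad s0 s1).1).
have Dn := vderiv_quadratic p0 p1 cf pn me (fun s s0 s1 => (opposite_quad s0 s1).2).
pose eps n : R := n.+1%:R^-1%R.
have eps0 n : (0 < eps n)%R by rewrite invr_gt0.
have eps_cvg : eps @ \oo --> (0%R : R) by exact: cvg_harmonic.
move: Dp; apply: filter_app; move: Dn; apply: filter_app.
apply: filterS2 (vderivP p0 p1 cf pg eps0 eps_cvg) (vderivP p0 p1 cf pn eps0 eps_cvg) => x [_ Hp] [_ Hn] Dn Dp f0.
have [fx|] := ltP (subslope f x) +oo; last by rewrite leye_eq => /eqP fx; rewrite Hp// Hn// oppe0.
(* Where the subslope is positive, [vd] is linear in [A1], hence odd; at subslope 0 it would be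
   even. *)
rewrite Dp// Dn// /vd; move: f0; rewrite (slE cf fx) lte_fin => ->.
by rewrite -EFinN mulrN mulNr opprK.
Qed.

End Opposite.

Lemma vderiv_opposite p f g : p != 0%R -> (p < 1)%R -> causal_fun f -> pert f g -> pert f (fopp g) ->
  {ae m, forall x, f x \is a fin_num -> g x \is a fin_num} ->
  {ae m, forall x, 0 < subslope f x -> - vderiv p (fopp g) f x = vderiv p g f x}.
Proof.
move=> p0 p1 cf pg pn fg; have [_ [e0 e00 cv]] := pg; have [_ [e1 e10 cu]] := pn.
exact: (vderiv_opposite_aux cf e00 e10 cv cu fg).
Qed.

End VerticalDerivative.

#[local] Transparent subslope fadd fscale line sl sq.

(** * Representation of initial gradients *)

Section SetwiseConvergence.
Variables (R : realType) (S : fmmst R) (pi : probability (curves S) R) (C T : R).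
Local Notation m := (refm S).
Local Notation dist := (@bdist R S).
Implicit Types (A B K U V : set S) (t : R).
Hypotheses (C0 : (0 < C)%R) (T0 : (0 < T)%R).
Hypothesis lawC : forall t, (0 <= t)%R -> (t <= T)%R ->
  forall A : set (borel S), measurable A -> pushforward pi (ev t) A <= C%:E * m A.
Hypothesis narrow : forall phi : S -> R, continuous phi ->
  (exists K : R, forall x, (`|phi x| <= K)%R) ->
  (fun t : R => \int[pi]_c (phi (ev t c))%:E) @ 0^'+ --> \int[pi]_c (phi (ev 0 c))%:E.

Definition law pi t A : R := fine (pi (ev t @^-1` (A : set (borel S)))).

Lemma measurable_ev_preimage t (A : set (borel S)) : measurable A -> measurable (ev t @^-1` A : set (curves S)).
Proof. by move=> mA; rewrite -[X in measurable X]setTI; exact: measurable_ev. Qed.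

Lemma lawE t (A : set (borel S)) : measurable A -> pi (ev t @^-1` A) = (law pi t A)%:E.
Proof. by move=> mA; rewrite /law fineK// fin_num_measure//; exact: measurable_ev_preimage. Qed.

Lemma law_le t (A B : set (borel S)) : measurable A -> measurable B -> A `<=` B -> (law pi t A <= law pi t B)%R.
Proof.
move=> mA mB AB; rewrite -lee_fin -!lawE// le_measure ?inE//; try exact: measurable_ev_preimage.
by move=> c; exact: AB.
Qed.

Lemma law_setD t (A B : set (borel S)) : measurable A -> measurable B -> B `<=` A ->
  law pi t (A `\` B) = (law pi t A - law pi t B)%R.
Proof.
move=> mA mB BA; apply: EFin_inj; rewrite EFinB -!lawE//; last exact: measurableD.
rewrite (_ : ev t @^-1` (A `\` B) = ev t @^-1` A `\` ev t @^-1` B)//.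
have mpA := measurable_ev_preimage t mA; have mpB := measurable_ev_preimage t mB.
rewrite measureD//; last by rewrite ltey_eq fin_num_measure.
by congr (_ - pi _); apply/seteqP; split => [c [] //|c Bc]; split=> //; exact: BA.
Qed.

Lemma law_compression t (A : set (borel S)) e : (0 <= t)%R -> (t <= T)%R -> measurable A -> m A <= e%:E ->
  (law pi t A <= C * e)%R.
Proof.
move=> t0 tT mA mAe; rewrite -lee_fin -lawE//; apply: le_trans (lawC t0 tT mA) _.
by rewrite EFinM lee_wpmul2l// lee_fin ltW.
Qed.

Lemma law_increasing t (F : nat -> set (borel S)) (A : set (borel S)) e : (0 < e)%R -> measurable A ->
  (forall n, measurable (F n)) -> nondecreasing_seq F -> \bigcup_n F n = A ->
  exists n, (law pi t A - e < law pi t (F n))%R.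
Proof.
move=> e0 mA mF ndF FA.
have mG n : measurable (ev t @^-1` F n : set (curves S)) by exact: measurable_ev_preimage.
have ndG : nondecreasing_seq (fun n => ev t @^-1` F n : set (curves S)).
  by move=> n k nk; apply/subsetPset => c; have /subsetPset := ndF n k nk; exact.
have GU : \bigcup_n (ev t @^-1` F n) = ev t @^-1` A :> set (curves S) by rewrite -FA preimage_bigcup.
have := nondecreasing_cvg_mu (mu := pi) mG _ ndG; rewrite GU => /(_ (measurable_ev_preimage t mA)) cv.
have {}cv : (fun n => law pi t (F n)) @ \oo --> law pi t A.
  have cv2 : (fun n => pi (ev t @^-1` F n)) @ \oo --> (law pi t A)%:E by rewrite -lawE.
  exact: (fine_cvg cv2).
have : \forall n \near \oo, (law pi t A - e < law pi t (F n))%R.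
  by apply: (cvgr_gt _ cv); rewrite gtrBl.
by case=> n _ /(_ n (leqnn n)); exists n.
Qed.

(** The portmanteau bound for open sets: [V] is exhausted by the sets [phi > 1 / (n + 1)], and the
    bounded continuous function [min 1 ((n + 1) phi)] lies between the indicators of such a set and
    of [V]. *)
Lemma law_open (V : set S) e : open V -> (0 < e)%R -> \forall t \near 0^'+, (law pi 0 V - e < law pi t V)%R.
Proof.
move=> oV e0; have [phi [lip phi01 Vphi]] := open_lipschitz oV.
pose F n : set S := [set x | (n.+1%:R^-1 < phi x)%R].
have mV : measurable (V : set (borel S)) by exact: borel_open.
have mF n : measurable (F n : set (borel S)) by apply: borel_open; exact: lipschitz_gt_open.
have ndF : nondecreasing_seq F.
  move=> n k nk; apply/subsetPset => x; rewrite /F/=; apply: le_lt_trans.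
  by rewrite lef_pV2 ?posrE// ler_nat.
have FV : \bigcup_n F n = V.
  apply/seteqP; split => x.
    by move=> [n _ /= nx]; apply/Vphi; rewrite (lt_trans _ nx)// invr_gt0.
  move=> /Vphi x0; have [n] := ltr_add_invr x0; rewrite add0r => nx.
  by exists n.
have e20 : (0 < e / 2)%R by rewrite divr_gt0.
have [n nF] := @law_increasing 0%R F V (e / 2)%R e20 mV mF ndF FV.
pose psi x : R := Num.min 1%R (n.+1%:R * phi x)%R.
have phi0 x : (0 <= phi x)%R by have /andP[] := phi01 x.
have psi0 x : (0 <= psi x)%R by rewrite le_min ler01/= mulr_ge0.
have psi1 x : (psi x <= 1)%R by rewrite ge_min lexx.
have cphi : continuous phi by exact: lipschitz_continuous.
have cpsi : continuous psi.
  move=> x; apply: (@continuous_min R S (cst 1%R) (fun x => n.+1%:R * phi x)%R x).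
    exact: cvg_cst.
  by apply: cvgMl_tmp; exact: cphi.
have mpsi t : measurable_fun [set: curves S] (fun c => (psi (ev t c))%:E).
  apply/measurable_EFinP; apply: measurable_minr; first exact: measurable_cst.
  apply: measurable_funM; first exact: measurable_cst.
  exact: (measurableT_comp (lipschitz_borel lip) (measurable_ev t)).
have psi_le t : \int[pi]_c (psi (ev t c))%:E <= (law pi t V)%:E.
  rewrite -(lawE t mV) -(setIT (ev t @^-1` V)) -integral_indic//; last exact: measurable_ev_preimage.
  apply: ge0_le_integral => //.
  - by move=> c _; rewrite lee_fin.
  - by apply/measurable_EFinP; apply: measurable_indic; exact: measurable_ev_preimage.
  move=> c _; rewrite lee_fin indicE; case: (boolP (c \in _)) => //= cV.
  have : ~ V (ev t c) by move=> Vc; move/negP : cV; apply; rewrite inE.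
  move=> nV; have -> : psi (ev t c) = 0%R => //.
  have : phi (ev t c) = 0%R by apply/eqP; rewrite eq_le phi0 andbT leNgt; apply/negP => /Vphi.
  by rewrite /psi => ->; rewrite mulr0 min_r.
have psi_ge : (law pi 0 (F n))%:E <= \int[pi]_c (psi (ev 0 c))%:E.
  rewrite -(lawE 0 (mF n)) -(setIT (ev 0 @^-1` F n)) -integral_indic//; last exact: measurable_ev_preimage.
  apply: ge0_le_integral => //.
    by apply/measurable_EFinP; apply: measurable_indic; exact: measurable_ev_preimage.
  move=> c _; rewrite lee_fin indicE; case: (boolP (c \in _)) => //= cV.
  move: cV; rewrite inE/= /F/= => nphi; rewrite /psi le_min lexx/= mulrC -ler_pdivrMr//.
  by rewrite mul1r ltW.
have psib : exists K : R, forall x, (`|psi x| <= K)%R by exists 1%R => x; rewrite ger0_norm.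
have cv := narrow cpsi psib.
have : \forall t \near 0^'+, (law pi 0 (F n) - e / 2)%:E < \int[pi]_c (psi (ev t c))%:E.
  apply: (cv _ (open_ereal_gt' _)); apply: lt_le_trans psi_ge; rewrite lte_fin; lra.
apply: filterS => t /lt_le_trans => /(_ _ (psi_le t)); rewrite lte_fin; lra.
Qed.

Lemma inner_compact (A : set (borel S)) e : measurable A -> m A < +oo -> (0 < e)%R ->
  exists K : set S, [/\ compact K, K `<=` A, measurable (K : set (borel S)) & m (A `\` K) <= e%:E].
Proof.
move=> mA Afin e0; have [_ rad] := refm_radon S.
have Af : m A \is a fin_num by rewrite ge0_fin_numE.
have : m A - e%:E < ereal_sup [set m K | K in [set K : set S | compact K /\ K `<=` A]].
  by rewrite -rad// lteBlDr// lteDl// lte_fin.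
move=> /ereal_sup_gt[_ [K [cK KA] <-] AK].
have mK : measurable (K : set (borel S)).
  rewrite -(setCK K); apply: measurableC; apply: borel_open; apply: closed_openC.
  exact: compact_closed (@hausdorff_carrier R S) cK.
exists K; split => //.
rewrite measureD//; have -> : A `&` K = K by apply/setIidPr.
have Kf : m K \is a fin_num by rewrite ge0_fin_numE// (le_lt_trans _ Afin)// le_measure ?inE.
by move: AK; rewrite leeBlDr// lteBlDr// addeC => /ltW.
Qed.

(* The laws at small times are below C m, so narrow convergence improves to setwise
   convergence: A contains a compact set that is m-close to an open neighbourhood. *)
Lemma law_setwise (A : set (borel S)) e : measurable A -> (0 < e)%R ->
  \forall t \near 0^'+, (law pi 0 A - e < law pi t A)%R.
Proof.
move=> mA e0; have [F [oF finF FT]] := refm_open_cover S.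
pose U n : set S := \bigcup_(k < n) F k.
have oU n : open (U n) by apply: bigcup_open => k _; exact: oF.
have mU n : measurable (U n : set (borel S)) by exact: borel_open.
have ndU : nondecreasing_seq U.
  by move=> n k nk; apply/subsetPset => x [i /= ik Fi]; exists i => //=; exact: leq_trans nk.
have UT : \bigcup_n (U n `&` A) = A.
  apply/seteqP; split => [x [n _ []//]|x Ax].
  have [k _ Fk] : (\bigcup_n F n) x by rewrite FT.
  by exists k.+1 => //; split=> //; exists k => /=.
(* The losses below are [d] for the truncation to [U n], [C d] for the compact [K], [d] for the open
   set [V] and [C d] for [V] without [K]; together they make [e]. *)
pose d : R := (e / (2 + 2 * C))%R.
have d0 : (0 < d)%R by rewrite divr_gt0// addr_gt0// mulr_gt0.
have [n nA] : exists n, (law pi 0 A - d < law pi 0 (U n `&` A))%R.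
  apply: law_increasing => //; first by move=> n; exact: measurableI.
  by move=> i j ij; apply/subsetPset; apply: setSI; apply/subsetPset; exact: ndU.
have finU : m (U n) < +oo.
  elim: n {nA} => [|n IH]; first by rewrite /U bigcup_mkord big_ord0 measure0.
  rewrite /U bigcup_mkord big_ord_recr/= -bigcup_mkord.
  apply: (@le_lt_trans _ _ (m (U n) + m (F n))); last exact: lte_add_pinfty.
  by apply: measureU2; [exact: mU|exact: borel_open].
have mUA : measurable (U n `&` A : set (borel S)) by exact: measurableI.
have finUA : m (U n `&` A) < +oo by apply: le_lt_trans finU; rewrite le_measure ?inE//; exact: subIsetl.
have [K [cK KUA mK mKe]] := inner_compact mUA finUA d0.
have mUK : measurable (U n `\` K : set (borel S)) by exact: measurableD.
have finUK : m (U n `\` K) < +oo by apply: le_lt_trans finU; rewrite le_measure ?inE//; exact: subDsetl.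
have [K2 [cK2 K2U mK2 mK2e]] := inner_compact mUK finUK d0.
(* Outer regularity obtained from inner regularity: removing from [U n] a compact set that nearly
   fills [U n] minus [K] leaves an open neighbourhood of [K] with excess at most [d]. *)
pose V := U n `\` K2.
have oV : open V.
  apply: openI; first exact: oU.
  by apply: closed_openC; exact: compact_closed (@hausdorff_carrier R S) cK2.
have mV : measurable (V : set (borel S)) by exact: borel_open.
have KV : K `<=` V by move=> x Kx; split; [have [] := KUA x Kx|move=> /K2U[]].
have VK : V `\` K = (U n `\` K) `\` K2.
  by apply/seteqP; split => x [[? ?] ?]; split.
have T' : \forall t \near 0^'+, (t <= T)%R by exact: nbhs_right_le.
have P' : \forall t \near 0^'+, (0 <= t :> R)%R by exact: nbhs_right_ge.
near=> t.
have t0 : (0 <= t)%R by near: t.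
have tT : (t <= T)%R by near: t.
have L1 : (law pi 0 V - d < law pi t V)%R by near: t; exact: law_open.
have L2 : (law pi t K <= law pi t A)%R by apply: law_le => // x /KUA[].
have L3 : (law pi t (V `\` K) <= C * d)%R.
  by apply: law_compression => //; [exact: measurableD|rewrite VK].
have L4 : (law pi 0 K <= law pi 0 V)%R by exact: law_le.
have L5 : (law pi 0 ((U n `&` A) `\` K) <= C * d)%R.
  by apply: law_compression => //; [exact: ltW|exact: measurableD].
rewrite (law_setD _ mV mK KV) in L3; rewrite (law_setD _ mUA mK KUA) in L5.
have E : ((2 + 2 * C) * d = e)%R by rewrite /d mulrC divfK// gt_eqF// addr_gt0// mulr_gt0.
rewrite -E; lra.
Unshelve. all: by end_near. Qed.

Lemma integral_cst_pi (k : R) : \int[pi]_c cst k%:E c = k%:E.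
Proof. by rewrite (integral_cst pi measurableT) -[RHS]mule1; congr (_ * _); exact: probability_setT. Qed.

Lemma integral_ev_le1 t (psi : S -> R) : measurable_fun (setT : set (borel S)) psi ->
  (forall x, (0 <= psi x <= 1)%R) -> \int[pi]_c (psi (ev t c))%:E = (fine (\int[pi]_c (psi (ev t c))%:E))%:E.
Proof.
move=> mpsi psi01; have mp : measurable_fun [set: curves S] (fun c => (psi (ev t c))%:E).
  by apply/measurable_EFinP; exact: (measurableT_comp mpsi (measurable_ev t)).
have p0 c : 0 <= (psi (ev t c))%:E by rewrite lee_fin; have /andP[] := psi01 (ev t c).
rewrite fineK// ge0_fin_numE; last exact: integral_ge0.
apply: (@le_lt_trans _ _ (\int[pi]_c cst 1 c)).
  apply: ge0_le_integral => //; move=> c _; rewrite lee_fin; have /andP[] := psi01 (ev t c) => //.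
by rewrite integral_cst_pi ltry.
Qed.

Lemma sum_indic_lt (n : nat) (z : R) : (0 <= z)%R -> (z <= n%:R)%R ->
  (z <= \sum_(i < n) (i%:R < z)%R%:R)%R /\ (\sum_(i < n) (i%:R < z)%R%:R <= z + 1)%R.
Proof.
elim: n z => [|n IH] z z0 zn; first by rewrite big_ord0 zn addr_ge0.
rewrite big_ord_recr/=; have [nz|nz] := ltP (n%:R)%R z; last first.
  by rewrite addr0; exact: IH.
have -> : (\sum_(i < n) (i%:R < z)%R%:R = n%:R :> R)%R.
  rewrite (eq_bigr (fun=> 1%R)) ?sumr_const ?card_ord// => i _.
  by rewrite (le_lt_trans _ nz)// ler_nat ltnW.
by move: zn nz; rewrite -natr1 mulr1n => zn nz; split; lra.
Qed.

Lemma staircase_bounds (y : R) (n : nat) : (0 <= y <= 1)%R ->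
  let s := (n.+1%:R^-1 * \sum_(i < n.+1) (i%:R / n.+1%:R < y)%R%:R)%R in
  (y <= s)%R /\ (s <= y + n.+1%:R^-1)%R.
Proof.
move=> /andP[y0 y1] /=.
have n0 : (0 < n.+1%:R :> R)%R by [].
have [l1 l2] : (y * n.+1%:R <= \sum_(i < n.+1) (i%:R < y * n.+1%:R)%R%:R)%R /\
    (\sum_(i < n.+1) (i%:R < y * n.+1%:R)%R%:R <= y * n.+1%:R + 1)%R.
  by apply: sum_indic_lt; [exact: mulr_ge0|rewrite ler_piMl].
rewrite (eq_bigr (fun i : 'I_n.+1 => (i%:R < y * n.+1%:R)%R%:R)); last by move=> i _; rewrite ltr_pdivrMr.
rewrite mulrC; split; first by rewrite ler_pdivlMr.
by rewrite ler_pdivrMr// mulrDl mulVf// gt_eqF.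
Qed.

(** Up to [1 / (n + 1)] the function is an average of finitely many indicators of superlevel sets,
    so setwise convergence applies to it. *)
Lemma law_unit_lower (psi : S -> R) e : measurable_fun (setT : set (borel S)) psi ->
  (forall x, (0 <= psi x <= 1)%R) -> (0 < e)%R ->
  \forall t \near 0^'+, \int[pi]_c (psi (ev 0 c))%:E - e%:E <= \int[pi]_c (psi (ev t c))%:E.
Proof.
move=> mpsi psi01 e0.
have [n] : exists n, (n.+1%:R^-1 < e / 2 :> R)%R.
  have e20 : (0 < e / 2)%R by rewrite divr_gt0.
  by have [n] := ltr_add_invr e20; rewrite add0r => nt; exists n.
move=> ne; pose B (i : 'I_n.+1) : set (borel S) := psi @^-1` `](i%:R / n.+1%:R)%R, +oo[.
have mB i : measurable (B i).
  by rewrite -[X in measurable X]setTI; apply: mpsi => //; exact: measurable_itv.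
have n0 : (0 < n.+1%:R^-1 :> R)%R by rewrite invr_gt0.
pose st x : R := (n.+1%:R^-1 * \sum_(i < n.+1) (i%:R / n.+1%:R < psi x)%R%:R)%R.
have st0 x : (0 <= st x)%R by rewrite mulr_ge0 ?(ltW n0)// sumr_ge0.
pose s t : R := (n.+1%:R^-1 * \sum_(i < n.+1) law pi t (B i))%R.
have BE t i c : (c \in ev t @^-1` B i) = (i%:R / n.+1%:R < psi (ev t c))%R.
  by apply/idP/idP; rewrite inE/= /B/= in_itv/= andbT.
have mI t (i : 'I_n.+1) : measurable_fun [set: curves S] (fun c => (i%:R / n.+1%:R < psi (ev t c))%R%:R : R).
  rewrite (_ : (fun c => _) = \1_(ev t @^-1` B i)); last first.
    by apply/funext => c; rewrite indicE BE.
  by apply: measurable_indic; exact: measurable_ev_preimage.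
have mst t : measurable_fun [set: curves S] (fun c => (st (ev t c))%:E).
  apply/measurable_EFinP; apply: measurable_funM; first exact: measurable_cst.
  by apply: measurable_sum => i; exact: mI.
have mp t : measurable_fun [set: curves S] (fun c => (psi (ev t c))%:E).
  by apply/measurable_EFinP; exact: (measurableT_comp mpsi (measurable_ev t)).
have psi0 x : (0 <= psi x)%R by have /andP[] := psi01 x.
have sE t : (s t)%:E = \int[pi]_c (st (ev t c))%:E.
  under eq_integral do rewrite EFinM -sumEFin.
  rewrite ge0_integralZl//; last first.
  - by move=> c _; apply: sume_ge0 => i _; rewrite lee_fin.
  - by apply: emeasurable_sum => i; apply/measurable_EFinP; exact: mI.
  rewrite ge0_integral_sum//; last by move=> i; apply/measurable_EFinP; exact: mI.
  rewrite /s EFinM -sumEFin; congr (_ * _); apply: eq_bigr => i _.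
  rewrite -(lawE t (mB i)) -(setIT (ev t @^-1` B i)) -integral_indic//; last exact: measurable_ev_preimage.
  by apply: eq_integral => c _; rewrite indicE BE.
have s_le t : \int[pi]_c (psi (ev t c))%:E <= (s t)%:E.
  rewrite sE; apply: ge0_le_integral => //; move=> c _; rewrite lee_fin//.
  by have [] := staircase_bounds n (psi01 (ev t c)).
have s_ge t : (s t)%:E <= \int[pi]_c (psi (ev t c))%:E + (n.+1%:R^-1)%:E.
  rewrite sE -[X in _ <= _ + X]integral_cst_pi.
  rewrite -ge0_integralD//; last first.
  - by move=> c _; rewrite lee_fin ltW.
  - by move=> c _; rewrite lee_fin.
  apply: ge0_le_integral => //.
  - by move=> c _; rewrite lee_fin.
  - by apply: emeasurable_funD => //; exact: measurable_cst.
  move=> c _; rewrite -EFinD lee_fin//.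
  by have [] := staircase_bounds n (psi01 (ev t c)).
have e20 : (0 < e / 2)%R by rewrite divr_gt0.
have H : \forall t \near 0^'+, forall i : 'I_n.+1, (law pi 0 (B i) - e / 2 < law pi t (B i))%R.
  by apply: filter_forall => i; exact: law_setwise.
apply: filterS H => t H.
have st' : (s 0%R - e / 2 <= s t)%R.
  rewrite /s -[X in (_ - X)%R](mulKf (x := n.+1%:R)) ?pnatr_eq0// -mulrBr ler_pM2l//.
  rewrite (_ : (n.+1%:R * (e / 2) = \sum_(i < n.+1) (e / 2))%R); last first.
    by rewrite sumr_const card_ord mulr_natl.
  by rewrite -sumrB; apply: ler_sum => i _; exact: ltW.
move: (integral_ev_le1 0 mpsi psi01) (integral_ev_le1 t mpsi psi01) (s_le 0%R) (s_ge t).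
move: (\int[pi]_c (psi (ev 0 c))%:E) (\int[pi]_c (psi (ev t c))%:E) => I0 It -> ->.
rewrite -!EFinD !lee_fin; move: ne st'.
move: (n.+1%:R^-1 : R)%R (s 0%R) (s t) (fine I0) (fine It) => u v w i0 it; lra.
Qed.

(** The lower bound for [1 - psi] is the upper bound for [psi]. *)
Lemma law_unit_cvg (psi : S -> R) e : measurable_fun (setT : set (borel S)) psi ->
  (forall x, (0 <= psi x <= 1)%R) -> (0 < e)%R ->
  \forall t \near 0^'+, (`|fine (\int[pi]_c (psi (ev t c))%:E) - fine (\int[pi]_c (psi (ev 0 c))%:E)| <= e)%R.
Proof.
move=> mpsi psi01 e0; pose psi' x := (1 - psi x)%R.
have mpsi' : measurable_fun (setT : set (borel S)) psi' by apply: measurable_funB => //; exact: measurable_cst.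
have psi'01 x : (0 <= psi' x <= 1)%R by have /andP[? ?] := psi01 x; apply/andP; rewrite /psi'; split; lra.
have sum1 t : (fine (\int[pi]_c (psi (ev t c))%:E) + fine (\int[pi]_c (psi' (ev t c))%:E) = 1)%R.
  apply: EFin_inj; rewrite EFinD -!integral_ev_le1// -ge0_integralD//; last first.
  - by apply/measurable_EFinP; exact: (measurableT_comp mpsi' (measurable_ev t)).
  - by move=> c _; rewrite lee_fin; have /andP[] := psi'01 (ev t c).
  - by apply/measurable_EFinP; exact: (measurableT_comp mpsi (measurable_ev t)).
  - by move=> c _; rewrite lee_fin; have /andP[] := psi01 (ev t c).
  by rewrite -[RHS](integral_cst_pi 1); apply: eq_integral => c _; rewrite -EFinD /psi' addrC subrK.
apply: filterS2 (law_unit_lower mpsi psi01 e0) (law_unit_lower mpsi' psi'01 e0) => t.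
move: (sum1 0%R) (sum1 t); rewrite (integral_ev_le1 0 mpsi psi01) (integral_ev_le1 t mpsi psi01).
rewrite (integral_ev_le1 0 mpsi' psi'01) (integral_ev_le1 t mpsi' psi'01) -!EFinD !lee_fin/=.
move: (fine _) (fine _) (fine _) (fine _) => a b c d ab cd h1 h2.
rewrite ler_norml; apply/andP; split; lra.
Qed.

Variable E : set (borel S).
Hypotheses (mE : measurable E) (stayE : forall t, (0 <= t)%R -> (t <= T)%R -> pushforward pi (ev t) (~` E) = 0).

Lemma law_ge0_integral t (psi : S -> \bar R) : (0 <= t)%R -> (t <= T)%R ->
  measurable_fun (setT : set (borel S)) psi -> (forall x, 0 <= psi x) ->
  \int[pi]_c psi (ev t c) <= C%:E * \int[m]_(x in E) psi x.
Proof.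
move=> t0 tT mpsi psi0.
pose psiE x := psi x * (\1_E x)%:E.
have mpsiE : measurable_fun (setT : set (borel S)) psiE.
  by apply: emeasurable_funM => //; apply/measurable_EFinP; exact: measurable_indic.
have psiE0 x : 0 <= psiE x by rewrite mule_ge0.
have -> : \int[pi]_c psi (ev t c) = \int[pi]_c psiE (ev t c).
  apply: ae_eq_integral_nm => //; exists (ev t @^-1` (~` E)); split.
  - exact: measurable_ev_preimage (measurableC mE).
  - exact: stayE.
  - move=> c /= H Ec; apply: H => _; rewrite /psiE indicE mem_set// mule1//.
have mt : measurable_fun [set: curves S] (ev t : curves S -> borel S) := measurable_ev t.
have -> : \int[pi]_c psiE (ev t c) = \int[pushforward pi (ev t)]_x psiE x.
  by rewrite ge0_integral_pushforward.
have -> : \int[m]_(x in E) psi x = \int[m]_x psiE x.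
  by rewrite (integral_mkcond E); apply: eq_integral => x _; rewrite epatch_indic.
have C0' : (0 <= C)%R by exact: ltW.
rewrite -[C]/(NngNum C0')%:num -ge0_integral_mscale//.
by apply: ge0_le_measure_integral => // A mA; exact: lawC.
Qed.

(** Truncation at height [n + 1]: the truncated part, divided by [n + 1], has values in [[0, 1]],
    and the compression bound controls the integral of the tail by [C] times its integral over [E],
    uniformly in [t]. *)
Lemma law_integrable_cvg (psi : S -> \bar R) :
  measurable_fun (setT : set (borel S)) psi -> (forall x, 0 <= psi x) ->
  \int[m]_(x in E) psi x < +oo ->
  (fun t : R => \int[pi]_c psi (ev t c)) @ 0^'+ --> \int[pi]_c psi (ev 0 c).
Proof.
move=> mpsi psi0 fin.
have fint t : (0 <= t)%R -> (t <= T)%R -> \int[pi]_c psi (ev t c) \is a fin_num.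
  move=> t0 tT; rewrite ge0_fin_numE; last exact: integral_ge0.
  apply: le_lt_trans (law_ge0_integral t0 tT mpsi psi0) _.
  by rewrite lte_mul_pinfty ?lee_fin ?(ltW C0).
have T' : \forall t \near 0^'+, (t <= T)%R by exact: nbhs_right_le.
have P' : \forall t \near 0^'+, (0 <= t :> R)%R by exact: nbhs_right_ge.
rewrite -(fineK (fint 0%R (lexx _) (ltW T0))); apply/fine_cvgP; split.
  by apply: filterS2 T' P' => t tT t0; exact: fint.
pose tail n x := psi x - mine (psi x) n.+1%:R%:E.
have mmin n : measurable_fun (setT : set (borel S)) (fun x => mine (psi x) n.+1%:R%:E).
  by apply: measurable_mine => //; exact: measurable_cst.
have min0 n x : 0 <= mine (psi x) n.+1%:R%:E by rewrite le_min psi0 lee_fin ler0n.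
have minfin n x : mine (psi x) n.+1%:R%:E \is a fin_num.
  by rewrite ge0_fin_numE// gt_min ltry orbT.
have mtail n : measurable_fun (setT : set (borel S)) (tail n) by exact: emeasurable_funB.
have tail0 n x : 0 <= tail n x by rewrite /tail leeBrDr// add0e ge_min lexx.
have tail_le n x : tail n x <= psi x by rewrite /tail leeBlDr// leeDl.
have split_ n x : psi x = mine (psi x) n.+1%:R%:E + tail n x by rewrite /tail addeC subeK.
have psi_int : m.-integrable E psi.
  apply/integrableP; split; first exact: measurable_funTS.
  by under eq_integral do rewrite gee0_abs//.
have tail_cvg : (fun n => \int[m]_(x in E) tail n x) @ \oo --> 0.
  rewrite -(integral0 m E); have [] // := @dominated_convergence _ _ _ m E mE tail (cst 0) psi _ _ _ psi_int _.
  - by move=> n; exact: measurable_funTS (mtail n).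
  - apply: filterS (integrable_ae mE psi_int) => x fx Ex.
    apply: cvg_near_cst; exists (Num.bound (fine (psi x))) => // n /= ln.
    rewrite /tail min_l ?subee ?fx// -(fineK (fx Ex)) lee_fin ltW//.
    by rewrite (lt_le_trans (archi_boundP (fine_ge0 (psi0 x))))// ler_nat ltnW.
  - by apply: aeW => x n _; rewrite gee0_abs.
apply/cvgrPdist_le => e e0.
(* After compression the tails at time [t] and at time 0 lie between 0 and [e / 3], and another
   [e / 3] is granted to the truncated part. *)
have [n tn] : exists n, \int[m]_(x in E) tail n x <= (e / 3 / C)%:E.
  have c0 : 0 < (e / 3 / C)%:E by rewrite lte_fin !divr_gt0.
  have [n _ /(_ n (leqnn n)) Hn] := tail_cvg _ (open_ereal_lt' c0).
  by exists n; exact: ltW.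
pose u x : R := (fine (mine (psi x) n.+1%:R%:E) / n.+1%:R)%R.
have uE x : mine (psi x) n.+1%:R%:E = n.+1%:R%:E * (u x)%:E.
  by rewrite -EFinM /u mulrC divfK// fineK.
have mu : measurable_fun (setT : set (borel S)) u.
  apply: measurable_funM; last exact: measurable_cst.
  exact: (measurableT_comp (fine_measurable measurableT) (mmin n)).
have u01 x : (0 <= u x <= 1)%R.
  apply/andP; split; first by rewrite divr_ge0// fine_ge0.
  by rewrite ler_pdivrMr// mul1r -lee_fin fineK// ge_min lexx orbT.
have n0 : (0 < n.+1%:R :> R)%R by [].
have en0 : (0 < e / 3 / n.+1%:R)%R by rewrite !divr_gt0.
have JE t : (0 <= t)%R -> (t <= T)%R -> exists2 b : R, (0 <= b <= e / 3)%R &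
    \int[pi]_c psi (ev t c) = (n.+1%:R * fine (\int[pi]_c (u (ev t c))%:E) + b)%:E.
  move=> t0 tT; have bl : 0 <= \int[pi]_c tail n (ev t c) by exact: integral_ge0.
  have bu : \int[pi]_c tail n (ev t c) <= (e / 3)%:E.
    apply: le_trans (law_ge0_integral t0 tT (mtail n) (tail0 n)) _.
    apply: (@le_trans _ _ (C%:E * (e / 3 / C)%:E)); first by rewrite lee_wpmul2l// lee_fin ltW.
    by rewrite -EFinM mulrC divfK ?gt_eqF.
  have bf : \int[pi]_c tail n (ev t c) \is a fin_num by rewrite ge0_fin_numE// (le_lt_trans bu)// ltry.
  exists (fine (\int[pi]_c tail n (ev t c))); first by rewrite -!lee_fin fineK// bl.
  rewrite EFinD EFinM (fineK bf) -(integral_ev_le1 t mu u01) -ge0_integralZl//; last first.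
  - by move=> c _; rewrite lee_fin; have /andP[] := u01 (ev t c).
  - by apply/measurable_EFinP; exact: (measurableT_comp mu (measurable_ev t)).
  rewrite -ge0_integralD//; last first.
  - exact: (measurableT_comp (mtail n) (measurable_ev t)).
  - apply: emeasurable_funM; first exact: measurable_cst.
    by apply/measurable_EFinP; exact: (measurableT_comp mu (measurable_ev t)).
  - by move=> c _; rewrite mule_ge0// lee_fin; have /andP[] := u01 (ev t c).
  by apply: eq_integral => c _; rewrite -uE -split_.
apply: filterS3 T' P' (law_unit_cvg mu u01 en0) => t tT t0.
have [b /andP[b0 b1] Et] := JE t t0 tT; have [b' /andP[b'0 b'1] E0] := JE 0%R (lexx _) (ltW T0).
rewrite /= Et E0/= {Et E0}; move: (fine _) (fine _) b b' b0 b1 b'0 b'1 => x y b b' b0 b1 b'0 b'1.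
rewrite ler_pdivlMr// => H.
have {H} : (`|n.+1%:R * x - n.+1%:R * y| <= e / 3)%R by rewrite distrC -mulrBr normrM (gtr0_norm n0) mulrC.
rewrite !ler_norml; move: (n.+1%:R * x)%R (n.+1%:R * y)%R => X Y /andP[h1 h2].
apply/andP; split; lra.
Qed.

End SetwiseConvergence.

(** * Extended powers and the reverse Young inequality *)

Section ExtendedPowers.
Variable R : realType.
Implicit Types (p q : R) (x y v : \bar R).

Lemma epow_ge0 x p : 0 <= epow x p.
Proof. by case: x => [x| |] //=; case: ifP => // _; rewrite ?lee_fin ?powR_ge0. Qed.

Lemma epow_pos (a : R) p : (0 < a)%R -> epow a%:E p = (a `^ p)%:E.
Proof. by move=> a0; rewrite /epow gt_eqF. Qed.

Lemma epowM (k : R) x p : (0 < k)%R -> 0 <= x -> epow (k%:E * x) p = (k `^ p)%:E * epow x p.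
Proof.
move=> k0; have kp : (0 < k `^ p)%R by rewrite powR_gt0.
case: x => [x| |] //; last first.
  by rewrite gt0_muley ?lte_fin//= => _; case: ifP => _; rewrite ?mule0// gt0_muley ?lte_fin.
rewrite lee_fin => x0; rewrite -EFinM /= mulf_eq0 gt_eqF//=.
by case: ifP => _; [rewrite gt0_muley ?lte_fin|rewrite -EFinM powRM ?(ltW k0)].
Qed.

Lemma epow_le p x y : (0 < p)%R -> 0 <= x -> x <= y -> epow x p <= epow y p.
Proof.
move=> p0; case: x y => [x| |] [y| |] //=; rewrite ?(ltNge p) ?(ltW p0)/= ?andbF ?leey//.
by rewrite !lee_fin => x0 xy; apply: ge0_ler_powR; rewrite ?nnegrE ?(ltW p0)// (le_trans x0).
Qed.

Lemma epow_anti p x y : (p < 0)%R -> 0 <= x -> x <= y -> epow y p <= epow x p.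
Proof.
move=> p0; case: x y => [x| |] [y| |] //=; rewrite ?p0/= ?andbT//; last first.
  by move=> x0 _; case: ifP => // _; rewrite lee_fin powR_ge0.
move=> x0 xy; rewrite !lee_fin in x0 xy; have [_|xn0] := eqVneq x 0%R; first by rewrite leey.
have xpos : (0 < x)%R by rewrite lt_neqAle eq_sym xn0.
have ypos := lt_le_trans xpos xy; rewrite gt_eqF// lee_fin.
rewrite -(opprK p) !(powRN _ (- p)%R) lef_pV2 ?posrE ?powR_gt0//.
by apply: ge0_ler_powR; rewrite ?nnegrE ?oppr_ge0 ?(ltW p0) ?(ltW xpos) ?(ltW ypos).
Qed.

Lemma measurable_epow d (T : measurableType d) (f : T -> \bar R) p :
  measurable_fun setT f -> (forall t, 0 <= f t) -> measurable_fun setT (fun t => epow (f t) p).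
Proof.
move=> mf f0.
have -> : (fun t => epow (f t) p) =
    (fun t => if f t < +oo then if 0 < f t then (fine (f t) `^ p)%:E else epow 0 p else epow +oo p).
  apply/funext => t; case: (f t) (f0 t) => [r| |] //; rewrite lee_fin ltry lte_fin => r0.
  case: ltP => [rp|rn]; first by rewrite epow_pos.
  by have -> : r = 0%R by apply/le_anti; rewrite rn.
apply: measurable_fun_ifT => //; first exact: measurable_fun_lte.
apply: measurable_fun_ifT => //; first exact: measurable_fun_lte.
apply/measurable_EFinP.
exact: (measurableT_comp (measurable_powR p) (measurableT_comp (fine_measurable measurableT) mf)).
Qed.

(** The ordinary Young inequality for the factors [(a b)^p] and [b^(- p)], whose product is [a^p],
    with the conjugate exponents [1 / p] and [1 / (1 - p)]. *)
Lemma reverse_young_pos p q (a b : R) : (0 < p)%R -> (p < 1)%R -> (p^-1 + q^-1 = 1)%R ->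
  (0 < a)%R -> (0 < b)%R -> (p^-1 * a `^ p <= a * b + (- q)^-1 * b `^ q)%R.
Proof.
move=> p0 p1 pq a0 b0.
have q1 : (q^-1 = (p - 1) / p)%R by rewrite -(addKr p^-1%R q^-1%R) pq; field; rewrite gt_eqF.
have qE : (q = p / (p - 1))%R by rewrite -[LHS]invrK q1 invf_div.
have p'0 : (0 < 1 - p)%R by rewrite subr_gt0.
have ab : (0 <= a * b)%R by rewrite ltW// mulr_gt0.
have := @conjugate_powR R ((a * b) `^ p)%R (b `^ (- p))%R p^-1%R (1 - p)^-1%R (powR_ge0 _ _) (powR_ge0 _ _).
rewrite !invr_gt0 !invrK subrKC => /(_ p0 p'0 erefl).
rewrite -!powRrM divff ?gt_eqF// (powRr1 ab) powRM ?(ltW a0) ?(ltW b0)// -mulrA -powRD; last first.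
  by rewrite (gt_eqF b0) implybT.
rewrite subrr powRr0 mulr1 => H.
have -> : (b `^ q = b `^ (- p / (1 - p)))%R by congr (_ `^ _)%R; rewrite qE -(opprB 1%R p) invrN mulrN mulNr.
have -> : ((- q)^-1 = p^-1 * (1 - p))%R by rewrite invrN q1; field; rewrite gt_eqF.
rewrite ler_pdivrMl//; move: H; move: (a `^ p)%R (b `^ _)%R => A B H.
rewrite (_ : p * _ = a * b * p + B * (1 - p))%R//.
by field; rewrite gt_eqF.
Qed.

(** Since [q < 0], the term in [v] is kept on the right with the positive coefficient [(- q)^-1].
    All terms are then nonnegative and no difference of infinities can occur. *)
Lemma reverse_young p q x v : (0 < p)%R -> (p < 1)%R -> (p^-1 + q^-1 = 1)%R -> 0 <= x -> 0 <= v ->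
  (p^-1)%:E * epow x p <= x * v + ((- q)^-1)%:E * epow v q.
Proof.
move=> p0 p1 pq x0 v0.
have qn : (q < 0)%R.
  rewrite -invr_lt0; have : (1 < p^-1)%R by rewrite invf_gt1.
  by move: pq; move: (p^-1)%R (q^-1)%R => a b; lra.
have c0 : (0 < (- q)^-1)%R by rewrite invr_gt0 oppr_gt0.
have r0 : 0 <= ((- q)^-1)%:E * epow v q by rewrite mule_ge0 ?epow_ge0// lee_fin ltW.
case: v v0 r0 => [b| |] // v0 r0; last first.
  have [->|xn0] := eqVneq x 0.
    by rewrite mul0e /= eqxx (ltNge p) (ltW p0)/= powR0 ?gt_eqF// mule0 add0e.
  by rewrite gt0_muley ?lt_neqAle 1?eq_sym ?xn0// addye ?leey// gt_eqF// (lt_le_trans _ r0).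
move: v0; rewrite lee_fin le_eqVlt => /predU1P[b0|b0].
  by rewrite -b0 /= eqxx qn/= gt0_muley ?lte_fin// addey ?leey// mule0.
case: x x0 => [a| |] // x0; last by rewrite gt0_mulye ?lte_fin// addye ?leey// gt_eqF// (lt_le_trans _ r0).
move: x0; rewrite lee_fin le_eqVlt => /predU1P[a0|a0].
  have E0 : epow (0%R : R)%:E p = 0 by rewrite /= eqxx (ltNge p) (ltW p0)/= powR0 ?gt_eqF.
  by rewrite -a0 E0 mule0 mul0e add0e.
rewrite !epow_pos// -!EFinM -EFinD lee_fin; exact: reverse_young_pos.
Qed.

End ExtendedPowers.

Section FilterLimits.
Variables (R : realType) (T : choiceType) (X : filteredType T) (F : set_system X).
Context {FF : ProperFilter F}.
Implicit Types (u : X -> \bar R).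

Lemma limf_esup_lt u (x : \bar R) : limf_esup u F < x -> \forall t \near F, u t < x.
Proof.
move=> /ereal_inf_lt[_ [V FV <-]] Vx; apply: filterS FV => t Vt.
by apply: le_lt_trans Vx; apply: ereal_sup_ubound; exists t.
Qed.

Lemma limf_einf_gt u (x : \bar R) : x < limf_einf u F -> \forall t \near F, x < u t.
Proof.
rewrite /limf_einf lteNr => /limf_esup_lt; apply: filterS => t.
by rewrite /= lteN2.
Qed.

Lemma limf_einf_bounds u (a b : R) : (\forall t \near F, a%:E <= u t <= b%:E) ->
  a%:E <= limf_einf u F <= b%:E.
Proof.
move=> H; apply/andP; rewrite limf_einfE; split.
  apply: le_trans (ereal_sup_ubound _); last by exists (fun t => a%:E <= u t <= b%:E).
  by apply: le_ereal_inf_tmp => _ [t /andP[at_ _] <-].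
apply: ge_ereal_sup => _ [V FV <-]; have [t [Vt /andP[_ tb]]] := filter_ex (filterI FV H).
by apply: le_trans tb; apply: ereal_inf_lbound; exists t.
Qed.

End FilterLimits.


Section Average.
Variable R : realType.
Local Notation leb := (@lebesgue_measure R).

Lemma average_bounds (j : R -> \bar R) (J d t : R) : (0 < t)%R -> measurable_fun [set: R] j ->
  (forall r, 0 <= j r) -> (forall r, (0 <= r)%R -> (r <= t)%R -> (J - d)%:E <= j r <= (J + d)%:E) ->
  (t * (J - d))%:E <= \int[leb]_(r in `[0%R, t]) j r <= (t * (J + d))%:E.
Proof.
move=> t0 mj j0 H.
have I (k : R) : \int[leb]_(r in `[0%R, t]) cst k%:E r = (t * k)%:E.
  have L : leb (`[0%R, t]%classic : set R) = t%:E by rewrite lebesgue_measure_itv/= lte_fin t0 sube0.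
  by rewrite (integral_cst leb (measurable_itv _)) EFinM muleC; congr (_ * _); exact: L.
have mj' : measurable_fun (`[0%R, t]%classic : set R) j by exact: measurable_funTS.
apply/andP; split.
  apply: (@le_trans _ _ (t * Num.max (J - d) 0)%:E); first by rewrite lee_fin ler_pM2l// le_max lexx.
  rewrite -I; apply: ge0_le_integral => //; first by move=> r _; rewrite lee_fin le_max lexx orbT.
  move=> r /=; rewrite in_itv/= => /andP[r0 rt]; have /andP[h _] := H r r0 rt.
  by rewrite EFin_max ge_max h j0.
have Jd : (0 <= J + d)%R.
  have /andP[_ h] := H 0%R (lexx _) (ltW t0); by rewrite -lee_fin (le_trans (j0 0%R) h).
rewrite -I; apply: ge0_le_integral => //.
move=> r /=; rewrite in_itv/= => /andP[r0 rt]; by have /andP[] := H r r0 rt.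
Qed.

End Average.

Section SlopeComparison.
Variables (R : realType) (S : fmmst R).
Local Notation m := (refm S).
Hypothesis mink : inf_minkowskian S.
Implicit Types (f g : S -> \bar R).

(** [f + e g] is [1 - e / e0] times the sum of [f] and a causal function, and superadditivity
    discards the latter. *)
Lemma subslope_perturbation_ge f g e0 e : causal_fun f -> causal_fun (fadd f (fscale e0 g)) ->
  (0 < e)%R -> (e < e0)%R ->
  {ae m, forall x, (1 - e / e0)%:E * subslope f x <= subslope (fadd f (fscale e g)) x}.
Proof.
move=> cf cv ep ee; rewrite (perturbation_convex f g ep ee).
move: (fadd f (fscale e0 g)) cv => v cv; have e00 : (0 < e0)%R by apply: lt_trans ee.
have s1 : (0 < 1 - e / e0)%R by rewrite subr_gt0 ltr_pdivrMr// mul1r.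
have t0 : (0 <= e / e0 / (1 - e / e0))%R by rewrite ltW// !divr_gt0.
have cL := causal_line cf cv t0.
have c2 : causal_fun (fscale (e / e0 / (1 - e / e0)) v) by apply: causal_fscale.
apply: filterS2 (subslope_scale s1 cL) (subslope_le_fadd cf c2) => x ->.
by rewrite -lineE => H; rewrite lee_wpmul2l// lee_fin ltW.
Qed.

(** Adding the causal function [(e / e1) (f - e1 g)] to [f + e g] gives [(1 + e / e1) f], and
    superadditivity discards the added term. With the lower bound this provides the domination of
    the difference quotients. *)
Lemma subslope_perturbation_le f g e0 e1 e : causal_fun f -> causal_fun (fadd f (fscale e0 g)) ->
  causal_fun (fadd f (fscale e1 (fopp g))) -> (0 < e)%R -> (e < e0)%R -> (0 < e1)%R ->
  {ae m, forall x, f x \is a fin_num -> g x \is a fin_num} ->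
  {ae m, forall x, subslope (fadd f (fscale e g)) x <= (1 + e / e1)%:E * subslope f x}.
Proof.
move=> cf cv cu ep ee e10 fg.
have ce := causal_perturbation cf cv ep ee.
have s1 : (0 < 1 + e / e1)%R by rewrite addr_gt0// divr_gt0.
have s0 : (0 < e / e1)%R by rewrite divr_gt0.
have c1 : causal_fun (fscale (e / e1) (fadd f (fscale e1 (fopp g)))) by apply: causal_fscale => //; exact: ltW.
have c2 : causal_fun (fscale (1 + e / e1) f) by apply: causal_fscale => //; exact: ltW.
have E : subslope (fadd (fadd f (fscale e g)) (fscale (e / e1) (fadd f (fscale e1 (fopp g))))) = subslope (fscale (1 + e / e1) f).
  apply: feq_subslope => //; first exact: causal_fadd.
  apply: filterS fg => x gf; rewrite !(faddE, fscaleE) /fopp => H.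
  have ff : f x \is a fin_num.
    case: H; first by rewrite !addx_fin => /andP[/andP[]].
    by rewrite fscale_fin// gt_eqF.
  have := gf ff; move: (f x) (g x) ff => [a| |] [b| |] //= _ _.
  rewrite /addx/=; congr EFin; field; rewrite gt_eqF//.
by apply: filterS2 (subslope_scale s1 cf) (subslope_le_fadd ce c1) => x <-; rewrite E.
Qed.

Lemma epow_between p (k l : R) x y : p != 0%R -> (0 < k)%R -> (0 < l)%R -> 0 <= x ->
  k%:E * x <= y -> y <= l%:E * x ->
  if (0 < p)%R then (k `^ p)%:E * epow x p <= epow y p <= (l `^ p)%:E * epow x p
  else (l `^ p)%:E * epow x p <= epow y p <= (k `^ p)%:E * epow x p.
Proof.
move=> p0 k0 l0 x0 kxy ylx; have kx0 : 0 <= k%:E * x by rewrite mule_ge0// lee_fin ltW.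
have y0 := le_trans kx0 kxy; rewrite -!epowM//.
case: ifPn => [pp|]; first by rewrite !epow_le.
by rewrite -leNgt le_eqVlt (negbTE p0)/= => pn; rewrite !epow_anti.
Qed.

End SlopeComparison.
Section Increments.
Variables (R : realType) (S : fmmst R) (pi : probability (curves S) R) (T : R).
Local Notation m := (refm S).
Implicit Types (f g : S -> \bar R).
Hypothesis cp : compression_le pi T.

Lemma increment_version f (t : R) : causal_fun f -> (0 < t)%R -> (t <= T)%R ->
  exists F : curves S -> \bar R, [/\ measurable_fun setT F, forall c, 0 <= F c &
    {ae pi, forall c, F c = subx (f (ev t c)) (f (ev 0 c))}].
Proof.
move=> cf t0 tT; have [f' mf' ff'] := refm_version cf.1.
have mt s : measurable_fun [set: curves S] (fun c => f' (ev s c)).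
  exact: (measurableT_comp mf' (measurable_ev s)).
exists (fun c => subx (maxe (f' (ev t c)) (f' (ev 0 c))) (f' (ev 0 c))); split.
- apply: measurable_subx => //; first exact: measurable_maxe.
  by move=> c; rewrite le_max lexx orbT.
- by move=> c; apply: subx_ge0; rewrite le_max lexx orbT.
have T0 : (0 <= T)%R by rewrite (le_trans (ltW t0)).
apply: filterS2 (compression_ae cp (lexx _) T0 ff') (compression_ae cp (ltW t0) tT ff') => c -> ->.
by rewrite max_l//; apply: curve_causal_fun => //; exact: ltW.
Qed.

Lemma increments_linear f g (e0 e1 t : R) : causal_fun f -> refm_measurable g ->
  (0 < e0)%R -> causal_fun (fadd f (fscale e0 g)) ->
  (0 < e1)%R -> causal_fun (fadd f (fscale e1 (fopp g))) ->
  {ae m, forall x, f x \is a fin_num -> g x \is a fin_num} ->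
  (0 < t)%R -> (t <= T)%R -> \int[pi]_c ((t^-1)%:E * subx (f (ev t c)) (f (ev 0 c))) < +oo ->
  exists a b : R, [/\ \int[pi]_c ((t^-1)%:E * subx (f (ev t c)) (f (ev 0 c))) = (t^-1 * a)%:E,
    forall k : R, \int[pi]_c (k%:E * subx (g (ev t c)) (g (ev 0 c))) = (k * b)%:E,
    forall k : R, \int[pi]_c (k%:E * subx (fopp g (ev t c)) (fopp g (ev 0 c))) = (k * - b)%:E &
    forall e, (0 < e)%R -> (e < e0)%R ->
      \int[pi]_c subx (fadd f (fscale e g) (ev t c)) (fadd f (fscale e g) (ev 0 c)) = (a + e * b)%:E].
Proof.
move=> cf mg e00 cv e10 cu fg t0 tT finf.
have T0 : (0 <= T)%R by rewrite (le_trans (ltW t0)).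
have [F [mF F0 FE]] := increment_version cf t0 tT.
have [g' mg' gg'] := refm_version mg.
pose G c := g' (ev t c) - g' (ev 0 c).
have mG : measurable_fun [set: curves S] G.
  apply: emeasurable_funB; [exact: (measurableT_comp mg' (measurable_ev t))|exact: (measurableT_comp mg' (measurable_ev 0))].
have ti0 : (0 < t^-1)%R by rewrite invr_gt0.
have FI : (t^-1)%:E * \int[pi]_c F c = \int[pi]_c ((t^-1)%:E * subx (f (ev t c)) (f (ev 0 c))).
  rewrite -ge0_integralZl//; last by rewrite lee_fin ltW.
  by apply: ae_eq_integral_nm => //; apply: filterS FE => c ->.
have Foo : \int[pi]_c F c < +oo.
  move: finf; rewrite -FI; have := @integral_ge0 _ _ _ pi setT F (fun c _ => F0 c).
  by case: (\int[pi]_c F c) => [r| |] //; rewrite ?ltry// gt0_muley.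
have iF : pi.-integrable setT F.
  apply/integrableP; split => //; by under eq_integral do rewrite gee0_abs//.
have fin_ae : {ae pi, forall c, exists x0 x1 y0 y1 : R,
    [/\ f (ev t c) = x1%:E, f (ev 0 c) = x0%:E, g (ev t c) = y1%:E, g (ev 0 c) = y0%:E &
        F c = (x1 - x0)%:E /\ G c = (y1 - y0)%:E]}.
  move: (compression_ae cp (lexx _) T0 fg) (compression_ae cp (ltW t0) tT fg).
  move: (compression_ae cp (lexx _) T0 gg') (compression_ae cp (ltW t0) tT gg').
  move=> H1 H2 H3 H4; move: H1; apply: filter_app; move: H2; apply: filter_app; move: H3; apply: filter_app.
  apply: filterS3 H4 FE (integrable_ae measurableT iF) => c gt Fc /(_ I); rewrite Fc => Sfin g0 g't g'0.
  have f01 : f (ev 0 c) <= f (ev t c) by apply: curve_causal_fun => //; exact: ltW.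
  move: Sfin; rewrite subxE//; case: ifP => // /andP[ft f0] _.
  move: (gt ft) (g0 f0) => gtf g0f.
  exists (fine (f (ev 0 c))), (fine (f (ev t c))), (fine (g (ev 0 c))), (fine (g (ev t c))).
  rewrite !fineK//; split => //; split.
    by rewrite EFinB !fineK.
  by rewrite /G g't g'0 EFinB !fineK.
have incr0 (h : S -> \bar R) c : causal_fun h -> 0 <= subx (h (ev t c)) (h (ev 0 c)).
  by move=> ch; apply: subx_ge0; apply: curve_causal_fun => //; exact: ltW.
have Gle : {ae pi, forall c, `|G c| <= (e0^-1 + e1^-1)%:E * F c}.
  apply: filterS fin_ae => c [x0 [x1 [y0 [y1 [f1 f0 g1 g0 [-> ->]]]]]].
  have := incr0 _ c cv; have := incr0 _ c cu; have := incr0 _ c cf.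
  rewrite !(faddE, fscaleE) /fopp f1 f0 g1 g0 /addx/= !subx_EFin !lee_fin => h0 h1 h2.
  rewrite ler_norml; have a0 : (0 < e0^-1)%R by rewrite invr_gt0.
  have a1 : (0 < e1^-1)%R by rewrite invr_gt0.
  have k0 : (0 <= (x1 - x0) * e0^-1 + (y1 - y0))%R.
    rewrite -(pmulr_rge0 _ e00) mulrDr mulrCA mulfV ?gt_eqF// mulr1.
    by rewrite (_ : (x1 - x0 + e0 * (y1 - y0) = x1 + e0 * y1 - (x0 + e0 * y0))%R)//; ring.
  have k1 : (0 <= (x1 - x0) * e1^-1 - (y1 - y0))%R.
    rewrite -(pmulr_rge0 _ e10) mulrBr mulrCA mulfV ?gt_eqF// mulr1.
    by rewrite (_ : (x1 - x0 - e1 * (y1 - y0) = x1 + e1 * - y1 - (x0 + e1 * - y0))%R)//; ring.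
  have p0 : (0 <= (x1 - x0) * e0^-1)%R by rewrite mulr_ge0// ltW.
  have p1 : (0 <= (x1 - x0) * e1^-1)%R by rewrite mulr_ge0// ltW.
  rewrite mulrC mulrDr; move: k0 k1 p0 p1; move: ((x1 - x0) / e0)%R ((x1 - x0) / e1)%R (y1 - y0)%R => u v w *.
  apply/andP; split; lra.
have kpos : (0 <= e0^-1 + e1^-1)%R by rewrite addr_ge0// invr_ge0 ltW.
have iG : pi.-integrable setT G.
  apply/integrableP; split => //.
  apply: (@le_lt_trans _ _ (\int[pi]_c ((e0^-1 + e1^-1)%:E * F c))).
    apply: ae_le_integral_nm => //.
    - by move=> c _; rewrite mule_ge0// lee_fin.
    - by apply: filterS Gle.
  by rewrite ge0_integralZl// lte_mul_pinfty.
have Ffin : \int[pi]_c F c \is a fin_num by exact: integrable_fin_num.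
have Gfin : \int[pi]_c G c \is a fin_num by exact: integrable_fin_num.
exists (fine (\int[pi]_c F c)), (fine (\int[pi]_c G c)); split.
- by rewrite -FI EFinM fineK.
- move=> k; rewrite EFinM fineK// -integralZl//; apply: ae_eq_integral_nm => //.
  by apply: filterS fin_ae => c [x0 [x1 [y0 [y1 [f1 f0 g1 g0 [_ ->]]]]]] _; rewrite g1 g0 subx_EFin.
- move=> k; rewrite EFinM EFinN fineK// -integralN; last by apply: integrable_add_def.
  rewrite -integralZl//; last exact: integrableN.
  apply: ae_eq_integral_nm => //; apply: filterS fin_ae => c [x0 [x1 [y0 [y1 [f1 f0 g1 g0 [_ ->]]]]]] _.
  by rewrite /fopp g1 g0 subx_EFin -EFinN opprB opprK addrC.
move=> e ep ee; rewrite EFinD EFinM !fineK// -integralZl// -integralD//; last exact: integrableZl.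
apply: ae_eq_integral_nm => //; apply: filterS fin_ae => c [x0 [x1 [y0 [y1 [f1 f0 g1 g0 [-> ->]]]]]] _.
rewrite !(faddE, fscaleE) f1 f0 g1 g0 /addx/= subx_EFin -EFinM -EFinD; congr EFin; ring.
Qed.

End Increments.
Section PathIntegrals.
Variables (R : realType) (S : fmmst R) (pi : probability (curves S) R).
Local Notation m := (refm S).
Local Notation leb := (@lebesgue_measure R).
Variables (H : curves S * measurableTypeR R -> \bar R) (t : R).
Hypotheses (mH : measurable_fun setT H) (H0 : forall cr, 0 <= H cr).

Let F (cr : curves S * measurableTypeR R) := H cr * (\1_(`[0%R, t]%classic : set R) cr.2)%:E.

Let F0 cr : 0 <= F cr.
Proof. by rewrite mule_ge0 ?lee_fin. Qed.

Let mF : measurable_fun setT F.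
Proof.
apply: emeasurable_funM => //; apply/measurable_EFinP.
have mI : measurable_fun [set: measurableTypeR R] (\1_(`[0%R, t]%classic : set R) : _ -> R).
  by apply: measurable_indic; exact: measurable_itv.
exact: (measurableT_comp mI measurable_snd).
Qed.

Let FE c : fubini_F (lebesgue_measure : measure (measurableTypeR R) R) F c = \int[leb]_(r in `[0%R, t]) H (c, r).
Proof.
by rewrite /fubini_F [RHS]integral_mkcond; apply: eq_integral => r _; rewrite epatch_indic.
Qed.

Lemma measurable_path_integral : measurable_fun [set: curves S] (fun c => \int[leb]_(r in `[0%R, t]) H (c, r)).
Proof.
rewrite (_ : (fun c => _) = fubini_F (lebesgue_measure : measure (measurableTypeR R) R) F).
  exact: measurable_fun_fubini_tonelli_F.
by apply/funext => c; rewrite FE.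
Qed.

Lemma path_integral_fubini :
  \int[pi]_c \int[leb]_(r in `[0%R, t]) H (c, r) = \int[leb]_(r in `[0%R, t]) \int[pi]_c H (c, r).
Proof.
under eq_integral do rewrite -FE.
rewrite /fubini_F (fubini_tonelli _ mF F0) [RHS]integral_mkcond; apply: eq_integral => r _.
rewrite /patch/F/= indicE; case: ifPn => rt; first by apply: eq_integral => c _; rewrite mule1.
by rewrite integral0_eq// => c _; rewrite mule0.
Qed.

Lemma measurable_law_integral : measurable_fun [set: measurableTypeR R] (fun r => \int[pi]_c H (c, r)).
Proof. exact: measurable_fun_fubini_tonelli_G. Qed.

End PathIntegrals.

Lemma young_integral d (X : measurableType d) (R : realType) (mu : {measure set X -> \bar R}) (D : set X)
    (p q : R) (f g : X -> \bar R) : measurable D -> (0 < p)%R -> (p < 1)%R -> (p^-1 + q^-1 = 1)%R ->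
  measurable_fun setT f -> measurable_fun setT g -> (forall x, 0 <= f x) -> (forall x, 0 <= g x) ->
  (p^-1)%:E * \int[mu]_(x in D) epow (f x) p <=
    \int[mu]_(x in D) (f x * g x) + ((- q)^-1)%:E * \int[mu]_(x in D) epow (g x) q.
Proof.
move=> mD p0 p1 pq mf mg f0 g0.
have qn : (q < 0)%R.
  rewrite -invr_lt0; have : (1 < p^-1)%R by rewrite invf_gt1.
  by move: pq; move: (p^-1)%R (q^-1)%R => a b; lra.
have k0 : (0 <= (- q)^-1)%R by rewrite invr_ge0 oppr_ge0 ltW.
have p'0 : (0 <= p^-1)%R by rewrite invr_ge0 ltW.
have mfp := measurable_epow p mf f0; have mgq := measurable_epow q mg g0.
have mfD : measurable_fun D (fun x => epow (f x) p) by exact: measurable_funTS.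
have mgD : measurable_fun D (fun x => epow (g x) q) by exact: measurable_funTS.
have mfg : measurable_fun D (fun x => f x * g x) by apply: measurable_funTS; exact: emeasurable_funM.
rewrite -ge0_integralZl//; last by move=> x _; exact: epow_ge0.
rewrite -ge0_integralZl//; last by move=> x _; exact: epow_ge0.
rewrite -ge0_integralD//; last 3 first.
- by move=> x _; rewrite mule_ge0.
- by move=> x _; rewrite mule_ge0 ?epow_ge0.
- by apply: emeasurable_funM => //; exact: measurable_cst.
apply: ae_le_integral_nm => //.
- by move=> x _; rewrite mule_ge0 ?epow_ge0.
- by move=> x _; rewrite adde_ge0 ?mule_ge0 ?epow_ge0.
- by apply: aeW => x _; exact: reverse_young.
Qed.

Lemma ae_integral_combination d (X : measurableType d) (R : realType) (mu : {measure set X -> \bar R})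
    (A B F A' B' F' : X -> \bar R) (k l a b s : R) : (0 <= k)%R -> (0 <= l)%R ->
  measurable_fun setT A' -> measurable_fun setT B' -> measurable_fun setT F' ->
  (forall x, 0 <= A' x) -> (forall x, 0 <= B' x) -> (forall x, 0 <= F' x) ->
  {ae mu, forall x, A' x = A x} -> {ae mu, forall x, B' x = B x} -> {ae mu, forall x, F' x = F x} ->
  {ae mu, forall x, k%:E * A x <= F x + l%:E * B x} ->
  \int[mu]_x A x = a%:E -> \int[mu]_x B x = b%:E -> \int[mu]_x F x = s%:E ->
  (k * a <= s + l * b)%R.
Proof.
move=> k0 l0 mA mB mF A0 B0 F0 AE BE FE le_ AI BI FI.
rewrite -lee_fin EFinD !EFinM -AI -BI -FI.
have fm : Filter (nbhs (almost_everywhere mu)) by exact: ae_filter_ringOfSetsType.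
have eqI (U U' : X -> \bar R) : {ae mu, forall x, U' x = U x} -> \int[mu]_x U x = \int[mu]_x U' x.
  by move=> UE; apply: ae_eq_integral_nm => //; apply: filterS UE => x ->.
rewrite (eqI _ _ AE) (eqI _ _ BE) (eqI _ _ FE) -!ge0_integralZl//.
rewrite -ge0_integralD//; last 2 first.
- by move=> x _; rewrite mule_ge0.
- by apply: emeasurable_funM => //; exact: measurable_cst.
apply: ae_le_integral_nm => //.
- by move=> x _; rewrite mule_ge0.
- by move=> x _; rewrite adde_ge0 ?mule_ge0.
move: AE; apply: filter_app; move: BE; apply: filter_app.
by apply: filterS2 FE le_ => x -> h -> -> _.
Qed.

Section IntegratedYoung.
Variables (R : realType) (S : fmmst R) (pi : probability (curves S) R) (T : R).
Local Notation m := (refm S).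
Local Notation leb := (@lebesgue_measure R).
Hypotheses (cp : compression_le pi T) (ms : measurable_speed pi T).

Lemma slope_power_version (N : S -> \bar R) (p : R) :
  measurable_fun (setT : set (borel S)) N -> (forall x, 0 <= N x) ->
  measurable_fun setT (fun cr : curves S * measurableTypeR R => epow (N (ev cr.2 cr.1)) p).
Proof.
move=> mN N0; have mj := @measurable_joint_eval R S _ (curves S) id (fun q _ => measurable_ev (ratr q)).
by apply: measurable_epow => //; exact: (measurableT_comp mN mj).
Qed.

Lemma energy_version (q t : R) : (t <= T)%R ->
  exists B : curves S -> \bar R, [/\ measurable_fun setT B, forall c, 0 <= B c &
    {ae pi, forall c, B c = \int[leb]_(r in `[0%R, t]) epow (causal_speed c r) q}].
Proof.
move=> tT; have [w mw hw] := ms.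
pose H (cr : curves S * measurableTypeR R) := epow (maxe 0 (w cr)) q.
have mH : measurable_fun setT H.
  apply: measurable_epow; last by move=> cr; rewrite le_max lexx.
  by apply: measurable_maxe => //; exact: measurable_cst.
exists (fun c => \int[leb]_(r in `[0%R, t]) H (c, r)); split.
- by apply: measurable_path_integral => // cr; exact: epow_ge0.
- by move=> c; apply: integral_ge0 => r _; exact: epow_ge0.
apply: filterS hw => c hw; apply: (@ae_eq_integral_nm _ (measurableTypeR R) R lebesgue_measure) => //.
apply: filterS hw => r wr /=; rewrite in_itv/= => /andP[r0 rt].
by rewrite /H wr ?(le_trans rt)// max_r// causal_speed_ge0.
Qed.

(** Exactly one of [p] and [q] lies in []0, 1[], and the reverse Young inequality is applied with
    the roles of subslope and speed chosen accordingly. Finiteness of the three integrals then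
    permits the form that is symmetric in the two exponents. *)
Lemma integrated_young (phi : S -> \bar R) (p q t a b s : R) : p != 0%R -> (p < 1)%R -> (p^-1 + q^-1 = 1)%R ->
  causal_fun phi -> (0 < t)%R -> (t <= T)%R -> (t <= 1)%R ->
  \int[pi]_c \int[leb]_(r in `[0%R, t]) epow (subslope phi (ev r c)) p = a%:E ->
  \int[pi]_c \int[leb]_(r in `[0%R, t]) epow (causal_speed c r) q = b%:E ->
  \int[pi]_c subx (phi (ev t c)) (phi (ev 0 c)) = s%:E ->
  (p^-1 * a + q^-1 * b <= s)%R.
Proof.
move=> p0 p1 pq cphi t0 tT t1 AI BI SI.
have [wphi _] := subslopeP cphi; have mN := measurable_subslope cphi.
have N0 x : 0 <= subslope phi x by exact: subslope_ge0.
have [F [mF F0 FE]] := increment_version cp cphi t0 tT.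
have [B [mB B0 BE]] := energy_version q tT.
have mA : measurable_fun [set: curves S] (fun c => \int[leb]_(r in `[0%R, t]) epow (subslope phi (ev r c)) p).
  have := measurable_path_integral t (slope_power_version p mN N0) (fun cr => epow_ge0 _ p).
  exact.
have A0 c : 0 <= \int[leb]_(r in `[0%R, t]) epow (subslope phi (ev r c)) p.
  by apply: integral_ge0 => r _; exact: epow_ge0.
have path := weak_subslope_sub cphi wphi cp ms (lexx _) t0 tT t1.
have mNc (c : LCC S) : measurable_fun [set: R] (fun r => subslope phi (c r)).
  exact: (measurableT_comp mN (measurable_curve c)).
have itv (c : LCC S) : \int[leb]_(r in `[0%R, t]) (subslope phi (c r) * causal_speed c r) =
    \int[leb]_(r in `]0%R, t[) (subslope phi (c r) * causal_speed c r).
  apply: ae_integral_itv_oo; first exact: measurable_slope_integrand.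
  by move=> r; exact: slope_integrand_ge0.
have [pp|] := ltP 0%R p.
  have qn : (q < 0)%R.
    rewrite -invr_lt0; have : (1 < p^-1)%R by rewrite invf_gt1.
    by move: pq; move: (p^-1)%R (q^-1)%R => u v; lra.
  have k0 : (0 <= (- q)^-1)%R by rewrite invr_ge0 oppr_ge0 ltW.
  have p'0 : (0 <= p^-1)%R by rewrite invr_ge0 ltW.
  have := ae_integral_combination p'0 k0 mA mB mF A0 B0 F0 (aeW _ (fun c => erefl _)) BE FE _ AI BI SI.
  move=> H.
  suff /H : {ae pi, forall c : curves S, (p^-1)%:E * \int[leb]_(r in `[0%R, t]) epow (subslope phi (ev r c)) p <=
    subx (phi (ev t c)) (phi (ev 0 c)) + ((- q)^-1)%:E * \int[leb]_(r in `[0%R, t]) epow (causal_speed c r) q}.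
    by rewrite invrN mulNr lerBrDr.
  apply: filterS path => c hc.
  have := @young_integral _ (measurableTypeR R) R lebesgue_measure _ p q _ _ (measurable_itv `[0%R, t]) pp p1 pq (mNc c) (measurable_speedf c) (fun r => N0 _) (causal_speed_ge0 c).
  move=> /le_trans; apply; apply: leeD => //.
  by rewrite [leLHS]itv; exact: hc.
move=> pn; have {pn} pn : (p < 0)%R by rewrite lt_neqAle p0.
have q0 : (0 < q)%R.
  rewrite -invr_gt0; have : (p^-1 < 0)%R by rewrite invr_lt0.
  by move: pq; move: (p^-1)%R (q^-1)%R => u v; lra.
have q1 : (q < 1)%R.
  rewrite -invf_gt1//; have : (p^-1 < 0)%R by rewrite invr_lt0.
  by move: pq; move: (p^-1)%R (q^-1)%R => u v; lra.
have k0 : (0 <= (- p)^-1)%R by rewrite invr_ge0 oppr_ge0 ltW.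
have q'0 : (0 <= q^-1)%R by rewrite invr_ge0 ltW.
have qp : (q^-1 + p^-1 = 1)%R by rewrite addrC.
have := ae_integral_combination q'0 k0 mB mA mF B0 A0 F0 BE (aeW _ (fun c => erefl _)) FE _ BI AI SI.
move=> H.
suff /H : {ae pi, forall c : curves S, (q^-1)%:E * \int[leb]_(r in `[0%R, t]) epow (causal_speed c r) q <=
  subx (phi (ev t c)) (phi (ev 0 c)) + ((- p)^-1)%:E * \int[leb]_(r in `[0%R, t]) epow (subslope phi (ev r c)) p}.
  by rewrite invrN mulNr lerBrDr addrC.
apply: filterS path => c hc.
have := @young_integral _ (measurableTypeR R) R lebesgue_measure _ q p _ _ (measurable_itv `[0%R, t]) q0 q1 qp (measurable_speedf c) (mNc c) (causal_speed_ge0 c) (fun r => N0 _).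
move=> /le_trans; apply; apply: leeD => //.
have E : (fun r => causal_speed c r * subslope phi (c r)) = (fun r => subslope phi (c r) * causal_speed c r).
  by apply/funext => r; rewrite muleC.
by rewrite E [leLHS]itv; exact: hc.
Qed.

End IntegratedYoung.

Lemma near_right_downward (R : realType) (P : R -> Prop) : (\forall t \near 0^'+, P t) ->
  \forall t \near 0^'+, forall r, (0 < r)%R -> (r <= t)%R -> P r.
Proof.
move=> [e /= e0 He]; apply: filterS (nbhs_right_lt e0) => t te r r0 rt.
by apply: He => //=; rewrite sub0r normrN gtr0_norm// (le_lt_trans rt).
Qed.

(** Three errors of size [e d / 3] come from the increments of [f], the energy and the powers of the
    subslope; the factor [|p|] in the last compensates the coefficient [p^-1]. Division by [e] turns
    their sum into [d]. *)
Lemma directional_algebra (R : realType) (p q e d al be a b l A B t : R) : p != 0%R -> (0 < e)%R -> (0 < t)%R ->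
  (t * al < p^-1 * B + l + e * d / 3)%R -> (l - e * d / 3 < q^-1 * (t * b))%R ->
  (p^-1 * a + q^-1 * b <= al + e * be)%R ->
  (A - `|p| * (e * d / 3) <= t * a)%R -> (t * a <= A + `|p| * (e * d / 3))%R ->
  ((A - B) / (p * e) - d < t * be)%R.
Proof.
move=> p0 e0 t0 hf he Y a1 a2.
have Y' : (p^-1 * (t * a) + q^-1 * (t * b) <= t * al + e * (t * be))%R.
  have -> : (p^-1 * (t * a) + q^-1 * (t * b) = t * (p^-1 * a + q^-1 * b))%R by ring.
  have -> : (t * al + e * (t * be) = t * (al + e * be))%R by ring.
  by rewrite ler_pM2l.
have H : (p^-1 * A - e * d / 3 <= p^-1 * (t * a))%R.
  have : (`|t * a - A| <= `|p| * (e * d / 3))%R by rewrite ler_norml; apply/andP; split; lra.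
  have p1 : (0 < `|p|^-1)%R by rewrite invr_gt0 normr_gt0.
  rewrite -(ler_pM2l p1) mulKf ?normr_eq0// -normfV -normrM ler_norml => /andP[h _].
  by move: h; rewrite mulrBr; lra.
have -> : ((A - B) / (p * e) - d = e^-1 * (p^-1 * A - p^-1 * B - e * d))%R.
  by field; rewrite p0 gt_eqF.
rewrite ltr_pdivrMl//; move: Y' H he hf.
move: (p^-1 * A)%R (p^-1 * B)%R (p^-1 * (t * a))%R (q^-1 * (t * b))%R (t * al)%R (e * (t * be))%R (e * d)%R.
move=> *; lra.
Qed.

(** The quotient is that of [u_p] at [a = 1] for [r = 1 + s eps], whose square is quadratic in
    [eps]; it converges, hence is bounded. *)
Lemma power_quotient_bounded (R : realType) (p s : R) (eps : nat -> R) : p != 0%R ->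
  (forall n, (0 < eps n)%R) -> eps @ \oo --> (0%R : R) -> (forall n, (0 < 1 + s * eps n)%R) ->
  exists2 M : R, (0 <= M)%R & forall n, (`|((1 + s * eps n) `^ p - 1) / (p * eps n)| <= M)%R.
Proof.
move=> p0 eps0 eps_cvg r0.
have Hr : \forall n \near \oo, [/\ (1 + s * eps n)%:E = (1 + s * eps n)%:E, (0 <= 1 + s * eps n)%R &
    ((1 + s * eps n) ^+ 2 = 1 ^+ 2 + eps n * (2 * s) + eps n ^+ 2 * s ^+ 2)%R].
  by apply: nearW => n; split => //; [exact: ltW|ring].
have := quotient_pos p0 ltr01 eps0 eps_cvg Hr.
have -> : (fun n => ((eps n)^-1)%:E * subx (u_ p (1 + s * eps n)%:E) (u_ p 1%R%:E)) =
    (fun n => (((1 + s * eps n) `^ p - 1) / (p * eps n))%:E).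
  apply/funext => n; rewrite !u_fin ?(ltW (r0 n))// (gt_eqF (r0 n)) oner_eq0/= subx_EFin powR1 -EFinM.
  by congr EFin; rewrite invfM; ring.
move=> /fine_cvg; rewrite /comp/= => cv.
have [M [_ HM]] := cvg_seq_bounded (cvgP _ cv).
have M1 : (M < `|M| + 1)%R by rewrite (le_lt_trans (ler_norm M))// ltrDl.
by exists (`|M| + 1)%R => [|n]; [rewrite addr_ge0|exact: HM M1 n I].
Qed.

Lemma power_difference_le (R : realType) (x y k l w M1 M2 : R) : (0 <= x)%R ->
  (`|(k - 1) / w| <= M1)%R -> (`|(l - 1) / w| <= M2)%R ->
  (k * x <= y <= l * x)%R \/ (l * x <= y <= k * x)%R ->
  (`|w^-1 * (y - x)| <= (M1 + M2) * x)%R.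
Proof.
move=> x0 B1 B2 H.
have : (`|y - x| <= `|k - 1| * x + `|l - 1| * x)%R.
  rewrite -{2 3}(ger0_norm x0) -!normrM !mulrBl !mul1r.
  have := ler_norm (k * x - x); have := ler_norm (l * x - x).
  have := ler_norm (- (k * x - x)); have := ler_norm (- (l * x - x)).
  rewrite !normrN; move: `|k * x - x|%R `|l * x - x|%R => u v.
  rewrite ler_norml; case: H => /andP[h1 h2] h3 h4 h5 h6; apply/andP; split; lra.
move=> /(ler_wpM2l (normr_ge0 w^-1%R)); rewrite -normrM => /le_trans; apply.
rewrite mulrDr mulrDl !mulrA -!normrM; apply: lerD; apply: ler_wpM2r => //.
  by rewrite mulrC.
by rewrite mulrC.
Qed.

Lemma two_sided_bound (R : realType) (D u w b d : R) : (`|D - u| <= d / 2)%R -> (`|- D - w| <= d / 2)%R ->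
  (u - d / 2 < b)%R -> (w - d / 2 < - b)%R -> (`|D - b| <= d)%R.
Proof.
rewrite !ler_norml => /andP[h1 h2] /andP[h3 h4] h5 h6.
apply/andP; split; lra.
Qed.

(** * Limit of the increments of a perturbation along the plan *)

Section GradientRepresentation.
Variables (R : realType) (S : fmmst R) (p q : R) (f : S -> \bar R) (E : set (borel S))
  (pi : probability (curves S) R) (C T : R).
Local Notation m := (refm S).
Local Notation leb := (@lebesgue_measure R).
Hypothesis mink : inf_minkowskian S.
Hypotheses (p0 : p != 0%R) (p1 : (p < 1)%R) (pq : (p^-1 + q^-1 = 1)%R).
Hypotheses (cf : causal_fun f) (mE : measurable E).
Hypotheses (C0 : (0 < C)%R) (T0 : (0 < T)%R) (T1 : (T <= 1)%R).
Hypothesis lawC : forall t, (0 <= t)%R -> (t <= T)%R ->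
  forall A : set (borel S), measurable A -> pushforward pi (ev t) A <= C%:E * m A.
Hypothesis ms : measurable_speed pi T.
Hypothesis narrow : forall phi : S -> R, continuous phi ->
  (exists K : R, forall x, (`|phi x| <= K)%R) ->
  (fun t : R => \int[pi]_c (phi (ev t c))%:E) @ 0^'+ --> \int[pi]_c (phi (ev 0 c))%:E.
Hypothesis stayE : forall t, (0 <= t)%R -> (t <= T)%R -> pushforward pi (ev t) (~` E) = 0.
Hypothesis intE : m.-integrable E (fun x => epow (subslope f x) p).

Let energy (t : R) : \bar R := \int[pi]_c \int[leb]_(r in `[0%R, t]) epow (causal_speed c r) q.

Hypothesis energy_fin : limf_esup (fun t : R => (t^-1)%:E * energy t) 0^'+ < +oo.
Hypothesis gradient : limf_esup (fun t : R =>
    \int[pi]_c ((t^-1)%:E * subx (f (ev t c)) (f (ev 0 c)))) 0^'+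
  <= (p^-1)%:E * \int[pi]_c epow (subslope f (ev 0 c)) p
     + limf_einf (fun t : R => ((t * q)^-1)%:E * energy t) 0^'+.

Let cp : compression_le pi T.
Proof. by exists C. Qed.

Definition power_mass (N : S -> \bar R) : R := fine (\int[pi]_c epow (N (ev 0 c)) p).

Section Power.
Variable N : S -> \bar R.
Hypotheses (mN : measurable_fun (setT : set (borel S)) N) (N0 : forall x, 0 <= N x).
Hypothesis intN : \int[m]_(x in E) epow (N x) p < +oo.

Let mNp : measurable_fun (setT : set (borel S)) (fun x => epow (N x) p).
Proof. exact: measurable_epow. Qed.

Lemma power_massE : \int[pi]_c epow (N (ev 0 c)) p = (power_mass N)%:E.
Proof.
rewrite /power_mass fineK// ge0_fin_numE; last by apply: integral_ge0 => c _; exact: epow_ge0.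
apply: le_lt_trans (law_ge0_integral C0 lawC mE stayE (lexx _) (ltW T0) mNp (fun x => epow_ge0 _ p)) _.
by rewrite lte_mul_pinfty ?lee_fin ?(ltW C0).
Qed.

Lemma power_integrable0 : pi.-integrable setT (fun c => epow (N (ev 0 c)) p).
Proof.
apply/integrableP; split; first exact: (measurableT_comp mNp (measurable_ev 0)).
under eq_integral do rewrite gee0_abs ?epow_ge0//.
by rewrite power_massE ltry.
Qed.

(** By Tonelli the double integral is the integral over [r] in [[0, t]] of the power integrated
    against the law at time [r], and these converge to the value at time 0. *)
Lemma power_average (d : R) : (0 < d)%R -> \forall t \near 0^'+, exists2 a : R,
  \int[pi]_c \int[leb]_(r in `[0%R, t]) epow (N (ev r c)) p = a%:E &
  (power_mass N - d <= t^-1 * a <= power_mass N + d)%R.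
Proof.
move=> d0.
have mH := slope_power_version p mN N0.
have cv := law_integrable_cvg C0 T0 lawC narrow mE stayE mNp (fun x => epow_ge0 _ p) intN.
pose j r := \int[pi]_c epow (N (ev r c)) p.
have mj : measurable_fun [set: measurableTypeR R] j.
  exact: (@measurable_law_integral R S pi _ mH (fun cr => epow_ge0 _ p)).
have j0 r : 0 <= j r by apply: integral_ge0 => c _; exact: epow_ge0.
have near_j : \forall r \near 0^'+, (power_mass N - d)%:E <= j r <= (power_mass N + d)%:E.
  move: cv; rewrite power_massE => /fine_cvgP[jf /cvgrPdist_le/(_ _ d0)].
  move: jf; apply: filterS2 => r jf; rewrite ler_norml /= => /andP[h1 h2].
  rewrite /j -(fineK jf) !lee_fin; apply/andP; split; lra.
have P' : \forall t \near 0^'+, (0 < t :> R)%R by exact: nbhs_right_gt.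
apply: filterS2 P' (near_right_downward near_j) => t t0 H.
have Hj r : (0 <= r)%R -> (r <= t)%R -> (power_mass N - d)%:E <= j r <= (power_mass N + d)%:E.
  rewrite le_eqVlt => /predU1P[<- _|]; last exact: H.
  by rewrite /j power_massE !lee_fin; apply/andP; split; lra.
have := average_bounds t0 mj j0 Hj.
have JE : \int[pi]_c \int[leb]_(r in `[0%R, t]) epow (N (ev r c)) p = \int[leb]_(r in `[0%R, t]) j r.
  exact: (path_integral_fubini pi t mH (fun cr => epow_ge0 _ p)).
rewrite JE => /andP[h1 h2].
have If : \int[leb]_(r in `[0%R, t]) j r \is a fin_num.
  by rewrite fin_numE gt_eqF ?(lt_le_trans _ h1) ?ltNyr//= lt_eqF// (le_lt_trans h2)// ltry.
exists (fine (\int[leb]_(r in `[0%R, t]) j r)); first by rewrite fineK.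
move: h1 h2; rewrite -(fineK If) !lee_fin /= => h1 h2.
by rewrite mulrC ler_pdivlMr// ler_pdivrMr// !(mulrC _ t) h1 h2.
Qed.

End Power.

(** The upper limit bounds [energy t / t], so its lower limit divided by [q] is finite for either
    sign of [q]. This permits subtracting the energy term in the gradient inequality. *)
Lemma energy_near : exists l : R, limf_einf (fun t : R => ((t * q)^-1)%:E * energy t) 0^'+ = l%:E /\
  \forall t \near 0^'+, exists b : R, energy t = b%:E.
Proof.
have e0 t : 0 <= energy t.
  by apply: integral_ge0 => c _; apply: integral_ge0 => r _; exact: epow_ge0.
have [M HM] : exists M : R, limf_esup (fun t : R => (t^-1)%:E * energy t) 0^'+ < M%:E.
  move: energy_fin; case: (limf_esup _ _) => [r| |] // _; last by exists 0%R; rewrite ltNyr.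
  by exists (r + 1)%R; rewrite lte_fin ltrDl.
have bnd : \forall t \near 0^'+, (t^-1)%:E * energy t < M%:E by apply: limf_esup_lt HM.
have P' : \forall t \near 0^'+, (0 < t :> R)%R by exact: nbhs_right_gt.
have fin_near : \forall t \near 0^'+, (0 < t)%R /\ exists b : R, [/\ energy t = b%:E, (0 <= b)%R & (t^-1 * b < M)%R].
  apply: filterS2 P' bnd => t t0; have ti : (0 < t^-1)%R by rewrite invr_gt0.
  move: (e0 t); case: (energy t) => [b| |] //.
    by rewrite -EFinM lte_fin => b0 h; split=> //; exists b.
  by rewrite gt0_muley// lte_fin.
exists (fine (limf_einf (fun t : R => ((t * q)^-1)%:E * energy t) 0^'+)); split; last first.
  by apply: filterS fin_near => t [_ [b [-> _ _]]]; exists b.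
rewrite fineK//.
have /andP[h1 h2] : (Num.min 0 (q^-1 * M))%:E <= limf_einf (fun t : R => ((t * q)^-1)%:E * energy t) 0^'+ <= (Num.max 0 (q^-1 * M))%:E.
  apply: limf_einf_bounds; apply: filterS fin_near => t [t0 [b [-> b0 bM]]].
  rewrite -EFinM !lee_fin invfM (mulrC t^-1%R) -mulrA.
  have tb : (0 <= t^-1 * b)%R by rewrite mulr_ge0// invr_ge0 ltW.
  move: bM tb; move: (t^-1 * b)%R (q^-1)%R => u v uM u0.
  have [v0|v0] := leP 0%R v.
    by rewrite ge_min mulr_ge0//= le_max ler_wpM2l// ?orbT// ltW.
  by rewrite ge_min (ler_wnM2l (ltW v0) (ltW uM)) orbT/= le_max nmulr_rle0// u0.
by rewrite fin_numE gt_eqF ?(lt_le_trans _ h1) ?ltNyr//= lt_eqF// (le_lt_trans h2)// ltry.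
Qed.

Section Direction.
Variables (g : S -> \bar R) (e0 e1 : R).
Hypotheses (mg : refm_measurable g) (e00 : (0 < e0)%R) (e10 : (0 < e1)%R).
Hypotheses (cv : causal_fun (fadd f (fscale e0 g))) (cu : causal_fun (fadd f (fscale e1 (fopp g)))).
Hypothesis fg : {ae m, forall x, f x \is a fin_num -> g x \is a fin_num}.

Let N := subslope f.
Let Ne e := subslope (fadd f (fscale e g)).

Lemma perturbed_power_fin e : (0 < e)%R -> (e < e0)%R -> \int[m]_(x in E) epow (Ne e x) p < +oo.
Proof.
move=> ep ee; have ce := causal_perturbation cf cv ep ee.
have k0 : (0 < 1 - e / e0)%R by rewrite subr_gt0 ltr_pdivrMr// mul1r.
have l0 : (0 < 1 + e / e1)%R by rewrite addr_gt0// divr_gt0.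
(* One of the two powers is the upper bound, which one depending on the sign of [p]; their sum
   covers both cases. *)
pose K := ((1 - e / e0) `^ p + (1 + e / e1) `^ p)%R.
have K0 : (0 <= K)%R by rewrite addr_ge0// powR_ge0.
have mNp : measurable_fun E (fun x => epow (N x) p).
  by apply: measurable_funTS; apply: measurable_epow; [exact: measurable_subslope|move=> x; exact: subslope_ge0].
have NI : \int[m]_(x in E) epow (N x) p < +oo.
  have /integrableP[_] := intE; apply: le_lt_trans.
  by under [leRHS]eq_integral do rewrite gee0_abs ?epow_ge0//.
apply: (@le_lt_trans _ _ (\int[m]_(x in E) (K%:E * epow (N x) p))); last first.
  rewrite ge0_integralZl//; last by move=> x _; exact: epow_ge0.
  by rewrite lte_mul_pinfty.
apply: ae_le_integral_nm => //.
- by move=> x _; exact: epow_ge0.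
- by move=> x _; rewrite mule_ge0// epow_ge0.
apply: filterS2 (subslope_perturbation_ge cf cv ep ee) (subslope_perturbation_le cf cv cu ep ee e10 fg) => x h1 h2 _.
have := epow_between p0 k0 l0 (subslope_ge0 x cf) h1 h2.
have pk : (0 <= (1 - e / e0) `^ p)%R by exact: powR_ge0.
have pl : (0 <= (1 + e / e1) `^ p)%R by exact: powR_ge0.
case: ifP => _ /andP[_ /le_trans]; apply; rewrite lee_wpmul2r ?epow_ge0// lee_fin /K.
  by rewrite lerDr.
by rewrite lerDl.
Qed.

(* The reverse Young inequality for f + e g, minus its asymptotic equality case for f. *)
Lemma directional_lower e d : (0 < e)%R -> (e < e0)%R -> (0 < d)%R ->
  \forall t \near 0^'+, exists b : R, [/\
    \int[pi]_c ((t^-1)%:E * subx (g (ev t c)) (g (ev 0 c))) = (t^-1 * b)%:E,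
    \int[pi]_c ((t^-1)%:E * subx (fopp g (ev t c)) (fopp g (ev 0 c))) = (t^-1 * - b)%:E &
    ((power_mass (Ne e) - power_mass N) / (p * e) - d < t^-1 * b)%R].
Proof.
move=> ep ee d0; have ce := causal_perturbation cf cv ep ee.
have [l [lE near_fin]] := energy_near.
have mN := measurable_subslope cf; have N0 x : 0 <= N x by exact: subslope_ge0.
have mNe := measurable_subslope ce; have Ne0 x : 0 <= Ne e x by exact: subslope_ge0.
have NI : \int[m]_(x in E) epow (N x) p < +oo.
  have /integrableP[_] := intE; apply: le_lt_trans.
  by under [leRHS]eq_integral do rewrite gee0_abs ?epow_ge0//.
pose d' := (e * d / 3)%R; have d'0 : (0 < d')%R by rewrite divr_gt0// mulr_gt0.
have d1 : (0 < `|p| * d')%R by rewrite mulr_gt0// normr_gt0.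
have near_a := power_average mNe Ne0 (perturbed_power_fin ep ee) d1.
have near_e : \forall t \near 0^'+, (l - d')%:E < ((t * q)^-1)%:E * energy t.
  by apply: limf_einf_gt; rewrite lE lte_fin; lra.
have near_f : \forall t \near 0^'+, \int[pi]_c ((t^-1)%:E * subx (f (ev t c)) (f (ev 0 c))) < (p^-1 * power_mass N + l + d')%:E.
  apply: limf_esup_lt; apply: le_lt_trans gradient _.
  by rewrite lE (power_massE mN N0 NI) -EFinM -EFinD lte_fin; lra.
have near_t : \forall t \near 0^'+, (0 < t <= T)%R.
  have H1 : \forall t \near 0^'+, (0 < t :> R)%R by exact: nbhs_right_gt.
  by apply: filterS2 H1 (nbhs_right_le T0) => t -> ->.
move: near_a; apply: filter_app; move: near_e; apply: filter_app; move: near_f; apply: filter_app.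
apply: filterS2 near_t near_fin => t /andP[t0 tT] [b bE] hf he [a aE /andP[a1 a2]].
have hfo := lt_le_trans hf (leey _).
have [al [be [alE beE bnE sE]]] := increments_linear cp cf mg e00 cv e10 cu fg t0 tT hfo.
exists be; split; [exact: beE|exact: bnE|].
have Y := integrated_young cp ms p0 p1 pq ce t0 tT (le_trans tT T1) aE bE (sE e ep ee).
move: hf; rewrite alE lte_fin => hf.
move: he; rewrite bE -EFinM lte_fin invfM (mulrC t^-1%R) -mulrA => he.
by apply: (directional_algebra p0 ep _ hf he Y a1 a2); rewrite invr_gt0.
Qed.

(** Dominated convergence: the two-sided bounds on [N(f + e g)] by multiples of [N f] dominate the
    quotients by a constant times the integrable [(N f)^p]. Where [N f = 0] the upper bound makes
    [N(f + e g)] vanish too, so the derivative is 0 there, a set that the oddness of the derivative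
    does not reach. *)
Lemma vderiv_integral (eps : nat -> R) : (forall n, (0 < eps n)%R) -> (forall n, (eps n < e0)%R) ->
  eps @ \oo --> (0%R : R) ->
  exists D : R, [/\ \int[pi]_c vderiv p g f (ev 0 c) = D%:E,
    {ae pi, forall c, subslope f (ev 0 c) = 0 -> vderiv p g f (ev 0 c) = 0} &
    (fun n => (power_mass (Ne (eps n)) - power_mass N) / (p * eps n))%R @ \oo --> D].
Proof.
move=> eps0 epse eps_cvg.
have mN := measurable_subslope cf; have N0 x : 0 <= N x by exact: subslope_ge0.
have NI : \int[m]_(x in E) epow (N x) p < +oo.
  have /integrableP[_] := intE; apply: le_lt_trans.
  by under [leRHS]eq_integral do rewrite gee0_abs ?epow_ge0//.
have ce n := causal_perturbation cf cv (eps0 n) (epse n).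
have mNe n := measurable_subslope (ce n); have Ne0 n x : 0 <= Ne (eps n) x by exact: subslope_ge0.
have NeI n := perturbed_power_fin (eps0 n) (epse n).
have iN := power_integrable0 mN N0 NI.
have iNe n := power_integrable0 (mNe n) (Ne0 n) (NeI n).
pose h n (c : curves S) := ((p * eps n)^-1)%:E * (epow (Ne (eps n) (ev 0 c)) p - epow (N (ev 0 c)) p).
have iB n := integrableB measurableT (iNe n) iN.
have ih n : pi.-integrable setT (h n) by exact: integrableZl (iB n).
have hI n : \int[pi]_c h n c = ((power_mass (Ne (eps n)) - power_mass N) / (p * eps n))%:E.
  rewrite (integralZl measurableT (iB n)) (integralB measurableT (iNe n) iN) (power_massE (mNe n) (Ne0 n) (NeI n)) (power_massE mN N0 NI).
  by rewrite -EFinB -EFinM mulrC.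
have k0 n : (0 < 1 - eps n / e0)%R by rewrite subr_gt0 ltr_pdivrMr// mul1r.
have l0 n : (0 < 1 + eps n / e1)%R by rewrite addr_gt0// divr_gt0.
have [M1 M10 HM1] : exists2 M : R, (0 <= M)%R & forall n, (`|((1 - eps n / e0) `^ p - 1) / (p * eps n)| <= M)%R.
  have H n : (0 < 1 + - e0^-1 * eps n)%R by rewrite mulNr mulrC.
  have [M M0 HM] := power_quotient_bounded p0 eps0 eps_cvg H.
  by exists M => // n; have := HM n; rewrite mulNr (mulrC e0^-1%R).
have [M2 M20 HM2] : exists2 M : R, (0 <= M)%R & forall n, (`|((1 + eps n / e1) `^ p - 1) / (p * eps n)| <= M)%R.
  have H n : (0 < 1 + e1^-1 * eps n)%R by rewrite mulrC.
  have [M M0 HM] := power_quotient_bounded p0 eps0 eps_cvg H.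
  by exists M => // n; have := HM n; rewrite (mulrC e1^-1%R).
have T0' := ltW T0.
have slopes : {ae pi, forall c, forall n, (1 - eps n / e0)%:E * N (ev 0 c) <= Ne (eps n) (ev 0 c) /\
    Ne (eps n) (ev 0 c) <= (1 + eps n / e1)%:E * N (ev 0 c)}.
  apply: ae_foralln => n.
  apply: filterS2 (compression_ae cp (lexx _) T0' (subslope_perturbation_ge cf cv (eps0 n) (epse n)))
    (compression_ae cp (lexx _) T0' (subslope_perturbation_le cf cv cu (eps0 n) (epse n) e10 fg)) => c h1 h2.
  by split.
have Nfin := integrable_ae measurableT iN.
have bound : {ae pi, forall c n, [set: curves S] c -> `|h n c| <= (M1 + M2)%:E * epow (N (ev 0 c)) p}.
  apply: filterS2 slopes Nfin => c slopes /(_ I) Nc n _.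
  have [h1 h2] := slopes n; have := epow_between p0 (k0 n) (l0 n) (N0 (ev 0 c)) h1 h2.
  move: (HM1 n) (HM2 n); rewrite /h; move: Nc (epow_ge0 (N (ev 0 c)) p) (epow_ge0 (Ne (eps n) (ev 0 c)) p).
  case: (epow (N (ev 0 c)) p) => [x| |] // _; case: (epow (Ne (eps n) (ev 0 c)) p) => [y| |]; rewrite ?if_same //=; last first.
    by case: ifP => _ _ _ _ _; rewrite -EFinM leye_eq andbF.
  rewrite !lee_fin => x0 y0 B1 B2 H; apply: power_difference_le x0 B1 B2 _.
  by move: H; case: ifP => _; [left|right].
have pg : pert f g by split=> //; exists e0.
have limit : {ae pi, forall c, h ^~ c @ \oo --> vderiv p g f (ev 0 c)}.
  have V := compression_ae cp (lexx _) T0' (vderivP mink p0 p1 cf pg eps0 eps_cvg).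
  apply: filterS3 slopes Nfin V => c slopes /(_ I) Nc [V1 V2].
  have [NF|] := ltP (N (ev 0 c)) +oo; last first.
    (* An infinite subslope with finite power occurs only for [p < 0]; then both powers are 0, in
       accordance with the convention that the derivative is 0 there. *)
    rewrite leye_eq => /eqP Noo; rewrite V2//; apply: cvg_near_cst; apply: nearW => n.
    have Noo' : epow +oo p \is a fin_num by rewrite -Noo; exact: Nc.
    have [h1 _] := slopes n; move: h1 Noo'; rewrite /h Noo gt0_muley ?lte_fin// leye_eq => /eqP -> /=.
    by case: ifP => // pn _; rewrite subee ?mule0.
  move: (V1 NF); apply: cvg_trans; apply: near_eq_cvg; apply: nearW => n; rewrite /h.
  have [h1 h2] := slopes n; have NeF : Ne (eps n) (ev 0 c) < +oo.
    by rewrite (le_lt_trans h2)// lte_mul_pinfty// lee_fin ltW.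
  move: Nc h1 h2 (N0 (ev 0 c)) (Ne0 n (ev 0 c)) NF NeF; rewrite /Ne /N.
  move: (subslope f (ev 0 c)) (subslope (fadd f (fscale (eps n) g)) (ev 0 c)) => [a| |] [r| |] // Nc.
  rewrite -!EFinM !lee_fin => h1 h2 a0 r0 _ _; move: Nc => /=; case: ifP => // /negbT anz _.
  have rnz : ~~ ((r == 0%R) && (p < 0)%R).
    apply: contra anz => /andP[/eqP r_0 ->]; rewrite andbT eq_le a0 andbT.
    by move: h1; rewrite r_0 pmulr_rle0.
  rewrite !u_fin// (negbTE anz) (negbTE rnz) subx_EFin -EFinB -!EFinM; congr EFin.
  by rewrite invfM; ring.
(* A measurable representative of the derivative along the plan, since [vderiv] is chosen only
   through its limit property. *)
pose D' c := limn_esup (h ^~ c).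
have mD' : measurable_fun [set: curves S] D'.
  by apply: measurable_fun_limn_esup => n; have /integrableP[] := ih n.
have D'E : {ae pi, forall c, D' c = vderiv p g f (ev 0 c)}.
  apply: filterS limit => c hc; rewrite /D' is_cvg_limn_esupE; last by apply/cvg_ex; eexists; exact: hc.
  exact/cvg_lim.
have mh n : measurable_fun [set: curves S] (h n) by have /integrableP[] := ih n.
have iM : pi.-integrable setT (fun c => (M1 + M2)%:E * epow (N (ev 0 c)) p) by exact: integrableZl.
have limit' : {ae pi, forall c, [set: curves S] c -> h ^~ c @ \oo --> D' c}.
  by apply: filterS2 D'E limit => c ->.
have [iD' _ cvI] := dominated_convergence measurableT mh mD' limit' iM bound.
have Df : \int[pi]_c D' c \is a fin_num by exact: integrable_fin_num.
exists (fine (\int[pi]_c D' c)); split.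
- rewrite fineK//; apply: ae_eq_integral_nm => //; by apply: filterS D'E => c ->.
- apply: filterS3 slopes Nfin limit => c slopes /(_ I) Nc lim_ Nz.
  apply: cvg_unique lim_ _ => //; apply: cvg_near_cst; apply: nearW => n; rewrite /h.
  have [_ h2] := slopes n; have -> : Ne (eps n) (ev 0 c) = N (ev 0 c).
    by apply/eqP; rewrite [N _]Nz eq_le Ne0 andbT (le_trans h2)// [N _]Nz mule0.
  by rewrite subee ?mule0.
move: cvI; rewrite -(fineK Df) (_ : (fun n => \int[pi]_c h n c) = fun n => ((power_mass (Ne (eps n)) - power_mass N) / (p * eps n))%:E); last by apply/funext => n; exact: hI.
by move=> /fine_cvg.
Qed.

End Direction.

(** The lower bound for [- g] is an upper bound for [g]. The two meet because the derivatives along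
    [g] and [- g] have opposite integrals: they are opposite where the subslope of [f] is positive,
    and both are 0 where it vanishes. *)
Lemma gradient_limit g : pert f g -> pert f (fopp g) ->
  {ae m, forall x, f x \is a fin_num -> g x \is a fin_num} ->
  (fun t : R => \int[pi]_c ((t^-1)%:E * subx (g (ev t c)) (g (ev 0 c)))) @ 0^'+
    --> \int[pi]_c vderiv p g f (ev 0 c).
Proof.
move=> pg pn fg; have [mg [e0 e00 cv]] := pg; have [mn [e1 e10 cu]] := pn.
have noppK : fopp (fopp g) = g by apply/funext => x; rewrite /fopp oppeK.
have cu' : causal_fun (fadd f (fscale e0 (fopp (fopp g)))) by rewrite noppK.
have fn : {ae m, forall x, f x \is a fin_num -> fopp g x \is a fin_num}.
  by apply: filterS fg => x gf /gf; rewrite /fopp fin_numN.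
pose k := Num.min e0 e1; have k0 : (0 < k)%R by rewrite lt_min e00.
pose eps n : R := (k / n.+2%:R)%R.
have eps0 n : (0 < eps n)%R by rewrite divr_gt0.
have epsk n : (eps n < k)%R by rewrite ltr_pdivrMr// ltr_pMr// ltr1n.
have eps_e0 n : (eps n < e0)%R by rewrite (lt_le_trans (epsk n))// ge_min lexx.
have eps_e1 n : (eps n < e1)%R by rewrite (lt_le_trans (epsk n))// ge_min lexx orbT.
have eps_cvg : eps @ \oo --> (0%R : R).
  rewrite -(mulr0 k); apply: cvgMl_tmp.
  by have := @cvg_harmonic R; rewrite -cvg_shiftS.
have [D [DI Dz Dcv]] := vderiv_integral mg e00 e10 cv cu fg eps0 eps_e0 eps_cvg.
have [D' [DI' Dz' Dcv']] := vderiv_integral mn e10 e00 cu cu' fn eps0 eps_e1 eps_cvg.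
have DD' : D' = (- D)%R.
  apply: EFin_inj; rewrite -DI' EFinN -DI -integralN; last first.
    have := DI; rewrite [LHS]integralE.
    by case: (\int[pi]_c _) => [x| |]; case: (\int[pi]_c _) => [y| |].
  apply: ae_eq_integral_nm => //.
  have O := compression_ae cp (lexx _) (ltW T0) (vderiv_opposite mink p0 p1 cf pg pn fg).
  apply: filterS3 O Dz Dz' => c O z z' _.
  have := subslope_ge0 (ev 0 c) cf; rewrite le_eqVlt => /predU1P[N0|Npos].
    by rewrite z// z'// oppe0.
  by rewrite -(O Npos) oppeK.
have near_b d : (0 < d)%R -> \forall t \near 0^'+, exists2 b : R,
    \int[pi]_c ((t^-1)%:E * subx (g (ev t c)) (g (ev 0 c))) = b%:E & (`|D - b| <= d)%R.
  move=> d0; have d20 : (0 < d / 2)%R by rewrite divr_gt0.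
  (* The steps [eps n1] and [eps n2] are fixed by the accuracy [d / 2] before [t] tends to 0; the
     other half of [d] is the error allowed in the lower bounds. *)
  have /cvgrPdist_le/(_ _ d20)[n1 _ /(_ n1 (leqnn n1))/= Hn1] := Dcv.
  have /cvgrPdist_le/(_ _ d20)[n2 _ /(_ n2 (leqnn n2))/= Hn2] := Dcv'.
  apply: filterS2 (directional_lower mg e00 e10 cv cu fg (eps0 n1) (eps_e0 n1) d20)
    (directional_lower mn e10 e00 cu cu' fn (eps0 n2) (eps_e1 n2) d20) => t [b [bE b'E lb]] [b' [b''E _ lb']].
  exists (t^-1 * b)%R => //.
  have bb : (t^-1 * b' = - (t^-1 * b))%R by apply: EFin_inj; rewrite -b''E b'E mulrN.
  by apply: (two_sided_bound Hn1 _ lb); [rewrite -DD'; exact: Hn2|rewrite -bb].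
rewrite DI; apply/fine_cvgP; split; first by apply: filterS (near_b _ ltr01) => t [b ->].
apply/cvgrPdist_le => d d0; apply: filterS (near_b _ d0) => t [b bE].
by rewrite /= bE.
Qed.

End GradientRepresentation.

Section Restriction.
Variables (R : realType) (S : fmmst R) (pi : probability (curves S) R).

Lemma compression_le_mono (T T' : R) : (T' <= T)%R -> compression_le pi T -> compression_le pi T'.
Proof. by move=> TT [C C0 H]; exists C => // t t0 tT; apply: H => //; exact: le_trans TT. Qed.

Lemma measurable_speed_mono (T T' : R) : (T' <= T)%R -> measurable_speed pi T -> measurable_speed pi T'.
Proof.
move=> TT [w mw H]; exists w => //; apply: filterS H => c; apply: filterS => t H t0 tT.
by apply: H => //; exact: le_trans TT.
Qed.

End Restriction.

Theorem theorem4p16 (R : realType) (S : fmmst R) (p : R) :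
  inf_minkowskian S -> p != 0%R -> (p < 1)%R ->
  [/\ (* (i) *)
      forall f g : S -> \bar R,
        causal_fun f -> pert f g -> pert f (fopp g) ->
        {ae refm S, forall x, f x \is a fin_num -> g x \is a fin_num} ->
        {ae refm S, forall x, 0 < subslope f x ->
           - vderiv p (fopp g) f x = vderiv p g f x},
      (* (ii) *)
      forall (f g : S -> \bar R) (q : R) (E : set (borel S))
             (pi : probability (curves S) R),
        causal_fun f -> pert f g -> pert f (fopp g) ->
        {ae refm S, forall x, f x \is a fin_num -> g x \is a fin_num} ->
        (p^-1 + q^-1 = 1)%R -> measurable E ->
        represents_gradient p q f E pi ->
        (fun t : R =>
           \int[pi]_c ((t^-1)%:E * subx (g (ev t c)) (g (ev 0 c)))) @ 0^'+
          --> \int[pi]_c vderiv p g f (ev 0 c) &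
      (* (iii) *)
      forall f g h : S -> \bar R,
        causal_fun f -> causal_fun g -> causal_fun h ->
        (forall p' : R, p' != 0%R -> (p' < 1)%R ->
           {ae refm S, forall x, 0 < subslope f x -> subslope f x < +oo ->
              dplus p g f x = dplus p' g f x}) /\
        (forall a b : R, (0 <= a)%R -> (0 <= b)%R ->
           {ae refm S, forall x,
              0 < Order.min (subslope f x)
                    (Order.min (subslope g x) (subslope h x)) ->
              subslope (fadd (fadd f g) h) x < +oo ->
              dplus p g f x = dplus p f g x /\
              dplus p (fadd (fscale a g) (fscale b h)) f x
                = addx (a%:E * dplus p g f x) (b%:E * dplus p h f x)})].
Proof.
move=> mink p0 p1; split.
- by move=> f g cf pg pn fg; exact: vderiv_opposite.
- move=> f g q E pi cf pg pn fg pq mE.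
  move=> [[[T1 [T10 T11 cp ms]] narrow] [T2 [T20 T21 stay]] intE energy_fin gradient].
  pose T := Num.min T1 T2.
  have T0 : (0 < T)%R by rewrite lt_min T10.
  have TT1 : (T <= T1)%R by rewrite ge_min lexx.
  have TT2 : (T <= T2)%R by rewrite ge_min lexx orbT.
  have [C C0 lawC] := compression_le_mono TT1 cp.
  have ms' := measurable_speed_mono TT1 ms.
  have stay' t : (0 <= t)%R -> (t <= T)%R -> pushforward pi (ev t) (~` E) = 0.
    by move=> t0 tT; apply: stay => //; exact: le_trans TT2.
  exact: (gradient_limit mink p0 p1 pq cf mE C0 T0 (le_trans TT2 T21) lawC ms' narrow stay' intE energy_fin gradient).
- move=> f g h cf cg ch; split.
    by move=> p' p'0 p'1; apply: dplus_independent => //; exact: pert_causal.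
  by move=> a b a0 b0; exact: dplus_cone.
Qed.
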